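(* Let $N\ge 3$, $2^*=2N/(N-2)$, and let $V_\infty>0$ be a constant. Assume: (a) $h\in\mathcal{C}^1(\mathbb{R}^N,\mathbb{R})$, $h(x)\ge0$ for all $x\in\mathbb{R}^N$, $\lim_{|x|\to\infty}h(x)=0$, and $\sup_{x\in\mathbb{R}^N}\left[-|x|^2\,\nabla h(x)\cdot x\right]<\infty$; (b) $f\in\mathcal{C}(\mathbb{R},\mathbb{R})$, there is a constant $\mathcal{C}_0>0$ with $|f(t)|\le \mathcal{C}_0(1+|t|^{2^*-1})$ for all $t\in\mathbb{R}$, $f(t)=o(t)$ as $t\to0$, $|f(t)|=o(|t|^{(N+2)/(N-2)})$ as $|t|\to+\infty$, and there exists $s_0>0$ such that $F(s_0)>\frac12V_\infty s_0^2$, where $F(t)=\int_0^tf(s)\,ds$. Then there exists a constant $\varepsilon_0>0$ such that for all $0<\varepsilon\le\varepsilon_0$ the problem $-\Delta u+[V_\infty-\varepsilon h(x)]u=f(u)$ in $\mathbb{R}^N$, $u\in H^1(\mathbb{R}^N)$, has a least energy solution $\bar u_\varepsilon\in H^1(\mathbb{R}^N)\setminus\{0\}$.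
   Context: Solutions are understood in the weak sense, i.e. as critical points of the energy functional on $H^1(\mathbb{R}^N)$ $$I_{(\varepsilon)}(u)=\frac12\int_{\mathbb{R}^N}\left[|\nabla u|^2+(V_\infty-\varepsilon h(x))u^2\right]dx-\int_{\mathbb{R}^N}F(u)\,dx.$$ A least energy solution is a nonzero critical point $\bar u_\varepsilon$ of $I_{(\varepsilon)}$ with $I_{(\varepsilon)}(\bar u_\varepsilon)=\inf\{I_{(\varepsilon)}(u):u\in H^1(\mathbb{R}^N)\setminus\{0\},\ I_{(\varepsilon)}'(u)=0\}$. *)

(* Defs.v *)
From HB Require Import structures.
From mathcomp Require Import all_boot all_order all_algebra.
From mathcomp Require Import all_classical all_reals all_analysis.

Set Implicit Arguments.
Unset Strict Implicit.
Unset Printing Implicit Defensive.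
Import Order.TTheory GRing.Theory Num.Theory.
Import numFieldNormedType.Exports.
Local Open Scope classical_set_scope.
Local Open Scope ring_scope.

(** ** Lebesgue measure on R^n, realised as ['rV[R]_n] *)

Definition rV_display : measure_display -> measure_display.
Proof. exact. Qed.

(* The sigma-algebra generated by the coordinates, i.e. the Borel sets. *)
Section measurable_rV.
Context {R : realType} (n : nat).

Let coord (i : 'I_n) (x : 'rV[R]_n) : R := x ord0 i.

Let rV_set0 : g_sigma_preimage coord set0.
Proof. exact: sigma_algebra0. Qed.

Let rV_setC A : g_sigma_preimage coord A -> g_sigma_preimage coord (~` A).
Proof. exact: sigma_algebraC. Qed.

Let rV_bigcup (F : (set 'rV[R]_n)^nat) : (forall i, g_sigma_preimage coord (F i)) ->
  g_sigma_preimage coord (\bigcup_i (F i)).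
Proof. exact: sigma_algebra_bigcup. Qed.

HB.instance Definition _ := @isMeasurable.Build (rV_display default_measure_display)
  'rV[R]_n (g_sigma_preimage coord) rV_set0 rV_setC rV_bigcup.

End measurable_rV.

Section lebesgue_rV.
Context {R : realType}.

Definition cons_rV n (p : R * 'rV[R]_n) : 'rV[R]_n.+1 :=
  \row_i if unlift ord0 i is Some j then p.2 ord0 j else p.1.

Lemma measurable_coord_rV n (i : 'I_n) :
  measurable_fun setT (fun x : 'rV[R]_n => x ord0 i).
Proof.
move=> _ Y mY; rewrite setTI /measurable /=; apply: sub_sigma_algebra.
case: n i => [[]//|n] i.
rewrite -bigcup_mkord_ord; exists i => //=.
by exists Y => //; rewrite setTI inord_val.
Qed.

Lemma measurable_fun_rV d (T : measurableType d) n (g : T -> 'rV[R]_n) :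
  (forall i, measurable_fun setT (fun t => g t ord0 i)) ->
  measurable_fun setT g.
Proof.
move=> mg.
apply: (measurability (\big[setU/set0]_(i < n)
  preimage_set_system setT (fun x : 'rV[R]_n => x ord0 i) measurable)) => //.
case: n g mg => [|n] g mg; first by rewrite big_ord0 => _ [? []].
move=> _ [B + <-]; rewrite -bigcup_mkord_ord => -[i iI [A mA <-]].
rewrite !setTI -comp_preimage -[X in measurable X]setTI.
exact: mg.
Qed.

Lemma measurable_cons_rV n : measurable_fun setT (@cons_rV n).
Proof.
apply: measurable_fun_rV => i; case: (unliftP ord0 i) => [j|] ->.
  under eq_fun do rewrite mxE liftK.
  exact: measurableT_comp (measurable_coord_rV j) measurable_snd.
under eq_fun do rewrite mxE unlift_none.
exact: measurable_fst.
Qed.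

Section step.
Context n (m : {sigma_finite_measure set 'rV[R]_n -> \bar R}).

Definition lebesgue_cons : set 'rV[R]_n.+1 -> \bar R :=
  pushforward (product_measure1 (@lebesgue_measure R) m) (@cons_rV n).

Let mcons : measurable_fun setT
  (@cons_rV n : measurableTypeR R * 'rV[R]_n -> 'rV[R]_n.+1).
Proof. exact: measurable_cons_rV. Qed.

Let lebesgue_cons0 : lebesgue_cons set0 = 0%E.
Proof. exact: measure0. Qed.

Let lebesgue_cons_ge0 A : (0 <= lebesgue_cons A)%E.
Proof. exact: measure_ge0. Qed.

Let lebesgue_cons_sigma_additive : semi_sigma_additive lebesgue_cons.
Proof. exact: measure_semi_sigma_additive. Qed.

HB.instance Definition _ := isMeasure.Build _ _ _ lebesgue_cons
  lebesgue_cons0 lebesgue_cons_ge0 lebesgue_cons_sigma_additive.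

Let lebesgue_cons_sigma_finite : sigma_finite setT lebesgue_cons.
Proof.
have /sigma_finiteP[F [TF ndF Foo]] := sigma_finiteT (@lebesgue_measure R).
have /sigma_finiteP[G [TG ndG Goo]] := sigma_finiteT m.
pose unc (x : 'rV[R]_n.+1) : measurableTypeR R * 'rV[R]_n :=
  (x ord0 ord0, \row_j x ord0 (lift ord0 j)).
have unc_meas : measurable_fun setT unc.
  apply/measurable_fun_pairP; split; first exact: measurable_coord_rV.
  apply: measurable_fun_rV => i.
  by under eq_fun do rewrite mxE; exact: measurable_coord_rV.
have consK : cancel (@cons_rV n) unc.
  move=> [a x]; rewrite /unc mxE unlift_none /=; congr pair.
  by apply/rowP => j; rewrite !mxE liftK.
exists (fun k => unc @^-1` (F k `*` G k)).
  rewrite -preimage_bigcup -[LHS](preimage_setT unc); congr (_ @^-1` _).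
  rewrite -setXTT TF TG predeqE => -[x y]; split.
    move=> [/= [i _ Fix] [j _ Gjy]]; exists (maxn i j) => //; split.
    - by move: x Fix; exact/subsetPset/ndF/leq_maxl.
    - by move: y Gjy; exact/subsetPset/ndG/leq_maxr.
  by move=> [i _ []/= ? ?]; split; exists i.
move=> k; have [mF Fk] := Foo k; have [mG Gk] := Goo k.
have mFG : measurable (F k `*` G k) by exact: measurableX.
split; first by rewrite -[X in measurable X]setTI; exact: unc_meas.
rewrite /lebesgue_cons /pushforward -comp_preimage.
rewrite (_ : unc \o _ = id); last by apply/funext => p; exact: consK.
by rewrite preimage_id product_measure1E// lte_mul_pinfty// ge0_fin_numE.
Qed.

HB.instance Definition _ :=
  Measure_isSigmaFinite.Build _ _ _ lebesgue_cons lebesgue_cons_sigma_finite.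

End step.

Fixpoint lebesgue_rV n : {sigma_finite_measure set 'rV[R]_n -> \bar R} :=
  if n is n'.+1 then lebesgue_cons (lebesgue_rV n') else \d_(0 : 'rV[R]_0).

Lemma lebesgue_rV_box n (A : 'I_n -> set R) : (forall i, measurable (A i)) ->
  lebesgue_rV n [set x | forall i, A i (x ord0 i)] =
  (\prod_(i < n) lebesgue_measure (A i))%E.
Proof.
elim: n A => [|n IH] A mA.
  rewrite big_ord0 /= diracE mem_set//=; by case.
rewrite big_ord_recl /= /lebesgue_cons /pushforward -IH; last by move=> i.
rewrite [X in product_measure1 _ _ X](_ : _ = A ord0 `*`
    [set x : 'rV[R]_n | forall i : 'I_n, A (lift ord0 i) (x ord0 i)]).
  rewrite product_measure1E//; first exact: mA.
  rewrite [X in measurable X](_ : _ = \bigcap_(i in [set: 'I_n])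
     ((fun x : 'rV[R]_n => x ord0 i) @^-1` A (lift ord0 i))).
    apply: fin_bigcap_measurable => //i _.
    by rewrite -[X in measurable X]setTI; exact: measurable_coord_rV.
  apply/seteqP; split => x /= Hx i; first by move=> _; exact: Hx.
  exact: Hx.
apply/seteqP; split => -[a x] /=.
  move=> H; split; first by have := H ord0; rewrite mxE unlift_none.
  by move=> i; have := H (lift ord0 i); rewrite mxE liftK.
move=> [Ha Hx] i; rewrite mxE; case: (unliftP ord0 i) => [j|] -> //=.
Qed.

End lebesgue_rV.

(** ** Sobolev space H^1(R^N) *)

Section sobolev.
Context {R : realType} (N : nat).
Implicit Types (u v phi : 'rV[R]_N -> R) (g : 'rV[R]_N -> 'rV[R]_N).

Local Notation mu := (@lebesgue_rV R N).

Definition dotv (x y : 'rV[R]_N) : R := \sum_i x ord0 i * y ord0 i.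

(* The norm of the library on ['rV[R]_N] is the sup norm. *)
Definition enorm (x : 'rV[R]_N) : R := Num.sqrt (dotv x x).

Definition partial (i : 'I_N) phi : 'rV[R]_N -> R := 'D_(delta_mx ord0 i) phi.

Definition grad phi (x : 'rV[R]_N) : 'rV[R]_N := \row_i partial i phi x.

Fixpoint Ck (k : nat) phi : Prop :=
  continuous phi /\
  if k is k'.+1 then
    forall i, (forall x, derivable phi x (delta_mx ord0 i)) /\
              Ck k' (partial i phi)
  else True.

Definition test_function phi : Prop :=
  (forall k, Ck k phi) /\ compact (closure [set x | phi x != 0]).

Definition weak_partial (i : 'I_N) u v : Prop := forall phi, test_function phi ->
  Rintegral mu setT (fun x => u x * partial i phi x) =
  - Rintegral mu setT (fun x => v x * phi x).

Definition L2 : set ('rV[R]_N -> R) := [set u | u \in Lfun mu 2%:E].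

Definition weak_grad_L2 u g : Prop := forall i,
  L2 (fun x => g x ord0 i) /\ weak_partial i u (fun x => g x ord0 i).

(* H^1(R^N) as a set of functions; two functions equal almost everywhere
   represent the same element. *)
Definition H1 : set ('rV[R]_N -> R) :=
  [set u | L2 u /\ exists g, weak_grad_L2 u g].

(* The weak gradient of u in H^1, well defined up to a null set. *)
Definition wgrad u : 'rV[R]_N -> 'rV[R]_N := xget (cst 0) (weak_grad_L2 u).

Definition H1norm u : R := Num.sqrt
  (Rintegral mu setT (fun x => enorm (wgrad u x) ^+ 2 + u x ^+ 2)).

Definition ae_zero u : Prop := {ae mu, forall x, u x = 0}.

(* J'(u) = 0 in the dual of H^1, J' being the Frechet derivative. *)
Definition critical_point (J : ('rV[R]_N -> R) -> R) u : Prop :=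
  H1 u /\ forall e : R, 0 < e -> exists2 d : R, 0 < d &
    forall v, H1 v -> H1norm v <= d ->
      `|J (fun x => u x + v x) - J u| <= e * H1norm v.

Definition least_energy_solution (J : ('rV[R]_N -> R) -> R) u : Prop :=
  [/\ critical_point J u, ~ ae_zero u &
    (J u)%:E =
      ereal_inf [set (J v)%:E | v in [set v | critical_point J v /\ ~ ae_zero v]]].

End sobolev.

Section energy.
Context {R : realType}.

Definition primitive0 (f : R -> R) (t : R) : R :=
  if 0 <= t then Rintegral lebesgue_measure `[0, t] f
  else - Rintegral lebesgue_measure `[t, 0] f.

Definition energy (N : nat) (Voo eps : R) (h : 'rV[R]_N -> R) (f : R -> R)
    (u : 'rV[R]_N -> R) : R :=
  2^-1 * Rintegral (lebesgue_rV N) setT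
           (fun x => enorm (wgrad u x) ^+ 2 + (Voo - eps * h x) * u x ^+ 2)
  - Rintegral (lebesgue_rV N) setT (fun x => primitive0 f (u x)).

Definition crit_exp (N : nat) : R := 2 * N%:R / (N%:R - 2).

End energy.

(* Main.v *)
(** For a weight [a] with values in [[0, 1]] vanishing at infinity, the functional
  [1/2 (lam |grad u|^2 + V u^2) - a F(u)] satisfies the Palais-Smale condition on bounded
  sequences, and Jeanjean's monotonicity trick, run on polygonal paths in [H^1], yields
  mountain pass critical points for some [lam] close to [1]; take [a = (1 + |x|^2)^(- eta)].
  Brezis-Kato iteration makes [f(u)] square integrable, so the Pohozaev identity holds; with
  the condition on [x . grad h] and Hardy's inequality it bounds the gradient in terms of the
  energy, uniformly in [lam] and [eta].  As [lam -> 1] and [eta -> 0] the weak limit is either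
  a nonzero solution with energy below the mountain pass level, or, after translation, a
  nonzero solution of the problem at infinity with nonlinearity [al f], [0 <= al <= 1].  In
  the second case, unless [al = 1] and [eps h = 0], the dilations of this solution form a path
  along which the energy stays strictly below the level, a contradiction.  The same dichotomy
  applied to a minimizing sequence of solutions gives the least energy solution. *)

From HB Require Import structures.
Require Import Defs.
From mathcomp Require Import all_boot all_order all_algebra.
From mathcomp Require Import all_classical all_reals all_analysis.
From mathcomp Require Import measurable_realfun.
From mathcomp Require Import ring lra.
Set Implicit Arguments.
Unset Strict Implicit.
Unset Printing Implicit Defensive.
Import Order.TTheory GRing.Theory Num.Theory.
Import numFieldNormedType.Exports.
Local Open Scope classical_set_scope.
Local Open Scope ring_scope.

Local Notation "E ~[ n ]~> l" := (E @[n --> \oo] --> l) (at level 70, n name, no associativity).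

(** Nothing is assumed on [f] beyond continuity and growth: without monotonicity of [f t / t] or a
    superquadraticity condition, Nehari projections and direct bounds on Palais-Smale sequences are
    out of reach. Gradient bounds therefore come from the slope of the level in [lam], and uniform
    ones from the Pohozaev identity. There [x . grad V] is controlled from one side only; it is
    written as a bounded decaying weight, which Hardy's inequality absorbs for small [eps], minus a
    nonnegative remainder, which is handled through its sign. The function [ln (1 + |x|^2)]
    oscillates by a bounded amount under translations of bounded size, so the weight becomes locally
    constant as [eta -> 0]; hence the constant factor [al] in the limit problem. Function spaces are
    treated through translations: weak derivatives are strong [L^2] limits of difference quotients,
    and the Rellich and Sobolev theorems rest on averages over cubes. Functions are not identified
    almost everywhere, so the Hilbert space arguments are carried out for a semidefinite form on a
    linear set of functions, complete for the seminorm. *)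

Ltac pos := solve [ done | exact: ltW |
 lazymatch goal with
 | |- is_true (0 <= _ + _) => apply: addr_ge0; pos
 | |- is_true (0 <= _ * _) => apply: mulr_ge0; pos
 | |- is_true (0 <= _^-1) => rewrite invr_ge0; pos
 | |- is_true (0 <= _ ^+ _) => apply: exprn_ge0; pos
 | |- is_true (0 <= _%:R) => exact: ler0n
 | |- is_true (0 < _ + _) => first [apply: ltr_wpDl; pos | apply: ltr_wpDr; pos]
 | |- is_true (0 < _ * _) => apply: mulr_gt0; pos
 | |- is_true (0 < _^-1) => rewrite invr_gt0; pos
 | |- is_true (0 < _ ^+ _) => apply: exprn_gt0; pos
 | |- is_true (0 < _ `^ _) => apply: powR_gt0; pos
 | |- is_true (0 < _%:R) => by rewrite ltr0n
 | |- is_true (?x <= ?x + _) => rewrite lerDl; pos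
 | |- is_true (?x <= _ + ?x) => rewrite lerDr; pos
 | |- is_true (_ && _) => apply/andP; split; pos
 end ].
Local Notation le_via y := (@le_trans _ _ y).

Ltac fring := rewrite ?fctE /GRing.scale /=; ring.
#[local] Hint Resolve sqr_ge0 powR_ge0 num_real expR_ge0 expR_gt0 : core.

Notation mfn := (measurable_fun setT).

Lemma cvg_EFin_seq (R : realType) (u : nat -> R) (l : R) :
 u n ~[n]~> l -> (u n)%:E ~[n]~> l%:E.
by move=> ul; apply: cvg_EFin => //; exact: nearW. Qed.

(** * Real-valued Lebesgue integration: algebra and limit theorems *)

Section real_integral.
Context d (T : measurableType d) (R : realType) (mu : {measure set T -> \bar R}).
Implicit Types f g h : T -> R.

Definition intg f := mu.-integrable setT (EFin \o f).
Local Notation Int := (Rintegral mu setT).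

Lemma intg_m f : intg f -> mfn f.
by move=> /measurable_int/measurable_EFinP. Qed.

Lemma intg_le f g : mfn f -> intg g -> (forall x, `|f x| <= g x) -> intg f.
move=> mf ig fg; apply: le_integrable ig => //; first exact/measurable_EFinP.
by move=> x _ /=; rewrite lee_fin (le_trans (fg x))// ler_norm.
Qed.

Lemma intgD f g : intg f -> intg g -> intg (fun x => f x + g x).
by move=> i1 i2; exact: (integrableD measurableT i1 i2). Qed.

Lemma intgB f g : intg f -> intg g -> intg (fun x => f x - g x).
by move=> i1 i2; exact: (integrableB measurableT i1 i2). Qed.

Lemma intgZ k f : intg f -> intg (fun x => k * f x).
by move=> i1; exact: (integrableZl measurableT k i1). Qed.

Lemma intg_norm f : intg f -> intg (fun x => `|f x|).
move=> /[dup] /intg_m mf i1.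
apply: le_integrable i1 => //; last by move=> x _ /=; rewrite normr_id.
by apply/measurable_EFinP; exact: measurableT_comp.
Qed.

Lemma intg0 : intg (fun=> 0).
exact: integrable0. Qed.

Lemma intg_sum (I : Type) (s : seq I) (P : pred I) (F : I -> T -> R) :
 (forall i, P i -> intg (F i)) -> intg (fun x => \sum_(i <- s | P i) F i x).
move=> iF; elim: s => [|i s IH].
 by under eq_fun do rewrite big_nil; exact: intg0.
under eq_fun do rewrite big_cons.
by case Pi : (P i) => //; apply: intgD => //; exact: iF.
Qed.

Lemma IntD f g : intg f -> intg g -> Int (fun x => f x + g x) = Int f + Int g.
by move=> i1 i2; rewrite RintegralD. Qed.

Lemma IntB f g : intg f -> intg g -> Int (fun x => f x - g x) = Int f - Int g.
by move=> i1 i2; rewrite RintegralB. Qed.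

Lemma IntZ k f : intg f -> Int (fun x => k * f x) = k * Int f.
by move=> i1; rewrite RintegralZl. Qed.

Lemma Int0 : Int (fun=> 0) = 0.
by rewrite Rintegral_cst// mul0r. Qed.

Lemma Int_sum (I : Type) (s : seq I) (P : pred I) (F : I -> T -> R) :
 (forall i, P i -> intg (F i)) ->
 Int (fun x => \sum_(i <- s | P i) F i x) = \sum_(i <- s | P i) Int (F i).
move=> iF; elim: s => [|i s IH].
 by rewrite big_nil; under eq_Rintegral do rewrite big_nil; exact: Int0.
rewrite big_cons; under eq_Rintegral do rewrite big_cons.
case Pi : (P i) => //; rewrite IntD ?IH//; first exact: iF.
exact: intg_sum.
Qed.

Lemma Int_le f g : intg f -> intg g -> (forall x, f x <= g x) -> Int f <= Int g.
by move=> i1 i2 fg; apply: le_Rintegral. Qed.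

Lemma Int_ge0 f : (forall x, 0 <= f x) -> 0 <= Int f.
by move=> f0; apply: Rintegral_ge0. Qed.

Lemma Int_norm f : intg f -> `|Int f| <= Int (fun x => `|f x|).
by move=> i1; apply: le_normr_Rintegral. Qed.

Lemma Int_eq f g : (forall x, f x = g x) -> Int f = Int g.
by move=> fg; apply: eq_Rintegral => x _. Qed.

Lemma Int_norm_le f g : mfn f -> intg g -> (forall x, `|f x| <= g x) ->
 `|Int f| <= Int g.
move=> mf ig fg; have i1 := intg_le mf ig fg.
by rewrite (le_trans (Int_norm i1))// Int_le//; exact: intg_norm.
Qed.

Lemma Int_ae f g : mfn f -> mfn g -> {ae mu, forall x, f x = g x} ->
 Int f = Int g.
move=> mf mg fg; congr fine; apply: ae_eq_integral => //=.
- exact/measurable_EFinP.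
- exact/measurable_EFinP.
- by move: fg; apply: filterS => x /= ->.
Qed.

Lemma Int_eq0_ae f : (forall x, 0 <= f x) -> intg f -> Int f = 0 ->
 {ae mu, forall x, f x = 0}.
move=> f0 fi If0.
have /ae_eq_integral_abs : measurable_fun setT (EFin \o f).
 exact/measurable_EFinP/intg_m.
move=> /(_ mu) [//|+ _].
have -> : (\int[mu]_x `|(EFin \o f) x| = 0)%E.
 under eq_integral do rewrite gee0_abs ?lee_fin//.
 by rewrite -[LHS]fineK ?integrable_fin_num// -[fine _]/(Int f) If0.
by move=> /(_ erefl); apply: filterS => x /= /(_ Logic.I) [].
Qed.

Lemma Int_dct (f_ : nat -> T -> R) f g :
 (forall n, mfn (f_ n)) -> mfn f ->
 {ae mu, forall x, f_ n x ~[n]~> f x} ->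
 intg g -> (forall n x, `|f_ n x| <= g x) ->
 intg f /\ Int (f_ n) ~[n]~> Int f.
move=> mf_ mf ff ig fg.
have [|||//||i1 _ i3] := @dominated_convergence _ _ _ mu setT measurableT
 (fun n => EFin \o f_ n) (EFin \o f) (EFin \o g).
- by move=> n; exact/measurable_EFinP.
- exact/measurable_EFinP.
- move: ff; apply: filterS => x /= H _; exact: cvg_EFin_seq.
- by apply/aeW => x n _ /=; rewrite lee_fin.
split=> //; apply: fine_cvg => //=.
by rewrite /Rintegral fineK//; exact: integrable_fin_num.
Qed.

(** Fatou's lemma in the form of a compactness statement: a uniform bound on integrals of
    nonnegative functions makes the almost everywhere limit integrable, with the same bound, and no
    dominating function has to be exhibited. *)
Lemma Int_fatou (f_ : nat -> T -> R) f M :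
 (forall n, intg (f_ n)) -> (forall n x, 0 <= f_ n x) -> mfn f ->
 (forall x, 0 <= f x) ->
 {ae mu, forall x, f_ n x ~[n]~> f x} ->
 (forall n, Int (f_ n) <= M) ->
 intg f /\ Int f <= M.
move=> if_ f_0 mf f0 ff fM.
have key : (\int[mu]_x (f x)%:E <= M%:E)%E.
 apply: (le_via (\int[mu]_x limn_einf (fun n => (f_ n x)%:E))%E).
  rewrite le_eqVlt; apply/orP; left; apply/eqP.
  apply: ge0_ae_eq_integral => //=.
  - exact/measurable_EFinP.
  - rewrite (_ : (fun x => _) = (fun x => - limn_esup (fun n => (- f_ n x)%:E))%E).
    apply/measurableT_comp => //; apply: measurable_fun_limn_esup => n.
    by apply/measurable_EFinP; apply: measurableT_comp => //; exact: intg_m.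
   by apply/funext => x; rewrite -[LHS]oppeK -limn_esupN.
  - by move=> x _; rewrite lee_fin.
  - move=> x _; rewrite limn_einf_lim; apply: lime_ge.
    exact: is_cvg_einfs.
   apply: nearW => n; apply: le_ereal_inf_tmp => _ [m _ <-]; by rewrite lee_fin.
  - move: ff; apply: filterS => x /= fx _; apply/esym.
   have H := cvg_EFin_seq fx.
   by rewrite is_cvg_limn_einfE; [exact/cvg_lim|exact/cvgP/H].
 apply: (le_via (limn_einf (fun n => \int[mu]_x (f_ n x)%:E))%E).
  apply: fatou => //; first by move=> n; exact/measurable_EFinP/intg_m.
  by move=> n x _; rewrite lee_fin.
 rewrite limn_einf_lim; apply: lime_le; first exact: is_cvg_einfs.
 apply: nearW => n; apply: (le_via (\int[mu]_x (f_ n x)%:E)%E).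
  by apply: ereal_inf_lbound; exists n => /=.
 by rewrite -(fineK (integrable_fin_num measurableT (if_ n))) lee_fin; exact: fM.
have fi : intg f.
 apply/integrableP; split; first exact/measurable_EFinP.
 under eq_integral do rewrite gee0_abs ?lee_fin//.
 by rewrite (le_lt_trans key)// ltry.
split=> //; rewrite -lee_fin fineK//; exact: integrable_fin_num.
Qed.

End real_integral.
Arguments intg {d T R} mu f.

(** Discriminant inequality without a sign assumption on [c]. It serves as Cauchy-Schwarz for
    semidefinite forms, and also for approximate minimizers, where [a] is the defect from the
    minimum. *)
Lemma quad_ge0 (R : realType) (a b c : R) :
 (forall t, 0 <= a + 2 * t * b + t ^+ 2 * c) -> b ^+ 2 <= a * c.
move=> H; have [c0|c0|c0] := ltgtP c 0; last first.
- rewrite c0 mulr0; have [->|b0] := eqVneq b 0; first by rewrite expr0n.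
 have := H (- (a + 1) / (2 * b)); rewrite c0 mulr0 addr0.
 have -> : a + 2 * (- (a + 1) / (2 * b)) * b = -1 by field.
 by rewrite ler0N1.
- have := H (- b / c).
 have -> : a + 2 * (- b / c) * b + (- b / c) ^+ 2 * c = a - b ^+ 2 / c.
  by field; rewrite gt_eqF.
 by rewrite subr_ge0 ler_pdivrMr.
(* A negative leading coefficient is excluded by the large value [t] below, which makes the
   polynomial negative. *)
- exfalso; have := H 0; rewrite mulr0 mul0r expr0n mul0r !addr0 => a0.
 pose t := (a + 1 + 2 * `|b|) / - c + 1.
 have c' : 0 < - c by rewrite oppr_gt0.
 have t1 : 1 <= t by rewrite /t lerDr divr_ge0 ?(ltW c')// addr_ge0// addr_ge0.
 have tc : t * - c >= a + 1 + 2 * `|b|.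
  by rewrite /t [leRHS]mulrDl mul1r divfK ?gt_eqF// lerDl ltW.
 have := H t; have := ler_norm b.
 have : t ^+ 2 * c <= - (t * (a + 1 + 2 * `|b|)).
  by rewrite expr2 -mulrA lerNr -mulrN ler_wpM2l ?(le_trans ler01 t1)// -mulrN.
 by nra.
Qed.

(** * Real sequences and extraction of subsequences *)

Lemma cvg0_le (R : realType) (u v : nat -> R) :
 (forall n, `|u n| <= v n) -> v n ~[n]~> 0 -> u n ~[n]~> 0.
move=> uv v0; apply/norm_cvg0P.
apply: (@squeeze_cvgr _ _ _ _ (fun=> 0) v) => //; last exact: cvg_cst.
by apply: nearW => n; rewrite normr_ge0 uv.
Qed.

Lemma sqr_norm (R : realDomainType) (x : R) : `|x| ^+ 2 = x ^+ 2.
by rewrite real_normK// num_real. Qed.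

Lemma cvg0P (R : realType) (u : nat -> R) :
 (forall e : R, 0 < e -> exists M, forall n, (M <= n)%N -> `|u n| <= e) <->
 u n ~[n]~> 0.
split=> [H|/cvgrPdist_le H e e0].
 apply/cvgrPdist_le => e e0; have [M HM] := H _ e0.
 by exists M => // n /= /HM; rewrite sub0r normrN.
have [M _ HM] := H _ e0; exists M => n /HM /=; by rewrite sub0r normrN.
Qed.

Lemma cvg0E (R : realType) (u : nat -> R) (e : R) : u n ~[n]~> 0 -> 0 < e ->
 exists M, forall n, (M <= n)%N -> `|u n| <= e.
by move=> /cvg0P; apply. Qed.

Lemma cvgBP (R : realType) (u : nat -> R) l :
 (u n - l) ~[n]~> 0 <-> u n ~[n]~> l.
exact: (iff_sym (rwP idP)) || exact: subr_cvg0. Qed.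

Lemma inc_ge (k : nat -> nat) : {homo k : m n / (m < n)%N} -> forall n, (n <= k n)%N.
by move=> kk; elim=> // n IH; rewrite (leq_ltn_trans IH)// kk. Qed.

Lemma cvg_sub (R : realType) (u : nat -> R) (l : R) (k : nat -> nat) :
 {homo k : m n / (m < n)%N} -> u n ~[n]~> l ->
 u (k n) ~[n]~> l.
move=> kk ul; apply: (cvg_comp k u _ ul) => A [M _ HM].
by exists M => // n /= Mn; apply: HM; rewrite /= (leq_trans Mn)// inc_ge.
Qed.

Lemma cauchy_cvg_seq (R : realType) (u : nat -> R) :
 (forall e : R, 0 < e -> exists M, forall m n, (M <= m)%N -> (M <= n)%N ->
   `|u m - u n| <= e) -> exists l : R, u n ~[n]~> l.
move=> H; have : cvgn u.
 apply/cauchy_cvgP.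
 apply/cauchy_ballP => e e0.
 have [M HM] := H (e / 2) ltac:(by pos).
 exists (u @` [set n | (M <= n)%N], u @` [set n | (M <= n)%N]) => /=.
  by split; exists M => // n Mn; exists n.
 move=> [_ _] /= [[m Mm <-] [n Mn <-]]; rewrite /ball /= (le_lt_trans (HM _ _ Mm Mn))//.
 by rewrite ltr_pdivrMr// ltr_pMr// ltr1n.
by move=> /cvg_ex.
Qed.

Lemma BW (R : realType) (u : nat -> R) M : (forall n, `|u n| <= M) ->
 exists k : nat -> nat, {homo k : m n / (m < n)%N} /\
  exists l : R, u (k n) ~[n]~> l.
move=> uM.
have : compact `[-M, M] by exact: segment_compact.
move=> /(_ (u @ \oo)) [].
 by exists 0%N => // n _ /=; rewrite in_itv/= -ler_norml uM.
move=> l [_ cl].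
have ex m (e : R) : 0 < e -> exists n, (m < n)%N /\ `|u n - l| <= e.
 move=> e0; have [] := cl [set u n | n in [set n | (m < n)%N]] (ball l e).
 - by exists m.+1 => // n mn; exists n.
 - exact: nbhsx_ballx.
 - move=> x [[n mn <-]]; rewrite /ball /= distrC => h.
  by exists n; split => //; exact: ltW.
have /choice[s Hs] : forall p : nat * nat, exists n, (p.1 < n)%N /\
  `|u n - l| <= (p.2.+1%:R)^-1.
 by move=> p; apply: ex; rewrite invr_gt0.
pose k := fix k n := if n is n'.+1 then s (k n', n) else s (0%N, 0%N).
have kS n : (k n < k n.+1)%N by exact: (Hs _).1.
exists k; split; first by apply: homo_ltn => //; exact: ltn_trans.
exists l; apply/cvgBP; apply: (@cvg0_le _ _ (fun n => (n.+1%:R)^-1)).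
 by case=> [|n]; [exact: (Hs (0%N,0%N)).2|exact: (Hs (k n, n.+1)).2].
exact: cvg_harmonic.
Qed.

Lemma diagonal (R : realType) (a : nat -> nat -> R) (M : nat -> R) :
 (forall i n, `|a i n| <= M i) ->
 exists k : nat -> nat, {homo k : m n / (m < n)%N} /\
  forall i, exists l : R, a i (k n) ~[n]~> l.
move=> aM.
have /choice[phi Hphi] : forall p : nat * (nat -> nat), exists s : nat -> nat,
  {homo s : m n / (m < n)%N} /\
  exists l : R, a p.1 (p.2 (s n)) ~[n]~> l.
 by move=> [i s]; exact: (@BW _ (fun n => a i (s n)) (M i)).
(* [K i] composes the first [i] extractions, so [K i.+1] is the first one along which row [i]
   converges. *)
pose K := fix K i := if i is i'.+1 then K i' \o phi (i', K i') else id.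
have Kinc i : {homo K i : m n / (m < n)%N}.
 elim: i => //= i IH m n mn; apply: IH; exact: (Hphi _).1.
have KK i j : exists s : nat -> nat, {homo s : m n / (m < n)%N} /\
  K (j + i)%N = K i \o s.
 elim: j => [|j [s [sinc Ks]]]; first by exists id; split.
 exists (s \o phi ((j + i)%N, K (j + i)%N)); split.
  by move=> m n mn; apply: sinc; exact: (Hphi _).1.
 by rewrite addSn /= Ks.
exists (fun n => K n n); split.
 apply: homo_ltn; first exact: ltn_trans.
 by move=> n /=; apply: Kinc; rewrite (leq_trans _ (inc_ge (Hphi _).1 _)).
move=> i; have [_ [l Hl]] := Hphi (i, K i); exists l.
apply/cvgBP/cvg0P => e e0; move/cvgBP/cvg0P: Hl => /(_ _ e0)[m Hm].
(* From index [i.+1] on, the diagonal is read off subsequences of [K i.+1]. *)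
exists (maxn m i.+1) => n; rewrite geq_max => /andP[mn inn].
have [s [sinc Ks]] := KK i.+1 (n - i.+1)%N.
rewrite subnK// in Ks; rewrite Ks /=; apply: Hm.
by rewrite (leq_trans mn)// inc_ge.
Qed.

(** * Hilbert space theory for a semidefinite form on a linear set *)

Section prehilbert.
Variables (R : realType) (E : lmodType R) (P : set E) (B : E -> E -> R).
Hypothesis P0 : P 0.
Hypothesis PD : forall x y, P x -> P y -> P (x + y).
Hypothesis PZ : forall a x, P x -> P (a *: x).
Hypothesis BC : forall x y, P x -> P y -> B x y = B y x.
Hypothesis BD : forall x y z, P x -> P y -> P z -> B (x + y) z = B x z + B y z.
Hypothesis BZ : forall a x y, P x -> P y -> B (a *: x) y = a * B x y.
Hypothesis B_ge0 : forall x, P x -> 0 <= B x x.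

Definition bn x := Num.sqrt (B x x).

Lemma PB x y : P x -> P y -> P (x - y).
by move=> Px Py; rewrite -scaleN1r; apply: PD => //; exact: PZ. Qed.

Lemma bDr x y z : P x -> P y -> P z -> B z (x + y) = B z x + B z y.
by move=> *; rewrite BC ?BD// ?[B _ z]BC//; exact: PD. Qed.

Lemma bZr a x y : P x -> P y -> B y (a *: x) = a * B y x.
by move=> *; rewrite BC ?BZ// ?[B _ y]BC//; exact: PZ. Qed.

Lemma bBl x y z : P x -> P y -> P z -> B (x - y) z = B x z - B y z.
by move=> *; rewrite -scaleN1r BD// ?BZ ?mulN1r//; exact: PZ. Qed.

Lemma bBr x y z : P x -> P y -> P z -> B z (x - y) = B z x - B z y.
by move=> *; rewrite -scaleN1r bDr// ?bZr ?mulN1r//; exact: PZ. Qed.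

Lemma bn_ge0 x : 0 <= bn x. exact: sqrtr_ge0. Qed.

Lemma bn2 x : P x -> bn x ^+ 2 = B x x.
by move=> Px; rewrite sqr_sqrtr// B_ge0. Qed.

Lemma quadE x y t : P x -> P y ->
 B (x + t *: y) (x + t *: y) = B x x + 2 * t * B x y + t ^+ 2 * B y y.
move=> Px Py; have Pty := PZ t Py.
rewrite BD ?bDr ?BZ ?bZr//; try exact: PD.
by rewrite [B y x]BC//; ring.
Qed.

Lemma cs2 x y : P x -> P y -> B x y ^+ 2 <= B x x * B y y.
move=> Px Py; apply: quad_ge0 => t; rewrite -quadE//.
by apply: B_ge0; apply: PD => //; exact: PZ.
Qed.

Lemma cs x y : P x -> P y -> `|B x y| <= bn x * bn y.
move=> Px Py; rewrite -sqrtrM ?B_ge0// -sqrtr_sqr ler_wsqrtr// cs2//.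
Qed.

Lemma bn_tri x y : P x -> P y -> bn (x + y) <= bn x + bn y.
move=> Px Py; rewrite -(@ler_pXn2r _ 2)// ?nnegrE ?addr_ge0 ?bn_ge0//.
rewrite bn2; last exact: PD.
have := quadE 1 Px Py; rewrite scale1r => ->.
rewrite sqrrD !bn2// mulr1 expr1n mul1r.
rewrite lerD2r lerD2l -[leRHS]mulr_natl ler_wpM2l// (le_trans (ler_norm _))//.
exact: cs.
Qed.

Lemma bnZ a x : P x -> bn (a *: x) = `|a| * bn x.
move=> Px; rewrite /bn BZ// ?bZr//; last exact: PZ.
by rewrite mulrA -expr2 sqrtrM ?sqr_ge0// sqrtr_sqr.
Qed.

Lemma bnN x : P x -> bn (- x) = bn x.
by move=> Px; rewrite -scaleN1r bnZ// normrN1 mul1r. Qed.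

Lemma bnB x y : P x -> P y -> bn (x - y) = bn (y - x).
by move=> Px Py; rewrite -opprB bnN//; exact: PB. Qed.

Lemma bn_triB x y : P x -> P y -> bn (x - y) <= bn x + bn y.
move=> Px Py; rewrite -(bnN Py); apply: bn_tri => //.
by rewrite -scaleN1r; exact: PZ.
Qed.

Lemma B_cvg (x_ : nat -> E) x y : (forall n, P (x_ n)) -> P x -> P y ->
 bn (x_ n - x) ~[n]~> 0 -> B (x_ n) y ~[n]~> B x y.
move=> Px_ Px Py H; apply/cvgBP.
apply: (@cvg0_le _ _ (fun n => bn (x_ n - x) * bn y)).
 by move=> n; rewrite -bBl//; apply: cs => //; exact: PB.
by rewrite -(mul0r (bn y)); apply: cvgMl.
Qed.

Hypothesis complete : forall x_ : nat -> E, (forall n, P (x_ n)) ->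
 (forall e : R, 0 < e -> exists M, forall m n, (M <= m)%N -> (M <= n)%N ->
   bn (x_ m - x_ n) <= e) ->
 exists2 x, P x & bn (x_ n - x) ~[n]~> 0.

Section riesz.
Variable C : set E.
Hypothesis CP : C `<=` P.
Hypothesis C0 : C 0.
Hypothesis CD : forall x y, C x -> C y -> C (x + y).
Hypothesis CZ : forall a x, C x -> C (a *: x).

(** The representative is found by minimizing [B z z - 2 * l z] over [C]. Since [C] is not assumed
    closed, the limit [x] of the minimizing sequence only lies in [P], and it represents [l] on [C];
    taking [C := P] gives Riesz's theorem, a smaller [C] gives density criteria. *)
Lemma riesz_closure (l : E -> R) (M : R) :
 (forall x y, C x -> C y -> l (x + y) = l x + l y) ->
 (forall a x, C x -> l (a *: x) = a * l x) ->
 (forall x, C x -> `|l x| <= M * bn x) ->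
 exists (z_ : nat -> E) (x : E), [/\ forall n, C (z_ n), P x,
  bn (z_ n - x) ~[n]~> 0 & forall y, C y -> l y = B x y].
move=> lD lZ lM; pose J z := B z z - 2 * l z.
have Jge z : C z -> - M ^+ 2 <= J z.
 move=> Cz; rewrite /J -bn2; last exact: CP.
 have := lM _ Cz; have := ler_norm (l z).
 by have := sqr_ge0 (bn z - M); nra.
pose S := [set J z | z in C].
have Sinf : has_inf S.
 split; first by exists (J 0); exists 0.
 by exists (- M ^+ 2) => _ [z Cz <-]; exact: Jge.
pose m := inf S.
have mJ z : C z -> m <= J z by move=> Cz; apply: ge_inf; [exact: Sinf.2|exists z].
have /choice[z_ Hz] : forall n : nat, exists z, C z /\ J z <= m + (n.+1%:R)^-1.
 move=> n; have n0 : 0 < (n.+1%:R : R)^-1 by pos.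
 have [_ [z Cz <-] lt] := inf_adherent n0 Sinf.
 by exists z; split=> //; exact: ltW.
have Cz n := (Hz n).1.
have Pz n := CP (Cz n).
(* Parallelogram identity: midpoints stay in [C], so a minimizing sequence is Cauchy. *)
have par x y : C x -> C y ->
  B (x - y) (x - y) = 2 * J x + 2 * J y - 4 * J (2^-1 *: (x + y)).
 move=> Cx Cy; have Cxy := CD Cx Cy; rewrite /J lZ// lD//.
 have Px := CP Cx; have Py := CP Cy; have Pxy := CP Cxy.
 rewrite BZ// ?bZr//; last exact: PZ.
 rewrite -[y]scale1r -[in LHS]scaleNr !quadE// !scale1r.
 by rewrite mulr1 expr1n sqrrN expr1n; field.
have cau i j : B (z_ i - z_ j) (z_ i - z_ j) <= 2 * (i.+1%:R)^-1 + 2 * (j.+1%:R)^-1.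
 rewrite par//; have := (Hz i).2; have := (Hz j).2.
 have := mJ (2^-1 *: (z_ i + z_ j)) (CZ _ (CD (Cz i) (Cz j))).
 move: (i.+1%:R^-1 : R) (j.+1%:R^-1 : R) => a b; lra.
have [x Px xz] : exists2 x, P x & bn (z_ n - x) ~[n]~> 0.
 apply: complete => // e e0.
 have : (n.+1%:R : R)^-1 ~[n]~> 0 by exact: cvg_harmonic.
 move=> /cvg0P/(_ (e ^+ 2 / 4))[|K HK]; first by pos.
 exists K => i j /HK + /HK; rewrite !ger0_norm ?invr_ge0// => Hi Hj.
 rewrite -(@ler_pXn2r _ 2)// ?nnegrE ?bn_ge0 ?(ltW e0)// bn2; last exact: PB.
 have := cau i j; move: Hi Hj.
 move: (i.+1%:R^-1 : R) (j.+1%:R^-1 : R) => a b; lra.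
exists z_, x; split => // y Cy; apply/esym.
have Py := CP Cy.
have c1 := B_cvg Pz Px Py xz.
apply: (cvg_unique _ c1) => //; apply/cvgBP.
(* Moving [z_ n] by [t *: y] cannot lower [J] by more than [1 / (n + 1)]; the discriminant of the
   resulting polynomial in [t] is the error in the Euler equation. *)
have bd n : (B (z_ n) y - l y) ^+ 2 <= (n.+1%:R)^-1 * B y y.
 apply: quad_ge0 => t.
 have := mJ (z_ n + t *: y) (CD (Cz n) (CZ t Cy)).
 have := (Hz n).2; rewrite /J quadE// lD ?lZ//; last exact: CZ.
 by rewrite mulrBr; move: (n.+1%:R^-1 : R) => a h1 h2; lra.
apply: (@cvg0_le _ _ (fun n => Num.sqrt ((n.+1%:R)^-1 * B y y))).
 by move=> n; rewrite -sqrtr_sqr ler_wsqrtr.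
rewrite -[X in _ --> X](sqrtr0 R) -(mul0r (B y y)).
apply: (cvg_comp (fun n => (n.+1%:R)^-1 * B y y) (@Num.sqrt R)).
 by apply: cvgMl; exact: cvg_harmonic.
exact: sqrt_continuous.
Qed.

(** The representative [x] of [B z] on [C] differs from [z] by a vector orthogonal to [C], hence by
    a null vector, and [x] is a limit of elements of [C]. Only [B z z = 0] is required of the
    orthogonal vectors, as fits functions that vanish almost everywhere. *)
Lemma dense_orth : (forall z, P z -> (forall y, C y -> B z y = 0) -> B z z = 0) ->
 forall z, P z -> forall e, 0 < e -> exists2 y, C y & bn (z - y) <= e.
move=> H z Pz e e0.
have [|||z_ [x [Cz Px zx zE]]] := @riesz_closure (B z) (bn z).
- by move=> u v /CP Pu /CP Pv; rewrite bDr.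
- by move=> a u /CP Pu; rewrite bZr.
- by move=> u /CP Pu; exact: cs.
have zx0 : bn (z - x) = 0.
 rewrite /bn H ?sqrtr0//; first exact: PB.
 by move=> y Cy; rewrite bBl ?zE ?subrr//; exact: CP.
have /cvg0P/(_ _ e0)[K /(_ K (leqnn _))] := zx.
rewrite ger0_norm ?bn_ge0// => HK; exists (z_ K) => //.
have Pk := CP (Cz K).
rewrite (_ : z - z_ K = (z - x) - (z_ K - x)); last by rewrite opprB addrA subrK.
by rewrite (le_trans (bn_triB _ _)) ?zx0 ?add0r//; exact: PB.
Qed.

End riesz.

Lemma riesz (l : E -> R) (M : R) :
 (forall x y, P x -> P y -> l (x + y) = l x + l y) ->
 (forall a x, P x -> l (a *: x) = a * l x) ->
 (forall x, P x -> `|l x| <= M * bn x) ->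
 exists2 x, P x & forall y, P y -> l y = B x y.
move=> lD lZ lM.
have [_ [x [_ Px _ xl]]] := @riesz_closure P (fun x Px => Px) P0 PD PZ l M lD lZ lM.
by exists x.
Qed.

(** A diagonal extraction makes the products with every term of the sequence converge. The vectors
    [z] with convergent products form a linear set [C] containing the sequence, and a vector of [P]
    is replaced by an almost nearest point of [C]; no separability of [P] and no projection onto a
    closed subspace is involved. *)
Lemma weak_compactness (x_ : nat -> E) (M : R) :
 (forall n, P (x_ n)) -> (forall n, bn (x_ n) <= M) ->
 exists (k : nat -> nat) (x : E), [/\ {homo k : m n / (m < n)%N}, P x &
  forall z, P z -> B (x_ (k n)) z ~[n]~> B x z].
move=> Px xM.
have M0 : 0 <= M by exact: le_trans (bn_ge0 _) (xM 0%N).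
have [k [kinc kl]] := @diagonal R (fun i n => B (x_ n) (x_ i)) (fun=> M * M)
 (fun i n => le_trans (cs (Px n) (Px i))
   (ler_pM (bn_ge0 _) (bn_ge0 _) (xM n) (xM i))).
pose y n := x_ (k n).
have Py n : P (y n) by exact: Px.
pose C := [set z | P z /\ exists l : R, B (y n) z ~[n]~> l].
have Cy n : C (y n) by split => //; exact: kl.
have CD u v a : C u -> C v -> C (u + a *: v).
 move=> [Pu [lu Hu]] [Pv [lv Hv]]; split; first by apply: PD => //; exact: PZ.
 exists (lu + a * lv).
 have -> : (fun n => B (y n) (u + a *: v)) =
   (fun n => B (y n) u + a * B (y n) v).
  by apply/funext => n; rewrite bDr ?bZr//; exact: PZ.
 by apply: cvgD => //; exact: cvgMr.
have key z : P z -> exists l : R, B (y n) z ~[n]~> l.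
 move=> Pz; pose S := [set B (z - s) (z - s) | s in C].
 have Sinf : has_inf S.
  split; first by exists (B (z - y 0%N) (z - y 0%N)); exists (y 0%N).
  by exists 0 => _ [s [Ps _] <-]; apply: B_ge0; exact: PB.
 (* As [s - t *: y n] stays in [C], almost minimality of the distance from [z] to [s] makes [z - s]
    almost orthogonal to all [y n] at once. *)
 have near (e : R) : 0 < e -> exists s, C s /\
   forall n, `|B (y n) z - B (y n) s| <= e.
  move=> e0; pose del := (e / (M + 1)) ^+ 2.
  have M1 : 0 < M + 1 by pos.
  have del0 : 0 < del by rewrite exprn_gt0// divr_gt0.
  have [_ [s Cs <-] lt] := inf_adherent del0 Sinf.
  have Ps := Cs.1.
  exists s; split => // n; rewrite -bBr//.
  have : B (z - s) (y n) ^+ 2 <= del * B (y n) (y n).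
   apply: quad_ge0 => t.
   have Pzs := PB Pz Ps.
   have Cst := CD _ _ (- t) Cs (Cy n).
   have : inf S <= B (z - (s - t *: y n)) (z - (s - t *: y n)).
    by apply: ge_inf; [exact: Sinf.2|exists (s - t *: y n); rewrite -scaleNr].
   have -> : z - (s - t *: y n) = z - s + t *: y n by rewrite opprB addrA addrAC.
   rewrite quadE//; lra.
  rewrite BC//; last exact: PB.
  move=> h; rewrite -(@ler_pXn2r _ 2)// ?nnegrE ?(ltW e0)//.
  rewrite -normrX ger0_norm ?sqr_ge0// (le_trans h)// -bn2//.
  have : bn (y n) ^+ 2 <= (M + 1) ^+ 2.
   rewrite ler_pXn2r ?nnegrE ?bn_ge0 ?(ltW M1)// (le_trans (xM _))//.
   by rewrite lerDl.
  move=> /(ler_wpM2l (ltW del0))/le_trans; apply.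
  by rewrite /del -exprMn divfK ?gt_eqF.
 apply: cauchy_cvg_seq => e e0.
 have [s [[Ps [l Hl]] Hs]] := near (e / 4) ltac:(by pos).
 move/cvgBP/cvg0P: Hl => /(_ (e / 4)) [|K HK]; first by pos.
 exists K => i j /HK Hi /HK Hj; have := Hs i; have := Hs j; move: Hi Hj.
 rewrite !ler_norml; lra.
pose l z := if pselect (P z) is left Pz then projT1 (cid (key z Pz)) else 0.
have lE z : P z -> B (y n) z ~[n]~> l z.
 by move=> Pz; rewrite /l; case: pselect => // Pz'; case: cid.
have [|||x Pxx xl] := @riesz l M.
- move=> u v Pu Pv; have := lE _ (PD Pu Pv); under eq_fun do rewrite bDr//.
 by move=> h; apply/esym; apply: (cvg_unique _ _ h) => //; apply: cvgD; exact: lE.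
- move=> a u Pu; have := lE _ (PZ a Pu); under eq_fun do rewrite bZr//.
 by move=> h; apply/esym; apply: (cvg_unique _ _ h) => //; apply: cvgMr; exact: lE.
- move=> u Pu; have /cvg_norm h := lE _ Pu.
 apply: (@limr_le_near _ _ _ _ _ _) || (rewrite -(cvg_lim _ h)//; apply: limr_le).
  by apply/cvgP/h.
 apply: nearW => n; rewrite (le_trans (cs _ _))// ler_wpM2r ?bn_ge0//; exact: xM.
- by exists k, x; split => // z Pz; rewrite -xl//; exact: lE.
Qed.

End prehilbert.

(** * The space of square integrable functions *)

Section L2.
Context d (T : measurableType d) (R : realType) (mu : {measure set T -> \bar R}).
Implicit Types f g h : T -> R.
Local Notation Int := (Rintegral mu setT).
Local Notation intg := (intg mu).

(** Plain functions, so [nrm] is only a seminorm. For the Lebesgue measure this is the set [L2], see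
    [L2P]. *)
Definition l2 : set (T -> R) :=
 [set f : T -> R | mfn f /\ intg (fun x => f x ^+ 2)].
Definition ip f g : R := Int (fun x => f x * g x).
Definition nrm : (T -> R) -> R := bn ip.

Lemma ip_Int f g : ip f g = Int (fun x => f x * g x). by []. Qed.

Lemma nrm_sqrt f : nrm f = Num.sqrt (ip f f). by []. Qed.

Lemma l2m f : l2 f -> mfn f. by case. Qed.
Lemma l2i f : l2 f -> intg (fun x => f x ^+ 2). by case. Qed.

Lemma l2_le f g : mfn f -> l2 g -> (forall x, `|f x| <= `|g x|) -> l2 f.
move=> mf [mg ig] fg; split => //; apply: intg_le ig _ => //.
 exact: measurable_funX.
by move=> x; rewrite normrX -[leRHS]sqr_norm lerXn2r.
Qed.

Lemma l2_intgM f g : l2 f -> l2 g -> intg (fun x => f x * g x).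
move=> [mf if_] [mg ig].
apply: (@intg_le _ _ _ _ _ (fun x => f x ^+ 2 + g x ^+ 2)).
- exact: measurable_funM.
- exact: intgD.
- move=> x; rewrite normrM -(real_normK (num_real (f x))) -(real_normK (num_real (g x))).
 have := sqr_ge0 (`|f x| - `|g x|); have := normr_ge0 (f x).
 by have := normr_ge0 (g x); nra.
Qed.

Lemma l2_0 : l2 0.
split; first exact: measurable_cst.
by under eq_fun do rewrite expr0n; exact: intg0.
Qed.

Lemma l2D f g : l2 f -> l2 g -> l2 (f + g).
move=> lf lg; split; first exact: measurable_funD lf.1 lg.1.
have -> : (fun x => (f + g) x ^+ 2) =
  (fun x => f x ^+ 2 + (2 * (f x * g x) + g x ^+ 2)).
 by apply/funext => x; rewrite fctE; ring.
apply: intgD; first exact: l2i.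
by apply: intgD; [apply: intgZ; exact: l2_intgM|exact: l2i].
Qed.

Lemma l2Z a f : l2 f -> l2 (a *: f).
move=> [mf if_]; split; first exact: measurable_funM.
by under eq_fun do rewrite fctE exprMn; exact: intgZ.
Qed.

Lemma l2N f : l2 f -> l2 (- f).
by move=> lf; rewrite -scaleN1r; exact: l2Z. Qed.

Lemma l2B f g : l2 f -> l2 g -> l2 (f - g).
by move=> lf lg; apply: l2D => //; exact: l2N. Qed.

Lemma l2_norm f : l2 f -> l2 (fun x => `|f x|).
move=> lf; apply: (l2_le _ lf); last by move=> x; rewrite normr_id.
exact: measurableT_comp (l2m lf).
Qed.

Lemma ipC f g : ip f g = ip g f.
by apply: Int_eq => x; rewrite mulrC. Qed.

Lemma ipD f g h : l2 f -> l2 g -> l2 h -> ip (f + g) h = ip f h + ip g h.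
move=> lf lg lh; rewrite /ip -IntD; [|exact: l2_intgM|exact: l2_intgM].
by apply: Int_eq => x; rewrite fctE mulrDl.
Qed.

Lemma ipZ a f g : l2 f -> l2 g -> ip (a *: f) g = a * ip f g.
move=> lf lg; rewrite /ip -IntZ; last exact: l2_intgM.
by apply: Int_eq => x; rewrite fctE mulrA.
Qed.

Lemma ip_ge0 f : l2 f -> 0 <= ip f f.
by move=> _; apply: Int_ge0 => x; rewrite -expr2 sqr_ge0. Qed.

Let C2 f g (_ : l2 f) (_ : l2 g) := ipC f g.

Lemma ipBl f g h : l2 f -> l2 g -> l2 h -> ip (f - g) h = ip f h - ip g h.
exact: (bBl l2Z ipD ipZ). Qed.

Lemma ipDr f g h : l2 f -> l2 g -> l2 h -> ip h (f + g) = ip h f + ip h g.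
exact: (bDr l2D C2 ipD). Qed.

Lemma ipBr f g h : l2 f -> l2 g -> l2 h -> ip h (f - g) = ip h f - ip h g.
exact: (bBr l2D l2Z C2 ipD ipZ). Qed.

Lemma ipZr a f g : l2 f -> l2 g -> ip g (a *: f) = a * ip g f.
exact: (bZr l2Z C2 ipZ). Qed.

Lemma ip_cs f g : l2 f -> l2 g -> `|ip f g| <= nrm f * nrm g.
exact: (cs l2D l2Z C2 ipD ipZ ip_ge0). Qed.

Lemma nrm_tri f g : l2 f -> l2 g -> nrm (f + g) <= nrm f + nrm g.
exact: (bn_tri l2D l2Z C2 ipD ipZ ip_ge0). Qed.

Lemma nrm_triB f g : l2 f -> l2 g -> nrm (f - g) <= nrm f + nrm g.
exact: (bn_triB l2D l2Z C2 ipD ipZ ip_ge0). Qed.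

Lemma nrmZ a f : l2 f -> nrm (a *: f) = `|a| * nrm f.
exact: (bnZ l2Z C2 ipZ). Qed.

Lemma nrmB f g : l2 f -> l2 g -> nrm (f - g) = nrm (g - f).
exact: (bnB l2D l2Z C2 ipZ). Qed.

Lemma nrm2 f : l2 f -> nrm f ^+ 2 = ip f f.
exact: (bn2 ip_ge0). Qed.

Lemma ip_cvg (f_ : nat -> T -> R) f g : (forall n, l2 (f_ n)) -> l2 f -> l2 g ->
 nrm (f_ n - f) ~[n]~> 0 -> ip (f_ n) g ~[n]~> ip f g.
exact: (B_cvg l2D l2Z C2 ipD ipZ ip_ge0). Qed.

Lemma nrm_ge0 f : 0 <= nrm f. exact: bn_ge0. Qed.

Lemma nrmE f : nrm f ^+ 2 = Int (fun x => f x ^+ 2).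
by rewrite sqr_sqrtr//; apply: Int_ge0 => x; rewrite sqr_ge0. Qed.

Lemma nrm_le f g : l2 f -> l2 g -> (forall x, `|f x| <= `|g x|) -> nrm f <= nrm g.
move=> lf lg fg; apply: ler_wsqrtr; apply: Int_le; [exact: l2i|exact: l2i|].
by move=> x; rewrite -!expr2 -(real_normK (num_real (f x)))
 -(real_normK (num_real (g x))) lerXn2r.
Qed.

Lemma nrm_norm f : nrm (fun x => `|f x|) = nrm f.
congr Num.sqrt; apply: Int_eq => x.
by rewrite -normrM -expr2 ger0_norm ?sqr_ge0.
Qed.

Lemma Int_norm_cs f g : l2 f -> l2 g -> Int (fun x => `|f x| * `|g x|) <= nrm f * nrm g.
move=> lf lg; rewrite -[nrm f]nrm_norm -[nrm g]nrm_norm.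
by rewrite (le_trans (ler_norm _))//; apply: ip_cs; exact: l2_norm.
Qed.

Lemma nrm_ae f g : mfn f -> mfn g -> {ae mu, forall x, f x = g x} -> nrm f = nrm g.
move=> mf mg fg; congr Num.sqrt; apply: Int_ae; [exact: measurable_funM|exact: measurable_funM|].
by move: fg; apply: filterS => x ->.
Qed.

Lemma ip_ae f g h : mfn f -> mfn g -> mfn h -> {ae mu, forall x, f x = g x} ->
 ip f h = ip g h.
move=> mf mg mh fg; apply: Int_ae; [exact: measurable_funM|exact: measurable_funM|].
by move: fg; apply: filterS => x ->.
Qed.

Lemma nrm_eq0 f : l2 f -> nrm f = 0 -> {ae mu, forall x, f x = 0}.
move=> lf f0; have := nrmE f; rewrite f0 expr0n /= => /esym h.
have := Int_eq0_ae (fun x => sqr_ge0 (f x)) (l2i lf) h.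
by apply: filterS => x /eqP; rewrite sqrf_eq0 => /eqP.
Qed.

Lemma l2_sum (I : Type) (s : seq I) (F : I -> T -> R) :
 (forall i, l2 (F i)) -> l2 (\sum_(i <- s) F i).
by move=> lF; elim/big_ind : _ => //; [exact: l2_0|exact: l2D].
Qed.

Lemma nrm0 : nrm 0 = 0.
rewrite /nrm /bn /ip (_ : Int _ = 0) ?sqrtr0//.
by rewrite (Int_eq _ (g := fun=> 0)) ?Int0// => x; exact: mul0r.
Qed.

Lemma nrm_sum (I : Type) (s : seq I) (F : I -> T -> R) :
 (forall i, l2 (F i)) -> nrm (\sum_(i <- s) F i) <= \sum_(i <- s) nrm (F i).
move=> lF; elim: s => [|i s IH]; first by rewrite !big_nil nrm0.
rewrite !big_cons (le_trans (nrm_tri (lF i) (l2_sum s lF)))//.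
by rewrite lerD2l.
Qed.

(** Riesz-Fischer: along a subsequence with steps at most [2 ^- i] the sum of the absolute steps has
    norm at most [2], hence is finite almost everywhere by monotone convergence. The subsequence
    then converges pointwise, and Fatou's lemma turns pointwise convergence into convergence of
    norms. *)
Lemma l2_complete (f_ : nat -> T -> R) : (forall n, l2 (f_ n)) ->
 (forall e : R, 0 < e -> exists M, forall m n, (M <= m)%N -> (M <= n)%N ->
   nrm (f_ m - f_ n) <= e) ->
 exists2 f, l2 f & nrm (f_ n - f) ~[n]~> 0.
move=> lf H.
have /choice[M HM] : forall i : nat, exists M, forall m n, (M <= m)%N ->
  (M <= n)%N -> nrm (f_ m - f_ n) <= (2 ^+ i)^-1.
 by move=> i; apply: H; rewrite invr_gt0 exprn_gt0.
(* The maximum makes [k] nondecreasing, so that all later terms fall under the Cauchy bound of index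
   [i]. *)
pose k := fix k i := if i is i'.+1 then maxn (k i') (M i) else M 0%N.
have kM i : (M i <= k i)%N by case: i => //= i; rewrite leq_maxr.
have kle : {homo k : m n / (m <= n)%N}.
 by apply: homo_leq => // [m|i] /=; [exact: leq_trans|rewrite leq_maxl].
pose g i := f_ (k i).
have lg i : l2 (g i) by exact: lf.
have gij i j : (i <= j)%N -> nrm (g j - g i) <= (2 ^+ i)^-1.
 by move=> ij; apply: HM; rewrite (leq_trans (kM i))// kle.
pose D i : T -> R := (fun x => `|g i.+1 x - g i x|).
have lD i : l2 (D i) by apply: l2_norm; exact: l2B.
pose S m : T -> R := \sum_(i < m) D i.
have lS m : l2 (S m) by exact: l2_sum.
have SE m x : S m x = \sum_(i < m) D i x by rewrite /S fct_sumE.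
have S0 m x : 0 <= S m x by rewrite SE; apply: sumr_ge0 => i _; exact: normr_ge0.
have Snd x : {homo S ^~ x : m n / (m <= n)%N >-> m <= n}.
 apply: homo_leq => // [y z t|i]; first exact: le_trans.
 by rewrite !SE big_ord_recr /= lerDl normr_ge0.
have nS m : nrm (S m) <= 2.
 apply: le_trans (nrm_sum _ (fun i : 'I_m => lD i)) _.
 rewrite (le_via (\sum_(i < m) (2 ^+ i)^-1))//.
  by apply: ler_sum => i _; rewrite nrm_norm; exact: (gij i i.+1).
 suff -> : \sum_(i < m) ((2 : R) ^+ i)^-1 = 2 - 2 * (2 ^+ m)^-1.
  by rewrite gerBl mulr_ge0// invr_ge0 exprn_ge0.
 elim: m => [|m IH]; first by rewrite big_ord0 expr0 invr1; ring.
 by rewrite big_ord_recr /= IH exprS; field; rewrite expf_neq0.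
pose h (x : T) : \bar R := limn (fun m => (S m x ^+ 2)%:E).
have ndS2 x : nondecreasing_seq (fun m => (S m x ^+ 2)%:E).
 by move=> m n mn; rewrite lee_fin lerXn2r ?nnegrE//; exact: Snd.
have cvS2 x : cvgn (fun m => (S m x ^+ 2)%:E).
 exact: ereal_nondecreasing_is_cvgn.
have mS2 m : measurable_fun setT (fun x => (S m x ^+ 2)%:E).
 by apply/measurable_EFinP; apply: measurable_funX; exact: l2m.
have mh : measurable_fun setT h.
 by apply: (@emeasurable_fun_cvg _ _ _ _ (fun m x => (S m x ^+ 2)%:E)) => [//|x _]; exact: cvS2.
have Ih : (\int[mu]_x h x <= 4%:E)%E.
 rewrite monotone_convergence//; last first.
  by move=> m x _; rewrite lee_fin sqr_ge0.
 apply: lime_le.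
  apply: ereal_nondecreasing_is_cvgn => m n mn; apply: ge0_le_integral => //.
   by move=> x _; rewrite lee_fin sqr_ge0.
  by move=> x _; exact: ndS2.
 apply: nearW => m.
 rewrite -(fineK (integrable_fin_num measurableT (l2i (lS m)))) lee_fin.
 rewrite -[fine _]/(Int _) -nrmE.
 have -> : 4 = (2 : R) ^+ 2 by ring.
 by rewrite lerXn2r ?nnegrE ?nrm_ge0.
have h0 x : (0 <= h x)%E.
 by apply: lime_ge => //; apply: nearW => m; rewrite lee_fin sqr_ge0.
have hae : {ae mu, forall x, h x \is a fin_num}.
 have : mu.-integrable setT h.
  apply/integrableP; split => //; under eq_integral do rewrite gee0_abs//.
  by rewrite (le_lt_trans Ih)// ltry.
 by move=> /(integrable_ae measurableT); apply: filterS => x; exact.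
pose A := [set x | h x \is a fin_num].
have mA : measurable A.
 by have := emeasurable_fin_num measurableT mh; rewrite setTI.
have gcv x : A x -> exists l : R, g i x ~[i]~> l.
 move=> Ax; apply: cauchy_cvg_seq => e e0.
 have Sb m : S m x <= fine (h x) + 1.
  have : S m x ^+ 2 <= fine (h x).
   rewrite -lee_fin fineK//.
   by apply: lime_ge => //; exists m => // n /= mn; exact: ndS2.
  by have := sqr_ge0 (S m x - 1); nra.
 have : cvgn (S ^~ x).
  apply: nondecreasing_is_cvgn; first by move=> m n; exact: Snd.
  by exists (fine (h x) + 1) => _ [m _ <-]; exact: Sb.
 move=> /cvg_ex[l /cvgBP/cvg0P/(_ (e / 2))[|K HK]]; first by pos.
 have gS i j : (i <= j)%N -> `|g j x - g i x| <= S j x - S i x.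
  move=> /subnK <-; elim: (_ - _)%N => [|n IH]; first by rewrite add0n !subrr normr0.
  rewrite addSn [S _.+1 x]SE big_ord_recr /= -SE.
  by move: IH (ler_distD (g (n + i)%N x) (g (n + i).+1 x) (g i x)); rewrite /D; lra.
 have gS' i j : `|g j x - g i x| <= `|S j x - S i x|.
  have [/gS ij|/ltnW/gS ij] := leqP i j; first by rewrite (le_trans ij)// ler_norm.
  by rewrite distrC (le_trans ij)// distrC ler_norm.
 exists K => i j /HK Hi /HK Hj; rewrite (le_trans (gS' _ _))//.
 by move: Hi Hj; rewrite !ler_norml; lra.
(* Cutting with the set where the sum is finite gives convergence at every point, hence a measurable
   limit. *)
pose g' i := (fun x => g i x * \1_A x).
have cg' x : exists l : R, g' i x ~[i]~> l.
 have [Ax|Ax] := pselect (A x).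
  have [l Hl] := gcv x Ax; exists l.
  by rewrite /g'; under eq_fun do rewrite indicE mem_set// mulr1.
 exists 0; rewrite /g'; under eq_fun do rewrite indicE memNset// mulr0.
 exact: cvg_cst.
have [f Hf] := choice cg'.
have mf : mfn f.
 apply: (@measurable_fun_cvg _ _ _ _ g') => [i|x _]; last exact: Hf.
 by apply: measurable_funM; [exact: l2m|exact: measurable_indic].
have gf : {ae mu, forall x, g i x ~[i]~> f x}.
 move: hae; apply: filterS => x Ax.
 have := Hf x; rewrite /g'; under eq_fun do rewrite indicE mem_set// mulr1.
 by [].
(* Fatou along [j + i]: the bound on the norm of [g (j + i) - g i] survives as [j] grows. *)
have key i : l2 (f - g i) /\ nrm (f - g i) <= (2 ^+ i)^-1.
 
 have mfg : mfn (f - g i) by apply: measurable_funB => //; exact: l2m.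
 have [] := @Int_fatou _ _ _ mu (fun j x => (g (j + i)%N - g i) x ^+ 2)
  (fun x => (f - g i) x ^+ 2) (((2 ^+ i)^-1) ^+ 2).
 - by move=> j; apply: l2i; exact: l2B.
 - by move=> *; rewrite sqr_ge0.
 - exact: measurable_funX.
 - by move=> *; rewrite sqr_ge0.
 - move: gf; apply: filterS => x gx.
  have gxi : (g (j + i)%N x) ~[j]~> f x by rewrite (cvg_shiftn i (fun n => g n x)).
  have d1 : (g (j + i)%N x - g i x) ~[j]~> f x - g i x.
   by apply: cvgB => //; exact: cvg_cst.
  exact: (cvgX 2 d1) || exact: (cvgM d1 d1).
 - by move=> j; rewrite -nrmE lerXn2r ?nnegrE ?nrm_ge0//; apply: gij; rewrite leq_addl.
 - move=> i2; rewrite -nrmE ler_pXn2r ?nnegrE ?nrm_ge0// => ->; split.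
have lff : l2 f.
 rewrite (_ : f = (f - g 0%N) + g 0%N); last by rewrite subrK.
 by apply: l2D => //; exact: (key 0%N).1.
exists f => //; apply/cvg0P => e e0.
have : ((2 : R) ^+ i)^-1 ~[i]~> 0.
 have := @cvg_geometric R 1 (2^-1); rewrite /geometric /=.
 under eq_fun do rewrite mul1r exprVn; apply.
 by rewrite ger0_norm// invf_lt1// ltr1n.
move=> /cvg0P/(_ (e / 2))[|i Hi]; first by pos.
exists (k i) => n kn; rewrite ger0_norm ?nrm_ge0//.
rewrite (_ : f_ n - f = (f_ n - g i) - (f - g i)); last by rewrite opprB addrA subrK.
rewrite (le_trans (nrm_triB _ _))//; [exact: l2B|exact: (key i).1|].
have := (key i).2; have := HM i n (k i) (leq_trans (kM i) kn) (kM i).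
have := Hi i (leqnn _); rewrite ger0_norm//.
move=> h1 h2 h3; rewrite (splitr e) lerD//; [exact: le_trans h2 h1|exact: le_trans h3 h1].
Qed.

End L2.
Arguments l2 {d T R} mu.
#[local] Hint Resolve nrm_ge0 : core.

(** * Boxes, Borel sets and changes of variables *)

Section boxes.
Context {R : realType} (n : nat).
Implicit Types (x y : 'rV[R]_n) (a b : 'I_n -> R).
Local Notation mu := (@lebesgue_rV R n).

Definition box a b : set 'rV[R]_n :=
 [set x | forall i, `]a i, b i]%classic (x ord0 i)].

Definition boxes : set (set 'rV[R]_n) := [set X | exists a b, X = box a b].

Lemma measurable_rect (A : 'I_n -> set R) : (forall i, measurable (A i)) ->
 measurable [set x : 'rV[R]_n | forall i, A i (x ord0 i)].
move=> mA; rewrite [X in measurable X](_ : _ = \bigcap_(i in [set: 'I_n])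
   ((fun x : 'rV[R]_n => x ord0 i) @^-1` A i)).
 apply: fin_bigcap_measurable => // i _.
 by rewrite -[X in measurable X]setTI; exact: measurable_coord_rV.
apply/seteqP; split => x /= Hx i; first by move=> _; exact: Hx.
exact: Hx.
Qed.

Lemma mbox a b : measurable (box a b).
exact: (@measurable_rect (fun i => `]a i, b i]%classic) (fun i => measurable_itv _)).
Qed.

Lemma boxI : setI_closed boxes.
move=> _ _ [a [b ->]] [a' [b' ->]].
exists (fun i => Num.max (a i) (a' i)), (fun i => Num.min (b i) (b' i)).
apply/seteqP; split => x /=.
 by move=> [H H'] i; have := H i; have := H' i;
  rewrite /= !in_itv/= gt_max le_min => /andP[-> ->] /andP[-> ->].
by move=> H; split=> i; have := H i; rewrite /= !in_itv/= gt_max le_min =>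
 /andP[/andP[? ?] /andP[? ?]]; apply/andP.
Qed.

Lemma rV_truncn_bound x : exists k : nat, forall i, `|x ord0 i| < k%:R.
exists (\max_(i < n) (Num.truncn `|x ord0 i|).+1) => i.
rewrite (lt_le_trans (truncnS_gt _))// ler_nat.
exact: (leq_bigmax i).
Qed.

Lemma bigcup_box : \bigcup_k box (fun=> - k%:R) (fun=> k%:R) = setT.
apply/seteqP; split => // x _; have [k Hk] := rV_truncn_bound x.
exists k => // i; rewrite /= in_itv/=; have := Hk i.
by rewrite ltr_norml => /andP[-> /ltW].
Qed.

(** A slab in one coordinate is the union over [k] of boxes of half-width [k] in the other
    coordinates, so boxes generate the coordinate sigma-algebra. *)
Lemma mboxes : @measurable _ 'rV[R]_n = <<s boxes >>.
apply/seteqP; split; last first.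
 apply: smallest_sub; first exact: sigma_algebra_measurable.
 by move=> _ [a [b ->]]; exact: mbox.
have mc (i : 'I_n) : measurable_fun setT
  ((fun x => x ord0 i) : g_sigma_algebraType boxes -> R).
 apply: (measurability (@ocitv R)) => // _ [_ [[u v] _ <-] <-] /=.
 rewrite setTI (_ : _ @^-1` _ = \bigcup_(k : nat)
  (box (fun j => if j == i then u else - k%:R)
    (fun j => if j == i then v else k%:R))).
  apply: bigcupT_measurable => k; apply: sub_sigma_algebra.
  by eexists; eexists.
 apply/seteqP; split => x /=.
  move=> xi; have [k Hk] := rV_truncn_bound x.
  exists k => // j; rewrite /= in_itv/=; have [->|ji] := eqVneq j i; first by [].
  have := Hk j; by rewrite ltr_norml => /andP[-> /ltW].
 by move=> [k _ /(_ i)] /=; rewrite eqxx.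
apply: smallest_sub; first exact: smallest_sigma_algebra.
elim/big_ind : _ => [X []|A B HA HB X [/HA|/HB]//|i _ X [Y mY <-]].
exact: mc.
Qed.

Lemma mu_box a b : (mu (box a b) =
 (\prod_(i < n) (if a i < b i then b i - a i else 0))%:E)%E.
transitivity (\prod_(i < n) lebesgue_measure `]a i, b i]%classic)%E.
 apply: (@lebesgue_rV_box R n (fun i => `]a i, b i]%classic)) => i.
 exact: measurable_itv.
rewrite -prodEFin; apply: eq_bigr => i _.
by rewrite lebesgue_measure_itv /= lte_fin; case: ifP.
Qed.

Lemma mu_box_lty a b : (mu (box a b) < +oo)%E.
by rewrite mu_box ltry. Qed.

Section change_of_variables.
Variables (phi : 'rV[R]_n -> 'rV[R]_n) (c : {nonneg R}).
Hypothesis mphi : measurable_fun setT phi.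
Hypothesis Hbox : forall a b, mu (phi @^-1` box a b) = (c%:num%:E * mu (box a b))%E.

Let phim : {mfun 'rV[R]_n >-> 'rV[R]_n} :=
 HB.pack phi (isMeasurableFun.Build _ _ _ _ _ mphi).

(** Boxes form an intersection-stable generator, and the space is a union of boxes of finite
    measure; two measures that agree on boxes are equal. Translations and dilations thus need to be
    computed on boxes only. *)
Lemma pushforward_mscale A : measurable A ->
 pushforward mu phi A = mscale c mu A.
move=> mA; apply/esym; apply: (@measure_unique _ R _ boxes
 (fun k => box (fun=> - k%:R) (fun=> k%:R)) mboxes boxI _ bigcup_box
 (mscale c mu) (pushforward mu phim)) => //.
- by move=> k; eexists; eexists.
- by move=> _ [a [b ->]]; exact/esym/Hbox.
- by move=> k; rewrite lte_mul_pinfty//; exact: mu_box_lty.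
Qed.

Lemma ge0_integral_map (f : 'rV[R]_n -> \bar R) : measurable_fun setT f ->
 (forall x, 0 <= f x)%E -> (\int[mu]_x f (phi x) = c%:num%:E * \int[mu]_x f x)%E.
move=> mf f0; rewrite -ge0_integral_mscale//.
rewrite -[LHS](@ge0_integral_pushforward _ _ _ _ _ _ mphi mu setT)//.
apply: (@eq_measure_integral _ _ _ setT (mscale c mu) (pushforward mu phim)) => A mA _.
exact: pushforward_mscale.
Qed.

Lemma intg_map (f : 'rV[R]_n -> R) : intg mu f -> intg mu (f \o phi).
move=> /[dup] /intg_m mf /integrableP[_ fi]; apply/integrableP; split.
 by apply/measurable_EFinP; exact: measurableT_comp.
have mnf : measurable_fun setT (fun x => `|(f x)%:E|%E).
 by apply: measurableT_comp => //; exact/measurable_EFinP.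
rewrite (@ge0_integral_map (fun x => `|(f x)%:E|%E))//.
by rewrite lte_mul_pinfty.
Qed.

Lemma Int_map (f : 'rV[R]_n -> R) : intg mu f ->
 Rintegral mu setT (f \o phi) = c%:num * Rintegral mu setT f.
move=> fi.
have H g : intg mu g -> (forall x, 0 <= g x) ->
  Rintegral mu setT (g \o phi) = c%:num * Rintegral mu setT g.
 move=> ig g0; rewrite /Rintegral (@ge0_integral_map (EFin \o g)).
 - by rewrite fineM//; exact: integrable_fin_num.
 - by apply/measurable_EFinP; exact: intg_m ig.
 - by move=> x; rewrite lee_fin.
(* The nonnegative case applies to [|f|] and to [|f| + f], whose difference is [f]. *)
have i1 := intg_norm fi; have i2 := intgD i1 fi.
have h1 := H _ i1 (fun x => normr_ge0 _).
have h2 := H _ i2 (fun x => ltac:(by rewrite -lerBlDl sub0r lerNnormlW)).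
rewrite -[LHS](addKr (Rintegral mu setT (fun x => `|f (phi x)|))) -IntD.
- rewrite [X in _ + X]h2 IntD// [X in - X + _]h1; ring.
- exact: intg_map i1.
- exact: intg_map fi.
Qed.

End change_of_variables.

Lemma measurable_shift y : measurable_fun setT (fun x => x + y).
apply: measurable_fun_rV => i; under eq_fun do rewrite mxE.
by apply: measurable_funD => //; exact: measurable_coord_rV.
Qed.

Lemma measurable_dil (t : R) : measurable_fun setT (fun x : 'rV[R]_n => t *: x).
apply: measurable_fun_rV => i; under eq_fun do rewrite mxE.
by apply: measurable_funM => //; exact: measurable_coord_rV.
Qed.

Lemma shift_box y a b : mu ((fun x => x + y) @^-1` box a b) =
 ((1%:nng : {nonneg R})%:num%:E * mu (box a b))%E.
rewrite mul1e (_ : _ @^-1` _ = box (fun i => a i - y ord0 i) (fun i => b i - y ord0 i)).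
 rewrite !mu_box; congr EFin; apply: eq_bigr => i _; rewrite ltrD2r.
 by case: ifP =>  _; ring.
by apply/seteqP; split=> x H i; have := H i;
 rewrite /= !in_itv/= mxE ltrBlDr lerBrDr.
Qed.

Lemma dil_box (t : {posnum R}) a b : mu ((fun x => t%:num *: x) @^-1` box a b) =
 (((t%:num ^- n)%:nng : {nonneg R})%:num%:E * mu (box a b))%E.

rewrite (_ : _ @^-1` _ = box (fun i => a i / t%:num) (fun i => b i / t%:num)).
 rewrite !mu_box -EFinM; congr EFin => /=.
 have -> : (t%:num ^- n) = \prod_(i < n) (t%:num)^-1.
  by rewrite prodr_const card_ord exprVn.
 rewrite -big_split /=; apply: eq_bigr => i _; rewrite ltr_pM2r//.
 by case: ifP =>  _; [ring|rewrite mulr0].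
by apply/seteqP; split=> x H i; have := H i;
 rewrite /= !in_itv/= mxE ltr_pdivrMr// ler_pdivlMr// [t%:num * _]mulrC.
Qed.

Definition intg_shift y := intg_map (measurable_shift y) (shift_box y).
Lemma Int_shift y (f : 'rV[R]_n -> R) : intg mu f ->
 Rintegral mu setT (fun x => f (x + y)) = Rintegral mu setT f.
by move=> fi; rewrite [LHS](Int_map (measurable_shift y) (shift_box y))// mul1r. Qed.

Lemma intg_dil t (f : 'rV[R]_n -> R) : 0 < t -> intg mu f ->
 intg mu (fun x => f (t *: x)).
by move=> t0; exact: (intg_map (measurable_dil t) (dil_box (PosNum t0))).
Qed.

Lemma Int_dil t (f : 'rV[R]_n -> R) : 0 < t -> intg mu f ->
 Rintegral mu setT (fun x => f (t *: x)) = t ^- n * Rintegral mu setT f.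
move=> t0 fi.
by rewrite [LHS](Int_map (measurable_dil t) (dil_box (PosNum t0))).
Qed.

Lemma coord_le_norm x i : `|x ord0 i| <= `|x|.
rewrite [leRHS]/Num.norm /= mx_normrE; apply/bigmax_geP; right => /=.
by exists (ord0, i).
Qed.

Lemma norm_le_coord x (c : R) : 0 <= c -> (forall i, `|x ord0 i| <= c) -> `|x| <= c.
move=> c0 H; rewrite [leLHS]/Num.norm /= mx_normrE; apply/bigmax_leP; split => //.
by move=> [j i] _ /=; rewrite (ord1 j).
Qed.

(** Links the sup norm topology with the coordinate sigma-algebra: an open set is the countable
    union of the boxes with rational centre and radius [1 / (k + 1)] that it contains. *)
Lemma open_measurable_rV (U : set 'rV[R]_n) : open U -> measurable U.
move=> oU.
pose B (p : 'rV[rat]_n * nat) := box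
 (fun i => ratr (p.1 ord0 i) - (p.2.+1%:R)^-1)
 (fun i => ratr (p.1 ord0 i) + (p.2.+1%:R)^-1).
rewrite (_ : U = \bigcup_p (if `[< B p `<=` U >] then B p else set0)).
 apply: countable_bigcupT_measurable => [|p]; first exact: countableP.
 by case: ifP => // _; exact: mbox.
apply/seteqP; split => x; last by move=> [p _]; case: asboolP => // BU /BU.
move=> Ux; have /nbhs_ballP[e /= e0 eU] : nbhs x U by exact: open_nbhs_nbhs.
have [k Hk] : exists k : nat, (k.+1%:R : R)^-1 < e / 2.
 exists (Num.truncn (2 / e)).
 by rewrite -[e / 2]invf_div ltf_pV2 ?posrE ?divr_gt0// truncnS_gt.
have [d dE] : exists d : R, d = k.+1%:R^-1 by eexists.
have k0 : 0 < d by rewrite dE invr_gt0.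
rewrite -dE in Hk.
have /choice[q Hq] : forall i : 'I_n, exists q : rat,
  x ord0 i - d < ratr q < x ord0 i + d.
 move=> i; have [|q] := @rat_in_itvoo R (x ord0 i - d) (x ord0 i + d); first by lra.
 by rewrite in_itv /=; exists q.
exists (\row_i q i, k) => //; case: asboolP => [_ i|].
 by rewrite /= in_itv/= mxE -dE; have /andP[] := Hq i => ? ?; apply/andP; split; lra.
apply: contra_notP => _ y By; apply: eU.
rewrite -ball_normE /=; apply: (@le_lt_trans _ _ (2 * d)); last by lra.
apply: norm_le_coord; first by lra.
move=> i; have := By i; rewrite /= in_itv/= !mxE -dE => /andP[? ?].
by have /andP[? ?] := Hq i; rewrite ler_norml; apply/andP; split; lra.
Qed.

Lemma mfn_cont (f : 'rV[R]_n -> R) : continuous f -> mfn f.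
move=> cf; apply: (measurability (@RGenOpens.G R)).
 exact: RGenOpens.measurableE.
move=> _ [_ [a [b ->]] <-]; rewrite setTI; apply: open_measurable_rV.
by apply: open_comp => [x _|]; [exact: cf|exact: interval_open].
Qed.

End boxes.

Lemma is_derive_cont_at (R : realType) (h : R -> R) (t d : R) : is_derive t 1 h d ->
 {for t, continuous h}.
move=> dh; apply: differentiable_continuous; apply/derivable1_diffP.
exact: (@ex_derive _ _ _ _ _ _ _ dh).
Qed.

Lemma is_derive_cont (R : realType) (h h' : R -> R) : (forall t : R, is_derive t 1 h (h' t)) -> continuous h.
by move=> dh t; exact: is_derive_cont_at (dh t).
Qed.

Lemma is_derive_exprVn (R : realType) m (t : R) : 0 < t ->
 is_derive t 1 (fun s : R => s ^- m) (- m%:R * t ^- m.+1).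
move=> t0; have := @is_deriveV _ (fun s : R => s ^+ m) t (m%:R * t ^+ m.-1) 1.
rewrite expf_neq0 ?gt_eqF// => /(_ erefl) H.
have /H : is_derive t 1 (fun s : R => s ^+ m) (m%:R * t ^+ m.-1).
 by split; [exact: exprn_derivable|rewrite exp_derive /GRing.scale /= mulr1].
move=> {}H; apply: (is_derive_eq H).
case: m {H} => [|m] /=; first by rewrite !mul0r oppr0 mul0r scaler0.
have : t ^+ m != 0 by rewrite expf_neq0// gt_eqF.
rewrite /GRing.scale /= !exprS; move: (t ^+ m) (m.+1%:R : R) => A B A0.
by field; rewrite A0 gt_eqF.
Qed.

(** * Flat exponentials, the source of smooth bumps *)

Section flat_exponential.
Context {R : realType} (c : R).
Hypothesis c0 : 0 < c.

(** The negative powers make the family closed under differentiation; letting the ambient [c] tend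
    to zero turns the function with [m = 0] into the indicator of the positive half-line. *)
Definition fexp (m : nat) (t : R) : R :=
 if 0 < t then t ^- m * expR (- (c / t)) else 0.

Lemma fexp_ge0 m t : 0 <= fexp m t.
rewrite /fexp; case: ifP => // t0.
by pos.
Qed.

(** One term of the exponential series, of order [m.+2], beats the singular power with two orders to
    spare; a quadratic bound is what makes the derivative at [0] vanish. *)
Lemma fexp_le m : exists2 K, 0 <= K & forall t : R, 0 <= t -> fexp m t <= K * t ^+ 2.
exists (m.+2`!%:R / c ^+ m.+2); first by pos.
move=> t t0; rewrite /fexp; case: ifP => [{}t0|_]; last first.
 by pos.
have ct : 0 <= c / t by pos.
have H := expR_ge1Dxn m.+1 ct.
have H' : (c / t) ^+ m.+2 / m.+2`!%:R <= expR (c / t).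
 by rewrite (le_trans _ H)// lerDr.
have f0 : 0 < m.+2`!%:R :> R by pos.
rewrite expRN mulrC -(ler_pM2l (expR_gt0 (c / t))) mulrA divff ?gt_eqF ?expR_gt0// mul1r.
apply: le_trans (ler_wpM2r _ H').
 rewrite expr_div_n; rewrite [X in _ <= X](_ : _ = t ^- m)//.
 have : c ^+ m.+2 != 0 by rewrite expf_neq0// gt_eqF.
 have : t ^+ m != 0 by rewrite expf_neq0// gt_eqF.
 rewrite (_ : t ^+ m.+2 = t ^+ 2 * t ^+ m); last by rewrite -exprD.
 move: f0 t0; move: (c ^+ m.+2) (t ^+ m) (m.+2`!%:R) => A B F F0 {H H' ct}t0 B0 A0.
 by field; rewrite A0 B0 !gt_eqF.
by pos.
Qed.

Lemma is_derive_fexp m (t : R) : is_derive t 1 (fexp m)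
 (c * fexp m.+2 t - m%:R * fexp m.+1 t).
have [t0|t0] := ltP 0 t.
 pose g (s : R) := s ^- m * expR (- (c / s)).
 apply: (@near_eq_is_derive _ _ _ g).
  near=> s; rewrite /g /fexp.
  have -> // : 0 < s by near: s; exact: lt_nbhsr.
 rewrite /fexp t0.
 have d1 := is_derive_exprVn m t0.
 have d2 : is_derive t 1 (fun s : R => expR (- (c / s))) (expR (- (c / t)) * (c * t ^- 2)).
  apply: is_derive1_comp.
  have := @is_deriveV _ id t 1 1; rewrite gt_eqF// => /(_ erefl) H.
  have h := is_deriveN (is_deriveZ c (H (is_derive_id _ _))).
  apply: (is_derive_eq h); rewrite /GRing.scale /=; field; exact: lt0r_neq0.
 have := is_deriveM d1 d2; move/is_derive_eq; apply.
 rewrite /GRing.scale /= !exprS; field; rewrite expf_neq0 ?gt_eqF//.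
have -> : c * fexp m.+2 t - m%:R * fexp m.+1 t = 0.
 by rewrite /fexp ltNge t0 /= !mulr0 subr0.
have [K K0 HK] := fexp_le m.
have ft : fexp m t = 0 by rewrite /fexp ltNge t0.
have cv : (fun h => h^-1 *: ((fexp m \o shift t) (h *: 1) - fexp m t)) @ 0^' --> (0 : R).
 apply/cvgr0Pnorm_le => e e0; near=> h.
 have h0 : h != 0 by near: h; exact: nbhs_dnbhs_neq.
 rewrite ft subr0 /= [h *: 1]mulr1 normrZ normfV ler_pdivrMl ?normr_gt0//.
 rewrite ger0_norm ?fexp_ge0//.
 have [ht|ht] := leP (h + t) 0.
  by rewrite /fexp ltNge ht /= mulr_ge0// ltW.
 rewrite (le_trans (HK _ (ltW ht)))//.
 have hh : h + t <= `|h| by rewrite (le_trans _ (ler_norm h))// gerDl.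
 rewrite (le_via (K * `|h| ^+ 2))//.
  by rewrite ler_wpM2l// lerXn2r ?nnegrE ?(ltW ht)//.
 rewrite expr2 mulrCA ler_wpM2l// (le_via ((K + 1) * `|h|))//.
  by rewrite ler_wpM2r// lerDl.
 rewrite mulrC -ler_pdivlMr ?ltr_wpDl//.
 near: h; apply: dnbhs0_le; by pos.
by split; [exact/cvgP/cv|exact/cvg_lim/cv].
Unshelve. all: by end_near. Qed.

End flat_exponential.

(** * Calculus of C^k functions and test functions *)

Section Ck_theory.
Context {R : realType} {N : nat}.
Implicit Types (f g phi : 'rV[R]_N -> R) (x y : 'rV[R]_N).

Definition ee (i : 'I_N) : 'rV[R]_N := delta_mx ord0 i.

Lemma Ck_cont k f : Ck k f -> continuous f.
by case: k => [|k] []. Qed.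

Lemma CkS k f : Ck k.+1 f -> Ck k f.
elim: k f => [|k IH] f [cf H]; first by split.
by split=> // i; split; [exact: (H i).1|exact/IH/(H i).2].
Qed.

Lemma partialD i f g : (forall x, derivable f x (ee i)) ->
 (forall x, derivable g x (ee i)) -> partial i (f + g) = partial i f + partial i g.
by move=> df dg; apply/funext => x; rewrite /partial deriveD. Qed.

Lemma partialM i f g : (forall x, derivable f x (ee i)) ->
 (forall x, derivable g x (ee i)) ->
 partial i (f * g) = f * partial i g + g * partial i f.
by move=> df dg; apply/funext => x; rewrite /partial deriveM. Qed.

Lemma partial_cst i (a : R) : partial i (cst a : 'rV[R]_N -> R) = cst 0.
by apply/funext => x; rewrite /partial derive_cst. Qed.

Lemma Ck_cst k (a : R) : Ck k (cst a : 'rV[R]_N -> R).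
elim: k a => [|k IH] a; first by split => // x; exact: cst_continuous.
split; first by move=> x; exact: cst_continuous.
by move=> i; split; [move=> x; exact: derivable_cst|rewrite partial_cst].
Qed.

Lemma CkD k f g : Ck k f -> Ck k g -> Ck k (f + g).
elim: k f g => [|k IH] f g [cf Hf] [cg Hg].
 by split => // x; apply: continuousD; [exact: cf|exact: cg].
split; first by move=> x; apply: continuousD; [exact: cf|exact: cg].
move=> i; split; first by move=> x; apply: derivableD; [exact: (Hf i).1|exact: (Hg i).1].
rewrite partialD; [|exact: (Hf i).1|exact: (Hg i).1].
by apply: IH; [exact: (Hf i).2|exact: (Hg i).2].
Qed.

Lemma CkM k f g : Ck k f -> Ck k g -> Ck k (f * g).
elim: k f g => [|k IH] f g /[dup] Cf [cf Hf] /[dup] Cg [cg Hg].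
 by split => // x; apply: continuousM; [exact: cf|exact: cg].
split; first by move=> x; apply: continuousM; [exact: cf|exact: cg].
move=> i; split; first by move=> x; apply: derivableM; [exact: (Hf i).1|exact: (Hg i).1].
rewrite partialM; [|exact: (Hf i).1|exact: (Hg i).1].
apply: CkD; first by apply: IH; [exact: CkS|exact: (Hg i).2].
by apply: IH; [exact: CkS|exact: (Hf i).2].
Qed.

Lemma CkZ k (a : R) f : Ck k f -> Ck k (a *: f).
move=> Cf; rewrite (_ : a *: f = cst a * f); first by apply: CkM => //; exact: Ck_cst.
by apply/funext => x.
Qed.

Lemma derive_shiftE f x y v :
 (fun h => h^-1 *: (((fun z => f (z + y)) \o shift x) (h *: v) - f (x + y))) =
 (fun h : R => h^-1 *: ((f \o shift (x + y)) (h *: v) - f (x + y))).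
by apply/funext => h /=; rewrite addrA. Qed.

Lemma derivable_shift f x y v : derivable f (x + y) v ->
 derivable (fun z => f (z + y)) x v.
by rewrite /derivable derive_shiftE. Qed.

Lemma partial_shift i f y : partial i (fun z => f (z + y)) = (fun z => partial i f (z + y)).
by apply/funext => x; rewrite /partial /derive derive_shiftE. Qed.

Lemma continuous_shift f y : continuous f -> continuous (fun z : 'rV[R]_N => f (z + y)).
move=> cf x; apply: (@continuous_comp _ _ _ (fun z : 'rV[R]_N => z + y) f x).
 by apply: continuousD; [exact: cvg_id|exact: cst_continuous].
exact: cf.
Qed.

Lemma Ck_shift k f y : Ck k f -> Ck k (fun z => f (z + y)).
elim: k f => [|k IH] f [cf H]; first by split=> //; exact: continuous_shift.
split; first exact: continuous_shift.
move=> i; split; first by move=> x; apply: derivable_shift; exact: (H i).1.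
by rewrite partial_shift; apply: IH; exact: (H i).2.
Qed.

Lemma is_derive_line f x i (s : R) : (forall y, derivable f y (ee i)) ->
 is_derive s 1 (fun h => f (x + h *: ee i)) (partial i f (x + s *: ee i)).
move=> df; have E : (fun h => h^-1 *: (((fun h => f (x + h *: ee i)) \o shift s) (h *: 1)
   - f (x + s *: ee i))) =
 (fun h : R => h^-1 *: ((f \o shift (x + s *: ee i)) (h *: ee i) - f (x + s *: ee i))).
 by apply/funext => h /=; rewrite [h *: 1]mulr1 scalerDl addrCA.
by split; [rewrite /derivable E; exact: df|rewrite /derive E].
Qed.

Lemma partial_mvt f x i (s : R) : (forall y, derivable f y (ee i)) ->
 exists2 th : R, `|th| <= `|s| & f (x + s *: ee i) - f x = s * partial i f (x + th *: ee i).
move=> df; pose g (h : R) := f (x + h *: ee i).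
have dg (h : R) : is_derive h 1 g (partial i f (x + h *: ee i)) by exact: is_derive_line.
have cg : continuous g.
 exact: is_derive_cont dg.
have g0 : f x = g 0 by rewrite /g scale0r addr0.
rewrite g0 -/(g s); have [s0|s0] := leP 0 s.
 have [th + ->] := @MVT_segment R g (fun h => partial i f (x + h *: ee i)) 0 s s0
  (fun h _ => dg h) (continuous_subspaceT cg).
 rewrite in_itv/= => /andP[t0 ts]; exists th; first by rewrite !ger0_norm.
 by rewrite subr0 mulrC.
have [th + E] := @MVT_segment R g (fun h => partial i f (x + h *: ee i)) s 0 (ltW s0)
 (fun h _ => dg h) (continuous_subspaceT cg).
rewrite in_itv/= => /andP[t0 ts]; exists th; first by rewrite !ler0_norm ?lerN2// ltW.
by rewrite -opprB E sub0r mulrN opprK mulrC.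
Qed.

Definition supp_in f (M : R) := forall x, f x != 0 -> `|x| <= M.

Lemma ball_compact (M : R) : compact [set x : 'rV[R]_N | `|x| <= M].
apply: bounded_closed_compact.
 exists M; split; first exact: num_real.
 by move=> K MK x /= xM; rewrite (le_trans xM)// ltW.
rewrite (_ : [set x | _] = (fun x : 'rV[R]_N => `|x|) @^-1` [set t | t <= M]); last by [].
by apply: closed_comp => [x _|]; [exact: norm_continuous|exact: closed_le].
Qed.

Lemma continuous_bounded f M : continuous f ->
 exists2 B : R, 0 <= B & forall x, `|x| <= M -> `|f x| <= B.
move=> cf; have [[x0 Hx0]|H] := pselect (exists x : 'rV[R]_N, `|x| <= M); last first.
 by exists 0 => // x xM; exfalso; apply: H; exists x.
have [|||c _ Hc] := @EVT_max_rV R N (fun x => `|f x|) [set x | `|x| <= M].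
- by exists x0.
- exact: ball_compact.
- apply: continuous_subspaceT => x; apply: continuous_comp; first exact: cf.
 exact: norm_continuous.
- by exists `|f c| => // x xM; apply: Hc; rewrite inE.
Qed.

Lemma supp_bounded f M : continuous f -> supp_in f M ->
 exists2 B : R, 0 <= B & forall x, `|f x| <= B.
move=> cf sf; have [B B0 HB] := continuous_bounded M cf; exists B => // x.
have [->|f0] := eqVneq (f x) 0; first by rewrite normr0.
by apply: HB; exact: sf.
Qed.

Lemma partial_supp i f M : continuous f -> supp_in f M -> supp_in (partial i f) M.
move=> cf sf x; apply: contraNT; rewrite -ltNge => Mx; apply/eqP.
rewrite /partial (@near_eq_derive _ _ _ f (cst 0) x); last first.
 near=> y; apply/eqP; apply/negPn/negP => /sf; apply/negP; rewrite -ltNge.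
 near: y; apply: (@cvgr_gt _ _ _ _ (fun y : 'rV[R]_N => `|y|) `|x|) => //.
 exact: norm_continuous.
by rewrite derive_cst.
Unshelve. all: by end_near. Qed.

Lemma test_supp phi : test_function phi -> exists2 M : R, 0 <= M & supp_in phi M.
move=> [_ /compact_bounded[M [_ HM]]]; exists (`|M| + 1); first by pos.
move=> x px; apply: (HM (`|M| + 1)); last exact: subset_closure.
by rewrite (le_lt_trans (ler_norm M))// ltrDl.
Qed.

Lemma testP phi : (forall k, Ck k phi) -> (exists M, supp_in phi M) -> test_function phi.
move=> Cp [M sp]; split=> //.
have : closed (closure [set x | phi x != 0]) by exact: closed_closure.
move/subclosed_compact => /(_ _ (@ball_compact M)); apply.
have cM : closed [set x : 'rV[R]_N | `|x| <= M].
 by apply: compact_closed (@ball_compact M); exact: norm_hausdorff.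
rewrite [X in _ `<=` X]((closure_id _).1 cM); exact: closureS.
Qed.

Lemma test_cont phi : test_function phi -> continuous phi.
by move=> [/(_ 0%N) []]. Qed.

Lemma test_derivable phi i x : test_function phi -> derivable phi x (ee i).
by move=> [/(_ 1%N) [_ /(_ i) [+ _]] _]; exact. Qed.

Lemma test_partial phi i : test_function phi -> test_function (partial i phi).
move=> tp; apply: testP.
 by move=> k; case: tp => /(_ k.+1) [_ /(_ i) []].
have [M _ sM] := test_supp tp; exists M; apply: partial_supp => //.
exact: test_cont.
Qed.

Lemma testD f g : test_function f -> test_function g -> test_function (f + g).
move=> tf tg; apply: testP; first by move=> k; apply: CkD; [exact: tf.1|exact: tg.1].
have [M M0 sM] := test_supp tf; have [L L0 sL] := test_supp tg.
exists (M + L) => x; have [fx|fx _] := eqVneq (f x) 0; last first.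
 by rewrite (le_trans (sM _ fx))// lerDl.
by rewrite fctE fx add0r => /sL xL; rewrite (le_trans xL)// lerDr.
Qed.

Lemma testZ a f : test_function f -> test_function (a *: f).
move=> tf; apply: testP; first by move=> k; apply: CkZ; exact: tf.1.
have [M M0 sM] := test_supp tf; exists M => x.
by rewrite fctE scaler_eq0 negb_or => /andP[_]; exact: sM.
Qed.

Lemma test_shift f y : test_function f -> test_function (fun x => f (x + y)).
move=> tf; apply: testP; first by move=> k; apply: Ck_shift; exact: tf.1.
have [M M0 sM] := test_supp tf; exists (M + `|y|) => x /sM h.
by rewrite -[x](addrK y) (le_trans (ler_normB _ _))// lerD2r.
Qed.

Lemma test0 : test_function (0 : 'rV[R]_N -> R).
apply: testP; first by move=> k; exact: (Ck_cst k 0).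
by exists 0 => x; rewrite eqxx.
Qed.

(** Induction on [k] for all [m] simultaneously, because differentiating [fexp c m] produces
    [fexp c m.+1] and [fexp c m.+2]. *)
Lemma Ck_fexp (c : R) (c0 : 0 < c) k m i (s a : R) :
 Ck k (fun x : 'rV[R]_N => fexp c m (s * (x ord0 i) + a)).
have ccont m' : continuous (fun x : 'rV[R]_N => fexp c m' (s * (x ord0 i) + a)).
 move=> x; apply: (@continuous_comp _ _ _ (fun x : 'rV[R]_N => s * (x ord0 i) + a)).
  apply: continuousD; last exact: cst_continuous.
  by apply: continuousM; [exact: cst_continuous|exact: coord_continuous].
 exact: is_derive_cont_at (is_derive_fexp c0 m' _).
have dd m' x j : is_derive x (ee j) (fun x : 'rV[R]_N => fexp c m' (s * (x ord0 i) + a))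
  ((i == j)%:R * s * (c * fexp c m'.+2 (s * x ord0 i + a)
   - m'%:R * fexp c m'.+1 (s * x ord0 i + a))).
 have E : (fun h => h^-1 *: (((fun x => fexp c m' (s * (x ord0 i) + a)) \o shift x) (h *: ee j)
   - fexp c m' (s * (x ord0 i) + a))) =
  (fun h : R => h^-1 *: (((fun t => fexp c m' (s * t * (i == j)%:R + (s * x ord0 i + a)))
     \o shift 0) (h *: 1) - (fun t => fexp c m' (s * t * (i == j)%:R + (s * x ord0 i + a))) 0)).
  apply/funext => h /=; rewrite !mxE eqxx /= [h *: 1]mulr1 addr0 mulr0 mul0r add0r.
  by congr (_ *: (fexp _ _ _ - _)); ring.
 have dg : is_derive (0 : R) 1 (fun t => fexp c m' (s * t * (i == j)%:R + (s * x ord0 i + a)))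
  ((i == j)%:R * s * (c * fexp c m'.+2 (s * x ord0 i + a)
   - m'%:R * fexp c m'.+1 (s * x ord0 i + a))).
  have h1 : is_derive (0 : R) 1 (fun t => s * t * (i == j)%:R + (s * x ord0 i + a))
    ((i == j)%:R * s).
   have -> : (fun t => s * t * (i == j)%:R + (s * x ord0 i + a)) =
     (((i == j)%:R * s) \*: id) + cst (s * x ord0 i + a).
    by apply/funext => t; rewrite fctE /= /GRing.scale /=; ring.
   by apply: is_derive_eq; rewrite addr0 /GRing.scale /= mulr1.
  have h2 := is_derive_fexp c0 m' (s * 0 * (i == j)%:R + (s * x ord0 i + a)).
  have := @is_derive1_comp R (fexp c m')
   (fun t => s * t * (i == j)%:R + (s * x ord0 i + a)) 0 _ _ h2 h1.
  move/is_derive_eq; apply.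
  by rewrite mulr0 mul0r add0r /GRing.scale /= mulrC.
 by split; [rewrite /derivable E; exact: (@ex_derive _ _ _ _ _ _ _ dg)|rewrite /derive E; exact: (@derive_val _ _ _ _ _ _ _ dg)].
elim: k m => [|k IH] m; first by split.
split=> // j; split; first by move=> x; exact: (@ex_derive _ _ _ _ _ _ _ (dd m x j)).
rewrite (_ : partial j _ = ((i == j)%:R * s * c) *: (fun x => fexp c m.+2 (s * (x ord0 i) + a))
  + (- ((i == j)%:R * s * m%:R)) *: (fun x => fexp c m.+1 (s * (x ord0 i) + a))).
 by apply: CkD; apply: CkZ.
apply/funext => x; rewrite /partial (@derive_val _ _ _ _ _ _ _ (dd m x j)).
apply: (@etrans _ _ (((i == j)%:R * s * c) * fexp c m.+2 (s * x ord0 i + a) +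
 - ((i == j)%:R * s * m%:R) * fexp c m.+1 (s * x ord0 i + a))); [ring|by []].
Qed.

(** Positive exactly in the open box [a < x < b]. The affine arguments are written in the shape
    covered by [Ck_fexp]. *)
Definition bump (c : R) (a b : 'I_N -> R) : 'rV[R]_N -> R :=
 \prod_(i < N) ((fun x => fexp c 0 (1 * x ord0 i + - a i)) *
         (fun x => fexp c 0 (- 1 * x ord0 i + b i))).

Lemma bumpE c a b x : bump c a b x =
 \prod_(i < N) (fexp c 0 (x ord0 i - a i) * fexp c 0 (b i - x ord0 i)).
rewrite /bump fct_prodE; apply: eq_bigr => i _.
by rewrite fctE mul1r mulN1r [- _ + _]addrC.
Qed.

Lemma fexp0_le1 (c t : R) : 0 < c -> fexp c 0 t <= 1.
move=> c0; rewrite /fexp; case: ifP => // t0.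
by rewrite expr0 invr1 mul1r -expR0 ler_expR oppr_le0 divr_ge0 ?ltW.
Qed.

Lemma bump_ge0 c a b x : 0 <= bump c a b x.
by rewrite bumpE; apply: prodr_ge0 => i _; rewrite mulr_ge0// fexp_ge0. Qed.

Lemma bump_le1 c a b x : 0 < c -> bump c a b x <= 1.
move=> c0; rewrite bumpE; apply: prodr_ile1 => i _.
by rewrite mulr_ge0 ?fexp_ge0//= mulr_ile1 ?fexp_ge0// fexp0_le1.
Qed.

Lemma bump_box c a b x : bump c a b x != 0 -> forall i, a i < x ord0 i < b i.
rewrite bumpE => /prodf_neq0 H i; have := H i isT.
rewrite mulf_eq0 negb_or /fexp !subr_gt0.
by case: (a i < _); case: (_ < b i); rewrite ?eqxx ?andbF.
Qed.

Lemma test_bump c a b : 0 < c -> test_function (bump c a b).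
move=> c0; apply: testP.
 move=> k; rewrite /bump; elim/big_ind : _.
 - exact: (Ck_cst k 1).
 - exact: CkM.
 - by move=> i _; apply: CkM; exact: Ck_fexp.
exists (\sum_(i < N) (`|a i| + `|b i|)) => x /bump_box H.
apply: norm_le_coord; first by apply: sumr_ge0 => i _; rewrite addr_ge0.
move=> i; rewrite (bigD1 i)//= (le_via (`|a i| + `|b i|))//; last first.
 by rewrite lerDl; apply: sumr_ge0 => j _; rewrite addr_ge0.
have /andP[ai bi] := H i.
have := ler_norm (b i); have := ler_norm (- a i); rewrite normrN.
have := normr_ge0 (a i); have := normr_ge0 (b i); rewrite ler_norml; lra.
Qed.

End Ck_theory.

(** * The primitive of the nonlinearity *)

Section primitive.
Context {R : realType}.
Variable f : R -> R.
Hypothesis cf : continuous f.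

Lemma primitive00 : primitive0 f 0 = 0.
by rewrite /primitive0 lexx set_itv1 Rintegral_set1. Qed.

Lemma is_derive_primitive0 (t : R) : is_derive t 1 (primitive0 f) (f t).
(* A base point to the left of both [0] and [t] turns both branches of [primitive0] into increments
   of a single integral [G]. *)
pose M := `|t| + 1.
have tM : `|t| < M by rewrite ltrDl.
have ig (a b : R) : lebesgue_measure.-integrable `[a, b]%classic (EFin \o f).
 apply: continuous_compact_integrable; first exact: segment_compact.
 exact: continuous_subspaceT.
pose G (x : R) := (\int[lebesgue_measure]_(s in `[(- M), x]) f s)%R.
have E (x : R) : - M <= x -> primitive0 f x = G x - G 0.
 move=> Mx; rewrite /primitive0 /G; case: ifPn => [x0|]; last rewrite -ltNge => x0.
  rewrite (@Rintegral_itvB _ _ (BLeft (- M)) (BRight x) 0) ?Rintegral_itv_obnd_cbnd//.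
  - apply: integrableS (ig 0 x) => //; exact: subset_itv_oc_cc.
  - by rewrite bnd_simp lerNl oppr0 (le_trans _ (ltW tM)).
 rewrite -(opprB (\int[lebesgue_measure]_(s in `[(- M), 0]) f s)%R); congr (- _).
 rewrite (@Rintegral_itvB _ _ (BLeft (- M)) (BRight 0) x) ?Rintegral_itv_obnd_cbnd// ?bnd_simp//.
 - apply: integrableS (ig x 0) => //; exact: subset_itv_oc_cc.
 - exact: ltW.
have Mt : - M < t by have := ltr_norml t M; rewrite tM => /esym/andP[].
have tM' : t < M by exact: le_lt_trans (ler_norm t) tM.
have [dG GE] := @continuous_FTC1_closed R f (- M) t M tM' (ig _ _) Mt (@cf t).
have dG' : is_derive t 1 G (f t) by split; [exact: dG|rewrite -[RHS]GE derive1E].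
have d : is_derive t 1 (fun x => G x - G 0) (f t).
 have := is_deriveB dG' (is_derive_cst (G 0) t 1); rewrite subr0; exact.
apply: (near_eq_is_derive _ d).
near=> x; apply/esym; rewrite E//.
by apply: ltW; near: x; exact: lt_nbhsr.
Unshelve. all: by end_near. Qed.

Lemma primitive0_mvt (a b : R) :
 exists2 c : R, `|c - a| <= `|b - a| & primitive0 f b - primitive0 f a = f c * (b - a).
have dP t := is_derive_primitive0 t.
have cP := is_derive_cont dP.
have [ab|ab] := leP a b.
 have [c + ->] := @MVT_segment R (primitive0 f) f a b ab (fun t _ => dP t) (continuous_subspaceT cP).
 rewrite in_itv/= => /andP[ac cb]; exists c => //.
 by rewrite !ger0_norm ?subr_ge0// lerD2r.
have [c + E] := @MVT_segment R (primitive0 f) f b a (ltW ab) (fun t _ => dP t) (continuous_subspaceT cP).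
rewrite in_itv/= => /andP[ac cb]; exists c; last by rewrite -opprB E -mulrN opprB.
by rewrite !ler0_norm ?subr_le0 ?(ltW ab)// lerN2 lerD2r.
Qed.

Lemma continuous_primitive0 : continuous (primitive0 f).
exact: is_derive_cont is_derive_primitive0. Qed.

End primitive.

Record nonlin (R : realType) (q : R) (f : R -> R) : Prop := Nonlin {
 nl_cont : continuous f;
 nl_at0 : f t / t @[t --> 0^'] --> (0 : R);
 nl_pinfty : `|f t| / `|t| `^ (q - 1) @[t --> +oo] --> (0 : R);
 nl_ninfty : `|f t| / `|t| `^ (q - 1) @[t --> -oo] --> (0 : R) }.

Section indicators.
Context {T : Type} {R : realType}.
Implicit Types (A : set T) (x : T).
Lemma ind_ge0 A x : 0 <= \1_A x :> R. by rewrite indicE ler0n. Qed.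
Lemma ind_le1 A x : \1_A x <= 1 :> R. by rewrite indicE lern1 leq_b1. Qed.
Lemma ind_sqr A x : (\1_A x : R) ^+ 2 = \1_A x.
by rewrite indicE; case: (_ \in A); rewrite ?expr1n ?expr0n. Qed.
Lemma ind_norm A x : `|\1_A x : R| = \1_A x.
by rewrite ger0_norm// ind_ge0. Qed.
Lemma ind1 A x : A x -> \1_A x = 1 :> R.
by move=> Ax; rewrite indicE mem_set. Qed.
Lemma ind0 A x : ~ A x -> \1_A x = 0 :> R.
by move=> Ax; rewrite indicE memNset. Qed.
End indicators.
#[local] Hint Resolve ind_ge0 : core.

(** * Linear inequalities of the deformation argument *)

Section arithmetic.
Context {R : realFieldType}.
Implicit Types c i x t b s d h k K : R.
Lemma mp_ar1 c' c K t : c' - c <= K * t -> c' + t <= c + (K + 1) * t.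
lra. Qed.
Lemma mp_ar2 i c K t d : i + t / 2 * d <= c + (K + 1) * t -> c - t <= i ->
 t * d <= 2 * ((K + 1) * t + t).
lra. Qed.
Lemma mp_ar3 i c x t b : c - t <= i -> t <= x -> x <= b -> - b <= i - c.
lra. Qed.
Lemma mp_ar4 i c x b : i <= c + x -> x <= b -> i - c <= b.
lra. Qed.
Lemma mp_ar5 x p b : - (b / 4) <= x - p -> b <= p -> 3 / 4 * b <= x.
lra. Qed.
Lemma mp_ar6 i' i d h k s b : b / 4 * (s * h) <= b / 4 * (s * k) ->
 s * (k * (3 / 4 * b)) <= s * d -> i' - i - - s * d <= b / 4 * (s * h) ->
 i' <= i - s * k * (b / 2).
lra. Qed.
Lemma mp_ar7 p x c t : - (t / 2) <= p - x -> c - t / 2 <= x -> c - t <= p.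
lra. Qed.
Lemma mp_ar8 i c K t sb : i <= c + (K + 1) * t -> (K + 2) * t <= sb -> 0 < t ->
 i - sb <= c - t / 2.
lra. Qed.
End arithmetic.

Section euclidean_space.
Context {R : realType} {N : nat}.
Local Notation T := 'rV[R]_N.
Local Notation mu := (@lebesgue_rV R N).
Local Notation Int := (Rintegral mu setT).
Local Notation l2 := (l2 mu).
Local Notation ip := (ip mu).
Local Notation nrm := (nrm mu).
Local Notation intg := (intg mu).
Local Notation "\I_ x ( E )" := (Int (fun x => E)) (at level 0, x name, E at level 200).
Implicit Types (u v w psi phi Phi om : T -> R) (x y : T).

Definition decays om := forall e : R, 0 < e -> exists K : R, forall x, K < `|x| -> `|om x| <= e.

Lemma cvg_prod_seq (I : Type) (s : seq I) (u : I -> nat -> R) (l : I -> R) :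
 (forall i, u i k ~[k]~> l i) ->
 \prod_(i <- s) u i k ~[k]~> \prod_(i <- s) l i.
move=> H; elim: s => [|i s IH].
 by under eq_fun do rewrite big_nil; rewrite big_nil; exact: cvg_cst.
by under eq_fun do rewrite big_cons; rewrite big_cons; exact: cvgM.
Qed.

(** * Density of test functions in L^2 *)

Section density.
Implicit Types (f g : T -> R).

Lemma L2P u : L2 u <-> l2 u.
split=> [Lu|[mu_ iu]].
 split; last exact: Lfun2_integrable_sqr.
 by move: Lu; rewrite /L2 /= inE => /andP[]; rewrite inE.
rewrite /L2 /= inE; apply/andP; split; rewrite inE//=.
rewrite /finite_norm unlock /=.
rewrite poweR_lty// (le_lt_trans _ (integrable_lty measurableT iu))//.
apply: ge0_le_integral => //.
- apply/measurable_EFinP.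
 apply: (@measurableT_comp _ _ _ _ _ _ (fun x : R => x `^ 2)) => //; last first.
 exact: measurableT_comp.
- by apply/measurable_EFinP; exact: measurable_funX.
- by move=> x _; rewrite lee_fin -[2]/(2%:R) powR_mulrn// sqr_norm.
Qed.

Lemma l2_indic A : measurable A -> (mu A < +oo)%E -> l2 (\1_A).
move=> mA fA; split; first exact: measurable_indic.
rewrite (_ : (fun x => _) = \1_A); last first.
 by apply/funext => x; rewrite indicE; case: (_ \in _); rewrite ?expr1n ?expr0n.
apply/integrableP; split; first exact/measurable_EFinP/measurable_indic.
under eq_integral do rewrite gee0_abs ?lee_fin//.
by rewrite integral_indic// setIT.
Qed.

(** Boxes exclude their lower faces; lowering the left end by one makes the cube contain the closed
    ball of radius [M] of the sup norm, see [in_cube]. *)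
Definition cube (M : R) : set T := box (fun=> - M - 1) (fun=> M).

Lemma mfn_box a b : mfn (\1_(box a b) : T -> R).
by apply: measurable_indic; exact: mbox. Qed.

Lemma mfn_cube M : mfn (\1_(cube M) : T -> R).
exact: mfn_box. Qed.

Lemma l2_cube M : l2 (\1_(cube M)).
by apply: l2_indic; [exact: mbox|exact: mu_box_lty]. Qed.

Lemma in_cube M x : `|x| <= M -> x \in cube M.
move=> xM; rewrite inE => i; rewrite /= in_itv/=.
by have := le_trans (coord_le_norm x i) xM; rewrite ler_norml; lra.
Qed.

Lemma supp_cube_le f M (B : R) : (forall x, `|f x| <= B) -> supp_in f M ->
 forall x, `|f x| <= B * (\1_(cube M) x : R).
move=> HB sf x; have B0 : 0 <= B by exact: le_trans (HB x).
rewrite indicE.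
have [->|f0] := eqVneq (f x) 0; first by rewrite normr0 mulr_ge0.
by rewrite in_cube ?mulr1//; exact: sf.
Qed.

Lemma supp_l2 f M : continuous f -> supp_in f M -> l2 f.
move=> cf sf; have [B B0 HB] := supp_bounded cf sf.
apply: (@l2_le _ _ _ _ _ (B *: \1_(cube M))).
- exact: mfn_cont.
- by apply: l2Z; exact: l2_cube.
- move=> x; rewrite (le_trans (supp_cube_le HB sf x))//; exact: ler_norm.
Qed.

Lemma test_l2 phi : test_function phi -> l2 phi.
move=> tp; have [M _ sM] := test_supp tp.
by apply: supp_l2 sM; exact: test_cont.
Qed.

Let eps (k : nat) : R := k.+1%:R^-1.
Let eps0 k : 0 < eps k. by rewrite invr_gt0. Qed.
Let eps_cvg : eps k ~[k]~> 0. exact: cvg_harmonic. Qed.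

(** The upper faces are moved outwards by [eps k] so that the bumps stay positive on the faces that
    [box a b] contains. There the exponent is at most [eps k ^+ 2 / eps k], which still tends to
    zero; hence the square. *)
Let bmp a b k := bump (eps k ^+ 2) a (fun i : 'I_N => b i + eps k).

Lemma fexp_cvg1 (t : R) : 0 < t -> fexp (eps k ^+ 2) 0 t ~[k]~> (1 : R).
move=> t0; rewrite /fexp t0.
under eq_fun do rewrite expr0 invr1 mul1r.
rewrite -expR0; apply: (cvg_comp (fun k => - (eps k ^+ 2 / t)) expR); last first.
 exact: continuous_expR.
rewrite -oppr0 -(mul0r t^-1) -(mulr0 (0 : R)) -[0 * 0]/(0 * 0) .
apply: cvgN; apply: cvgMl; exact: cvgM.
Qed.

Lemma fexp_cvg2 (t : R) : 0 <= t -> fexp (eps k ^+ 2) 0 (t + eps k) ~[k]~> (1 : R).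
move=> t0.
apply: (@squeeze_cvgr _ _ _ _ (fun k => expR (- eps k)) (fun=> 1)).
- apply: nearW => k; rewrite fexp0_le1 ?exprn_gt0// andbT.
 rewrite /fexp ltr_wpDl// expr0 invr1 mul1r ler_expR lerN2.
 by rewrite ler_pdivrMr ?ltr_wpDl// expr2 ler_wpM2l ?(ltW (eps0 k))// lerDr.
- rewrite -expR0; apply: (cvg_comp (fun k => - eps k) expR); last exact: continuous_expR.
 by rewrite -oppr0; exact: cvgN.
- exact: cvg_cst.
Qed.

Lemma bump_cvg a b x : bmp a b k x ~[k]~> (\1_(box a b) x : R).
rewrite (_ : (\1_(box a b) x : R) =
 \prod_(i < N) (a i < x ord0 i <= b i)%R%:R); last first.
 rewrite indicE; have [/[!inE] xb|xb] := boolP (x \in box a b).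
  rewrite big1// => i _; have := xb i; by rewrite /= in_itv/= => ->.
 apply/esym/eqP; rewrite prodf_seq_eq0 /=.
 apply: contraNT xb => /hasPn H; rewrite inE => i; rewrite /= in_itv/=.
 have := H i (mem_index_enum _); by case: (_ < _ <= _); rewrite //= eqxx.
under eq_fun do rewrite /bmp bumpE; apply: cvg_prod_seq => i.
have [xa|xa] := leP (x ord0 i) (a i).
 rewrite /= (_ : (fun k => _) = (fun=> 0)); first exact: cvg_cst.
 by apply/funext => k; rewrite /fexp subr_gt0 ltNge xa /= mul0r.
have [xb|xb] := leP (x ord0 i) (b i).
 rewrite /= -[X in _ --> X](mulr1 (1 : R)); apply: cvgM.
  by apply: fexp_cvg1; rewrite subr_gt0.
 by under eq_fun do rewrite addrAC; apply: fexp_cvg2; rewrite subr_ge0.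
apply: cvg_near_cst.
have : 0 < x ord0 i - b i by rewrite subr_gt0.
move=> /(cvgr0_norm_lt _ eps_cvg); apply: filterS => k.
rewrite ger0_norm ?(ltW (eps0 k))// => h.
rewrite [X in _ * X](_ : _ = 0) ?mulr0//.
by rewrite /fexp subr_gt0 ltNge -lerBrDl ltW.
Qed.

Lemma orth_box w a b : l2 w -> (forall phi, test_function phi -> ip w phi = 0) ->
 \I_x(w x * \1_(box a b) x) = 0.
move=> lw H.
have lQ : l2 (\1_(box a (fun i => b i + 1))).
 by apply: l2_indic; [exact: mbox|exact: mu_box_lty].
have [|||||_] := @Int_dct _ _ _ mu (fun k x => w x * bmp a b k x)
 (fun x => w x * \1_(box a b) x)
 (fun x => `|w x| * \1_(box a (fun i => b i + 1)) x); last first.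
- rewrite (_ : (fun k => Int _) = (fun=> 0)); last first.
  by apply/funext => k; apply: H; apply: test_bump; rewrite exprn_gt0.
 by move=> cv; apply/esym; apply: (cvg_unique _ _ cv) => //; exact: cvg_cst.
- move=> k x; rewrite normrM ler_wpM2l// ger0_norm ?bump_ge0//.
 have [->|/bump_box h] := eqVneq (bmp a b k x) 0; first by rewrite indicE.
 rewrite indicE mem_set; first by rewrite bump_le1// exprn_gt0.
 move=> i; rewrite /= in_itv/=; have /andP[-> /ltW xb] := h i.
 by rewrite /= (le_trans xb)// lerD2l invf_le1// ler1n.
- by apply: l2_intgM => //; exact: l2_norm.
- by apply: aeW => x; apply: cvgMr; exact: bump_cvg.
- by apply: measurable_funM; [exact: l2m lw|exact: mfn_box].
- move=> k; apply: measurable_funM; first exact: l2m lw.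
 apply: mfn_cont; apply: test_cont; apply: test_bump.
 by pos.
Qed.

(** Bumps test the indicators of boxes, and the sets [A] over which [w] has zero integral inside the
    cube [Q k] form a Dynkin class; the sets where [w] is positive and negative are then admissible.
    Cutting with [Q k] keeps every integral finite. *)
Lemma fundamental_lemma w : l2 w ->
 (forall phi, test_function phi -> ip w phi = 0) -> {ae mu, forall x, w x = 0}.
move=> lw H.
pose Q k : set T := box (fun=> - k%:R) (fun=> k%:R).
have mQ k : measurable (Q k) by exact: mbox.
have lQ A k : measurable A -> l2 (\1_(A `&` Q k)).
 move=> mA; apply: l2_indic; first exact: measurableI.
 apply: le_lt_trans (@mu_box_lty R N (fun=> - k%:R) (fun=> k%:R)).
 by apply: le_measure; rewrite ?inE; [exact: measurableI|exact: mbox|exact: subIsetr].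
have iQ A k : measurable A -> intg (fun x => w x * \1_(A `&` Q k) x).
 by move=> mA; apply: l2_intgM => //; exact: lQ.
have key k A : measurable A -> \I_x(w x * \1_(A `&` Q k) x) = 0.
 rewrite (mboxes N) => mA; move: A mA.
 apply: (@dynkin_induction _ _ _
  (fun A => \I_x(w x * \1_(A `&` Q k) x) = 0) (mboxes N) (@boxI R N)).
 - by rewrite setTI; exact: orth_box.
 - move=> _ [a [b ->]].
  have [||c [d ->]] := @boxI R N (box a b) (Q k); try by eexists; eexists.
  exact: orth_box.
 - move=> S mS IS.
  rewrite (@Int_eq _ _ _ mu _ (fun x => w x * \1_(setT `&` Q k) x - w x * \1_(S `&` Q k) x)).
   rewrite IntB ?iQ// IS setTI subr0; exact: orth_box.
  move=> x; rewrite -mulrBr; congr (_ * _).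
  rewrite !indicE !in_setI in_setT in_setC /=.
  by case: (x \in S); case: (x \in Q k); rewrite /= ?subr0 ?subrr.
 - move=> F mF tF IF.
  have mU : measurable (\bigcup_j F j) by exact: bigcupT_measurable.
  have sumE n x : (\sum_(j < n) \1_(F j `&` Q k) x : R) =
    \1_((\big[setU/set0]_(j < n) F j) `&` Q k) x.
   elim: n => [|n IHn]; first by rewrite !big_ord0 set0I indicE in_set0.
   rewrite !big_ord_recr /= IHn !indicE !in_setI in_setU.
   have : ~~ ((x \in \big[setU/set0]_(j < n) F j) && (x \in F n)).
    apply/negP => /andP[/set_mem + /set_mem Fn].
    rewrite -bigcup_mkord => -[j /= jn Fj].
    have := tF j n Logic.I Logic.I (ex_intro _ x (conj Fj Fn)) => jE.
    by move: jn; rewrite jE ltnn.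
   by case: (x \in \big[setU/set0]_(j < n) F j); case: (x \in F n);
    case: (x \in Q k) => //=; rewrite ?addr0 ?add0r.
  have mUn n : measurable (\big[setU/set0]_(j < n) F j) by exact: bigsetU_measurable.
  have [|||||_] := @Int_dct _ _ _ mu
   (fun n x => w x * \1_((\big[setU/set0]_(j < n) F j) `&` Q k) x)
   (fun x => w x * \1_((\bigcup_j F j) `&` Q k) x)
   (fun x => `|w x| * \1_(setT `&` Q k) x).
  + move=> n; exact: intg_m (iQ _ k (mUn n)).
  + exact: intg_m (iQ _ k mU).
  + apply: aeW => x; apply: cvgMr; rewrite indicE in_setI.
   apply: cvg_near_cst.
   have [/set_mem [j _ Fj]|xU] := boolP (x \in \bigcup_j F j).
    exists j.+1 => // n /= jn; rewrite indicE in_setI.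
    by have -> : x \in \big[setU/set0]_(i < n) F i
     by apply: mem_set; rewrite -bigcup_mkord; exists j.
   apply: nearW => n; rewrite indicE in_setI.
   have /negbTE -> // : x \notin \big[setU/set0]_(i < n) F i.
   apply: contra xU => /set_mem; rewrite -bigcup_mkord => -[j _ Fj].
   by apply: mem_set; exists j.
  + by apply: l2_intgM; [exact: l2_norm|exact: lQ].
  + move=> n x; rewrite normrM ler_wpM2l// !indicE !in_setI in_setT /=.
   by case: (_ \in _) => /=; rewrite// ger0_norm.
  + rewrite (_ : (fun n => Int _) = (fun=> 0)); last first.
    apply/funext => n; rewrite (@Int_eq _ _ _ mu _
     (fun x => \sum_(j < n) (w x * \1_(F j `&` Q k) x))).
     by rewrite Int_sum ?big1// => j _; exact: iQ.
    by move=> x; rewrite -sumE mulr_sumr.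
   by move=> cv; apply/esym; apply: (cvg_unique _ _ cv) => //; exact: cvg_cst.
have mw := l2m lw.
have aek k : {ae mu, forall x, `|w x| * \1_(setT `&` Q k) x = 0}.
 pose A1 := [set x | 0 < w x]; pose A2 := [set x | w x < 0].
 have mA1 : measurable A1.
  have := mw measurableT _ (measurable_itv `]0, +oo[); rewrite setTI; congr measurable.
  by apply/seteqP; split => x /=; rewrite in_itv/= andbT.
 have mA2 : measurable A2.
  by have := mw measurableT _ (measurable_itv `]-oo, 0[); rewrite setTI.
 have wE x : `|w x| * \1_(setT `&` Q k) x =
   w x * \1_(A1 `&` Q k) x - w x * \1_(A2 `&` Q k) x.
  rewrite !indicE !in_setI in_setT /= -mulrBr.
  have -> : (x \in A1) = (0 < w x) by apply/idP/idP => [/set_mem//|]; rewrite inE.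
  have -> : (x \in A2) = (w x < 0) by apply/idP/idP => [/set_mem//|]; rewrite inE.
  case: (x \in Q k); last by rewrite !andbF subrr !mulr0.
  rewrite !andbT mulr1; have [w0|w0|w0] := ltgtP (w x) 0.
  - by rewrite ltr0_norm// sub0r mulrN1.
  - by rewrite gtr0_norm// subr0 mulr1.
  - by rewrite w0 normr0 mul0r.
 apply: Int_eq0_ae.
 - by move=> x; rewrite mulr_ge0.
 - by apply: l2_intgM; [exact: l2_norm|exact: lQ].
 - by rewrite (Int_eq _ wE) IntB ?iQ// !key// subrr.
have := ae_foralln aek; apply: filterS => x Hx.
have : (\bigcup_k Q k) x by rewrite bigcup_box.
move=> [k _ Qk]; have := Hx k; rewrite indicE mem_set ?mulr1; last by split.
by move=> /eqP; rewrite normr_eq0 => /eqP.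
Qed.

Lemma test_dense w : l2 w -> forall e : R, 0 < e ->
 exists2 phi, test_function phi & nrm (w - phi) <= e.
move=> lw e e0; have := @dense_orth R _ l2 ip (@l2D _ _ _ mu) (@l2Z _ _ _ mu)
 (fun f g _ _ => ipC mu f g) (@ipD _ _ _ mu) (@ipZ _ _ _ mu) (@ip_ge0 _ _ _ mu)
 (@l2_complete _ _ _ mu) (@test_function R N) test_l2 test0 testD (fun a f => @testZ R N a f).
apply=> // z lz H; have z0 := fundamental_lemma lz H.
rewrite -(Int0 mu); apply: Int_ae => //.
 by apply: measurable_funM; exact: l2m lz.
by move: z0; apply: filterS => x ->; rewrite mul0r.
Qed.

(** Norms can be computed by duality against test functions, where a translation or a derivative may
    be moved onto the smooth factor. *)
Lemma nrm_dual w (M : R) : l2 w -> 0 <= M ->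
 (forall phi, test_function phi -> `|ip w phi| <= M * nrm phi) -> nrm w <= M.
move=> lw M0 H.
have key e : 0 < e -> nrm w ^+ 2 <= M * nrm w + (nrm w + M) * e.
 move=> e0; have [phi tp Hp] := test_dense lw e0; have lp := test_l2 tp.
 rewrite nrm2//; have -> : ip w w = ip w (w - phi) + ip w phi by rewrite ipBr// subrK.
 have h1 : ip w (w - phi) <= nrm w * e.
  rewrite (le_trans (ler_norm _))// (le_trans (ip_cs lw (l2B lw lp)))//.
  by rewrite ler_wpM2l// nrm_ge0.
 have h2 := le_trans (ler_norm _) (H _ tp).
 have h3 : nrm phi <= nrm w + e.
  rewrite (_ : phi = w - (w - phi)); last by rewrite opprB addrC subrK.
  by rewrite (le_trans (nrm_triB lw (l2B lw lp)))// lerD2l.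
 by have := ler_wpM2l M0 h3; lra.
have h : nrm w ^+ 2 <= M * nrm w.
 apply/ler_addgt0Pr => e e0.
 have p0 : 0 < nrm w + M + 1 by rewrite ltr_wpDl// addr_ge0// nrm_ge0.
 have := key _ (divr_gt0 e0 p0); set d := e / _ => kd.
 rewrite (le_trans kd)// lerD2l (le_via ((nrm w + M + 1) * d))//.
  by rewrite ler_wpM2r ?divr_ge0 ?(ltW e0) ?(ltW p0)// lerDl.
 by rewrite /d mulrC divfK ?gt_eqF.
have [->//|w0] := eqVneq (nrm w) 0.
have wp : 0 < nrm w by rewrite lt_neqAle eq_sym w0 nrm_ge0.
by rewrite -(ler_pM2r wp) -expr2.
Qed.

End density.

(* A quadratic one-step error disappears under subdivision of [0, s]. *)
Lemma increment_bound (J K : R -> R) (C K0 L s : R) :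
 0 <= C -> 0 <= L ->
 (forall s k, `|k| <= 1 -> `|J (s + k) - J s - k * K s| <= C * k ^+ 2) ->
 (forall t, `|t| <= `|s| -> `|K t - K0| <= L) ->
 `|J s - J 0 - s * K0| <= L * `|s|.
move=> C0 L0 HJ HK; apply/ler_addgt0Pr => e e0.
pose n := (Num.truncn (C * s ^+ 2 / e + `|s|)).+1.
have n1 : C * s ^+ 2 / e + `|s| < n%:R by exact: truncnS_gt.

pose k := s / n%:R.
have s2 : 0 <= C * s ^+ 2 / e by rewrite divr_ge0 ?(ltW e0)// mulr_ge0// sqr_ge0.
have k1 : `|k| <= 1.
 rewrite /k normrM normfV [`|n%:R|]ger0_norm// ler_pdivrMr// mul1r.
 by have := normr_ge0 s; lra.
have step j : (j <= n)%N -> `|J (j%:R * k) - J 0 - (j%:R * k) * K0| <=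
  j%:R * (L * `|k| + C * k ^+ 2).
 elim: j => [|j IH] jn; first by rewrite !mul0r !subrr normr0.
 have {}IH := IH (ltnW jn).
 have h1 := HJ (j%:R * k) k k1.
 have h2 : `|k * (K (j%:R * k) - K0)| <= L * `|k|.
  rewrite normrM mulrC ler_wpM2r//; apply: HK.
  rewrite /k mulrCA normrM ler_piMr// normrM normfV !ger0_norm//.
  by rewrite ler_pdivrMr// mul1r ler_nat ltnW.
 rewrite -natr1 [X in J X](_ : _ = j%:R * k + k); last by rewrite mulrDl mul1r.
 rewrite (_ : J _ - _ - _ = (J (j%:R * k) - J 0 - j%:R * k * K0) +
  (J (j%:R * k + k) - J (j%:R * k) - k * K (j%:R * k)) +
  k * (K (j%:R * k) - K0)); last by ring.
 rewrite (le_trans (ler_normD _ _))// mulrDl mul1r.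
 by have := ler_normD (J (j%:R * k) - J 0 - j%:R * k * K0)
  (J (j%:R * k + k) - J (j%:R * k) - k * K (j%:R * k)); lra.
have := step n (leqnn n).
have -> : n%:R * k = s by rewrite /k mulrC divfK// gt_eqF.
move/le_trans; apply; rewrite mulrDr.
have -> : n%:R * (L * `|k|) = L * `|s|.
 rewrite /k normrM normfV [`|n%:R|]ger0_norm// mulrCA; congr (_ * _).
 by rewrite mulrCA divff ?mulr1 ?gt_eqF.
rewrite lerD2l /k (_ : n%:R * _ = C * s ^+ 2 / n%:R).
 rewrite ler_pdivrMr// [e * _]mulrC -ler_pdivrMr// ltW//; apply: le_lt_trans n1.
 by rewrite lerDl.
by field; rewrite gt_eqF.
Qed.

(** * Translations and L^2 difference quotients *)

Section difference_quotients.
Implicit Types (f g : T -> R).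

Definition shf y u : T -> R := fun x => u (x + y).

Lemma mfn_shf y u : mfn u -> mfn (shf y u).
by move=> mu_; exact: measurableT_comp (measurable_shift y). Qed.

Lemma l2_shf y u : l2 u -> l2 (shf y u).
by move=> [mu_ iu]; split; [exact: mfn_shf|exact: (intg_shift y iu)].
Qed.

Lemma ip_shf2 y u v : l2 u -> l2 v -> ip (shf y u) (shf y v) = ip u v.
by move=> lu lv; exact: (@Int_shift R N y (fun x => u x * v x) (l2_intgM lu lv)).
Qed.

Lemma nrm_shf y u : l2 u -> nrm (shf y u) = nrm u.
by move=> lu; rewrite !nrm_sqrt ip_shf2. Qed.

Lemma shfK y u : shf (- y) (shf y u) = u.
by apply/funext => x; rewrite /shf subrK. Qed.

Lemma shfA y y' u : shf y (shf y' u) = shf (y + y') u.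
by apply/funext => x; rewrite /shf addrA. Qed.

Lemma shf0 u : shf 0 u = u.
by apply/funext => x; rewrite /shf addr0. Qed.

Lemma ip_shf y u v : l2 u -> l2 v -> ip (shf y u) v = ip u (shf (- y) v).
move=> lu lv; rewrite -(@ip_shf2 (- y) (shf y u)) ?shfK//.
exact: l2_shf.
Qed.

Variable i : 'I_N.

Lemma ip_tr (s : R) u v : l2 u -> l2 v ->
 ip (shf (s *: ee i) u) v = ip u (shf (- s *: ee i) v).
by move=> lu lv; rewrite ip_shf// scaleNr. Qed.

Local Notation tr s := (shf (s *: ee i)).

Lemma norm_see (s : R) : `|s *: ee i : T| <= `|s|.
apply: norm_le_coord => // j; rewrite !mxE eqxx /=.
by rewrite normrM ler_piMr//; case: (_ == _); rewrite ?normr1 ?normr0.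
Qed.

Lemma supp_bound_nrm f M (B : R) : mfn f -> (forall x, `|f x| <= B) -> supp_in f M ->
 l2 f /\ nrm f <= B * nrm (\1_(cube M)).
move=> mf HB sf; have lc := @l2_cube M.
have B0 : 0 <= B by exact: le_trans (HB 0).
have le x : `|f x| <= `|(B *: (\1_(cube M) : T -> R)) x|.
 by rewrite (le_trans (supp_cube_le HB sf x))//; exact: ler_norm.
have lf : l2 f by apply: (l2_le mf (l2Z B lc)).
split=> //; rewrite -[X in X * _](ger0_norm B0) -nrmZ//.
exact: nrm_le (l2Z B lc) le.
Qed.

Lemma supp_shf f M (s : R) : supp_in f M -> `|s| <= 1 -> supp_in (tr s f) (M + 1).
move=> sf s1 x /sf h; rewrite -[x](addrK (s *: ee i)).
by rewrite (le_trans (ler_normB _ _))// lerD// (le_trans (norm_see s)).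
Qed.

Lemma supp_sum f g M : supp_in f M -> supp_in g M -> supp_in (f - g) M.
move=> sf sg x; have [fx|/sf//] := eqVneq (f x) 0.
have -> : (f - g) x = - g x by rewrite fctE fx sub0r.
by rewrite oppr_eq0; exact: sg.
Qed.

Lemma supp_le f M M' : M <= M' -> supp_in f M -> supp_in f M'.
by move=> MM sf x /sf h; exact: le_trans MM. Qed.

Lemma test_lipschitz phi : test_function phi -> exists2 C : R, 0 <= C &
 forall s : R, `|s| <= 1 -> nrm (tr s phi - phi) <= C * `|s|.
move=> tp; have [M M0 sM] := test_supp tp.
have tp' := test_partial i tp; have [M' _ sM'] := test_supp tp'.
have [B B0 HB] := supp_bounded (test_cont tp') sM'.
exists (B * nrm (\1_(cube (M + 1)))); first by rewrite mulr_ge0// nrm_ge0.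
move=> s s1; rewrite mulrAC.
have [|||_ //] := @supp_bound_nrm (tr s phi - phi) (M + 1) (B * `|s|).
- have mp := mfn_cont (test_cont tp).
 by apply: measurable_funB => //; exact: mfn_shf.
- move=> x; have [th _] := partial_mvt x s (fun y => @test_derivable _ _ _ i y tp).
 move=> E; rewrite [(_ - _) x]E normrM mulrC ler_wpM2r//.
- apply: supp_sum; first exact: supp_shf.
 by apply: supp_le sM; rewrite lerDl.
Qed.

Lemma test_quotient phi : test_function phi -> exists2 C : R, 0 <= C &
 forall s : R, `|s| <= 1 -> nrm (tr s phi - phi - s *: partial i phi) <= C * s ^+ 2.
move=> tp; have [M M0 sM] := test_supp tp.
have tp' := test_partial i tp; have tp'' := test_partial i tp'.
have [M' _ sM'] := test_supp tp''.
have [B B0 HB] := supp_bounded (test_cont tp'') sM'.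
exists (B * nrm (\1_(cube (M + 1)))); first by rewrite mulr_ge0// nrm_ge0.
move=> s s1; rewrite mulrAC.
have mp := mfn_cont (test_cont tp).
have mp' := mfn_cont (test_cont tp').
have [|||_ //] := @supp_bound_nrm (tr s phi - phi - s *: partial i phi) (M + 1) (B * s ^+ 2).
- apply: measurable_funB; first by apply: measurable_funB => //; exact: mfn_shf.
 exact: measurable_funM.
- move=> x; have [th ts E] := partial_mvt x s (fun y => @test_derivable _ _ _ i y tp).
 have [t2 tt E2] := partial_mvt x th (fun y => @test_derivable _ _ _ i y tp').
 have -> : (tr s phi - phi - s *: partial i phi) x = s * (th * partial i (partial i phi) (x + t2 *: ee i)).
  by rewrite -E2 mulrBr -E.
 rewrite !normrM.
 rewrite mulrA [leRHS]mulrC ler_pM//.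
 by rewrite -[leRHS]sqr_norm expr2 ler_wpM2l.
- apply: supp_sum; first apply: supp_sum; first exact: supp_shf.
  by apply: supp_le sM; rewrite lerDl.
 move=> x; rewrite [(_ *: _) x]/(_ * _) mulf_eq0 negb_or => /andP[_].
 move=> /(partial_supp (test_cont tp) sM) h; by rewrite (le_trans h)// lerDl.
Qed.

Lemma l2_shift_continuous w : l2 w -> forall e : R, 0 < e -> exists2 d : R, 0 < d &
 forall s : R, `|s| <= d -> nrm (tr s w - w) <= e.
move=> lw e e0.
have [phi tp Hp] := test_dense lw (divr_gt0 e0 (ltr0Sn R 2)).
have [C C0 HC] := test_lipschitz tp; have lp := test_l2 tp.
exists (Num.min 1 (e / 3 / (C + 1))); first by rewrite lt_min ltr01 !divr_gt0// ltr_wpDl.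
move=> s; rewrite le_min => /andP[s1 sC].
have h2 : nrm (tr s phi - phi) <= e / 3.
 rewrite (le_trans (HC _ s1))// (le_via ((C + 1) * `|s|))//.
  by rewrite ler_wpM2r// lerDl.
 by rewrite mulrC -ler_pdivlMr// ltr_wpDl.
have -> : tr s w - w = (tr s (w - phi) + (tr s phi - phi)) - (w - phi).
 by apply/funext => x; rewrite /shf !fctE; ring.
have l1 := l2_shf (s *: ee i) (l2B lw lp).
have l3 : l2 (tr s phi - phi) by apply: l2B => //; exact: l2_shf.
have := nrm_triB (l2D l1 l3) (l2B lw lp).
have := nrm_tri l1 l3; rewrite (nrm_shf _ (l2B lw lp)).
lra.
Qed.

(** Moved onto [phi], the one-step error becomes the second order Taylor remainder of [phi]; since
    translations are isometries, its bound does not depend on [s]. *)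
Lemma ip_step u g phi : l2 u -> l2 g -> weak_partial i u g -> test_function phi ->
 exists2 C : R, 0 <= C & forall s k : R, `|k| <= 1 ->
  `|ip (tr (s + k) u) phi - ip (tr s u) phi - k * ip (tr s g) phi| <= C * k ^+ 2.
move=> lu lg ug tp; have [C C0 HC] := test_quotient tp.
exists (nrm u * C); first by rewrite mulr_ge0// nrm_ge0.
move=> s k k1; pose psi := tr (- s) phi.
have tpsi : test_function psi by exact: test_shift.
have lpsi := test_l2 tpsi.
have lp := test_l2 tp.
have ldp := test_l2 (test_partial i tp).
have pE : partial i psi = tr (- s) (partial i phi) by exact: partial_shift.
have -> : ip (tr (s + k) u) phi - ip (tr s u) phi - k * ip (tr s g) phi =
  ip u (tr (- k) psi - psi - (- k) *: partial i psi).
 rewrite !ip_tr// -/psi.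
 have -> : tr (- (s + k)) phi = tr (- k) psi.
  by rewrite shfA -scalerDl opprD addrC.
 have ltr : l2 (tr (- k) psi) by exact: l2_shf.
 have ldpsi : l2 (partial i psi) by exact/test_l2/test_partial.
 rewrite ipBr// ?ipBr// ?ipZr//; [|exact: l2B|exact: l2Z].
 have ugp : ip u (partial i psi) = - ip g psi := ug _ tpsi.
 by rewrite ugp; ring.
have lq : l2 (tr (- k) psi - psi - (- k) *: partial i psi).
 apply: l2B; first by apply: l2B; exact: l2_shf.
 by apply: l2Z; exact/test_l2/test_partial.
rewrite (le_trans (ip_cs lu lq))// -mulrA ler_wpM2l ?nrm_ge0//.
have -> : tr (- k) psi - psi - (- k) *: partial i psi =
  tr (- s) (tr (- k) phi - phi - (- k) *: partial i phi).
 have E : tr (- k) psi = tr (- s) (tr (- k) phi) by rewrite /psi !shfA addrC.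
 by rewrite E pE.
rewrite nrm_shf; first by rewrite -[k ^+ 2]sqrrN; apply: HC; rewrite normrN.
by apply: l2B; [apply: l2B => //; exact: l2_shf|exact: l2Z].
Qed.

(** Against a test function, the translates of [u] have the translates of [g] as derivative;
    [increment_bound] integrates this and [nrm_dual] removes the test function. The choice [v := 0]
    gives the Lipschitz estimate [dq_le], the choice [v := g] strong convergence of the
    quotients. *)
Lemma dq_bound u g (s L : R) v : l2 u -> l2 g -> l2 v -> 0 <= L -> weak_partial i u g ->
 (forall t : R, `|t| <= `|s| -> nrm (tr t g - v) <= L) ->
 nrm (tr s u - u - s *: v) <= L * `|s|.
move=> lu lg lv L0 ug HL.
have lt := l2_shf (s *: ee i) lu; have lb := l2B lt lu.
apply: nrm_dual => [||phi tp]; [|by pos|].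
 by apply: l2B => //; exact: l2Z.
have lp := test_l2 tp.
rewrite ipBl// ?ipBl// ?ipZ//; last exact: l2Z.
have [C C0 HC] := ip_step lu lg ug tp.
have := @increment_bound (fun s => ip (tr s u) phi) (fun s => ip (tr s g) phi)
 C (ip v phi) (L * nrm phi) s C0 (mulr_ge0 L0 (nrm_ge0 _ _)) HC.
rewrite scale0r shf0 mulrAC; apply=> t ts.
have ltg := l2_shf (t *: ee i) lg.
rewrite -ipBl// (le_trans (ip_cs (l2B ltg lv) lp))// ler_wpM2r ?nrm_ge0//.
exact: HL.
Qed.

Lemma dq_le u g (s : R) : l2 u -> l2 g -> weak_partial i u g ->
 nrm (tr s u - u) <= nrm g * `|s|.
move=> lu lg ug.
have := @dq_bound u g s (nrm g) 0 lu lg (l2_0 _) (nrm_ge0 _ _) ug.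
rewrite scaler0 subr0; apply=> t _; rewrite subr0 nrm_shf//.
Qed.

(** Strong differentiability in [L^2] along [ee i]. It is equivalent to [weak_partial] for square
    integrable pairs, and it is the form in which composition, products and dilations are
    checked. *)
Definition has_dq u g := forall e : R, 0 < e -> exists2 d : R, 0 < d &
 forall s : R, `|s| <= d -> nrm (tr s u - u - s *: g) <= e * `|s|.

Lemma weak_partial_dq u g : l2 u -> l2 g -> weak_partial i u g -> has_dq u g.
move=> lu lg ug e e0; have [d d0 Hd] := l2_shift_continuous lg e0.
exists d => // s sd; apply: (dq_bound lu lg lg (ltW e0) ug) => t ts.
by apply: Hd; exact: le_trans sd.
Qed.

Lemma dq_weak_partial u g : l2 u -> l2 g -> has_dq u g -> weak_partial i u g.
move=> lu lg H phi tp.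
have lp := test_l2 tp; have ldp := test_l2 (test_partial i tp).
rewrite -[LHS]/(ip u (partial i phi)) -[X in _ = - X]/(ip g phi).
apply/eqP; rewrite -subr_eq0 opprK -normr_eq0; apply/eqP/le_anti.
rewrite normr_ge0 andbT; apply/ler_addgt0Pr => e e0; rewrite add0r.
have [C C0 HC] := test_quotient tp.
pose e1 := e / 2 / (nrm phi + 1).
have e10 : 0 < e1 by rewrite !divr_gt0// ltr_wpDl// nrm_ge0.
have [d d0 Hd] := H _ e10.
pose s := Num.min d (Num.min 1 (e / 2 / (nrm u * C + 1))).
have uC : 0 < nrm u * C + 1 by rewrite ltr_wpDl// mulr_ge0// nrm_ge0.
have s0 : 0 < s by rewrite !lt_min d0 ltr01 !divr_gt0.
have ns : `|s| = s by rewrite gtr0_norm.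
have [sd s1 sC] : [/\ s <= d, s <= 1 & s <= e / 2 / (nrm u * C + 1)].
 by split; rewrite /s !ge_min lexx ?orbT.
have {}Hd := Hd s; rewrite ns in Hd; have {Hd sd}h1 := Hd sd.
have h2 : nrm (tr (- s) phi - phi - (- s) *: partial i phi) <= C * s ^+ 2.
 by rewrite -sqrrN; apply: HC; rewrite normrN ns.
have ltu := l2_shf (s *: ee i) lu; have ltp := l2_shf ((- s) *: ee i) lp.
(* Discrete integration by parts: what remains are the remainders of [u] at step [s] and of [phi] at
   step [- s], both small compared with [s]. *)
have E : s * (ip u (partial i phi) + ip g phi) =
  - ip (tr s u - u - s *: g) phi + ip u (tr (- s) phi - phi - (- s) *: partial i phi).
 rewrite ipBl ?ipBl ?ipZ// ?ipBr ?ipZr//; try exact: l2Z; try exact: l2B.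
 by rewrite ip_tr//; ring.
have k1 : `|ip (tr s u - u - s *: g) phi| <= e / 2 * s.
 rewrite (le_trans (ip_cs _ lp))//.
  by apply: l2B; [exact: l2B|exact: l2Z].
 rewrite (le_via (e1 * s * (nrm phi + 1)))//.
  by rewrite ler_pM ?nrm_ge0// lerDl.
 by rewrite mulrAC /e1 divfK// gt_eqF// ltr_wpDl// nrm_ge0.
have k2 : `|ip u (tr (- s) phi - phi - (- s) *: partial i phi)| <= e / 2 * s.
 rewrite (le_trans (ip_cs lu _))//.
  by apply: l2B; [exact: l2B|exact: l2Z].
 rewrite (le_via (nrm u * (C * s ^+ 2)))// ?ler_wpM2l ?nrm_ge0//.
 rewrite mulrA expr2 mulrA ler_wpM2r ?(ltW s0)//.
 rewrite (le_via ((nrm u * C + 1) * s))//.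
  by rewrite ler_wpM2r ?(ltW s0)// lerDl.
 by rewrite mulrC -ler_pdivlMr.
rewrite -(ler_pM2l s0) -{1}ns -normrM E.
rewrite (le_trans (ler_normD _ _))// normrN.
by lra.
Qed.

End difference_quotients.

Lemma heine (f : R -> R) (M : R) : continuous f ->
 forall e : R, 0 < e -> exists2 d : R, 0 < d &
  forall a b, `|a| <= M -> `|b| <= M -> `|a - b| <= d -> `|f a - f b| <= e.
move=> cf e e0; apply: contrapT => H.
have /choice[p Hp] : forall n : nat, exists p : R * R,
  [/\ `|p.1| <= M, `|p.2| <= M, `|p.1 - p.2| <= n.+1%:R^-1 & e < `|f p.1 - f p.2|].
 move=> n; apply: contrapT => Hn; apply: H; exists n.+1%:R^-1; first by pos.
 move=> a b aM bM ab; rewrite leNgt; apply/negP => fab; apply: Hn.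
 by exists (a, b).
have [k [kinc [l Hl]]] := @BW R (fun n => (p n).1) M (fun n => let: And4 h _ _ _ := Hp n in h).
have Hl2 : (p (k n)).2 ~[n]~> l.
 have h : ((p (k n)).1 - (p (k n)).2) ~[n]~> 0.
  apply: (@cvg0_le _ _ (fun n => (k n).+1%:R^-1)); first by move=> n; case: (Hp (k n)).
  by apply: (@cvg_sub R (fun n => n.+1%:R^-1) 0 k kinc); exact: cvg_harmonic.
 have E : (fun n => (p (k n)).2) = (fun n => (p (k n)).1 - ((p (k n)).1 - (p (k n)).2)).
  by apply/funext => n; rewrite opprB addrC subrK.
 by rewrite E -[X in _ --> X]subr0; exact: cvgB Hl h.
have f1 := cvg_comp _ _ Hl (cf l); have f2 := cvg_comp _ _ Hl2 (cf l).
have h : (f (p (k n)).1 - f (p (k n)).2) ~[n]~> (0 : R).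
 by rewrite -(subrr (f l)); exact: cvgB f1 f2.
have [n Hn] := cvg0E h e0.
move: (Hn n (leqnn _)) => {Hn} /=.
by case: (Hp (k n)) => _ _ _; rewrite ltNge => /negP.
Qed.

(** Spends a tolerance [a] on a constant [K] that may vanish, whence the [+ 1] in the denominators
    throughout. *)
Lemma absorb (K a : R) : 0 <= K -> 0 <= a -> K * (a / (K + 1)) <= a.
move=> K0 a0; rewrite mulrCA ler_piMr// ler_pdivrMr ?ltr_wpDl// mul1r; lra.
Qed.

(** * Sobolev functions with an explicit gradient *)

Section sobolev_theory.
Implicit Types (f : T -> R) (g : 'I_N -> T -> R).

(** [wgrad] is an arbitrary choice of representative, unusable in computations. Work is done with an
    explicit gradient [g] and carried over by uniqueness almost everywhere, see [sob_unique] and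
    [dgE]. *)
Definition sob u g := l2 u /\ forall i, l2 (g i) /\ weak_partial i u (g i).

Definition Dw u (i : 'I_N) : T -> R := fun x => wgrad u x ord0 i.

Lemma sob_H1 u g : sob u g -> H1 u.
move=> [lu H]; split; first exact/L2P.
exists (fun x => \row_i g i x) => i; have [lg wg] := H i.
rewrite (_ : (fun x => _) = g i); last by apply/funext => x; rewrite mxE.
by split; first exact/L2P.
Qed.

Lemma H1_sob u : H1 u -> sob u (Dw u).
move=> [/L2P lu [g Hg]]; split=> // i.
have := @xgetPex _ (cst 0) (weak_grad_L2 u) (ex_intro _ g Hg).
by move=> /(_ i) [/L2P h1 h2].
Qed.

Lemma sob_l2 u g : sob u g -> l2 u. by case. Qed.
Lemma sob_grad u g i : sob u g -> l2 (g i). by case=> _ /(_ i) []. Qed.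
Lemma sob_weak u g i : sob u g -> weak_partial i u (g i).
by case=> _ /(_ i) []. Qed.
Lemma sob_dq u g i : sob u g -> has_dq i u (g i).
by move=> su; apply: weak_partial_dq; [exact: sob_l2 su|exact: sob_grad su|exact: sob_weak].
Qed.

Lemma dq_sob u g : l2 u -> (forall i, l2 (g i)) -> (forall i, has_dq i u (g i)) -> sob u g.
by move=> lu lg H; split=> // i; split => //; exact: dq_weak_partial. Qed.

Lemma sob_unique u u' g g' i : {ae mu, forall x, u x = u' x} ->
 sob u g -> sob u' g' -> {ae mu, forall x, g i x = g' i x}.
move=> uu su su'; have lg := sob_grad i su; have lg' := sob_grad i su'.
have := @fundamental_lemma (g i - g' i) (l2B lg lg').
case=> [phi tp|A [mA A0 sA]]; last first.
 exists A; split => // x /= gx; apply: sA => /=; apply: contra_not gx => /eqP.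
 by rewrite subr_eq0 => /eqP.
have lp := test_l2 tp; rewrite ipBl//.
have h1 : ip u (partial i phi) = - ip (g i) phi := sob_weak i su tp.
have h2 : ip u' (partial i phi) = - ip (g' i) phi := sob_weak i su' tp.
apply/eqP; rewrite subr_eq0 -eqr_opp -h1 -h2; apply/eqP.
by apply: ip_ae uu; [exact: l2m (sob_l2 su)|exact: l2m (sob_l2 su')|
 exact: l2m (test_l2 (test_partial i tp))].
Qed.

Lemma sobD u v g g' : sob u g -> sob v g' -> sob (u + v) (fun i => g i + g' i).
move=> su sv; split; first by apply: l2D; [exact: sob_l2 su|exact: sob_l2 sv].
move=> i; have lg := sob_grad i su; have lg' := sob_grad i sv.
split; first exact: l2D.
move=> phi tp; have lp := test_l2 tp; have ldp := test_l2 (test_partial i tp).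
have h1 : ip u (partial i phi) = - ip (g i) phi := sob_weak i su tp.
have h2 : ip v (partial i phi) = - ip (g' i) phi := sob_weak i sv tp.
rewrite -[LHS]/(ip (u + v) _) -[X in _ = - X]/(ip (g i + g' i) phi).
by rewrite !ipD// ?h1 ?h2 ?opprD//; [exact: sob_l2 su|exact: sob_l2 sv].
Qed.

Lemma sobZ a u g : sob u g -> sob (a *: u) (fun i => a *: g i).
move=> su; split; first by apply: l2Z; exact: sob_l2 su.
move=> i; have lg := sob_grad i su; split; first exact: l2Z.
move=> phi tp; have lp := test_l2 tp; have ldp := test_l2 (test_partial i tp).
have h1 : ip u (partial i phi) = - ip (g i) phi := sob_weak i su tp.
rewrite -[LHS]/(ip (a *: u) _) -[X in _ = - X]/(ip (a *: g i) phi).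
by rewrite !ipZ// ?h1 ?mulrN//; exact: sob_l2 su.
Qed.

Lemma sobB u v g g' : sob u g -> sob v g' -> sob (u - v) (fun i => g i - g' i).
move=> su sv; have := sobD su (sobZ (- 1) sv).
rewrite scaleN1r (_ : (fun i => _) = (fun i => g i - g' i))//.
by apply/funext => i; rewrite scaleN1r.
Qed.

Lemma sob0 : sob 0 (fun=> 0).
split=> [|i]; first exact: l2_0.
split; first exact: l2_0.
move=> phi tp; rewrite -[LHS]/(ip 0 _) -[X in _ = - X]/(ip 0 phi) !ip_Int.
by rewrite !(@Int_eq _ _ _ mu _ (fun=> 0)) ?Int0 ?oppr0// => x; exact: mul0r.
Qed.

Lemma sob_shf y u g : sob u g -> sob (shf y u) (fun i => shf y (g i)).
move=> su; have lu := sob_l2 su.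
apply: dq_sob => [|i|i]; [exact: l2_shf|by apply: l2_shf; exact: sob_grad su|].
have lg := sob_grad i su.
move=> e e0; have [d d0 Hd] := sob_dq i su e0; exists d => // s sd.
have -> : shf (s *: ee i) (shf y u) - shf y u - s *: shf y (g i) =
  shf y (shf (s *: ee i) u - u - s *: g i).
 have E : shf (s *: ee i) (shf y u) = shf y (shf (s *: ee i) u) by rewrite !shfA addrC.
 by rewrite E.
rewrite nrm_shf; first exact: Hd.
by apply: l2B; [apply: l2B => //; exact: l2_shf|exact: l2Z].
Qed.

Definition dil (t : R) u : T -> R := fun x => u (t *: x).

Lemma mfn_dil t u : mfn u -> mfn (dil t u).
by move=> mu_; exact: measurableT_comp (measurable_dil t). Qed.

Lemma l2_dil t u : 0 < t -> l2 u -> l2 (dil t u).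
by move=> t0 [mu_ iu]; split; [exact: mfn_dil|exact: (intg_dil t0 iu)]. Qed.

Lemma ip_dil t u v : 0 < t -> l2 u -> l2 v -> ip (dil t u) (dil t v) = t ^- N * ip u v.
by move=> t0 lu lv; exact: (@Int_dil R N t (fun x => u x * v x) t0 (l2_intgM lu lv)).
Qed.

Lemma nrm_dil t u : 0 < t -> l2 u -> nrm (dil t u) = Num.sqrt (t ^- N) * nrm u.
move=> t0 lu; rewrite !nrm_sqrt ip_dil// sqrtrM//.
by pos.
Qed.

Lemma sob_dil t u g : 0 < t -> sob u g -> sob (dil t u) (fun i => t *: dil t (g i)).
move=> t0 su; have lu := sob_l2 su.
apply: dq_sob => [|i|i]; first exact: l2_dil.
 by apply: l2Z; apply: l2_dil => //; exact: sob_grad su.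
have lg := sob_grad i su.
pose c := Num.sqrt (t ^- N) * t.
have c0 : 0 <= c by rewrite mulr_ge0// ltW.
move=> e e0; have [d d0 Hd] := sob_dq i su (divr_gt0 e0 (ltr_wpDl c0 ltr01)).
exists (d / t); first exact: divr_gt0.
move=> s; rewrite ler_pdivlMr// => sd.
have -> : shf (s *: ee i) (dil t u) - dil t u - s *: (t *: dil t (g i)) =
  dil t (shf ((t * s) *: ee i) u - u - (t * s) *: g i).
 apply/funext => x; rewrite /dil /shf /=.
 rewrite [LHS]/(u (t *: (x + s *: ee i)) - u (t *: x) - s * (t * g i (t *: x))).
 by rewrite mulrA [s * t]mulrC scalerDr scalerA.
rewrite nrm_dil//; last by apply: l2B; [apply: l2B => //; exact: l2_shf|exact: l2Z].
have h := Hd (t * s); rewrite normrM (gtr0_norm t0) mulrC in h; have {}h := h sd.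
rewrite (le_trans (ler_wpM2l (sqrtr_ge0 _) h))//.
rewrite (_ : _ * _ = (c / (c + 1)) * (e * `|s|)).
 by rewrite ler_piMl ?mulr_ge0 ?(ltW e0)// ler_pdivrMr ?ltr_wpDl// mul1r lerDl.
by rewrite /c; field; rewrite gt_eqF// ltr_wpDl.
Qed.

Lemma sob_test phi : test_function phi -> sob phi (fun i => partial i phi).
move=> tp; apply: dq_sob => [|i|i]; [exact: test_l2|exact/test_l2/test_partial|].
move=> e e0; have [C C0 HC] := test_quotient i tp.
exists (Num.min 1 (e / (C + 1))); first by rewrite lt_min ltr01 divr_gt0// ltr_wpDl.
move=> s; rewrite le_min => /andP[s1 sC].
rewrite (le_trans (HC s s1))// -[s ^+ 2]sqr_norm expr2 mulrA ler_wpM2r//.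
rewrite (le_via ((C + 1) * `|s|)) ?ler_wpM2r ?lerDl//.
by rewrite mulrC -ler_pdivlMr// ltr_wpDl.
Qed.

Lemma l2_bmul (K : R) f u : mfn f -> (forall x, `|f x| <= K) -> l2 u ->
 l2 (f * u) /\ nrm (f * u) <= K * nrm u.
move=> mf fK lu; have K0 : 0 <= K by exact: le_trans (fK 0).
have le x : `|(f * u) x| <= `|(K *: u) x|.
 rewrite [(f * u) x]/(f x * u x) [(K *: u) x]/(K * u x) !normrM.
 by rewrite ler_wpM2r// (ger0_norm K0).
have l1 : l2 (f * u).
 by apply: (l2_le _ (l2Z K lu) le); apply: measurable_funM => //; exact: l2m lu.
by split=> //; rewrite (le_trans (nrm_le l1 (l2Z K lu) le))// nrmZ// ger0_norm.
Qed.

(** Where [|f| > n] the weight is at most [K] and the tail of [f] is small by dominated convergence;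
    elsewhere the product is at most [L * n * |v|]. Smallness is uniform over all [v] of small
    norm. *)
Lemma l2_weight_small f (K L : R) : l2 f -> 0 <= K -> 0 <= L -> forall e : R, 0 < e ->
 exists2 d : R, 0 < d & forall v, l2 v -> nrm v <= d ->
  nrm (fun x => Num.min K (L * `|v x|) * f x) <= e.
move=> lf K0 L0 e e0.
pose h (n : nat) x : R := if `|f x| <= n%:R then 0 else f x.
have mh n : mfn (h n).
 apply: measurable_fun_ifT => //; last exact: l2m lf.
 by apply: measurable_fun_ler => //; apply: measurableT_comp => //; exact: l2m lf.
have hf n x : `|h n x| <= `|f x| by rewrite /h; case: ifP; rewrite ?normr0.
have lh n : l2 (h n) := l2_le (mh n) lf (hf n).
have [|||||_] := @Int_dct _ _ _ mu (fun n x => h n x ^+ 2) (fun=> 0) (fun x => f x ^+ 2).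
- by move=> n; exact: measurable_funX.
- exact: measurable_cst.
- apply: aeW => x; apply: cvg_near_cst; exists (Num.truncn `|f x|).+1 => // n /= xn.
 rewrite /h (_ : _ <= _ = true) ?expr0n//; apply/ltW.
 by rewrite (lt_le_trans (truncnS_gt _))// ler_nat.
- exact: l2i lf.
- move=> n x; rewrite normrX -[leRHS]sqr_norm lerXn2r//.
rewrite Int0 => /cvg0P.
have K1 : 0 < K + 1 by pos.
move=> /(_ ((e / 2 / (K + 1)) ^+ 2)) [|n /(_ n (leqnn _))]; first by pos.
rewrite -nrmE ger0_norm ?sqr_ge0// ler_pXn2r ?nnegrE ?nrm_ge0 ?divr_ge0 ?(ltW e0) ?(ltW K1)// => Hn.
have Ln : 0 < L * n%:R + 1 by pos.
exists (e / 2 / (L * n%:R + 1)); first by pos.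
move=> v lv vd.
pose a : T -> R := (K + 1) *: (h n : T -> R).
pose b : T -> R := (L * n%:R + 1) *: v.
have lab : l2 (fun x => `|a x| + `|b x|).
 exact: (l2D (l2_norm (l2Z _ (lh n))) (l2_norm (l2Z _ lv))).
have mw : mfn (fun x => Num.min K (L * `|v x|) * f x).
 apply: measurable_funM; last exact: l2m lf.
 apply: measurable_minr => //; apply: measurable_funM => //.
 by apply: measurableT_comp => //; exact: l2m lv.
have le x : `|Num.min K (L * `|v x|) * f x| <= `| `|a x| + `|b x| |.
 have m0 : 0 <= Num.min K (L * `|v x|) by rewrite le_min K0 mulr_ge0.
 rewrite [leRHS]ger0_norm// normrM (ger0_norm m0).
 rewrite [a x]/((K + 1) * h n x) [b x]/((L * n%:R + 1) * v x) !normrM.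
 rewrite (gtr0_norm K1) (gtr0_norm Ln) /h; case: ifP => [fn|_].
  rewrite normr0 mulr0 add0r (le_via (L * `|v x| * n%:R))//.
   by rewrite ler_pM// ge_min lexx orbT.
  by rewrite mulrAC ler_wpM2r// lerDl.
 rewrite (le_via (K * `|f x|)) ?ler_wpM2r ?ge_min ?lexx//.
 by rewrite ler_wpDr ?mulr_ge0 ?(ltW Ln)// ler_wpM2r// lerDl.
have lw := l2_le mw lab le.
rewrite (le_trans (nrm_le lw lab le))//.
rewrite (le_trans (nrm_tri (l2_norm (l2Z _ (lh n))) (l2_norm (l2Z _ lv))))//.
rewrite !nrm_norm !nrmZ// (gtr0_norm K1) (gtr0_norm Ln) (splitr e) lerD//.
- by rewrite mulrC -ler_pdivlMr.
- by rewrite mulrC -ler_pdivlMr.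
Qed.

(** The mean value theorem writes the increment of [Phi (u)] as [phi c] times that of [u]. As [phi]
    is merely continuous, replacing [phi c] by [phi (u x)] uses uniform continuity where [|u|] is
    bounded and the increment is small; the other points are paid for by the tail of [g i] and by
    [l2_weight_small]. *)
Lemma sob_comp (Phi phi : R -> R) (K : R) u g :
 Phi 0 = 0 -> (forall t : R, is_derive t 1 Phi (phi t)) -> continuous phi ->
 (forall t, `|phi t| <= K) -> sob u g ->
 sob (fun x => Phi (u x)) (fun i x => phi (u x) * g i x).
move=> P0 dP cphi HK su; have lu := sob_l2 su.
have K0 : 0 <= K by exact: le_trans (HK 0).
have cP : continuous Phi by exact: is_derive_cont dP.
have mvt a b : exists2 c, `|c - a| <= `|b - a| & Phi b - Phi a = phi c * (b - a).
 have [ab|ab] := leP a b.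
  have [c + ->] := @MVT_segment R Phi phi a b ab (fun t _ => dP t) (continuous_subspaceT cP).
  rewrite in_itv/= => /andP[ac cb]; exists c => //.
  by rewrite !ger0_norm ?subr_ge0// lerD2r.
 have [c + E] := @MVT_segment R Phi phi b a (ltW ab) (fun t _ => dP t) (continuous_subspaceT cP).
 rewrite in_itv/= => /andP[ac cb]; exists c; last by rewrite -opprB E -mulrN opprB.
 by rewrite !ler0_norm ?subr_le0 ?(ltW ab)// lerN2 lerD2r.
have mu_ := l2m lu.
have mphi : mfn (fun x => phi (u x)).
 by apply: measurableT_comp => //; exact: continuous_measurable_fun.
have mPhi : mfn (fun x => Phi (u x)).
 by apply: measurableT_comp => //; exact: continuous_measurable_fun.
have lP : l2 (fun x => Phi (u x)).
 apply: (l2_le mPhi (l2Z K lu)) => x.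
 have [c _ E] := mvt 0 (u x); rewrite P0 !subr0 in E.
 by rewrite E [(K *: u) x]/(K * u x) !normrM ler_wpM2r// (ger0_norm K0).
have lpg v : l2 v -> l2 ((phi \o u) * v) /\ nrm ((phi \o u) * v) <= K * nrm v.
 by move=> lv; exact: (l2_bmul mphi (fun x => HK (u x)) lv).
apply: dq_sob => // i; first by have [] := lpg _ (sob_grad i su).
have lg := sob_grad i su.
move=> e e0.
(* |phi(c) - phi(u)| <= e1 + 2K 1_{|u|>M} + min(2K, L|c - u|) *)
have [M HM] : exists M : nat, nrm (fun x => if `|u x| <= M%:R then 0 else g i x) <= e / 8 / (2 * K + 1).
 pose h (n : nat) x : R := if `|u x| <= n%:R then 0 else g i x.
 have mh n : mfn (h n).
  apply: measurable_fun_ifT => //; last exact: l2m lg.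
  by apply: measurable_fun_ler => //; apply: measurableT_comp.
 have [|||||_] := @Int_dct _ _ _ mu (fun n x => h n x ^+ 2) (fun=> 0) (fun x => g i x ^+ 2).
 - by move=> n; exact: measurable_funX.
 - exact: measurable_cst.
 - apply: aeW => x; apply: cvg_near_cst; exists (Num.truncn `|u x|).+1 => // n /= xn.
  rewrite /h (_ : _ <= _ = true) ?expr0n//; apply/ltW.
  by rewrite (lt_le_trans (truncnS_gt _))// ler_nat.
 - exact: l2i lg.
 - move=> n x; rewrite normrX -[leRHS]sqr_norm lerXn2r//.
  by rewrite /h; case: ifP; rewrite ?normr0.
 have K1 : 0 < 2 * K + 1 by pos.
 rewrite Int0 => /cvg0P/(_ ((e / 8 / (2 * K + 1)) ^+ 2)) [|n /(_ n (leqnn _))].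
  by pos.
 rewrite -nrmE ger0_norm ?sqr_ge0// ler_pXn2r ?nnegrE ?nrm_ge0 ?divr_ge0 ?(ltW e0) ?(ltW K1)// => Hn.
 by exists n.
have [e1 e10 e1E] : exists2 e1 : R, 0 < e1 & e1 * nrm (g i) <= e / 8.
 exists (e / 8 / (nrm (g i) + 1)); first by rewrite !divr_gt0// ltr_wpDl// nrm_ge0.
 by rewrite mulrC absorb ?nrm_ge0// divr_ge0// ltW.
have [sg sg0 Hsg] := heine (M%:R + 1) cphi e10.
pose sg' := Num.min sg 1.
have sg'0 : 0 < sg' by rewrite lt_min sg0 ltr01.
(* With this slope [Num.min (2 * K) (L * |v|)] reaches [2 * K] as soon as the increment exceeds
   [sg']. *)
pose L := 2 * K / sg'.
have K20 : 0 <= 2 * K by pos.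
have L0 : 0 <= L by rewrite divr_ge0 ?(ltW sg'0).
have [d1 d10 Hd1] := l2_weight_small lg K20 L0 (divr_gt0 e0 (ltr0Sn R 7)).
have k30 : 0 < 3 * K + 1 by pos.
have [d2 d20 Hd2] := sob_dq i su (divr_gt0 (divr_gt0 e0 (ltr0Sn R 1)) k30).
exists (Num.min d2 (d1 / (nrm (g i) + 1))).
 by rewrite lt_min d20 divr_gt0// ltr_wpDl// nrm_ge0.
move=> s; rewrite le_min => /andP[sd2 sd1].
pose v : T -> R := shf (s *: ee i) u - u.
have lv : l2 v by apply: l2B => //; exact: l2_shf.
have nv : nrm v <= d1.
 rewrite (le_trans (dq_le s lu lg (sob_weak i su)))//.
 rewrite (le_via ((nrm (g i) + 1) * `|s|)) ?ler_wpM2r ?lerDl//.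
 by rewrite mulrC -ler_pdivlMr// ltr_wpDl// nrm_ge0.
have Hq := Hd2 s sd2; rewrite -/v in Hq.
have lq : l2 (v - s *: g i) by apply: l2B => //; exact: l2Z.
pose h1 : T -> R := fun x => if `|u x| <= M%:R then 0 else g i x.
have lh1 : l2 h1.
 apply: (l2_le _ lg) => [|x]; last by rewrite /h1; case: ifP; rewrite ?normr0.
 apply: measurable_fun_ifT => //; last exact: l2m lg.
 by apply: measurable_fun_ler => //; apply: measurableT_comp.
pose w : T -> R := fun x => Num.min (2 * K) (L * `|v x|) * g i x.
have lw : l2 w.
 have mw : mfn (fun x => Num.min (2 * K) (L * `|v x|)).
  apply: measurable_minr => //; apply: measurable_funM => //.
  by apply: measurableT_comp => //; exact: l2m lv.
 have [] // := l2_bmul mw (K := 2 * K) _ lg.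
 move=> x; have m0 : 0 <= Num.min (2 * K) (L * `|v x|) by rewrite le_min K20 mulr_ge0.
 by rewrite ger0_norm// ge_min lexx.
pose Z := shf (s *: ee i) (fun x => Phi (u x)) - (fun x => Phi (u x)) - s *: ((phi \o u) * g i).
have lZ : l2 Z.
 apply: l2B; first by apply: l2B => //; exact: l2_shf.
 by apply: l2Z; have [] := lpg _ lg.
pose Y : T -> R := (fun x => `|((3 * K) *: (v - s *: g i)) x|) + ((fun x => `|((`|s| * e1) *: g i) x|) +
 ((fun x => `|((`|s| * (2 * K)) *: h1) x|) + (fun x => `|(`|s| *: w) x|))).
have lY3 := l2D (l2_norm (l2Z (`|s| * (2 * K)) lh1)) (l2_norm (l2Z `|s| lw)).
have lY2 := l2D (l2_norm (l2Z (`|s| * e1) lg)) lY3.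
have lY : l2 Y := l2D (l2_norm (l2Z (3 * K) lq)) lY2.
have ZY x : `|Z x| <= `|Y x|.
 have [c Hc E] := mvt (u x) (u (x + s *: ee i)).
 have -> : Z x = phi c * v x - s * (phi (u x) * g i x) by rewrite -[v x]/(u (x + s *: ee i) - u x) -E.
 have YE : Y x = 3 * K * `|v x - s * g i x| + (`|s| * e1 * `|g i x| + (`|s| * (2 * K) * `|h1 x| + `|s| * `|w x|)).
  transitivity (`|3 * K * (v x - s * g i x)| +
    (`| `|s| * e1 * g i x| + (`| `|s| * (2 * K) * h1 x| + `| `|s| * w x|))) => //.
  have nn (c' y : R) : 0 <= c' -> `|c' * y| = c' * `|y|.
   by move=> c0; rewrite normrM ger0_norm.
  have se : 0 <= `|s| * e1 by pos.
  have sk : 0 <= `|s| * (2 * K) by pos.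
  by rewrite (nn (3 * K)) ?mulr_ge0// (nn (`|s| * e1))// (nn (`|s| * (2 * K)))// (nn `|s|).
 have Y0 : 0 <= Y x by rewrite YE !addr_ge0 ?mulr_ge0// (ltW e10).
 rewrite (ger0_norm Y0) YE.
 have -> : phi c * v x - s * (phi (u x) * g i x) =
   phi c * (v x - s * g i x) + s * ((phi c - phi (u x)) * g i x) by ring.
 rewrite (le_trans (ler_normD _ _))// lerD//.
  rewrite normrM ler_wpM2r// (le_trans (HK c))//; move: K0; lra.
 rewrite normrM -!mulrA -!mulrDr ler_wpM2l// normrM.
 have dif : `|phi c - phi (u x)| <= 2 * K.
  by rewrite (le_trans (ler_normB _ _))// mulr_natl mulr2n lerD.
 have w0 : 0 <= `|w x| by [].
 have [ux|ux] := boolP (`|u x| <= M%:R); last first.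
  rewrite /h1 (negbTE ux) (le_via (2 * K * `|g i x|)) ?ler_wpM2r//.
  have : 0 <= e1 * `|g i x| by pos.
  by move: w0; lra.
 rewrite /h1 ux normr0 !mulr0 add0r.
 have [cs|cs] := leP `|c - u x| sg'.
  have : `|phi c - phi (u x)| <= e1.
   move: cs; rewrite le_min => /andP[cs1 cs2]; apply: Hsg => //.
    have := ler_normD (c - u x) (u x); rewrite subrK; move: ux cs2; lra.
   by rewrite (le_trans ux)// lerDl.
  move=> /(ler_wpM2r (normr_ge0 (g i x))); move: w0; lra.
 have -> : `|w x| = 2 * K * `|g i x|.
  rewrite /w normrM (_ : Num.min _ _ = 2 * K) ?[`|2 * K|]ger0_norm//.
  apply/min_idPl; rewrite /L -mulrA ler_peMr// mulrC ler_pdivlMr// mul1r.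
  by rewrite (le_trans (ltW cs))// (le_trans Hc).
 have := ler_wpM2r (normr_ge0 (g i x)) dif.
 have : 0 <= e1 * `|g i x| by pos.
 lra.
rewrite (le_trans (nrm_le lZ lY ZY))//.
rewrite (le_trans (nrm_tri (l2_norm (l2Z (3 * K) lq)) lY2))//.
have t2 := nrm_tri (l2_norm (l2Z (`|s| * e1) lg)) lY3.
have t3 := nrm_tri (l2_norm (l2Z (`|s| * (2 * K)) lh1)) (l2_norm (l2Z `|s| lw)).
rewrite !nrm_norm !nrmZ// !normrM !normr_id (gtr0_norm e10) in t2 t3.
rewrite !nrm_norm !nrmZ//.
have q1 : `|3 * K| * nrm (v - s *: g i) <= e / 2 * `|s|.
 rewrite ger0_norm ?mulr_ge0// (le_trans (ler_wpM2l _ Hq)) ?mulr_ge0//.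
 by rewrite mulrA ler_wpM2r//; apply: absorb; rewrite ?mulr_ge0 ?invr_ge0// ltW.
have q2 : `|s| * e1 * nrm (g i) <= e / 8 * `|s|.
 by rewrite -mulrA mulrC ler_wpM2r.
have q3 : `|s| * (`|2| * `|K|) * nrm h1 <= e / 8 * `|s|.
 rewrite -mulrA mulrC ler_wpM2r// -normrM (ger0_norm K20).
 rewrite (le_trans (ler_wpM2l K20 HM))//.
 rewrite mulrCA ler_piMr ?divr_ge0 ?(ltW e0)// ler_pdivrMr ?mul1r ?lerDl//.
 by pos.
have q4 : `|s| * nrm w <= e / 8 * `|s|.
 by rewrite mulrC ler_wpM2r//; exact: Hd1.
have Q := lerD q1 (le_trans t2 (lerD q2 (le_trans t3 (lerD q3 q4)))).
rewrite (le_trans Q)// -!mulrDl ler_wpM2r//; move: e0; lra.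
Qed.

End sobolev_theory.

Lemma cvg_sum_seq (I : Type) (s : seq I) (u : I -> nat -> R) (l : I -> R) :
 (forall i, u i k ~[k]~> l i) ->
 \sum_(i <- s) u i k ~[k]~> \sum_(i <- s) l i.
move=> H; elim: s => [|i s IH].
 by rewrite big_nil (_ : (fun k => _) = fun=> 0);
  [exact: cvg_cst|apply/funext => k; rewrite big_nil].
rewrite big_cons (_ : (fun k => _) = fun k => u i k + \sum_(j <- s) u j k).
 exact: cvgD.
by apply/funext => k; rewrite big_cons.
Qed.

Lemma cvg_sqr0 (u : nat -> R) :
 u n ~[n]~> 0 -> u n ^+ 2 ~[n]~> 0.
move=> h; rewrite (_ : (fun n => _) = (fun n => u n * u n)); last exact/funext.
by rewrite -[X in _ --> X](mulr0 (0 : R)); exact: cvgM.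
Qed.

(** * The Hilbert structure of H^1 and weak convergence *)

Section H1_space.
Implicit Types (f : T -> R) (g : 'I_N -> T -> R).

(** The Dirichlet form is locked, so that it remains an atom for rewriting and for the arithmetic
    tactics. *)
Fact dg_key : unit. exact: tt. Qed.
Definition dg := locked_with dg_key (fun u v => \sum_i ip (Dw u i) (Dw v i)).
Lemma dg_def u v : dg u v = \sum_i ip (Dw u i) (Dw v i).
by rewrite /dg unlock. Qed.
Definition hB u v : R := dg u v + ip u v.
Definition hn : (T -> R) -> R := bn hB.

Lemma H1_l2 u : H1 u -> l2 u. by move/H1_sob/sob_l2. Qed.
Lemma H1_Dw u i : H1 u -> l2 (Dw u i). by move/H1_sob/(sob_grad i). Qed.

Lemma Dw_ae u g i : sob u g -> {ae mu, forall x, Dw u i x = g i x}.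
by move=> su; apply: (sob_unique i _ (H1_sob (sob_H1 su)) su); exact: aeW. Qed.

Lemma ip_ae2 (f1 f2 g1 g2 : T -> R) : l2 f1 -> l2 f2 -> l2 g1 -> l2 g2 ->
 {ae mu, forall x, f1 x = f2 x} -> {ae mu, forall x, g1 x = g2 x} -> ip f1 g1 = ip f2 g2.
move=> l1 l3 k1 k2 e1 e2; rewrite (ip_ae (l2m l1) (l2m l3) (l2m k1) e1) ipC.
by rewrite (ip_ae (l2m k1) (l2m k2) (l2m l3) e2) ipC.
Qed.

Lemma dgE u v g g' : sob u g -> sob v g' -> dg u v = \sum_i ip (g i) (g' i).
move=> su sv; rewrite dg_def; apply: eq_bigr => i _; apply: ip_ae2; try exact: Dw_ae.
- by apply: H1_Dw; exact: sob_H1 su.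
- exact: sob_grad su.
- by apply: H1_Dw; exact: sob_H1 sv.
- exact: sob_grad sv.
Qed.

Lemma H1_0 : H1 (0 : T -> R). exact: sob_H1 sob0. Qed.
Lemma H1D u v : H1 u -> H1 v -> H1 (u + v).
by move=> /H1_sob su /H1_sob sv; exact: sob_H1 (sobD su sv). Qed.
Lemma H1Z a u : H1 u -> H1 (a *: u).
by move=> /H1_sob su; exact: sob_H1 (sobZ a su). Qed.
Lemma H1B u v : H1 u -> H1 v -> H1 (u - v).
by move=> /H1_sob su /H1_sob sv; exact: sob_H1 (sobB su sv). Qed.
Lemma H1_shf y u : H1 u -> H1 (shf y u).
by move=> /H1_sob su; exact: sob_H1 (sob_shf y su). Qed.
Lemma H1_dil t u : 0 < t -> H1 u -> H1 (dil t u).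
by move=> t0 /H1_sob su; exact: sob_H1 (sob_dil t0 su). Qed.
Lemma H1_test phi : test_function phi -> H1 phi.
by move/sob_test/sob_H1. Qed.

Lemma dgC u v : dg u v = dg v u.
by rewrite !dg_def; apply: eq_bigr => i _; rewrite ipC. Qed.
Lemma dgD u v w : H1 u -> H1 v -> H1 w -> dg (u + v) w = dg u w + dg v w.
move=> Hu Hv Hw; rewrite (dgE (sobD (H1_sob Hu) (H1_sob Hv)) (H1_sob Hw)) !dg_def -big_split/=.
by apply: eq_bigr => i _; rewrite ipD//; exact: H1_Dw.
Qed.
Lemma dgZ a u w : H1 u -> H1 w -> dg (a *: u) w = a * dg u w.
move=> Hu Hw; rewrite (dgE (sobZ a (H1_sob Hu)) (H1_sob Hw)) dg_def mulr_sumr.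
by apply: eq_bigr => i _; rewrite ipZ//; exact: H1_Dw.
Qed.
Lemma dg_ge0 u : H1 u -> 0 <= dg u u.
by move=> Hu; rewrite dg_def; apply: sumr_ge0 => i _; apply: ip_ge0; exact: H1_Dw. Qed.

Lemma hBC u v : hB u v = hB v u. by rewrite /hB dgC ipC. Qed.
Lemma hBD u v w : H1 u -> H1 v -> H1 w -> hB (u + v) w = hB u w + hB v w.
by move=> Hu Hv Hw; rewrite /hB (dgD Hu Hv Hw) (ipD (H1_l2 Hu) (H1_l2 Hv) (H1_l2 Hw)) addrACA. Qed.
Lemma hBZ a u w : H1 u -> H1 w -> hB (a *: u) w = a * hB u w.
by move=> Hu Hw; rewrite /hB (dgZ _ Hu Hw) (ipZ _ (H1_l2 Hu) (H1_l2 Hw)) mulrDr. Qed.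
Lemma hB_ge0 u : H1 u -> 0 <= hB u u.
by move=> Hu; rewrite addr_ge0 ?dg_ge0// ip_ge0//; exact: H1_l2. Qed.

Let hC u v (_ : H1 u) (_ : H1 v) := hBC u v.
Let dC u v (_ : H1 u) (_ : H1 v) := dgC u v.

Lemma hn_ge0 u : 0 <= hn u. exact: bn_ge0. Qed.
Lemma hn2 u : H1 u -> hn u ^+ 2 = hB u u.
exact: (bn2 hB_ge0). Qed.
Lemma hn_tri u v : H1 u -> H1 v -> hn (u + v) <= hn u + hn v.
exact: (bn_tri H1D H1Z hC hBD hBZ hB_ge0). Qed.
Lemma hn_triB u v : H1 u -> H1 v -> hn (u - v) <= hn u + hn v.
exact: (bn_triB H1D H1Z hC hBD hBZ hB_ge0). Qed.
Lemma hnZ a u : H1 u -> hn (a *: u) = `|a| * hn u.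
exact: (bnZ H1Z hC hBZ). Qed.
Lemma dg_cs u v : H1 u -> H1 v -> `|dg u v| <= bn dg u * bn dg v.
exact: (cs H1D H1Z dC dgD dgZ dg_ge0). Qed.
Lemma dgBl u v w : H1 u -> H1 v -> H1 w -> dg (u - v) w = dg u w - dg v w.
exact: (bBl H1Z dgD dgZ). Qed.
Lemma dgDr u v w : H1 u -> H1 v -> H1 w -> dg w (u + v) = dg w u + dg w v.
by move=> Hu Hv Hw; rewrite dgC dgD// dgC [dg v w]dgC. Qed.
Lemma dgZr a u w : H1 u -> H1 w -> dg w (a *: u) = a * dg w u.
by move=> Hu Hw; rewrite dgC dgZ// dgC. Qed.
Lemma dgBr u v w : H1 u -> H1 v -> H1 w -> dg w (u - v) = dg w u - dg w v.
by move=> Hu Hv Hw; rewrite dgC dgBl// dgC [dg v w]dgC. Qed.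

Lemma dg_le_hn u : H1 u -> dg u u <= hn u ^+ 2.
by move=> Hu; rewrite hn2// /hB lerDl ip_ge0//; exact: H1_l2. Qed.
Lemma nrm_le_hn u : H1 u -> nrm u <= hn u.
move=> Hu; rewrite -(@ler_pXn2r _ 2) ?nnegrE ?nrm_ge0 ?hn_ge0// hn2// nrm2; last exact: H1_l2.
by rewrite /hB lerDr dg_ge0.
Qed.
Lemma bndg_le_hn u : H1 u -> bn dg u <= hn u.
move=> Hu; rewrite -(@ler_pXn2r _ 2) ?nnegrE ?bn_ge0// (bn2 dg_ge0)//.
exact: dg_le_hn.
Qed.
Lemma Dw_le_hn u i : H1 u -> nrm (Dw u i) <= hn u.
move=> Hu; rewrite -(@ler_pXn2r _ 2) ?nnegrE ?nrm_ge0 ?hn_ge0// nrm2; last exact: H1_Dw.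
rewrite (le_trans _ (dg_le_hn Hu))// dg_def (bigD1 i)//= lerDl sumr_ge0// => j _.
by apply: ip_ge0; exact: H1_Dw.
Qed.

Lemma hn0 : hn 0 = 0.
by rewrite -(scale0r (0 : T -> R)) hnZ ?normr0 ?mul0r//; exact: H1_0. Qed.

Lemma H1normE u : H1 u -> H1norm u = hn u.
move=> Hu; rewrite /H1norm /hn /bn; congr Num.sqrt; rewrite /hB dg_def.
have i1 i : intg (fun x => Dw u i x * Dw u i x) by apply: l2_intgM; exact: H1_Dw.
rewrite -Int_sum// -IntD; last 2 first.
- exact: intg_sum.
- by apply: l2_intgM; exact: H1_l2.
apply: Int_eq => x; rewrite /enorm sqr_sqrtr; first by rewrite -expr2.
by apply: sumr_ge0 => i _; rewrite -expr2 sqr_ge0.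
Qed.

Lemma sob_lim (u_ : nat -> T -> R) (g_ : nat -> 'I_N -> T -> R) u g :
 (forall n, sob (u_ n) (g_ n)) -> l2 u -> (forall i, l2 (g i)) ->
 nrm (u_ n - u) ~[n]~> 0 ->
 (forall i, nrm (g_ n i - g i) ~[n]~> 0) -> sob u g.
move=> su lu lg cu cg; split=> // i; split=> // phi tp.
have lp := test_l2 tp; have lpi := test_l2 (test_partial i tp).
have h1 := ip_cvg (fun n => sob_l2 (su n)) lu lpi cu.
have h2 := ip_cvg (fun n => sob_grad i (su n)) (lg i) lp (cg i).
have E : (fun n => ip (u_ n) (partial i phi)) = (fun n => - ip (g_ n i) phi).
 by apply/funext => n; exact: (sob_weak i (su n) tp).
rewrite E in h1.
exact: (cvg_unique _ h1 (cvgN h2)).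
Qed.

Lemma hn_sob u g : sob u g -> hn u ^+ 2 = \sum_i nrm (g i) ^+ 2 + nrm u ^+ 2.
move=> su; rewrite hn2; last exact: sob_H1 su.
rewrite /hB (dgE su su) nrm2; last exact: sob_l2 su.
by congr +%R; apply: eq_bigr => i _; rewrite nrm2//; exact: sob_grad su.
Qed.

Lemma H1_complete (u_ : nat -> T -> R) : (forall n, H1 (u_ n)) ->
 (forall e : R, 0 < e -> exists M, forall m n, (M <= m)%N -> (M <= n)%N ->
   hn (u_ m - u_ n) <= e) ->
 exists2 u, H1 u & hn (u_ n - u) ~[n]~> 0.
move=> Hu cau.
have [u lu cu] : exists2 u, l2 u & nrm (u_ n - u) ~[n]~> 0.
 apply: l2_complete => [n|e e0]; first exact: H1_l2.
 have [M HM] := cau _ e0; exists M => m n Mm Mn.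
 by rewrite (le_trans (nrm_le_hn (H1B (Hu m) (Hu n))))// HM.
have /choice[g Hg] : forall i : 'I_N, exists g : T -> R, l2 g /\ nrm (Dw (u_ n) i - g) ~[n]~> 0.
 move=> i; have [g lg cg] : exists2 g : T -> R, l2 g & nrm (Dw (u_ n) i - g) ~[n]~> 0.
  apply: l2_complete => [n|e e0]; first exact: H1_Dw.
  have [M HM] := cau _ e0; exists M => m n Mm Mn.
  rewrite (le_trans _ (HM m n Mm Mn))//.
  have Hmn := H1B (Hu m) (Hu n).
  rewrite (le_trans _ (Dw_le_hn i Hmn))//.
  have H1m := H1_Dw i (Hu m); have H1n := H1_Dw i (Hu n).
  rewrite (@nrm_ae _ _ _ mu _ (Dw (u_ m - u_ n) i))//.
  - exact: l2m (l2B H1m H1n).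
  - exact: l2m (H1_Dw i Hmn).
  have := Dw_ae i (sobB (H1_sob (Hu m)) (H1_sob (Hu n))).
  by apply: filterS => x ->.
 by exists g.
have su := sob_lim (fun n => H1_sob (Hu n)) lu (fun i => (Hg i).1) cu (fun i => (Hg i).2).
exists u; first exact: sob_H1 su.
have E n : hn (u_ n - u) ^+ 2 = \sum_i nrm (Dw (u_ n) i - g i) ^+ 2 + nrm (u_ n - u) ^+ 2.
 exact: hn_sob (sobB (H1_sob (Hu n)) su).
apply/cvg0P => e e0.
have : (\sum_i nrm (Dw (u_ n) i - g i) ^+ 2 + nrm (u_ n - u) ^+ 2) ~[n]~> (0 : R).
 rewrite -[X in _ --> X]addr0; apply: cvgD; last first.
  exact: cvg_sqr0.
 rewrite [X in _ --> X](_ : _ = \sum_(i < N) (0 : R)); last by rewrite big1.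
 by apply: cvg_sum_seq => i; apply: cvg_sqr0; have [] := Hg i.
move=> h; have [M HM] := cvg0E h (exprn_gt0 2 e0).
exists M => n Mn; have := HM n Mn; rewrite -E ger0_norm ?sqr_ge0// ger0_norm ?hn_ge0//.
by rewrite ler_pXn2r ?nnegrE ?hn_ge0// ltW.
Qed.

Definition wkcvg (u_ : nat -> T -> R) u :=
 forall z, H1 z -> hB (u_ n) z ~[n]~> hB u z.

Lemma H1_weak_compact (u_ : nat -> T -> R) (M : R) :
 (forall n, H1 (u_ n)) -> (forall n, hn (u_ n) <= M) ->
 exists (k : nat -> nat) u, [/\ {homo k : m n / (m < n)%N}, H1 u & wkcvg (u_ \o k) u].
by move=> Hu Hb; exact: (weak_compactness H1_0 H1D H1Z hC hBD hBZ hB_ge0 H1_complete Hu Hb).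
Qed.

Lemma wkcvg_lin (u_ : nat -> T -> R) u (l : (T -> R) -> R) (K : R) :
 (forall n, H1 (u_ n)) -> H1 u -> wkcvg u_ u ->
 (forall v w, H1 v -> H1 w -> l (v + w) = l v + l w) ->
 (forall a v, H1 v -> l (a *: v) = a * l v) ->
 (forall v, H1 v -> `|l v| <= K * hn v) -> l (u_ n) ~[n]~> l u.
move=> Hu_ Hu wk lD lZ lK.
have [z Hz lE] := riesz H1_0 H1D H1Z hC hBD hBZ hB_ge0 H1_complete lD lZ lK.
rewrite lE// hBC (_ : (fun n => l (u_ n)) = (fun n => hB (u_ n) z)); first exact: wk.
by apply/funext => n; rewrite lE// hBC.
Qed.

Lemma wkcvg_ip (u_ : nat -> T -> R) u z : (forall n, H1 (u_ n)) -> H1 u -> wkcvg u_ u ->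
 l2 z -> ip (u_ n) z ~[n]~> ip u z.
move=> Hu_ Hu wk lz; apply: (@wkcvg_lin u_ u (fun v => ip v z) (nrm z)) => //.
- by move=> v w Hv Hw; apply: ipD => //; exact: H1_l2.
- by move=> a v Hv; apply: ipZ => //; exact: H1_l2.
- move=> v Hv; rewrite (le_trans (ip_cs (H1_l2 Hv) lz))// mulrC ler_wpM2l ?nrm_ge0//.
 exact: nrm_le_hn.
Qed.

Lemma wkcvg_dg (u_ : nat -> T -> R) u z : (forall n, H1 (u_ n)) -> H1 u -> wkcvg u_ u ->
 H1 z -> dg (u_ n) z ~[n]~> dg u z.
move=> Hu_ Hu wk lz; apply: (@wkcvg_lin u_ u (fun v => dg v z) (hn z)) => //.
- by move=> v w Hv Hw; apply: dgD.
- by move=> a v Hv; apply: dgZ.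
- move=> v Hv; rewrite (le_trans (dg_cs Hv lz))// mulrC ler_pM ?bn_ge0//; exact: bndg_le_hn.
Qed.

Lemma wkcvg_sub (u_ : nat -> T -> R) u (k : nat -> nat) : {homo k : m n / (m < n)%N} ->
 wkcvg u_ u -> wkcvg (u_ \o k) u.
by move=> kinc wk z Hz; exact: (cvg_sub kinc (wk z Hz)). Qed.

(** Lower semicontinuity of the gradient part alone, from [dg (u_ n - u) (u_ n - u) >= 0]. The bound
    is only asked up to [e] for large [n], as it comes from limits. *)
Lemma dg_lsc (u_ : nat -> T -> R) u (K : R) : (forall n, H1 (u_ n)) -> H1 u -> wkcvg u_ u ->
 (forall e : R, 0 < e -> exists M, forall n, (M <= n)%N -> dg (u_ n) (u_ n) <= K + e) ->
 dg u u <= K.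
move=> Hu_ Hu wk HK; rewrite leNgt; apply/negP => Ku.
have c : (2 * dg (u_ n) u - dg u u) ~[n]~> dg u u.
 have E : dg u u = 2 * dg u u - dg u u by ring.
 rewrite [X in _ --> X]E; apply: cvgB; last exact: cvg_cst.
 by apply: cvgM; [exact: cvg_cst|exact: wkcvg_dg].
pose e := (dg u u - K) / 3.
have e0 : 0 < e by rewrite divr_gt0// subr_gt0.
have [M1 HM1] := HK e e0.
have [M2 HM2] := cvg0E ((@cvgBP _ _ _).2 c) e0.
have h1 := HM1 _ (leq_maxl M1 M2); have h2 := HM2 _ (leq_maxr M1 M2).
set n := maxn M1 M2 in h1 h2.
have h3 : 0 <= dg (u_ n - u) (u_ n - u) by apply: dg_ge0; exact: H1B.
rewrite dgBl ?dgBr// in h3; try exact: H1B.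
rewrite [dg u (u_ n)]dgC in h3.
have {}h2 := le_trans (ler_norm _) (le_trans (eq_ind _ (fun z => z <= e) h2 _ (distrC _ _)) (lexx _)).
move: h1 h2 h3; rewrite /e; lra.
Qed.

End H1_space.
#[local] Hint Resolve hn_ge0 : core.

Section tonelli.

Lemma EFin_Int (f : T -> R) : intg f -> ((Int f)%:E = \int[mu]_x (f x)%:E)%E.
by move=> If; rewrite /Rintegral fineK//; exact: integrable_fin_num. Qed.

Lemma intg_le_integral (f : T -> R) M : mfn f -> (forall x, 0 <= f x) ->
 (\int[mu]_x (f x)%:E <= M%:E)%E -> intg f /\ Int f <= M.
move=> mf f0 key.
have If : intg f.
 apply/integrableP; split; first exact/measurable_EFinP.
 rewrite (_ : (fun x => _) = (EFin \o f)); last first.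
  by apply/funext => x /=; rewrite ger0_norm.
 by rewrite (le_lt_trans key)// ltry.
by split=> //; rewrite -lee_fin EFin_Int.
Qed.

(** Exchange of integrals in the form of an estimate: bounds [k y] on the sections in [x] give
    integrability of the partial integral in [y]. *)
Lemma tonelli_le (G : T * T -> R) (k : T -> R) :
 measurable_fun setT G -> (forall z, 0 <= G z) ->
 (forall x, intg (fun y => G (x, y))) ->
 (forall y, intg (fun x => G (x, y)) /\ \I_x(G (x, y)) <= k y) ->
 intg k ->
 intg (fun x => \I_y(G (x, y))) /\
 \I_x(\I_y(G (x, y))) <= Int k.
move=> mG G0 iy ix ik.
have mEG : measurable_fun setT (EFin \o G) by exact/measurable_EFinP.
have EG0 z : (0 <= (EFin \o G) z)%E by rewrite lee_fin.
apply: intg_le_integral.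
- apply/measurable_EFinP; rewrite (_ : _ \o _ = fubini_F mu (EFin \o G)).
  exact: measurable_fun_fubini_tonelli_F.
 by apply/funext => x /=; rewrite EFin_Int.
- by move=> x; apply: Int_ge0.
rewrite (_ : (fun x => _) = fun x => (\int[mu]_y (EFin \o G) (x, y))%E); last first.
 by apply/funext => x; rewrite EFin_Int.
rewrite fubini_tonelli// EFin_Int//; apply: ge0_le_integral => //.
- by move=> y _; apply: integral_ge0.
- exact: (@measurable_fun_fubini_tonelli_G _ _ _ _ _ mu (EFin \o G) mEG EG0).
- by apply/measurable_EFinP; exact: intg_m ik.
- by move=> y _; have [i1 i2] := ix y; rewrite -EFin_Int// lee_fin.
Qed.

End tonelli.

(** * Averages over small cubes and the Rellich theorem *)

Section averages.
Implicit Types (f : T -> R) (r : R).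

Definition Q r : set T := box (fun=> 0) (fun=> r).
(** Mean of [u] over the cube of side [r] with lower corner [x]. As an inner product with a
    translate it is Lipschitz in [x] and passes pointwise to weak limits. *)
Definition avg r u : T -> R := fun x => r ^- N * ip (\1_(Q r)) (shf x u).

Lemma l2_Q r : l2 (\1_(Q r)).
by apply: l2_indic; [exact: mbox|exact: mu_box_lty]. Qed.

Lemma ip_Q r : 0 < r -> ip (\1_(Q r)) (\1_(Q r)) = r ^+ N.
move=> r0; apply: EFin_inj; rewrite !ip_Int EFin_Int; last by apply: l2_intgM; exact: l2_Q.
rewrite (_ : (fun x => _) = fun x : T => (\1_(Q r) x)%:E); last first.
 by apply/funext => x; rewrite indicE; case: (_ \in _); rewrite ?mulr1 ?mulr0.
rewrite integral_indic//; last exact: mbox.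
rewrite setIT; have := @mu_box R N (fun=> 0) (fun=> r).
by rewrite r0 subr0 prodr_const card_ord.
Qed.

Lemma nrm_Q2 r : 0 < r -> nrm (\1_(Q r)) ^+ 2 = r ^+ N.
by move=> r0; rewrite nrm2 ?ip_Q//; exact: l2_Q. Qed.

(** A translation is performed one coordinate after the other, each costing [dq_le]; the factor [N]
    is the price of this path. *)
Lemma shf_le u y : H1 u -> nrm (shf y u - u) <= N%:R * `|y| * bn dg u.
move=> Hu; have lu := H1_l2 Hu.
have nD i : nrm (Dw u i) <= bn dg u.
 rewrite -(@ler_pXn2r _ 2) ?nnegrE ?bn_ge0// nrm2; last exact: H1_Dw.
 rewrite (bn2 dg_ge0)// dg_def (bigD1 i)//= lerDl sumr_ge0// => j _.
 by apply: ip_ge0; exact: H1_Dw.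
have key (s : seq 'I_N) : nrm (shf (\sum_(i <- s) y ord0 i *: ee i) u - u) <=
  (size s)%:R * (`|y| * bn dg u).
 elim: s => [|i s IH]; first by rewrite big_nil shf0 subrr nrm0 mul0r.
 rewrite big_cons -shfA.
 have l1 := l2_shf (\sum_(j <- s) y ord0 j *: ee j) lu.
 have l3 := l2B l1 lu; have l4 := l2_shf (y ord0 i *: ee i) lu.
 have -> : shf (y ord0 i *: ee i) (shf (\sum_(j <- s) y ord0 j *: ee j) u) - u =
   shf (y ord0 i *: ee i) (shf (\sum_(j <- s) y ord0 j *: ee j) u - u) +
   (shf (y ord0 i *: ee i) u - u).
  apply/funext => x; rewrite /shf; fring.
 rewrite (le_trans (nrm_tri (l2_shf _ l3) (l2B l4 lu)))// nrm_shf//.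
 rewrite -natr1 mulrDl mul1r lerD//.
 have sw := sob_weak i (H1_sob Hu).
 rewrite (le_trans (dq_le (y ord0 i) lu (H1_Dw i Hu) sw))// mulrC ler_pM ?nrm_ge0//.
 exact: coord_le_norm.
have := key (index_enum 'I_N); rewrite -row_sum_delta -mulrA.
by rewrite (_ : size _ = N)// -[RHS]card_ord cardE enumT.
Qed.

Lemma avg_lip r u x x' : 0 < r -> H1 u ->
 `|avg r u x - avg r u x'| <= r ^- N * nrm (\1_(Q r)) * (N%:R * `|x - x'| * bn dg u).
move=> r0 Hu; have lu := H1_l2 Hu.
have rN : 0 <= r ^- N by pos.
rewrite /avg -mulrBr -ipBr; try by [exact: l2_Q|exact: l2_shf].
rewrite normrM (ger0_norm rN) -mulrA ler_wpM2l//.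
rewrite (le_trans (ip_cs (l2_Q r) (l2B (l2_shf x lu) (l2_shf x' lu))))//.
rewrite ler_wpM2l ?nrm_ge0//.
have -> : shf x u - shf x' u = shf x' (shf (x - x') u - u).
 apply/funext => z.
 have E : z + x' + (x - x') = z + x by rewrite addrA -[z + x' + x]addrA [x' + x]addrC addrA addrK.
 by rewrite -[LHS]/(u (z + x) - u (z + x')) -E.
by rewrite nrm_shf ?shf_le//; apply: l2B => //; exact: l2_shf.
Qed.

Lemma avg_bound r u x : 0 < r -> l2 u -> `|avg r u x| <= r ^- N * nrm (\1_(Q r)) * nrm u.
move=> r0 lu; have rN : 0 <= r ^- N by pos.
rewrite /avg normrM (ger0_norm rN) -mulrA ler_wpM2l//.
by rewrite (le_trans (ip_cs (l2_Q r) (l2_shf x lu)))// nrm_shf.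
Qed.

Lemma continuous_avg r u : 0 < r -> H1 u -> continuous (avg r u).
move=> r0 Hu x; apply/(@cvgrPdist_le _ _ _ (nbhs x) (nbhs_filter x)) => e e0 /=.
pose C := r ^- N * nrm (\1_(Q r)) * (N%:R * bn dg u).
have C0 : 0 <= C.
 by rewrite !mulr_ge0 ?bn_ge0// invr_ge0 exprn_ge0// ltW.
near=> z; rewrite (le_trans (avg_lip x z r0 Hu))//.
rewrite (_ : _ * _ = C * `|x - z|); last by rewrite /C; ring.
rewrite (le_via (C * (e / (C + 1))))//; last by rewrite absorb// ltW.
rewrite ler_wpM2l//; near: z.
apply: cvgr_dist_le; last by pos.
exact: cvg_id.
Unshelve. all: by end_near.
Qed.

Lemma mfn_avg r u : 0 < r -> H1 u -> mfn (avg r u).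
by move=> r0 Hu; apply: mfn_cont; exact: continuous_avg. Qed.

(** A Poincare inequality on all of space: Cauchy-Schwarz over the cube bounds the square of the
    deviation by a mean of squared translation differences, Tonelli exchanges the integrals, and
    [shf_le] bounds each translation. *)
Lemma avg_diff r u : 0 < r -> H1 u ->
 l2 (u - avg r u) /\ nrm (u - avg r u) <= N%:R * r * bn dg u.
move=> r0 Hu; have lu := H1_l2 Hu; have rN0 : 0 < r ^+ N by pos.
pose K := N%:R * r * bn dg u.
have K0 : 0 <= K by rewrite !mulr_ge0 ?bn_ge0// ltW.
pose G (z : T * T) : R := r ^- N * (\1_(Q r) z.2 * (u z.1 - u (z.2 + z.1)) ^+ 2).
have mQ : measurable_fun setT (\1_(Q r) : T -> R).
 exact: mfn_box.
have madd : measurable_fun setT (fun z : T * T => z.2 + z.1).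
 apply: measurable_fun_rV => i; under eq_fun do rewrite mxE.
 apply: measurable_funD.
  by apply: (measurableT_comp (measurable_coord_rV i)); exact: measurable_snd.
 by apply: (measurableT_comp (measurable_coord_rV i)); exact: measurable_fst.
have mG : measurable_fun setT G.
 apply: measurable_funM => //; apply: measurable_funM.
  by apply: measurableT_comp mQ _; exact: measurable_snd.
 apply: measurable_funX; apply: measurable_funB.
  by apply: measurableT_comp (l2m lu) _; exact: measurable_fst.
 exact: measurableT_comp (l2m lu) madd.
have G0 z : 0 <= G z.
 rewrite mulr_ge0 ?invr_ge0 ?(ltW rN0)// mulr_ge0 ?sqr_ge0// ind_ge0.
pose Gy x : T -> R := fun y => \1_(Q r) y * (u x - u (y + x)).
have lGy x : l2 (Gy x).
 have -> : Gy x = u x *: (\1_(Q r) : T -> R) - (\1_(Q r) * shf x u).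
  by apply/funext => y; rewrite /Gy mulrBr mulrC.
 apply: l2B; first by apply: l2Z; exact: l2_Q.
 have [] // := @l2_bmul 1 (\1_(Q r)) (shf x u) mQ _ (l2_shf x lu).
 by move=> y; rewrite ind_norm ind_le1.
have GE x y : G (x, y) = r ^- N * (Gy x y) ^+ 2 by rewrite /G /Gy exprMn ind_sqr.
have iy x : intg (fun y => G (x, y)).
 rewrite (_ : (fun y => _) = (fun y => r ^- N * (Gy x y) ^+ 2)); last by apply/funext.
 by apply: intgZ; exact: l2i (lGy x).
have i1 : intg (fun y => \1_(Q r) y * \1_(Q r) y : R) by apply: l2_intgM; exact: l2_Q.
have kI : intg (fun y => r ^- N * K ^+ 2 * (\1_(Q r) y * \1_(Q r) y)) by exact: intgZ.
have [] := @tonelli_le G (fun y => r ^- N * K ^+ 2 * (\1_(Q r) y * \1_(Q r) y)) mG G0 iy _ kI.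
 move=> y; have ld : l2 (u - shf y u) by apply: l2B => //; exact: l2_shf.
 have id2 := l2i ld.
 have E : (fun x => G (x, y)) = fun x => (r ^- N * \1_(Q r) y) * ((u - shf y u) x) ^+ 2.
  apply/funext => x; rewrite /G /= -mulrA; congr (_ * (_ * _)).
  by rewrite [y + x]addrC.
 rewrite E; split; first exact: intgZ.
 rewrite IntZ// -nrmE -[\1_(Q r) y * \1_(Q r) y]expr2 ind_sqr mulrAC.
 have [Qy|Qy] := pselect (Q r y); last by rewrite ind0// !mulr0.
 rewrite ind1// !mulr1 ler_wpM2l ?invr_ge0 ?(ltW rN0)// lerXn2r ?nnegrE ?nrm_ge0//.
 rewrite nrmB//; last exact: l2_shf.
 rewrite (le_trans (shf_le y Hu))// ler_wpM2r ?bn_ge0// ler_wpM2l//.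
 apply: norm_le_coord; first exact: ltW.
 by move=> i; have := Qy i; rewrite /= in_itv/= => /andP[y0 yr]; rewrite gtr0_norm.
rewrite IntZ// -/(ip (\1_(Q r)) (\1_(Q r))) ip_Q// mulrAC mulVf ?gt_eqF// mul1r => iG leG.
have mu_avg : mfn (u - avg r u) by apply: measurable_funB; [exact: l2m lu|exact: mfn_avg].
have le x : (u - avg r u) x ^+ 2 <= \I_y(G (x, y)).
 have E : (u - avg r u) x = r ^- N * ip (\1_(Q r)) (Gy x).
  have -> : Gy x = u x *: (\1_(Q r) : T -> R) - (\1_(Q r) * shf x u).
   by apply/funext => y; rewrite /Gy mulrBr mulrC.
  have lQs : l2 (\1_(Q r) * shf x u).
   have [] // := @l2_bmul 1 (\1_(Q r)) (shf x u) mQ _ (l2_shf x lu).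
   by move=> y; rewrite ind_norm ind_le1.
  rewrite ipBr ?ipZr ?ip_Q//; try by [exact: l2_Q|apply: l2Z; exact: l2_Q].
  rewrite mulrBr mulrCA mulVf ?gt_eqF// mulr1; congr (_ - _ * _).
  by apply: Int_eq => y; rewrite -[(_ * shf x u) y]/(\1_(Q r) y * _) mulrA -expr2 ind_sqr.
 rewrite E (_ : (fun y => _) = (fun y => r ^- N * (Gy x y) ^+ 2)); last by apply/funext.
 rewrite IntZ; last exact: l2i (lGy x).
 rewrite -nrmE exprMn expr2 -!mulrA ler_wpM2l ?invr_ge0 ?(ltW rN0)//.
 rewrite mulrC ler_pdivrMr// -nrm_Q2// -exprMn -[leLHS]sqr_norm.
 by rewrite lerXn2r ?nnegrE ?mulr_ge0 ?nrm_ge0// mulrC; apply: ip_cs => //; exact: l2_Q.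
have iu : intg (fun x => (u - avg r u) x ^+ 2).
 apply: (@intg_le _ _ _ mu _ (fun x => \I_y(G (x, y)))) => //.
  exact: measurable_funX.
 by move=> x; rewrite ger0_norm ?sqr_ge0.
split; first by split.
rewrite -(@ler_pXn2r _ 2) ?nnegrE ?nrm_ge0// nrmE.
exact: le_trans (Int_le iu iG le) leG.
Qed.

Lemma wkcvg_avg (u_ : nat -> T -> R) u r x : (forall n, H1 (u_ n)) -> H1 u -> wkcvg u_ u ->
 avg r (u_ n) x ~[n]~> avg r u x.
move=> Hu_ Hu wk; apply: cvgM; first exact: cvg_cst.
have E v : H1 v -> ip (\1_(Q r)) (shf x v) = ip v (shf (- x) (\1_(Q r))).
 by move=> Hv; rewrite ipC ip_shf//; [exact: H1_l2|exact: l2_Q].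
rewrite E// (_ : (fun n => _) = (fun n => ip (u_ n) (shf (- x) (\1_(Q r))))).
 by apply: wkcvg_ip => //; apply: l2_shf; exact: l2_Q.
by apply/funext => n; rewrite E.
Qed.

Lemma avgB r u v x : l2 u -> l2 v -> avg r (u - v) x = avg r u x - avg r v x.
move=> lu lv; rewrite /avg -mulrBr; congr (_ * _).
by rewrite -ipBr//; [exact: l2_shf|exact: l2_shf|exact: l2_Q].
Qed.

(** The deviation from the averages is small with [r], uniformly in [n], by [avg_diff]; for fixed
    [r] the averages tend to zero pointwise by weak convergence and are bounded, so dominated
    convergence applies on the cube. *)
Lemma rellich_cube (u_ : nat -> T -> R) u (M K : R) : (forall n, H1 (u_ n)) -> H1 u ->
 wkcvg u_ u -> (forall n, hn (u_ n) <= M) ->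
 nrm (\1_(cube K) * (u_ n - u)) ~[n]~> 0.
move=> Hu_ Hu wk HM.
pose v n := u_ n - u.
have Hv n : H1 (v n) by exact: H1B.
pose M' := M + hn u.
have hv n : hn (v n) <= M' by rewrite (le_trans (hn_triB (Hu_ n) Hu))// lerD2r.
have M'0 : 0 <= M' by rewrite (le_trans (hn_ge0 _) (hv 0%N)).
have mC := mfn_cube K.
have lC v0 : l2 v0 -> l2 (\1_(cube K) * v0) /\ nrm (\1_(cube K) * v0) <= 1 * nrm v0.
 by move=> lv; apply: l2_bmul => // x; rewrite ind_norm ind_le1.
apply/cvg0P => e e0.
(* This side length makes the contribution of the deviation at most [e / 2]. *)
pose r := e / 2 / (N%:R * M' + 1).
have c0 : 0 < N%:R * M' + 1 by pos.
have r0 : 0 < r by rewrite !divr_gt0.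
have c : \I_x((\1_(cube K) x * avg r (v n) x) ^+ 2) ~[n]~> (0 : R).
 pose B := r ^- N * nrm (\1_(Q r)) * M'.
 have B0 : 0 <= B by rewrite !mulr_ge0 ?nrm_ge0// invr_ge0 exprn_ge0// ltW.
 have [|||||_] := @Int_dct _ _ _ mu (fun n x => (\1_(cube K) x * avg r (v n) x) ^+ 2) (fun=> 0)
   (fun x => B ^+ 2 * (\1_(cube K) x * \1_(cube K) x)).
 - by move=> n; apply: measurable_funX; apply: measurable_funM => //; exact: mfn_avg.
 - exact: measurable_cst.
 - apply: aeW => x.
  have h := @wkcvg_avg u_ u r x Hu_ Hu wk.
  apply: cvg_sqr0; rewrite -[X in _ --> X](mulr0 (\1_(cube K) x)).
  apply: cvgM; first exact: cvg_cst.
  rewrite (_ : (fun n => _) = (fun n => avg r (u_ n) x - avg r u x)); first exact/cvgBP.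
  by apply/funext => n; rewrite avgB//; exact: H1_l2.
 - by apply: intgZ; apply: l2_intgM; exact: l2_cube.
 - move=> n x; rewrite ger0_norm ?sqr_ge0// exprMn -expr2 !ind_sqr mulrC ler_wpM2r//.
  rewrite -[leLHS]sqr_norm lerXn2r//.
  rewrite (le_trans (avg_bound x r0 (H1_l2 (Hv n))))// ler_wpM2l//.
   by rewrite mulr_ge0 ?nrm_ge0// invr_ge0 exprn_ge0// ltW.
  by rewrite (le_trans (nrm_le_hn (Hv n))).
 by rewrite Int0.
have e20 : 0 < e / 2 by pos.
have [n0 Hn0] := cvg0E c (exprn_gt0 2 e20).
exists n0 => n nn0; rewrite ger0_norm ?nrm_ge0// -/(v n).
have [ld nd] := avg_diff r0 (Hv n).
have [l1 n1] := lC _ ld.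
have la : l2 (\1_(cube K) * avg r (v n)).
 have -> : \1_(cube K) * avg r (v n) = \1_(cube K) * v n - \1_(cube K) * (v n - avg r (v n)).
  by rewrite -mulrBr subKr.
 by apply: l2B; have [] := lC _ (H1_l2 (Hv n)).
have -> : \1_(cube K) * v n = \1_(cube K) * (v n - avg r (v n)) + \1_(cube K) * avg r (v n).
 by rewrite -mulrDr subrK.
rewrite (le_trans (nrm_tri l1 la))// (splitr e) lerD//.
 rewrite (le_trans n1)// mul1r (le_trans nd)//.
 rewrite (le_via (N%:R * M' * r))//; last by rewrite /r absorb ?mulr_ge0// ltW.
 by rewrite mulrAC ler_wpM2r ?(ltW r0)// ler_wpM2l// (le_trans (bndg_le_hn (Hv n))).
have := Hn0 n nn0; rewrite -nrmE ger0_norm ?sqr_ge0// ler_pXn2r ?nnegrE ?nrm_ge0//.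
exact: ltW.
Qed.

(** A weight vanishing at infinity replaces the bounded domain: this is where the decay of the
    weight restores compactness. *)
Lemma rellich_decay (u_ : nat -> T -> R) u (M B : R) om :
 (forall n, H1 (u_ n)) -> H1 u -> wkcvg u_ u -> (forall n, hn (u_ n) <= M) ->
 mfn om -> (forall x, `|om x| <= B) ->
 decays om ->
 nrm (om * (u_ n - u)) ~[n]~> 0.
move=> Hu_ Hu wk HM mom omB dec.
have B0 : 0 <= B by exact: le_trans (omB 0).
pose M' := M + hn u.
have hv n : nrm (u_ n - u) <= M'.
 rewrite (le_trans (nrm_le_hn (H1B (Hu_ n) Hu)))//.
 by rewrite (le_trans (hn_triB (Hu_ n) Hu))// lerD2r.
have M'0 : 0 <= M' by rewrite (le_trans (nrm_ge0 _ _) (hv 0%N)).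
apply/cvg0P => e e0; have e20 : 0 < e / 2 by pos.
have [K HK] := dec _ (divr_gt0 e20 (ltr_wpDl M'0 ltr01)).
have [n0 Hn0] := cvg0E (rellich_cube K Hu_ Hu wk HM) (divr_gt0 e20 (ltr_wpDl B0 ltr01)).
exists n0 => n nn0; rewrite ger0_norm ?nrm_ge0//.
have lv := H1_l2 (H1B (Hu_ n) Hu).
have [lw _] := l2_bmul mom omB lv.
have mC := mfn_cube K.
have [lC _] := @l2_bmul 1 _ _ mC (fun x => eq_ind_r (fun z => z <= 1) (ind_le1 (cube K) x) (ind_norm _ x)) lv.
set d := e / 2 / (M' + 1) in HK.
have d0 : 0 <= d by rewrite !divr_ge0 ?(ltW e0)// addr_ge0.
have dM : d * M' <= e / 2 by rewrite /d mulrC absorb// ltW.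
clearbody d.
pose Y := (fun x => `|(B *: (\1_(cube K) * (u_ n - u))) x|) + (fun x => `|(d *: (u_ n - u)) x|).
have lY : l2 Y by apply: l2D; apply: l2_norm; exact: l2Z.
have le x : `|(om * (u_ n - u)) x| <= `|Y x|.
 have nn (c y : R) : 0 <= c -> `|c * y| = c * `|y| by move=> c0; rewrite normrM ger0_norm.
 have -> : Y x = B * (\1_(cube K) x * `|(u_ n - u) x|) + d * `|(u_ n - u) x|.
  transitivity (`|B * (\1_(cube K) x * (u_ n - u) x)| + `|d * (u_ n - u) x|) => //.
  by rewrite nn// nn// nn// ind_ge0.
 rewrite [leRHS]ger0_norm; last by pos.
 have -> : (om * (u_ n - u)) x = om x * (u_ n - u) x by [].
 rewrite normrM mulrA -mulrDl ler_wpM2r//.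
 have [xK|xK] := leP `|x| K.
  by rewrite ind1 ?mulr1 ?(le_trans (omB x)) ?lerDl; move: (in_cube xK); rewrite inE.
 by rewrite (le_trans (HK x xK))// lerDr mulr_ge0.
rewrite (le_trans (nrm_le lw lY le))//.
rewrite (le_trans (nrm_tri (l2_norm (l2Z _ lC)) (l2_norm (l2Z _ lv))))//.
rewrite !nrm_norm !nrmZ// !ger0_norm// (splitr e) lerD//.
 have := Hn0 n nn0; rewrite ger0_norm ?nrm_ge0// => h.
 by rewrite (le_trans (ler_wpM2l B0 h))// absorb// ltW.
by rewrite (le_trans (ler_wpM2l d0 (hv n))).
Qed.

(** Against a fixed square integrable [z] local compactness is enough, since [z] is close to a test
    function. *)
Lemma rellich_l2 (u_ : nat -> T -> R) u (M : R) z :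
 (forall n, H1 (u_ n)) -> H1 u -> wkcvg u_ u -> (forall n, hn (u_ n) <= M) -> l2 z ->
 \I_x(`|u_ n x - u x| * `|z x|) ~[n]~> 0.
move=> Hu_ Hu wk HM lz.
have lz' := l2_norm lz.
pose M' := M + hn u.
have hv n : nrm (u_ n - u) <= M'.
 rewrite (le_trans (nrm_le_hn (H1B (Hu_ n) Hu)))//.
 by rewrite (le_trans (hn_triB (Hu_ n) Hu))// lerD2r.
have M'0 : 0 <= M' by rewrite (le_trans (nrm_ge0 _ _) (hv 0%N)).
apply/cvg0P => e e0; have e20 : 0 < e / 2 by pos.
have [phi tp np] := test_dense lz (divr_gt0 e20 (ltr_wpDl M'0 ltr01)).
have [K K0 sK] := test_supp tp.
have lp := test_l2 tp.
have [n0 Hn0] := cvg0E (rellich_cube K Hu_ Hu wk HM) (divr_gt0 e20 (ltr_wpDl (nrm_ge0 mu phi) ltr01)).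
exists n0 => n nn0.
have lv := H1_l2 (H1B (Hu_ n) Hu).
have mC := mfn_cube K.
have [lC _] := @l2_bmul 1 _ _ mC (fun x => eq_ind_r (fun z => z <= 1) (ind_le1 (cube K) x) (ind_norm _ x)) lv.
rewrite ger0_norm; last by apply: Int_ge0 => x; exact: mulr_ge0.
have lzp := l2B lz lp.
have i1 := l2_intgM (l2_norm lv) (l2_norm lzp).
have i2 := l2_intgM (l2_norm lC) (l2_norm lp).
rewrite (le_via (\I_x(`|(u_ n - u) x| * `|(z - phi) x| +
  `|(\1_(cube K) * (u_ n - u)) x| * `|phi x|)))//.
 apply: Int_le; [exact: l2_intgM (l2_norm lv) lz'|exact: intgD|move=> x].
 have -> : (\1_(cube K) * (u_ n - u)) x = \1_(cube K) x * (u_ n - u) x by [].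
 rewrite -[u_ n x - u x]/((u_ n - u) x) normrM ind_norm.
 have [xK|xK] := boolP (phi x == 0).
  have -> : (z - phi) x = z x by rewrite -[LHS]/(z x - phi x) (eqP xK) subr0.
  by rewrite lerDl !mulr_ge0.
 rewrite ind1 ?mul1r; last by move: (in_cube (sK _ xK)); rewrite inE.
 rewrite -mulrDr ler_wpM2l//.
 have -> : z x = (z - phi) x + phi x by rewrite -[(z - phi) x]/(z x - phi x) subrK.
 exact: ler_normD.
rewrite IntD// (splitr e) lerD//.
 rewrite (le_trans (Int_norm_cs lv lzp))// (le_trans (ler_pM (nrm_ge0 _ _) (nrm_ge0 _ _) (hv n) np))//.
 by rewrite absorb// ltW.
rewrite (le_trans (Int_norm_cs lC lp))//.
have := Hn0 n nn0; rewrite ger0_norm ?nrm_ge0// => h.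
by rewrite (le_trans (ler_wpM2r (nrm_ge0 _ _) h))// mulrC absorb// ltW.
Qed.

End averages.

(** * Polygonal paths *)

Section polygons.
Implicit Types (p q : T -> R) (g : nat -> T -> R).

Definition seg p q (t : R) : T -> R := p + t *: (q - p).

Lemma H1_seg p q t : H1 p -> H1 q -> H1 (seg p q t).
by move=> Hp Hq; apply: H1D => //; apply: H1Z; exact: H1B. Qed.

Lemma seg0 p q : seg p q 0 = p. by rewrite /seg scale0r addr0. Qed.
Lemma seg1 p q : seg p q 1 = q. by rewrite /seg scale1r addrC subrK. Qed.

Lemma seg_seg p q s s' t : seg (seg p q s) (seg p q s') t = seg p q (s + t * (s' - s)).
apply/funext => x.
rewrite /seg; fring.
Qed.

Lemma segB p q s t : seg p q s - seg p q t = (s - t) *: (q - p).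
apply/funext => x.
rewrite /seg; fring.
Qed.

(** Vertex [i] of the polygon [g] after each edge is cut into [m] equal pieces: quotient and
    remainder of [i] by [m] give the edge and the position on it. *)
Definition sub g (m i : nat) : T -> R :=
 seg (g (i %/ m)%N) (g (i %/ m).+1%N) ((i %% m)%N%:R / m%:R).

Lemma subS g m i : (0 < m)%N ->
 sub g m i.+1 = seg (g (i %/ m)%N) (g (i %/ m).+1%N) ((i %% m).+1%N%:R / m%:R).
move=> m0; rewrite /sub.
have [jm|jm] := ltnP (i %% m).+1 m.
 have -> : (i.+1 %/ m = i %/ m)%N.
  by rewrite {1}(divn_eq i m) -addnS divnMDl// (divn_small jm) addn0.
 have -> // : (i.+1 %% m = (i %% m).+1)%N.
 by rewrite {1}(divn_eq i m) -addnS modnMDl modn_small.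
have E : ((i %% m).+1 = m)%N by apply/eqP; rewrite eqn_leq jm ltn_mod m0.
have iE : (i.+1 = (i %/ m).+1 * m)%N by rewrite {1}(divn_eq i m) -addnS E mulSn addnC.
rewrite E divff ?pnatr_eq0 -?lt0n// seg1 {1 2 3}iE mulnK// modnMl mul0r seg0//.
Qed.

Lemma sub_edge g m i t : (0 < m)%N ->
 seg (sub g m i) (sub g m i.+1) t =
 seg (g (i %/ m)%N) (g (i %/ m).+1%N) (((i %% m)%N%:R + t) / m%:R).
move=> m0; rewrite subS// {1}/sub seg_seg; congr seg.
have m0' : m%:R != 0 :> R by rewrite pnatr_eq0 -lt0n.
by rewrite -natr1; field.
Qed.

(** With polygons instead of continuous paths a deformation moves finitely many vertices. The
    refinement runs along the old path, so bounds on the energy are kept, and its edges are short,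
    so vertices control edges. *)
Lemma fine_polygon n g (e : R) : (forall i, H1 (g i)) -> 0 < e ->
 exists (n' : nat) (g' : nat -> T -> R), [/\ forall i, H1 (g' i), g' 0 = g 0, g' n' = g n,
  forall i t, (i < n')%N -> 0 <= t <= 1 -> exists k s, [/\ (k < n)%N, 0 <= s <= 1 &
   seg (g' i) (g' i.+1) t = seg (g k) (g k.+1) s] &
  forall i t, (i < n')%N -> 0 <= t <= 1 -> hn (seg (g' i) (g' i.+1) t - g' i) <= e /\
   hn (seg (g' i) (g' i.+1) t - g' i.+1) <= e].
move=> Hg e0; pose D := \sum_(k < n) hn (g k.+1 - g k).
have D0 : 0 <= D by apply: sumr_ge0 => k _; exact: hn_ge0.
(* [D] is the total length and dominates every edge, so that all new edges have length at most
   [D / m <= e]. *)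
pose m := (Num.truncn (D / e)).+1.
have m0 : (0 < m)%N by [].
have mR : 0 < m%:R :> R by pos.
have De : D / m%:R <= e.
 by rewrite ler_pdivrMr// mulrC -ler_pdivrMr// ltW// truncnS_gt.
have Hs i : H1 (sub g m i) by exact: H1_seg.
have st i (t : R) : 0 <= t <= 1 -> 0 <= ((i %% m)%N%:R + t) / m%:R <= 1.
 move=> /andP[t0 t1]; rewrite divr_ge0 ?addr_ge0//= ler_pdivrMr// mul1r.
 rewrite (le_via (i %% m).+1%N%:R)// ?ler_nat ?ltn_mod//.
 by rewrite -natr1 lerD2l.
exists (n * m)%N, (sub g m); split=> //.
- by rewrite /sub div0n mod0n mul0r seg0.
- by rewrite /sub mulnK// modnMl mul0r seg0.
- move=> i t iN t01; exists (i %/ m)%N, (((i %% m)%N%:R + t) / m%:R); split.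
 + by rewrite ltn_divLR.
 + exact: st.
 + exact: sub_edge.
move=> i t iN /andP[t0 t1]; rewrite sub_edge//.
have kn : (i %/ m < n)%N by rewrite ltn_divLR.
have hk : hn (g (i %/ m).+1%N - g (i %/ m)%N) <= D.
 rewrite /D (bigD1 (Ordinal kn))//= lerDl sumr_ge0// => k _; exact: hn_ge0.
have key (z : R) : `|z| <= 1 -> `|z / m%:R| * hn (g (i %/ m).+1%N - g (i %/ m)%N) <= e.
 have mi : 0 < m%:R^-1 :> R by pos.
 move=> z1; rewrite (le_trans _ De)// normrM (gtr0_norm mi) mulrAC ler_wpM2r//.
 rewrite (le_trans _ hk)// ler_piMl//.
split.
 rewrite /sub segB hnZ; last exact: H1B.
 rewrite -mulrBl (addrC _ t) addrK key// ger0_norm//.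
rewrite subS// segB hnZ; last exact: H1B.
rewrite -mulrBl key// -natr1 opprD addrACA subrr add0r distrC ger0_norm ?subr_ge0//.
by rewrite gerBl.
Qed.

End polygons.

Lemma intg_bmul (c g : T -> R) (B : R) : mfn c -> (forall x, `|c x| <= B) -> intg g ->
 intg (fun x => c x * g x) /\ `|\I_x(c x * g x)| <= B * \I_x(`|g x|).
move=> mc cB ig; have ign := intg_norm ig.
have mcg : mfn (fun x => c x * g x) by apply: measurable_funM => //; exact: intg_m ig.
have le x : `|c x * g x| <= B * `|g x| by rewrite normrM ler_wpM2r.
split; first exact: (@intg_le _ _ _ mu _ _ mcg (intgZ B ign) le).
by rewrite -IntZ//; exact: Int_norm_le mcg (intgZ B ign) le.
Qed.

(** * One-variable calculus: positive part and a C^1 step *)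

Section derivatives.

Lemma is_derive_quad (f : R -> R) (t L C : R) :
 (forall h, `|f (t + h) - f t - h * L| <= C * h ^+ 2) -> is_derive t 1 f L.
move=> H; have C0 : 0 <= C by have := H 1; rewrite expr1n mulr1; exact: le_trans.
have cv : (fun h => h^-1 *: ((f \o shift t) (h *: 1) - f t)) @ 0^' --> L.
 apply/cvgrPdist_le => e e0; near=> h.
 have h0 : h != 0 by near: h; exact: nbhs_dnbhs_neq.
 have -> : L - h^-1 *: ((f \o shift t) (h *: 1) - f t) = - (h^-1 * (f (t + h) - f t - h * L)).
  rewrite /= [h *: 1]mulr1 [h + t]addrC.
  have E (a b k : R) : k != 0 -> L - k^-1 * (a - b) = - (k^-1 * (a - b - k * L)).
   by move=> k0; field.
  exact: E.
 rewrite normrN normrM normfV ler_pdivrMl ?normr_gt0// (le_trans (H h))//.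
 rewrite -[h ^+ 2]sqr_norm expr2 mulrCA ler_wpM2l//.
 rewrite (le_via ((C + 1) * `|h|))//; first by rewrite ler_wpM2r// lerDl.
 rewrite mulrC -ler_pdivlMr ?ltr_wpDl//.
 near: h; apply: dnbhs0_le; by pos.
by split; [exact/cvgP/cv|exact/cvg_lim/cv].
Unshelve. all: by end_near. Qed.

Lemma powR_le (a b r : R) : 0 <= r -> 0 <= a -> a <= b -> a `^ r <= b `^ r.
by move=> r0 a0 ab; apply: ge0_ler_powR => //; rewrite nnegrE// (le_trans a0). Qed.

Definition pp (s : R) : R := (s + `|s|) / 2.

Lemma pp_pos s : 0 <= s -> pp s = s. by move=> s0; rewrite /pp ger0_norm//; field. Qed.
Lemma pp_neg s : s <= 0 -> pp s = 0. by move=> s0; rewrite /pp ler0_norm// subrr mul0r. Qed.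

Lemma is_derive_pp2 (t : R) : is_derive t 1 (fun s => pp s ^+ 2) (2 * pp t).
apply: (@is_derive_quad _ _ _ 1) => h; rewrite mul1r.
have [t0|t0] := leP 0 t; have [th|th] := leP 0 (t + h).
- by rewrite !pp_pos// ler_norml; apply/andP; split; nra.
- by rewrite (pp_pos t0) (pp_neg (ltW th)) ler_norml; apply/andP; split; nra.
- by rewrite (pp_pos th) (pp_neg (ltW t0)) ler_norml; apply/andP; split; nra.
- have z2 : (0 : R) ^+ 2 = 0 by rewrite expr0n.
 by rewrite (pp_neg (ltW th)) (pp_neg (ltW t0)) z2 !mulr0 !subr0 normr0 sqr_ge0.
Qed.

Lemma continuous_pp : continuous pp.
move=> s; rewrite /continuous_at /pp; apply: cvgM; last exact: cvg_cst.
by apply: cvgD; [exact: cvg_id|exact: norm_continuous].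
Qed.

(** A [C^1] function of [t ^ 2], with second derivative [1] in that variable on [(1, 5/2)], [- 1] on
    [(5/2, 4)] and [0] elsewhere: it rises from [0] for [|t| <= 1] to [9 / 4] for [|t| >= 2], with
    slope at most [6] in [t]. *)
Definition step (t : R) : R :=
 2^-1 * pp (t ^+ 2 - 1) ^+ 2 - pp (t ^+ 2 - 5 / 2) ^+ 2 + 2^-1 * pp (t ^+ 2 - 4) ^+ 2.
Definition dstep (t : R) : R :=
 2 * t * (pp (t ^+ 2 - 1) - 2 * pp (t ^+ 2 - 5 / 2) + pp (t ^+ 2 - 4)).

Lemma is_derive_step (t : R) : is_derive t 1 step (dstep t).
have d0 (a : R) : is_derive t 1 (fun s : R => pp (s ^+ 2 - a) ^+ 2) (2 * pp (t ^+ 2 - a) * (2 * t)).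
 apply: (@is_derive1_comp _ (fun s => pp s ^+ 2) (fun s => s ^+ 2 - a)).
  exact: is_derive_pp2.
 have h : is_derive t 1 (fun s : R => s ^+ 2 - a) (2 * t) by apply: (@is_derive_quad _ _ _ 1) => h; rewrite mul1r (_ : _ - _ = h ^+ 2) ?ger0_norm ?sqr_ge0//; ring.
 exact: h.
have h1 := is_deriveZ (2^-1 : R) (d0 1); have h3 := is_deriveZ (2^-1 : R) (d0 4).
have h := is_deriveD (is_deriveB h1 (d0 (5 / 2))) h3.
apply: (is_derive_eq h); rewrite /GRing.scale /= /dstep; by field.
Qed.

Lemma step_low t : t ^+ 2 <= 1 -> step t = 0 /\ dstep t = 0.
by move=> h; rewrite /step /dstep !pp_neg//; move: h; lra.
Qed.

Lemma step_high t : 4 <= t ^+ 2 -> step t = 9 / 4 /\ dstep t = 0.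
by move=> h; rewrite /step /dstep !pp_pos; try (split; field); lra.
Qed.

Lemma step_bd t : 0 <= step t <= 9 / 4.
have [h1|h1] := leP (t ^+ 2) 1; first by rewrite (step_low h1).1 lexx /= divr_ge0.
have [h4|h4] := leP 4 (t ^+ 2); first by rewrite (step_high h4).1 lexx /= divr_ge0.
rewrite /step (@pp_pos (t ^+ 2 - 1)) ?subr_ge0 ?(ltW h1)//.
rewrite (@pp_neg (t ^+ 2 - 4)) ?subr_le0 ?(ltW h4)//.
move: h1 h4; set s := t ^+ 2 => h1 h4.
have [h5|h5] := leP (s - 5 / 2) 0; last rewrite (pp_pos (ltW h5)).
 by rewrite (pp_neg h5); apply/andP; split; nra.
by apply/andP; split; nra.
Qed.

Lemma dstep_bd t : `|dstep t| <= 6.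
have [h1|h1] := leP (t ^+ 2) 1; first by rewrite (step_low h1).2 normr0.
have [h4|h4] := leP 4 (t ^+ 2); first by rewrite (step_high h4).2 normr0.
have t2 : `|t| <= 2.
 by rewrite -(@ler_pXn2r _ 2) ?nnegrE// sqr_norm; lra.
rewrite /dstep (@pp_pos (t ^+ 2 - 1)) ?subr_ge0 ?(ltW h1)//.
rewrite (@pp_neg (t ^+ 2 - 4)) ?subr_le0 ?(ltW h4)//.
move: h1 h4; set s := t ^+ 2 => h1 h4.
rewrite !normrM [`|2|]ger0_norm//.
have h : `|s - 1 - 2 * pp (s - 5 / 2) + 0| <= 3 / 2.
 have [h5|h5] := leP (s - 5 / 2) 0; last rewrite (pp_pos (ltW h5)).
  by rewrite (pp_neg h5) ler_norml; apply/andP; split; lra.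
 by rewrite ler_norml; apply/andP; split; lra.
rewrite (le_via (2 * 2 * (3 / 2)))//; last by lra.
by rewrite ler_pM// ler_wpM2l.
Qed.

Lemma continuous_dstep : continuous dstep.
have csq (a : R) : continuous (fun t : R => pp (t ^+ 2 - a)).
 move=> t; apply: (@continuous_comp _ _ _ (fun t : R => t ^+ 2 - a) pp); last exact: continuous_pp.
 by apply: cvgB; [exact: exprn_continuous|exact: cvg_cst].
move=> t; rewrite /continuous_at /dstep; apply: cvgM.
 by apply: cvgM; [exact: cvg_cst|exact: cvg_id].
apply: cvgD; last exact: csq.
apply: cvgB; first exact: csq.
by apply: cvgM; [exact: cvg_cst|exact: csq].
Qed.

End derivatives.

(** The multipliers [Phi] for which [Phi * u] remains differentiable in direction [i]; boundedness
    is global, continuity of the derivative is replaced by measurability. *)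
Definition c1b (i : 'I_N) Phi :=
 [/\ mfn Phi, mfn (partial i Phi), forall x, derivable Phi x (ee i) &
  exists K : R, forall x, `|Phi x| <= K /\ `|partial i Phi x| <= K].

(** * Products and integration by parts through difference quotients *)

Section quotients.
Implicit Types (h : T -> R) (i j : 'I_N).

Definition dq i (t : R) u : T -> R := t^-1 *: (shf (t *: ee i) u - u).

Definition null (t_ : nat -> R) := t_ n ~[n]~> (0 : R) /\ forall n, t_ n != 0.

Lemma nrm_cvg0 (f_ : nat -> T -> R) : \I_x(f_ n x ^+ 2) ~[n]~> (0 : R) ->
 nrm (f_ n) ~[n]~> (0 : R).
move=> H; apply/cvg0P => e e0.
have [n0 Hn0] := cvg0E H (exprn_gt0 2 e0).
exists n0 => n /Hn0; rewrite -nrmE ger0_norm ?sqr_ge0// => ?.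
by rewrite ger0_norm ?nrm_ge0// -ler_sqr// ?nnegrE ?nrm_ge0// ltW.
Qed.

Lemma ip_cvg2 (a_ b_ : nat -> T -> R) u v : (forall n, l2 (a_ n)) -> (forall n, l2 (b_ n)) ->
 l2 u -> l2 v -> nrm (a_ n - u) ~[n]~> (0 : R) ->
 nrm (b_ n - v) ~[n]~> (0 : R) -> ip (a_ n) (b_ n) ~[n]~> ip u v.
move=> la lb lu lv au bv; apply/cvgBP.
pose r n := nrm (a_ n - u) * nrm v + (nrm (a_ n - u) * nrm (b_ n - v) + nrm u * nrm (b_ n - v)).
apply: (@cvg0_le _ _ r).
 move=> n; have la' := l2B (la n) lu; have lb' := l2B (lb n) lv.
 have -> : ip (a_ n) (b_ n) - ip u v =
   ip (a_ n - u) v + (ip (a_ n - u) (b_ n - v) + ip u (b_ n - v)).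
  rewrite !ipBl ?ipBr//; ring.
 apply: (le_trans (ler_normD _ _)); apply: lerD; first exact: ip_cs.
 by apply: (le_trans (ler_normD _ _)); apply: lerD; exact: ip_cs.
rewrite [X in _ --> X](_ : 0 = 0 * nrm v + (0 * 0 + nrm u * 0) :> R); last by rewrite !mul0r mulr0 !addr0.
by apply: cvgD; [apply: cvgMl|apply: cvgD; [exact: cvgM|exact: cvgMr]].
Qed.

Lemma l2_dq i (t : R) u : l2 u -> l2 (dq i t u).
by move=> lu; apply: l2Z; apply: l2B => //; exact: l2_shf. Qed.

Lemma dq_cvg i u g t_ : l2 u -> l2 g -> has_dq i u g -> null t_ ->
 nrm (dq i (t_ n) u - g) ~[n]~> (0 : R).
move=> lu lg Hd [t0 tn]; apply/cvg0P => e e0.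
have [d d0 H] := Hd e e0; have [n0 Hn0] := cvg0E t0 d0.
exists n0 => n /Hn0/H; have := tn n; move: (t_ n) => t tne Ht.
have -> : dq i t u - g = t^-1 *: (shf (t *: ee i) u - u - t *: g).
 apply/funext => x.
 have E (a b c : R) : t^-1 * (a - b) - c = t^-1 * (a - b - t * c) by field.
 exact: E.
rewrite ger0_norm ?nrm_ge0// nrmZ; last by do 2?[apply: l2B]; [exact: l2_shf|by []|exact: l2Z].
by rewrite normfV mulrC ler_pdivrMr ?normr_gt0.
Qed.

Lemma cvg_dq i u g : l2 u -> l2 g ->
 (forall t_, null t_ -> nrm (dq i (t_ n) u - g) ~[n]~> (0 : R)) ->
 has_dq i u g.
move=> lu lg H e e0; apply: contrapT => nH.
have bad n : exists t : R, `|t| <= n.+1%:R^-1 /\ e * `|t| < nrm (shf (t *: ee i) u - u - t *: g).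
 apply: contrapT => nb; apply: nH; exists n.+1%:R^-1; first by pos.
 move=> s sn; rewrite leNgt; apply/negP => lt; apply: nb; by exists s.
have [t_ Ht] := choice bad.
have tn n : t_ n != 0.
 apply/eqP => E; have [_] := Ht n.
 rewrite E normr0 mulr0 scale0r shf0 subrr scale0r subr0 nrm0 ltxx//.
have nt : null t_.
 split => //; apply: (@cvg0_le _ _ (fun n => n.+1%:R^-1)); last exact: cvg_harmonic.
 by move=> n; have [] := Ht n.
have [n0 Hn0] := cvg0E (H _ nt) e0.
have := Hn0 n0 (leqnn _); have [_] := Ht n0; have := tn n0; move: (t_ n0) => t tne.
have -> : shf (t *: ee i) u - u - t *: g = t *: (dq i t u - g).
 apply/funext => x.
 have E (a b c : R) : a - b - t * c = t * (t^-1 * (a - b) - c) by field.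
 exact: E.
rewrite nrmZ; last by apply: l2B => //; exact: l2_dq.
rewrite [e * _]mulrC ltr_pM2l ?normr_gt0// [`|nrm _|]ger0_norm ?nrm_ge0//.
by move=> lt /(lt_le_trans lt); rewrite ltxx.
Qed.

Lemma dqE i (t : R) u x : dq i t u x = t^-1 * (u (x + t *: ee i) - u x).
by []. Qed.

Lemma dq_ptw i Phi x t_ : derivable Phi x (ee i) -> null t_ ->
 dq i (t_ n) Phi x ~[n]~> partial i Phi x.
move=> dP [t0 tn].
have /cvgr_dnbhsP H : (fun h : R => h^-1 *: ((Phi \o shift x) (h *: ee i) - Phi x)) @ 0^' --> partial i Phi x by exact: dP.
have := H t_ (conj tn t0).
by under eq_fun do rewrite /= [_ *: ee i + _]addrC.
Qed.

Lemma dq_bounded i Phi (K t : R) x : (forall x, derivable Phi x (ee i)) ->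
 (forall x, `|partial i Phi x| <= K) -> t != 0 -> `|dq i t Phi x| <= K.
move=> dP KP t0; have [th _ E] := partial_mvt x t dP.
by rewrite dqE E mulKf.
Qed.

Lemma mfn_dq i (t : R) Phi : mfn Phi -> mfn (dq i t Phi).
move=> mP; have m2 := measurable_funB (mfn_shf (t *: ee i) mP) mP.
exact: (measurable_funM (measurable_cst t^-1) m2).
Qed.

Lemma c1b_dq i Phi w t_ : c1b i Phi -> l2 w -> null t_ ->
 nrm ((dq i (t_ n) Phi - partial i Phi) * w) ~[n]~> (0 : R).
move=> [mP mdP dP [K HK]] lw nt; apply: nrm_cvg0.
have mq n : mfn (dq i (t_ n) Phi - partial i Phi) by apply: measurable_funB => //; exact: mfn_dq.
have [|||||_] := @Int_dct _ _ _ mu (fun n x => ((dq i (t_ n) Phi - partial i Phi) x * w x) ^+ 2)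
 (cst 0) (fun x => (K + K) ^+ 2 * w x ^+ 2).
- move=> n; apply: (measurable_funX 2); exact: measurable_funM (mq n) (l2m lw).
- exact: measurable_cst.
- apply: aeW => x; apply: cvg_sqr0.
 rewrite -[X in _ --> X](mul0r (w x)); apply: cvgMl.
 by apply/(@cvgBP _ (fun n => dq i (t_ n) Phi x)); exact: dq_ptw.
- apply: intgZ; exact: l2i.
- move=> n x; rewrite ger0_norm ?sqr_ge0// exprMn ler_wpM2r ?sqr_ge0//.
 rewrite -[leLHS]sqr_norm ler_sqr//; last first.
  by have [_ /(le_trans (normr_ge0 _)) K0] := HK 0; rewrite nnegrE addr_ge0.
 apply: (le_trans (ler_normB _ _)); apply: lerD; last by have [] := HK x.
 apply: dq_bounded => //; last by have [] := nt.
 by move=> y; have [] := HK y.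
have -> : Int (cst 0) = 0 by exact: Int0.
by [].
Qed.

Lemma c1b_l2 i Phi w : c1b i Phi -> l2 w -> l2 (Phi * w) /\ l2 (partial i Phi * w).
move=> [mP mdP dP [K HK]] lw; split.
 by have [] := l2_bmul mP (fun x => (HK x).1) lw.
by have [] := l2_bmul mdP (fun x => (HK x).2) lw.
Qed.

Lemma sob_mul Phi u (g : 'I_N -> T -> R) : l2 (Phi * u) -> (forall i, c1b i Phi) -> sob u g ->
 sob (Phi * u) (fun i => Phi * g i + partial i Phi * u).
move=> lPu cP su; have lu := sob_l2 su.
have lD i : l2 (Phi * g i + partial i Phi * u).
 apply: l2D; first by have [] := c1b_l2 (cP i) (sob_grad i su).
 by have [] := c1b_l2 (cP i) lu.
apply: dq_sob => // i; apply: cvg_dq => // t_ nt.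
have lg := sob_grad i su; have [mP mdP dP [K HK]] := cP i.
pose r n := K * nrm (dq i (t_ n) u - g i) + (K * nrm (g i) * `|t_ n| +
  nrm ((dq i (t_ n) Phi - partial i Phi) * u)).
apply: (@cvg0_le _ _ r); last first.
 have -> : 0 = K * 0 + (K * nrm (g i) * `|0 : R| + 0) :> R by rewrite normr0 !mulr0 !addr0.
 apply: cvgD; first by apply: cvgMr; apply: dq_cvg => //; exact: sob_dq.
 apply: cvgD; last exact: c1b_dq.
 by apply: cvgMr; apply: cvg_norm; have [] := nt.
move=> n; rewrite ger0_norm ?nrm_ge0//; have tn := nt.2 n; rewrite /r; move: (t_ n) tn => t tn.
(* Discrete Leibniz rule with [Phi] translated; what is left is the error of the quotient of [u], a
   term of size [t], and the error of the quotient of [Phi]. *)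
have -> : dq i t (Phi * u) - (Phi * g i + partial i Phi * u) =
 shf (t *: ee i) Phi * (dq i t u - g i) + ((t *: dq i t Phi) * g i + (dq i t Phi - partial i Phi) * u).
 apply/funext => x.
 have E (a b c d p q : R) : t^-1 * (a * b - c * d) - (c * p + q * d) =
  a * (t^-1 * (b - d) - p) + ((t * (t^-1 * (a - c))) * p + (t^-1 * (a - c) - q) * d) by field.
 exact: E.
have lq : l2 (dq i t u - g i) by apply: l2B => //; exact: l2_dq.
have [l1 n1] := l2_bmul (mfn_shf (t *: ee i) mP) (fun x => (HK _).1) lq.
have HKd x := @dq_bounded i Phi K t x dP (fun y => (HK y).2) tn.
have mq := mfn_dq i t mP.
have HKt x : `|(t *: dq i t Phi) x| <= K * `|t|.
 by rewrite [X in `|X|](_ : _ = t * dq i t Phi x)// normrM mulrC ler_wpM2r.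
have mt : mfn (t *: dq i t Phi) by exact: (measurable_funM (measurable_cst t) mq).
have [l3 n3] := l2_bmul mt HKt lg.
have HKu x : `|(dq i t Phi - partial i Phi) x| <= K + K.
 by apply: (le_trans (ler_normB _ _)); apply: lerD; have [] := HK x.
have [l4 _] := l2_bmul (measurable_funB mq mdP) HKu lu.
apply: (le_trans (nrm_tri l1 (l2D l3 l4))); apply: lerD => //.
apply: (le_trans (nrm_tri l3 l4)); apply: lerD => //.
by apply: (le_trans n3); rewrite mulrAC.
Qed.

(* The symmetric difference makes the quadratic remainder vanish identically. *)
Lemma ibp_sym i Phi u t_ : c1b i Phi -> l2 u -> null t_ ->
 ip (Phi * u) (dq i (t_ n) u + dq i (- t_ n) u) ~[n]~> - ip (partial i Phi * u) u.
move=> cP lu nt; have [l1 l3] := c1b_l2 cP lu; have [mP mdP dP [K HK]] := cP.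
have lq n : l2 (dq i (t_ n) Phi * u).
 have HKd x := @dq_bounded i Phi K (t_ n) x dP (fun y => (HK y).2) (nt.2 n).
 by have [] := l2_bmul (mfn_dq i (t_ n) mP) HKd lu.
have E n : ip (Phi * u) (dq i (t_ n) u + dq i (- t_ n) u) =
  - ip (dq i (t_ n) Phi * u) (shf (t_ n *: ee i) u).
 have := nt.2 n; have := lq n; move: (t_ n) => t lqt tn.
 have lut := @l2_shf (t *: ee i) _ lu; have lum := @l2_shf (- t *: ee i) _ lu.
 have -> : dq i t u + dq i (- t) u = t^-1 *: (shf (t *: ee i) u - shf (- t *: ee i) u).
  apply/funext => x.
  have E (a b c : R) : t^-1 * (a - b) + (- t)^-1 * (c - b) = t^-1 * (a - c) by field.
  exact: E.
 rewrite ipZr//; last exact: l2B.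
 rewrite ipBr// -[X in _ - X]ip_tr//.
 have lP := @l2_shf (t *: ee i) _ l1.
 have -> : dq i t Phi * u = t^-1 *: (shf (t *: ee i) Phi * u - Phi * u).
  apply/funext => x.
  rewrite /dq; fring.
 have l5 : l2 (shf (t *: ee i) Phi * u).
  by have [] := l2_bmul (mfn_shf (t *: ee i) mP) (fun x => (HK _).1) lu.
 rewrite ipZ//; last exact: l2B.
 rewrite ipBl//.
 have -> : ip (shf (t *: ee i) (Phi * u)) u = ip (shf (t *: ee i) Phi * u) (shf (t *: ee i) u).
  apply: Int_eq => x; rewrite /shf; fring.
 ring.
under eq_fun do rewrite E.
apply: cvgN; apply: ip_cvg2 => //.
- by move=> n; exact: l2_shf.
- have := c1b_dq cP lu nt.
 by under eq_fun do rewrite mulrBl.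
- apply/cvg0P => e e0; have [d d0 H] := l2_shift_continuous i lu e0.
 have [n0 Hn0] := cvg0E nt.1 d0.
 by exists n0 => n /Hn0/H; rewrite ger0_norm ?nrm_ge0.
Qed.

Lemma null_harmonic : null (fun n => n.+1%:R^-1).
by split; [exact: cvg_harmonic|move=> n; rewrite invr_neq0]. Qed.

Lemma nullN t_ : null t_ -> null (fun n => - t_ n).
move=> [t0 tn]; split; last by move=> n; rewrite oppr_eq0.
by rewrite -oppr0; exact: cvgN.
Qed.

Lemma dqs_cvg i u (g : 'I_N -> T -> R) t_ : sob u g -> null t_ ->
 nrm (dq i (t_ n) u + dq i (- t_ n) u - (g i + g i)) ~[n]~> (0 : R).
move=> su nt; have lu := sob_l2 su; have lg := sob_grad i su.
pose r n := nrm (dq i (t_ n) u - g i) + nrm (dq i (- t_ n) u - g i).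
apply: (@cvg0_le _ _ r); last first.
 rewrite -[X in _ --> X](addr0 0); apply: cvgD; first by apply: dq_cvg => //; exact: sob_dq.
 by apply: (@dq_cvg _ _ _ (fun n => - t_ n)) => //; [exact: sob_dq|exact: nullN].
move=> n; rewrite ger0_norm ?nrm_ge0// /r opprD addrACA.
by apply: nrm_tri; apply: l2B => //; exact: l2_dq.
Qed.

(** The symmetric quotients tend strongly to [g i + g i], while [ibp_sym] gives their limit against
    [Phi * u]; uniqueness of limits is the identity. *)
Lemma ibp i Phi u (g : 'I_N -> T -> R) : c1b i Phi -> sob u g ->
 2 * ip (Phi * u) (g i) = - ip (partial i Phi * u) u.
move=> cP su; have lu := sob_l2 su; have lg := sob_grad i su.
have [l1 l3] := c1b_l2 cP lu.
have C1 := ibp_sym cP lu null_harmonic.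
have lD n : l2 (dq i n.+1%:R^-1 u + dq i (- n.+1%:R^-1) u) by apply: l2D; exact: l2_dq.
have := ip_cvg lD (l2D lg lg) l1 (dqs_cvg i su null_harmonic).
under eq_fun do rewrite ipC.
rewrite ipC ipDr// => C2.
by rewrite (cvg_unique _ C1 C2)// mulr_natl mulr2n.
Qed.

Lemma Int_wcvg (om_ : nat -> T -> R) om h (K : R) : (forall n, mfn (om_ n)) -> mfn om ->
 (forall n x, `|om_ n x| <= K) -> (forall x, om_ n x ~[n]~> om x) ->
 intg h -> \I_x(om_ n x * h x) ~[n]~> \I_x(om x * h x).
move=> mo mo' HK cv ih.
have [|||||_] := @Int_dct _ _ _ mu (fun n x => om_ n x * h x) (fun x => om x * h x) (fun x => K * `|h x|) => //.
- by move=> n; exact: measurable_funM (mo n) (intg_m ih).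
- exact: measurable_funM mo' (intg_m ih).
- by apply: aeW => x; apply: cvgMl.
- apply: intgZ; exact: intg_norm.
- by move=> n x; rewrite normrM ler_wpM2r.
Qed.

End quotients.

(** * Radial functions and the truncated dilation field *)

Section radial.
Implicit Types (h : T -> R) (i j : 'I_N).

Lemma contM (f g : T -> R) : continuous f -> continuous g -> continuous (fun x => f x * g x).
by move=> cf cg x; apply: continuousM; [exact: cf|exact: cg]. Qed.

Lemma contZ (a : R) (f : T -> R) : continuous f -> continuous (fun x => a * f x).
by move=> cf; apply: contM => // x; exact: cst_continuous. Qed.

Lemma cont_comp (f : T -> R) (G : R -> R) : continuous f ->
 (forall x, {for f x, continuous G}) -> continuous (fun x => G (f x)).
by move=> cf cG x; apply: (@continuous_comp _ _ _ f G x); [exact: cf|exact: cG]. Qed.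

Lemma is_derive_lineV (f : T -> R) x i (D : R) :
 is_derive (0 : R) 1 (fun s => f (x + s *: ee i)) D -> is_derive x (ee i) f D.
have E : (fun s : R => s^-1 *: (((fun s => f (x + s *: ee i)) \o shift 0) (s *: 1)
   - f (x + 0 *: ee i))) = (fun s : R => s^-1 *: ((f \o shift x) (s *: ee i) - f x)).
 by apply/funext => s /=; rewrite [s *: 1]mulr1 addr0 scale0r addr0 [x + _]addrC.
case=> d1 d2; split.
 by rewrite /derivable -E; exact: d1.
by rewrite /derive -E; exact: d2.
Qed.

Lemma partial_coord i j x : is_derive x (ee i) (fun y => y ord0 j) (i == j)%:R.
apply: is_derive_lineV.
have -> : (fun s : R => (x + s *: ee i) ord0 j) = (fun s : R => x ord0 j + s * (i == j)%:R).
 by apply/funext => s; rewrite !mxE eqxx /= eq_sym.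
apply: is_derive_eq.
by rewrite /= !(scaler0, add0r, mul1r) [LHS]mulr1.
Qed.

Lemma Ck1I (f : T -> R) (D : 'I_N -> T -> R) : continuous f -> (forall i, continuous (D i)) ->
 (forall i x, is_derive x (ee i) f (D i x)) -> Ck 1 f.
move=> cf cD H; split=> // i; split; first by move=> x; have [] := H i x.
split=> //; have -> : partial i f = D i by apply/funext => x; have [_] := H i x.
exact: cD.
Qed.

Lemma Ck1_coord j : Ck 1 (fun x : T => x ord0 j).
apply: (@Ck1I _ (fun i => cst (i == j)%:R)); first exact: coord_continuous.
- by move=> i x; exact: cst_continuous.
- by move=> i x; exact: partial_coord.
Qed.

Lemma dotv_ge0 x : 0 <= dotv x x.
by apply: sumr_ge0 => i _; rewrite -expr2 sqr_ge0. Qed.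

Lemma dotv_line x i (s : R) :
 dotv (x + s *: ee i) (x + s *: ee i) = dotv x x + (2 * x ord0 i * s + s ^+ 2).
rewrite /dotv (bigD1 i)//= [in RHS](bigD1 i)//= -addrA [X in _ = _ + X]addrC addrA; congr (_ + _).
 by rewrite !mxE !eqxx /=; ring.
by apply: eq_bigr => j ji; rewrite !mxE (negPf ji) andbF mulr0 addr0.
Qed.

Lemma continuous_dotv : continuous (fun x : T => dotv x x).
rewrite /dotv; elim: (index_enum _) => [|i s IH].
 rewrite (_ : (fun x => _) = cst 0); first by move=> x; exact: cst_continuous.
 by apply/funext => x; rewrite big_nil.
rewrite (_ : (fun x => _) = (fun x : T => x ord0 i * x ord0 i) + (fun x : T => \sum_(i <- s) x ord0 i * x ord0 i)).
 move=> x; apply: continuousD; last exact: IH.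
 by apply: contM; exact: coord_continuous.
by apply/funext => x; rewrite big_cons.
Qed.

Lemma is_derive_radial (G dG : R -> R) i x : (forall s : R, 0 <= s -> is_derive s 1 G (dG s)) ->
 is_derive x (ee i) (fun y => G (dotv y y)) (dG (dotv x x) * (2 * x ord0 i)).
move=> H; apply: is_derive_lineV.
have -> : (fun s : R => G (dotv (x + s *: ee i) (x + s *: ee i))) =
 G \o (fun s : R => dotv x x + (2 * x ord0 i * s + s ^+ 2)).
 by apply/funext => s /=; rewrite dotv_line.
apply: is_derive1_comp.
 by rewrite expr0n /= mulr0 !addr0; apply: H; exact: dotv_ge0.
apply: is_derive_eq.
by rewrite /= !(scaler0, scale0r, add0r, addr0) [_ *: 1]mulr1 mul1r.
Qed.

Lemma sqr_le_dotv x i : x ord0 i ^+ 2 <= dotv x x.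
rewrite /dotv (bigD1 i)//= expr2 lerDl; apply: sumr_ge0 => j _; by rewrite -expr2 sqr_ge0.
Qed.

Lemma norm_le_dotv x i j : `|x ord0 i * x ord0 j| <= dotv x x.
have h1 := sqr_le_dotv x i; have h2 := sqr_le_dotv x j.
have h3 := sqr_ge0 (x ord0 i - x ord0 j); have h4 := sqr_ge0 (x ord0 i + x ord0 j).
by rewrite ler_norml; apply/andP; split; nra.
Qed.

(** A [C^1] radial cutoff supported in [d * |x|^2 <= 1], tending to [1] as [d -> 0]; [dchi] is its
    derivative with respect to [|x|^2]. *)
Definition chi (d : R) x : R := pp (1 - d * dotv x x) ^+ 2.
Definition dchi (d : R) x : R := - (2 * d * pp (1 - d * dotv x x)).

Lemma pp_ge0 (s : R) : 0 <= pp s.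
by case: (lerP 0 s) => s0; [rewrite pp_pos|rewrite pp_neg// ltW]. Qed.

Lemma chi_derive (d : R) i x : is_derive x (ee i) (chi d) (dchi d x * (2 * x ord0 i)).
pose G (s : R) := pp (1 - d * s) ^+ 2.
apply: (@is_derive_radial G (fun s => - (2 * d * pp (1 - d * s)))) => s _.
rewrite -[G]/((fun s => pp s ^+ 2) \o (fun s => 1 - d * s)).
apply: is_derive_eq; first by apply: is_derive1_comp; exact: is_derive_pp2.
rewrite /= !(scaler0, add0r, addr0, sub0r) [_ *: 1]mulr1; ring.
Qed.

Lemma continuous_ppd (d : R) : continuous (fun x : T => pp (1 - d * dotv x x)).
apply: (@cont_comp _ (fun s => pp (1 - d * s))); first exact: continuous_dotv.
move=> x; apply: (@continuous_comp _ _ _ (fun s => 1 - d * s) pp); last exact: continuous_pp.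
by apply: cvgB; [exact: cvg_cst|apply: cvgMr; exact: cvg_id].
Qed.

Lemma Ck1_chi (d : R) : Ck 1 (chi d).
have c := @continuous_ppd d.
apply: (@Ck1I _ (fun i x => dchi d x * (2 * x ord0 i))); last by move=> i x; exact: chi_derive.
- exact: contM.
- move=> i; apply: contM; last by apply: contZ; exact: coord_continuous.
 rewrite (_ : dchi d = fun x => - (2 * d) * pp (1 - d * dotv x x)); first exact: contZ.
 by apply/funext => x; rewrite mulNr.
Qed.

Lemma chi_supp (d : R) : 0 < d -> supp_in (chi d) (d^-1 + 1).
move=> d0 x; apply: contraNT; rewrite -ltNge => h; apply/eqP.
rewrite /chi pp_neg ?expr0n//.
have i0 : 0 < d^-1 by pos.
have [i hi] : exists i, d^-1 + 1 < `|x ord0 i|.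
 apply: contrapT => nE; move: h; rewrite ltNge => /negP; apply.
 apply: norm_le_coord; first by pos.
 by move=> i; rewrite leNgt; apply/negP => ?; apply: nE; exists i.
have := sqr_le_dotv x i; rewrite -sqr_norm => h2.
have h3 : d^-1 <= `|x ord0 i| ^+ 2 by nra.
rewrite subr_le0 -ler_pdivrMl// mulr1; exact: le_trans h2.
Qed.

Lemma chi_ge0 (d : R) x : 0 <= chi d x. exact: sqr_ge0. Qed.

Lemma chi_le1 (d : R) x : 0 <= d -> chi d x <= 1.
move=> d0; have h := mulr_ge0 d0 (dotv_ge0 x); rewrite expr_le1 ?pp_ge0//.
by case: (lerP 0 (1 - d * dotv x x)) => s0; [rewrite pp_pos//; lra|rewrite pp_neg// ltW].
Qed.

Lemma dchi_bound (d : R) x : 0 <= d -> `|dchi d x| * dotv x x <= 2.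
move=> d0; have h := mulr_ge0 d0 (dotv_ge0 x).
rewrite /dchi normrN ger0_norm; last by apply: mulr_ge0; [lra|exact: pp_ge0].
have p0 := pp_ge0 (1 - d * dotv x x).
have p1 : d * dotv x x * pp (1 - d * dotv x x) <= 1.
 case: (lerP 0 (1 - d * dotv x x)) => s0; last by rewrite pp_neg ?mulr0 ltW.
 by rewrite pp_pos; set z := d * _ in h s0 *; nra.
rewrite (_ : 2 * d * _ * _ = 2 * (d * dotv x x * pp (1 - d * dotv x x))); last by ring.
lra.
Qed.

Lemma chi_cvg (d_ : nat -> R) x : d_ n ~[n]~> (0 : R) -> chi (d_ n) x ~[n]~> (1 : R).
move=> d0; have -> : (1 : R) = pp (1 - 0 * dotv x x) ^+ 2 by rewrite mul0r subr0 pp_pos// expr1n.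
have h : pp (1 - d_ n * dotv x x) ~[n]~> pp (1 - 0 * dotv x x).
 apply: continuous_cvg; first exact: continuous_pp.
 by apply: cvgB; [exact: cvg_cst|exact: cvgMl].
exact: cvgM.
Qed.

Lemma dchi_cvg (d_ : nat -> R) x : d_ n ~[n]~> (0 : R) -> dchi (d_ n) x ~[n]~> (0 : R).
move=> d0; have -> : (0 : R) = - (2 * 0 * pp (1 - 0 * dotv x x)) by rewrite mulr0 mul0r oppr0.
apply: cvgN; apply: cvgM; first exact: cvgMr.
apply: continuous_cvg; first exact: continuous_pp.
by apply: cvgB; [exact: cvg_cst|exact: cvgMl].
Qed.

Lemma Ck1_derivable (f : T -> R) i x : Ck 1 f -> derivable f x (ee i).
by move=> [_ /(_ i)[H _]]; exact: H. Qed.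

Lemma Ck1_partial (f : T -> R) i : Ck 1 f -> continuous (partial i f).
by move=> [_ /(_ i)[_ [H _]]]. Qed.

Lemma c1b_supp (f : T -> R) (M : R) i : Ck 1 f -> supp_in f M -> c1b i f.
move=> Cf sf; have cf := Ck_cont Cf; have cd := Ck1_partial (i := i) Cf.
have [B B0 HB] := supp_bounded cf sf.
have [B' B0' HB'] := supp_bounded cd (partial_supp (i := i) cf sf).
split; try exact: mfn_cont; first by move=> x; exact: Ck1_derivable.
exists (B + B') => x; split.
 by apply: (le_trans (HB x)); rewrite lerDl.
by apply: (le_trans (HB' x)); rewrite lerDr.
Qed.

(** Component [i] of the generator [x] of dilations, cut off by [chi]. Its derivatives are bounded
    by [5] for every [d] and tend to the Kronecker symbol, which is what removing the cutoff in the
    Pohozaev identity takes. *)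
Definition xi (d : R) i : T -> R := (fun x => x ord0 i) * chi d.

Lemma Ck1_xi d i : Ck 1 (xi d i).
by apply: CkM; [exact: Ck1_coord|exact: Ck1_chi]. Qed.

Lemma partial_xi d i j x :
 partial j (xi d i) x = x ord0 i * (dchi d x * (2 * x ord0 j)) + chi d x * (j == i)%:R.
rewrite /xi partialM; last 2 first.
- by move=> y; have [] := partial_coord j i y.
- by move=> y; have [] := chi_derive d j y.
have [_ E1] := partial_coord j i x; have [_ E2] := chi_derive d j x.
by rewrite /GRing.add /= /GRing.mul /= [partial _ _ x]E2 [partial _ (fun _ => _) x]E1.
Qed.

Lemma partial_xi_bound d i j x : 0 <= d -> `|partial j (xi d i) x| <= 5.
move=> d0; rewrite partial_xi; apply: (le_trans (ler_normD _ _)).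
have h1 : `|x ord0 i * (dchi d x * (2 * x ord0 j))| <= 4.
 rewrite (_ : x ord0 i * _ = 2 * (dchi d x * (x ord0 i * x ord0 j))); last by ring.
 rewrite normrM ger0_norm// normrM.
 have := ler_wpM2l (normr_ge0 (dchi d x)) (norm_le_dotv x i j); have := dchi_bound x d0; lra.
have h2 : `|chi d x * (j == i)%:R| <= 1.
 rewrite normrM ger0_norm ?chi_ge0//.
 case: (j == i); rewrite ?normr0 ?mulr0// normr1 mulr1; exact: chi_le1.
lra.
Qed.

Lemma partial_xi_cvg (d_ : nat -> R) i j x : d_ n ~[n]~> (0 : R) ->
 partial j (xi (d_ n) i) x ~[n]~> ((j == i)%:R : R).
move=> d0; have -> : (j == i)%:R = x ord0 i * (0 * (2 * x ord0 j)) + 1 * (j == i)%:R :> R.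
 by rewrite mul0r mulr0 add0r mul1r.
under eq_fun do rewrite partial_xi.
by apply: cvgD; [apply: cvgMr; apply: cvgMl; exact: dchi_cvg|apply: cvgMl; exact: chi_cvg].
Qed.

Lemma supp_xi d i h : 0 < d -> supp_in (h * xi d i) (d^-1 + 1).
move=> d0 x hx; apply: (chi_supp d0); apply: contra hx => /eqP c0.
by rewrite /xi /GRing.mul /= c0 !mulr0.
Qed.

Lemma partialMx i h Phi x : Ck 1 h -> Ck 1 Phi ->
 partial i (h * Phi) x = h x * partial i Phi x + Phi x * partial i h x.
by move=> Ch CP; rewrite partialM// => y; exact: Ck1_derivable. Qed.

Lemma dotv_grad h x : dotv (grad h x) x = \sum_i x ord0 i * partial i h x.
by apply: eq_bigr => i _; rewrite mxE mulrC. Qed.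

Lemma mfn_xgrad h : Ck 1 h -> mfn (fun x => dotv (grad h x) x).
move=> Ch; rewrite /dotv; apply: (@measurable_sum _ _ _ _ _ _ (fun i x => grad h x ord0 i * x ord0 i)) => i.
apply: measurable_funM; last exact: measurable_coord_rV.
under eq_fun do rewrite mxE; apply: mfn_cont; exact: Ck1_partial.
Qed.

End radial.

Section dimension_at_least_three.
Hypothesis N3 : (3 <= N)%N.
Local Notation q := (@crit_exp R N).

(** * Sobolev inequality: one dyadic level *)

Section level_sets.
Variable u : T -> R.
Hypothesis Hu : H1 u.
Implicit Types l : R.

Let lu := H1_l2 Hu.

Definition lev l x : R := if l <= `|u x| then 1 else 0.
Definition mlev l : R := Int (lev l).
Definition g2 x : R := \sum_i Dw u i x ^+ 2.
(** Gradient energy in the layer [l <= |u| < 2 * l]; over successive doublings of [l] these energies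
    telescope. *)
Definition blev l : R := \I_x((lev l x - lev (2 * l) x) * g2 x).

Lemma mfn_lev l : mfn (lev l).
apply: measurable_fun_ifT => //; apply: measurable_fun_ler => //.
by apply: measurableT_comp => //; exact: l2m lu.
Qed.

Lemma lev_ge0 l x : 0 <= lev l x. by rewrite /lev; case: ifP. Qed.

Lemma lev_le l x : 0 < l -> l ^+ 2 * lev l x <= u x ^+ 2.
move=> l0; rewrite /lev; case: ifP => [h|_]; last by rewrite mulr0 sqr_ge0.
by rewrite mulr1 -[leRHS]sqr_norm lerXn2r ?nnegrE// ltW.
Qed.

Lemma lev_mono l l' x : l <= l' -> lev l' x <= lev l x.
by move=> ll; rewrite /lev; case: ifP => [h|_]; [rewrite (le_trans ll h)|case: ifP]. Qed.

Lemma intg_lev l : 0 < l -> intg (lev l).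
move=> l0; apply: (@intg_le _ _ _ mu _ (fun x => l ^- 2 * u x ^+ 2)).
- exact: mfn_lev.
- by apply: intgZ; exact: l2i lu.
- by move=> x; rewrite ger0_norm ?lev_ge0// ler_pdivlMl ?exprn_gt0// lev_le.
Qed.

Lemma mlev_ge0 l : 0 <= mlev l. by apply: Int_ge0 => x; exact: lev_ge0. Qed.

Lemma mlev_cheb l : 0 < l -> l ^+ 2 * mlev l <= nrm u ^+ 2.
move=> l0; rewrite -IntZ ?nrmE; last exact: intg_lev.
apply: Int_le; [by apply: intgZ; exact: intg_lev|exact: l2i lu|].
by move=> x; exact: lev_le.
Qed.

Lemma intg_g2 : intg g2.
by apply: intg_sum => i _; apply: l2i; exact: H1_Dw. Qed.

Lemma g2_ge0 x : 0 <= g2 x. by apply: sumr_ge0 => i _; exact: sqr_ge0. Qed.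

Lemma Int_g2 : Int g2 = dg u u.
rewrite dg_def /g2 Int_sum; first by apply: eq_bigr => i _; apply: Int_eq => x; rewrite expr2.
by move=> i _; apply: l2i; exact: H1_Dw.
Qed.

Lemma intg_blev l l' : intg (fun x => (lev l x - lev l' x) * g2 x).
apply: (@intg_le _ _ _ mu _ g2); last 2 first.
- exact: intg_g2.
- move=> x; rewrite normrM (ger0_norm (g2_ge0 x)) ler_piMl ?g2_ge0// ler_norml.
 by rewrite /lev; case: ifP; case: ifP => *; apply/andP; split; lra.
apply: measurable_funM; last exact: intg_m intg_g2.
by apply: measurable_funB; exact: mfn_lev.
Qed.

(** The truncation [v = step (u / l)] is [9 / 4] where [|u| >= 2 * l] and [0] where [|u| < l]. On
    cubes of volume twice the measure of [|u| >= l] its average is at most [9 / 8], so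
    [v - avg r v >= 9 / 8] on the higher level set, and [avg_diff] bounds the measure of that set.
    The factor [36] is the squared slope of [step]. *)
Lemma level_step l : 0 < l ->
 l ^+ 2 * mlev (2 * l) <= 36 * N%:R ^+ 2 * ((2 * mlev l) `^ (2 / N%:R)) * blev l.
move=> l0; have l20 : 0 < 2 * l by pos.
have N0 : (0 < N)%N by exact: leq_trans N3.
have ll2 : l <= 2 * l by lra.
have b0 : 0 <= blev l.
 apply: Int_ge0 => x; rewrite mulr_ge0 ?g2_ge0// subr_ge0; exact: lev_mono.
(* A null level set would lead to a cube of side zero. *)
have [m0|m0] := leP (mlev l) 0.
 have -> : mlev (2 * l) = 0.
  apply/eqP; rewrite eq_le mlev_ge0 andbT (le_trans _ m0)//.
  apply: Int_le; [exact: intg_lev|exact: intg_lev|move=> x].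
  exact: lev_mono.
 by rewrite mulr0 mulr_ge0// mulr_ge0 ?powR_ge0// mulr_ge0// sqr_ge0.
pose Phi t : R := step (l^-1 * t).
pose phi t : R := l^-1 * dstep (l^-1 * t).
have dPhi (t : R) : is_derive t 1 Phi (phi t).
 have h0 : is_derive t 1 (fun t => l^-1 * t) (l^-1).
  by apply: (@is_derive_quad _ _ _ 0) => h; rewrite mul0r (_ : _ - _ = 0) ?normr0//; ring.
 have h := is_derive1_comp (is_derive_step (l^-1 * t)) h0.
 by apply: (is_derive_eq h); rewrite /phi mulrC.
have cphi : continuous phi.
 move=> t; rewrite /continuous_at /phi; apply: cvgM; first exact: cvg_cst.
 apply: (@continuous_comp _ _ _ (fun t : R => l^-1 * t) dstep); last exact: continuous_dstep.
 by apply: cvgM; [exact: cvg_cst|exact: cvg_id].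
have li0 : 0 <= l^-1 by pos.
have bphi t : `|phi t| <= l^-1 * 6.
 by rewrite /phi normrM (ger0_norm li0) ler_wpM2l// dstep_bd.
have P0 : Phi 0 = 0 by rewrite /Phi mulr0; apply: (step_low _).1; rewrite expr0n.
pose v x := Phi (u x).
have sv : sob v (fun i x => phi (u x) * Dw u i x) := sob_comp P0 dPhi cphi bphi (H1_sob Hu).
have Hv := sob_H1 sv; have lv := H1_l2 Hv.
have sq t : (l^-1 * t) ^+ 2 = (`|t| / l) ^+ 2.
 by rewrite mulrC -[LHS]sqr_norm normrM (ger0_norm li0).
have low x : `|u x| < l -> Phi (u x) = 0 /\ phi (u x) = 0.
 move=> h; have [|h1 h2] := @step_low (l^-1 * u x); last by rewrite /phi h2 mulr0.
 by rewrite sq -[1](expr1n R 2) lerXn2r ?nnegrE ?divr_ge0 ?(ltW l0)// ler_pdivrMr ?mul1r ?ltW.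
have high x : 2 * l <= `|u x| -> Phi (u x) = 9 / 4 /\ phi (u x) = 0.
 move=> h; have [|h1 h2] := @step_high (l^-1 * u x); last by rewrite /phi h2 mulr0.
 rewrite sq (_ : 4 = 2 ^+ 2); last by rewrite expr2; lra.
 by rewrite lerXn2r ?nnegrE ?divr_ge0 ?(ltW l0)// ler_pdivlMr.
have v0 x : 0 <= v x by have /andP[] := step_bd (l^-1 * u x).
have vle x : v x <= 9 / 4 * lev l x.
 rewrite /lev; case: ifP => h; last by rewrite mulr0 /v (low x _).1// ltNge h.
 by rewrite mulr1; have /andP[] := step_bd (l^-1 * u x).
have iv : intg v.
 apply: (@intg_le _ _ _ mu _ (fun x => 9 / 4 * lev l x)); first exact: l2m lv.
  by apply: intgZ; exact: intg_lev.
 by move=> x; rewrite ger0_norm.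
(* The side of a cube of volume [2 * mlev l]. *)
pose r := (2 * mlev l) `^ (N%:R^-1).
have r0 : 0 < r by rewrite powR_gt0// mulr_gt0.
have rN : r ^+ N = 2 * mlev l.
 rewrite -powR_mulrn ?powR_ge0// -powRrM mulVf ?powRr1 ?mulr_ge0 ?mlev_ge0//.
 by rewrite pnatr_eq0 -lt0n.
have r2 : r ^+ 2 = (2 * mlev l) `^ (2 / N%:R).
 by rewrite -powR_mulrn ?powR_ge0// -powRrM [2 / _]mulrC.
have av x : avg r v x <= 9 / 8.
 have h : ip (\1_(Q r)) (shf x v) <= 9 / 4 * mlev l.
  rewrite (le_via (Int (shf x v)))//.
   apply: Int_le; [by apply: l2_intgM; [exact: l2_Q|exact: l2_shf]|exact: (intg_shift x iv)|].
   by move=> y; rewrite ler_piMl//; exact: v0.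
  rewrite (Int_shift x iv) /mlev -IntZ; last exact: intg_lev.
  by apply: Int_le => //; apply: intgZ; exact: intg_lev.
 rewrite /avg rN (le_trans (ler_wpM2l _ h)) ?invr_ge0 ?mulr_ge0 ?mlev_ge0//.
 rewrite le_eqVlt; apply/orP; left; apply/eqP; field; exact: lt0r_neq0.
have [ld nd] := avg_diff r0 Hv.
have key : 81 / 64 * mlev (2 * l) <= nrm (v - avg r v) ^+ 2.
 rewrite nrmE -IntZ; last exact: intg_lev.
 apply: Int_le; [by apply: intgZ; exact: intg_lev|exact: l2i ld|move=> x].
 rewrite /lev; case: ifP => h; last by rewrite mulr0 sqr_ge0.
 have -> : (v - avg r v) x = 9 / 4 - avg r v x by rewrite -(high x h).1.
 rewrite mulr1; have := av x; move: (avg r v x) => z; nra.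
have dgv : dg v v <= l ^- 2 * 36 * blev l.
 rewrite (dgE sv sv) /blev -IntZ; last exact: intg_blev.
 have ig i : intg (fun x => phi (u x) * Dw u i x * (phi (u x) * Dw u i x)).
  by have lgi := sob_grad i sv; exact: (l2_intgM lgi lgi).
 rewrite -Int_sum//; apply: Int_le; [exact: intg_sum|by apply: intgZ; exact: intg_blev|move=> x].
 rewrite (eq_bigr (fun i => phi (u x) ^+ 2 * Dw u i x ^+ 2)); last by move=> i _; ring.
 rewrite -mulr_sumr -/(g2 x) mulrA ler_wpM2r ?g2_ge0//.
 have h36 : phi (u x) ^+ 2 <= l ^- 2 * 36.
  rewrite -[leLHS]sqr_norm (_ : l ^- 2 * 36 = (l^-1 * 6) ^+ 2).
   by rewrite lerXn2r ?nnegrE// mulr_ge0.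
  by field; exact: lt0r_neq0.
 rewrite /lev; case: ifP => h1; case: ifP => h2.
 - by rewrite (high x h2).2 expr0n subrr mulr0.
 - by rewrite subr0 mulr1.
 - move: h2 h1; by move=> /(le_trans ll2) ->.
 - by rewrite (low x _).2 ?expr0n ?subrr ?mulr0// ltNge h1.
have k2 : 81 / 64 * mlev (2 * l) <= N%:R ^+ 2 * r ^+ 2 * (l ^- 2 * 36 * blev l).
 rewrite (le_trans key)// (le_via ((N%:R * r * bn dg v) ^+ 2))//.
  by rewrite lerXn2r ?nnegrE ?mulr_ge0 ?bn_ge0// ltW.
 by rewrite !exprMn (bn2 dg_ge0)// ler_wpM2l// mulr_ge0 ?sqr_ge0.
have l2' : 0 < l ^+ 2 by pos.
have := ler_wpM2l (ltW l2') k2; rewrite -r2.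
have -> : l ^+ 2 * (N%:R ^+ 2 * r ^+ 2 * (l ^- 2 * 36 * blev l)) =
 36 * N%:R ^+ 2 * r ^+ 2 * blev l by field; exact: lt0r_neq0.
apply: le_trans; rewrite mulrCA ler_peMl//; first by rewrite mulr_ge0 ?mlev_ge0// ltW.
lra.
Qed.

End level_sets.

(** * Sobolev inequality: summation over the levels *)

Section sobolev.
Local Notation th := (2 / N%:R : R).

Lemma N3R : 3 <= N%:R :> R. by rewrite (ler_nat _ 3 N). Qed.

Lemma crit_gt2 : 2 < q.
have h := N3R; rewrite /crit_exp ltr_pdivlMr; last by lra.
by lra.
Qed.

Lemma crit_th : q * th = q - 2.
have h := N3R; rewrite /crit_exp; field; apply/andP; split; rewrite gt_eqF//; lra.
Qed.

Lemma th_bd : 0 < th < 1.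
have h := N3R; apply/andP; split; first by rewrite divr_gt0//; lra.
by rewrite ltr_pdivrMr; lra.
Qed.

Lemma powR_absorb (C t : R) : 0 <= C -> 0 < t < 1 ->
 exists2 K : R, 0 <= K & forall S, 0 <= S -> C * S `^ t <= S / 2 + K.
move=> C0 /andP[t0 t1]; pose S0 := (2 * C + 1) `^ ((1 - t)^-1).
have t10 : 0 < 1 - t by rewrite subr_gt0.
exists (C * S0 `^ t); first by rewrite mulr_ge0 ?powR_ge0.
move=> S S_ge0; have [SS|SS] := leP S S0.
 rewrite ler_wpDl ?divr_ge0// ler_wpM2l// ge0_ler_powR ?nnegrE ?powR_ge0 ?(ltW t0)//.
rewrite ler_wpDr ?mulr_ge0 ?powR_ge0//.
have Sp : 0 < S by rewrite (le_lt_trans _ SS)// powR_ge0.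
have h : 2 * C + 1 <= S `^ (1 - t).
 have -> : 2 * C + 1 = S0 `^ (1 - t).
  by rewrite /S0 -powRrM mulVf ?gt_eqF// powRr1// addr_ge0// mulr_ge0.
 by rewrite ge0_ler_powR ?nnegrE ?powR_ge0// ltW.
have E : S = S `^ t * S `^ (1 - t).
 by rewrite -powRD ?(gt_eqF Sp) ?implybT// addrC subrK powRr1.
rewrite {2}E mulrC -mulrA ler_wpM2l ?powR_ge0// ler_pdivlMr//; lra.
Qed.

Section dyadic.
Variable u : T -> R.
Hypothesis Hu : H1 u.
Variable l : R.
Hypothesis l0 : 0 < l.

Let L (k : nat) := l * 2 ^+ k.
(** Layer-cake weights: up to the factor [2 ^ q], their sum bounds the integral of [|u| ^ q] over
    the levels considered. *)
Let a k := L k `^ q * mlev u (L k).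

Let L0 k : 0 < L k. by rewrite mulr_gt0// exprn_gt0. Qed.
Let LS k : L k.+1 = 2 * L k. by rewrite /L exprS mulrCA. Qed.
Let a0 k : 0 <= a k. by rewrite mulr_ge0 ?powR_ge0 ?mlev_ge0. Qed.
Let C1 := 2 `^ q * (36 * N%:R ^+ 2 * 2 `^ th).
Let q0 : q != 0. by rewrite gt_eqF// (lt_trans _ crit_gt2). Qed.

Let C10 : 0 <= C1. by rewrite !mulr_ge0// sqr_ge0. Qed.

Lemma blev_ge0 k : 0 <= blev u (L k).
apply: Int_ge0 => x; rewrite mulr_ge0 ?g2_ge0// subr_ge0; apply: lev_mono.
by move: (L0 k); lra.
Qed.

(** The relation [q * (2 / N) = q - 2] makes [level_step] scale invariant: the powers of [L k]
    combine exactly into [a k ^ (2 / N)]. *)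
Lemma dyadic_step k : a k.+1 <= C1 * a k `^ th * blev u (L k).
have h := level_step Hu (L0 k).
have m0 := mlev_ge0 u (L k).
rewrite /a LS powRM ?(ltW (L0 k))// powRM// -powRrM crit_th.
have -> : L k `^ q = L k `^ (q - 2) * L k ^+ 2.
 rewrite -powR_mulrn ?(ltW (L0 k))// -powRD ?subrK//.
 by rewrite (gt_eqF (L0 k)) implybT.
rewrite -[in leLHS]mulrA -[in leLHS]mulrA.
rewrite (le_trans (ler_wpM2l (powR_ge0 _ _) (ler_wpM2l (powR_ge0 _ _) h)))//.
rewrite powRM// /C1 le_eqVlt; apply/orP; left; apply/eqP; ring.
Qed.

Lemma blev_sum n : \sum_(k < n) blev u (L k) =
 \I_x((lev u l x - lev u (L n) x) * g2 u x).
elim: n => [|n IH].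
 rewrite big_ord0 (@Int_eq _ _ _ mu _ (fun=> 0)) ?Int0// => x.
 by rewrite /L expr0 mulr1 subrr mul0r.
rewrite big_ord_recr/= IH /blev -LS -IntD; [|exact: intg_blev..].
by apply: Int_eq => x; ring.
Qed.

Lemma blev_sum_le n : \sum_(k < n) blev u (L k) <= dg u u.
rewrite blev_sum -Int_g2//; apply: Int_le; [exact: intg_blev|exact: intg_g2|].
move=> x; rewrite ler_piMl ?g2_ge0// /lev; do 2 case: ifP => _; lra.
Qed.

(** The layer energies add up to at most [1], so summing [dyadic_step] bounds [S] by [a 0] plus a
    multiple of [S ^ (2 / N)]. The exponent is below [1], hence [S] bounds itself. *)
Lemma dyadic_sum (K : R) n : dg u u <= 1 ->
 (forall S, 0 <= S -> C1 * S `^ th <= S / 2 + K) ->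
 \sum_(k < n.+1) a k <= 2 * (a 0 + K).
move=> du HK; set S := \sum_(k < n.+1) a k.
have S0 : 0 <= S by apply: sumr_ge0 => k _.
have h : S <= a 0 + C1 * S `^ th.
 rewrite {1}/S big_ord_recl lerD2l.
 apply: (le_via (\sum_(k < n) C1 * S `^ th * blev u (L k))).
  apply: ler_sum => k _; rewrite (le_trans (dyadic_step k))// ler_wpM2r ?blev_ge0//.
  rewrite ler_wpM2l//; apply: powR_le => //.
  rewrite /S (bigD1 (widen_ord (leqnSn n) k))//= lerDl; exact: sumr_ge0.
 rewrite -mulr_sumr ler_piMr ?mulr_ge0 ?powR_ge0//.
 exact: le_trans (blev_sum_le n) du.
have := HK S S0; lra.
Qed.

Definition band n x : R := if (l <= `|u x|) && (`|u x| < L n) then `|u x| `^ q else 0.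

Lemma band_le n x : band n x <= \sum_(k < n) (2 * L k) `^ q * lev u (L k) x.
elim: n => [|n IH].
 rewrite big_ord0 /band /L expr0 mulr1; case: ifP => // /andP[h1 h2].
 by move: (le_lt_trans h1 h2); rewrite ltxx.
rewrite big_ord_recr/=.
have t0 : 0 <= (2 * L n) `^ q * lev u (L n) x by rewrite mulr_ge0 ?powR_ge0 ?lev_ge0.
have s0 : 0 <= \sum_(k < n) (2 * L k) `^ q * lev u (L k) x.
 by apply: sumr_ge0 => k _; rewrite mulr_ge0 ?powR_ge0 ?lev_ge0.
have [h|h] := ltP `|u x| (L n).
 rewrite ler_wpDr// (le_trans _ IH)// /band h andbT; case: (l <= _) => //=.
 by case: ifP.
rewrite ler_wpDl// /lev h mulr1 /band; case: ifP => [/andP[_ h2]|_]; last exact: powR_ge0.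
apply: powR_le => //; last by rewrite -LS ltW.
exact: ltW (lt_trans _ crit_gt2).
Qed.

Lemma band_ge0 n x : 0 <= band n x. by rewrite /band; case: ifP => // _; exact: powR_ge0. Qed.

Lemma mfn_absq : mfn (fun x => `|u x| `^ q).
apply: (measurableT_comp (measurable_powR q)).
by apply: measurableT_comp => //; exact: l2m (H1_l2 Hu).
Qed.

Lemma intg_band n : intg (band n).
apply: (@intg_le _ _ _ mu _ (fun x => \sum_(k < n) (2 * L k) `^ q * lev u (L k) x)).
- have mu_ : mfn (fun x => `|u x|) by apply: measurableT_comp => //; exact: l2m (H1_l2 Hu).
 apply: measurable_fun_ifT => //; last exact: mfn_absq.
 by apply: measurable_and; [exact: measurable_fun_ler|exact: measurable_fun_ltr].
- by apply: intg_sum => k _; apply: intgZ; exact: intg_lev.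
- by move=> x; rewrite ger0_norm ?band_ge0// band_le.
Qed.

Lemma band_Int (K : R) n : dg u u <= 1 -> 0 <= K ->
 (forall S, 0 <= S -> C1 * S `^ th <= S / 2 + K) ->
 Int (band n) <= 2 `^ q * (2 * (a 0 + K)).
move=> du K0 HK; case: n => [|n].
 rewrite (@Int_eq _ _ _ mu _ (fun=> 0)) ?Int0.
  by pos.
 move=> x; rewrite /band /L expr0 mulr1; case: ifP => // /andP[h1 h2].
 by move: (le_lt_trans h1 h2); rewrite ltxx.
have i1 k : intg (fun x => (2 * L k) `^ q * lev u (L k) x).
 by apply: intgZ; exact: intg_lev.
apply: (le_via (\I_x(\sum_(k < n.+1) (2 * L k) `^ q * lev u (L k) x))).
 apply: Int_le; [exact: intg_band|by apply: intg_sum|exact: band_le].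
rewrite Int_sum// (eq_bigr (fun k : 'I_n.+1 => 2 `^ q * a k)).
 by rewrite -mulr_sumr ler_wpM2l// dyadic_sum.
move=> k _; rewrite IntZ; last exact: intg_lev.
by rewrite powRM ?(ltW (L0 k))// -mulrA.
Qed.

End dyadic.

(** The constant does not see the [L^2] norm of [u]: starting from a low enough level, Chebyshev's
    inequality gives [a 0 <= 1]. The lowest level then tends to zero and the highest to infinity,
    with Fatou's lemma for the limit. *)
Lemma sobolev1 : exists2 S : R, 0 < S & forall u : T -> R, H1 u -> dg u u <= 1 ->
 intg (fun x => `|u x| `^ q) /\ \I_x(`|u x| `^ q) <= S.
have C10 : 0 <= 2 `^ q * (36 * N%:R ^+ 2 * 2 `^ th) by pos.
have [K K0 HK] := powR_absorb C10 th_bd.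
exists (2 `^ q * (2 * (1 + K))); first by pos.
move=> u Hu du.
pose n2 := nrm u ^+ 2 + 1.
have n20 : 0 < n2 by rewrite ltr_wpDl// sqr_ge0.
have q2 : 0 < q - 2 by rewrite subr_gt0 crit_gt2.
(* The level at which [ls ^ (q - 2) * n2 = 1]; all lower starting levels have [a 0 <= 1] as well. *)
pose ls := n2^-1 `^ ((q - 2)^-1).
have ls0 : 0 < ls by rewrite powR_gt0// invr_gt0.
pose l (j : nat) := ls / 2 ^+ j.
have l0 j : 0 < l j by rewrite divr_gt0// exprn_gt0.
have lls j : l j <= ls by rewrite ler_pdivrMr// ler_peMr ?(ltW ls0)// exprn_ege1// ler1n.
have a1 j : (l j * 2 ^+ 0) `^ q * mlev u (l j * 2 ^+ 0) <= 1.
 rewrite expr0 mulr1.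
 have -> : l j `^ q = l j `^ (q - 2) * l j ^+ 2.
  rewrite -powR_mulrn ?(ltW (l0 j))// -powRD ?subrK//.
  by rewrite (gt_eqF (l0 j)) implybT.
 rewrite -mulrA (le_trans (ler_wpM2l (powR_ge0 _ _) (mlev_cheb Hu (l0 j))))//.
 have h : l j `^ (q - 2) <= n2^-1.
  have -> : n2^-1 = ls `^ (q - 2).
   by rewrite /ls -powRrM mulVf ?gt_eqF// powRr1// invr_ge0 ltW.
  by rewrite ge0_ler_powR ?nnegrE ?(ltW q2) ?(ltW (l0 j)) ?(ltW ls0).
 rewrite (le_trans (ler_wpM2r (sqr_ge0 _) h))// ler_pdivrMl// mulr1 /n2; lra.
apply: (@Int_fatou _ _ _ mu (fun j => band u (l j) (j + j))).
- by move=> j; exact: intg_band.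
- by move=> j x; exact: band_ge0.
- exact: mfn_absq.
- by move=> x; exact: powR_ge0.
- apply: aeW => x; have [ux|ux] := eqVneq (u x) 0.
  rewrite ux normr0 powR0; last by rewrite gt_eqF// (lt_trans _ crit_gt2).
  rewrite (_ : (fun n => _) = fun=> 0); first exact: cvg_cst.
  by apply/funext => j; rewrite /band ux normr0 leNgt l0.
 have ux0 : 0 < `|u x| by rewrite normr_gt0.
 have p2 (m : nat) (z : R) : (Num.truncn z < m)%N -> z < 2 ^+ m.
  move=> h; rewrite (lt_le_trans (truncnS_gt z))//.
  by rewrite -natrX ler_nat (leq_trans h)// ltnW// ltn_expl.
 apply: cvg_near_cst; exists (maxn (Num.truncn (ls / `|u x|)).+1 (Num.truncn (`|u x| / ls)).+1) => //.
 move=> j /=; rewrite geq_max => /andP[/p2 h1 /p2 h2]; rewrite /band.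
 rewrite ltr_pdivrMr// in h1; rewrite ltr_pdivrMr// in h2.
 have -> : l j <= `|u x| by rewrite /l ler_pdivrMr// mulrC ltW.
 have -> // : `|u x| < l j * 2 ^+ (j + j).
 rewrite (lt_le_trans h2)// /l exprD mulrA divfK// mulrC lexx//.
- move=> j; rewrite (le_trans (band_Int Hu (l0 j) _ du K0 HK))//.
 by rewrite ler_wpM2l// ler_wpM2l// lerD2r.
Qed.

(** By homogeneity. Here [s] is any positive bound of the gradient norm, so that a vanishing
    gradient is covered by letting [s] tend to zero. *)
Lemma sobolev : exists2 S : R, 0 < S & forall u (s : R), H1 u -> 0 < s ->
 dg u u <= s ^+ 2 ->
 intg (fun x => `|u x| `^ q) /\ \I_x(`|u x| `^ q) <= S * s `^ q.
have [S S0 HS] := sobolev1; exists S => // u s Hu s0 du.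
have Hv := H1Z s^-1 Hu.
have dv : dg (s^-1 *: u) (s^-1 *: u) <= 1.
 rewrite dgZ// dgZr// mulrA -invfM -expr2 mulrC ler_pdivrMr ?exprn_gt0// mul1r//.
have [i1 h1] := HS _ Hv dv.
have E : (fun x => `|u x| `^ q) = (fun x => s `^ q * `|(s^-1 *: u) x| `^ q).
 apply/funext => x; have -> : (s^-1 *: u) x = s^-1 * u x by [].
 rewrite -powRM ?(ltW s0)// normrM gtr0_norm ?invr_gt0// mulVKf// gt_eqF//.
by rewrite E; split; [exact: intgZ|rewrite IntZ// mulrC ler_wpM2r ?powR_ge0].
Qed.

End sobolev.

Definition wgt (a : T -> R) := mfn a /\ forall x, 0 <= a x <= 1.
Definition pot (V0 V1 : R) (V : T -> R) :=
 mfn V /\ forall x, V0 <= V x <= V1.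

(** * Hardy's inequality and the slowly decaying weights *)

Section hardy.
Implicit Types (h : T -> R) (i j : 'I_N).

Definition rho x : R := (1 + dotv x x)^-1.

Lemma rho_gt0 x : 0 < rho x.
by rewrite invr_gt0 ltr_wpDr// dotv_ge0. Qed.

Lemma rho_le1 x : rho x <= 1.
by rewrite invf_le1 ?ltr_wpDr ?dotv_ge0// lerDl dotv_ge0. Qed.

Lemma rho_dotv x : dotv x x * rho x <= 1.
by rewrite ler_pdivrMr ?ltr_wpDr ?dotv_ge0// mul1r lerDr. Qed.

Lemma is_derive_rho i x : is_derive x (ee i) rho (- rho x ^+ 2 * (2 * x ord0 i)).
have -> : - rho x ^+ 2 = - (1 + dotv x x) ^- 2 by rewrite /rho exprVn.
apply: (@is_derive_radial (fun s => (1 + s)^-1) (fun s => - (1 + s) ^- 2)) => s s0.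
have s1 : 1 + s != 0 by apply: lt0r_neq0; rewrite ltr_wpDr.
have h := is_deriveV s1 (is_deriveD (is_derive_cst (1 : R) s 1) (is_derive_id s 1)).
by apply: (is_derive_eq h); rewrite add0r [LHS]mulr1.
Qed.

Lemma Ck1_rho : Ck 1 rho.
have c : continuous rho.
 apply: (@cont_comp _ (fun s => (1 + s)^-1)); first exact: continuous_dotv.
 move=> x; apply: cvgV; first by apply: lt0r_neq0; rewrite ltr_wpDr// dotv_ge0.
 by apply: cvgD; [exact: cvg_cst|exact: cvg_id].
apply: (@Ck1I _ (fun i x => - rho x ^+ 2 * (2 * x ord0 i))) => //.
- move=> i; apply: contM; last by apply: contZ; exact: coord_continuous.
 rewrite (_ : (fun x => _) = (fun x => (-1) * (rho x * rho x))); first by apply: contZ; exact: contM.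
 by apply/funext => x; rewrite mulN1r expr2.
- by move=> i x; exact: is_derive_rho.
Qed.

Lemma xrho_sqr i x : (x ord0 i * rho x) ^+ 2 <= rho x.
rewrite exprMn [rho x ^+ 2]expr2 mulrA -[leRHS]mul1r ler_wpM2r ?(ltW (rho_gt0 x))//.
apply: le_trans (rho_dotv x); rewrite ler_wpM2r ?(ltW (rho_gt0 x))//; exact: sqr_le_dotv.
Qed.

Lemma partial_xrho i x : partial i ((fun x => x ord0 i) * rho) x = rho x - 2 * (x ord0 i * rho x) ^+ 2.
rewrite partialMx; [|exact: Ck1_coord|exact: Ck1_rho].
have [_ E1] := partial_coord i i x; have [_ E2] := is_derive_rho i x.
by rewrite [partial _ rho x]E2 [partial _ (fun _ => _) x]E1 eqxx /=; ring.
Qed.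

Lemma c1b_xrho i : c1b i ((fun x => x ord0 i) * rho).
have C1 : Ck 1 ((fun x => x ord0 i) * rho) by apply: CkM; [exact: Ck1_coord|exact: Ck1_rho].
split.
- apply: mfn_cont; exact: Ck_cont C1.
- apply: mfn_cont; exact: Ck1_partial.
- by move=> x; exact: Ck1_derivable.
exists 3 => x; have h1 := xrho_sqr i x; have h3 := rho_le1 x.
have h4 := sqr_ge0 (x ord0 i * rho x).
split; last by rewrite partial_xrho ler_norml; apply/andP; split; lra.
rewrite -[_ x]/(x ord0 i * rho x).
by rewrite ler_norml; apply/andP; split; nra.
Qed.

Lemma young_ar (m a b : R) : 0 < m -> 2 * (a * b) <= a ^+ 2 / (2 * m) + 2 * m * b ^+ 2.
move=> m0; have h := sqr_ge0 (a - 2 * m * b).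
have -> : a ^+ 2 / (2 * m) + 2 * m * b ^+ 2 = ((a - 2 * m * b) ^+ 2) / (2 * m) + 2 * (a * b).
 by field; apply: lt0r_neq0.
by pos.
Qed.

(* Vector field x / (1 + |x|^2), whose divergence is at least (N - 2) / (1 + |x|^2). *)
Lemma hardy u : H1 u -> intg (fun x => rho x * u x ^+ 2) /\
 \I_x(rho x * u x ^+ 2) <= 4 * N%:R * dg u u.
move=> Hu; have su := H1_sob Hu; have lu := sob_l2 su; have iu := l2i lu.
have mr : mfn rho by apply: mfn_cont; exact: Ck_cont Ck1_rho.
have r1 x : `|rho x| <= 1 by rewrite ger0_norm ?rho_le1// ltW// rho_gt0.
have ir := (intg_bmul mr r1 iu).1; split => //.
set H := Int _; pose z i : T -> R := (fun x => x ord0 i) * rho.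
have N0 : 0 < N%:R :> R by rewrite ltr0n; apply: leq_trans N3.
have nz i : nrm (z i * u) ^+ 2 <= H.
 have [lz _] := c1b_l2 (c1b_xrho i) lu.
 rewrite nrmE; apply: Int_le => //; first exact: l2i lz.
 by move=> x; rewrite [(z i * u) x ^+ 2]exprMn ler_wpM2r ?sqr_ge0//; exact: xrho_sqr.
have idz i : intg (fun x => partial i (z i) x * u x ^+ 2).
 have [_ mp _ [K HK]] := c1b_xrho i.
 exact: (intg_bmul mp (fun x => (HK x).2) iu).1.
have le1 : H <= \sum_i \I_x(partial i (z i) x * u x ^+ 2).
 rewrite -Int_sum//; apply: Int_le => //; first by apply: intg_sum => i _; exact: idz.
 move=> x; rewrite -mulr_suml ler_wpM2r ?sqr_ge0//.
 under eq_bigr do rewrite partial_xrho exprMn mulrA.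
 rewrite sumrB sumr_const card_ord -mulr_suml -mulr_sumr.
 have -> : \sum_(i < N) x ord0 i ^+ 2 = dotv x x by apply: eq_bigr => i _; rewrite expr2.
 rewrite -mulr_natl; have := rho_dotv x; have := rho_gt0 x.
 have h3 : 3 <= N%:R :> R by rewrite ler_nat.
 have := dotv_ge0 x; move: (dotv x x) (rho x) => b r b0 r0 br; nra.
(* Young's inequality with parameter [N]: the [N] terms [H / (2 * N)] add up to [H / 2], which the
   left side absorbs. *)
have le2 i : \I_x(partial i (z i) x * u x ^+ 2) <= H / (2 * N%:R) + 2 * N%:R * ip (Dw u i) (Dw u i).
 have -> : \I_x(partial i (z i) x * u x ^+ 2) = ip (partial i (z i) * u) u.
  by apply: Int_eq => x; rewrite expr2 mulrA.
 rewrite -[leLHS]opprK -(ibp (c1b_xrho i) su).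
 have [lz _] := c1b_l2 (c1b_xrho i) lu; have lg := sob_grad i su.
 apply: (le_trans (ler_norm _)); rewrite normrN normrM ger0_norm//.
 apply: (le_via (2 * (nrm (z i * u) * nrm (Dw u i)))); first by rewrite ler_wpM2l//; exact: ip_cs.
 apply: (le_trans (young_ar _ _ N0)); rewrite -nrm2// lerD2r.
 by apply: ler_wpM2r; [rewrite invr_ge0 mulr_ge0// ltW|exact: nz].
have : H <= H / 2 + 2 * N%:R * dg u u.
 apply: (le_trans le1); apply: (le_trans (ler_sum _ (fun i _ => le2 i))).
 rewrite big_split /= sumr_const card_ord -mulr_sumr (dgE su su) lerD2r.
 by rewrite -mulr_natl le_eqVlt; apply/orP; left; apply/eqP; field; apply: lt0r_neq0.
lra.
Qed.

(* (1 + |x|^2)^(- eta) *)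
Definition awt (eta : R) x : R := expR (- (eta * ln (1 + dotv x x))).

Lemma one_dotv x : 1 <= 1 + dotv x x.
by rewrite lerDl dotv_ge0. Qed.

Lemma awt0 : awt 0 = cst 1.
by apply/funext => x; rewrite /awt mul0r oppr0 expR0. Qed.

Lemma is_derive_awt1 (eta s : R) : 0 <= s -> is_derive s 1 (fun s => expR (- (eta * ln (1 + s))))
 (- (eta * (1 + s)^-1 * expR (- (eta * ln (1 + s))))).
move=> s0; have s1 : 0 < 1 + s by pos.
have h1 : is_derive s 1 (fun s => 1 + s) 1.
 by apply: (is_derive_eq (is_deriveD (is_derive_cst (1 : R) s 1) (is_derive_id s 1))); rewrite add0r.
have h2 : is_derive s 1 ((@ln R) \o (fun s => 1 + s)) ((1 + s)^-1 * 1).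
 by apply: is_derive1_comp; exact: is_derive1_ln.
have h3 := is_deriveN (is_deriveZ eta h2).
have h4 := @is_derive1_comp _ (@expR R) (- (eta *: ((@ln R) \o (fun s => 1 + s)))) s _ _ (is_derive_expR _) h3.
apply: (is_derive_eq h4).
by rewrite -[X in expR X]/(- (eta * ln (1 + s))) -[eta *: _]/(eta * _) mulr1; ring.
Qed.

Lemma is_derive_awt eta i x : is_derive x (ee i) (awt eta) (- (eta * rho x * awt eta x) * (2 * x ord0 i)).
apply: (@is_derive_radial (fun s => expR (- (eta * ln (1 + s))))
  (fun s => - (eta * (1 + s)^-1 * expR (- (eta * ln (1 + s)))))) => s s0.
exact: is_derive_awt1.
Qed.

Lemma continuous_awt eta : continuous (awt eta).
apply: (@cont_comp _ (fun s => expR (- (eta * ln (1 + s))))); first exact: continuous_dotv.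
by move=> x; exact: is_derive_cont_at (is_derive_awt1 eta (dotv_ge0 x)).
Qed.

Lemma Ck1_awt eta : Ck 1 (awt eta).
apply: (@Ck1I _ (fun i x => - (eta * rho x * awt eta x) * (2 * x ord0 i))).
- exact: continuous_awt.
- move=> i; apply: contM; last by apply: contZ; exact: coord_continuous.
 rewrite (_ : (fun x => _) = (fun x => (- eta) * (rho x * awt eta x))).
  apply: contZ; apply: contM; [exact: Ck_cont Ck1_rho|exact: continuous_awt].
 by apply/funext => x; ring.
- by move=> i x; exact: is_derive_awt.
Qed.

Lemma ln_dotv x : 0 <= ln (1 + dotv x x).
by apply: ln_ge0; exact: one_dotv. Qed.

Lemma awt_wgt eta : 0 <= eta -> wgt (awt eta).
move=> e0; split; first by apply: mfn_cont; exact: continuous_awt.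
move=> x; rewrite expR_ge0 /= -expR0 ler_expR oppr_le0 mulr_ge0//; exact: ln_dotv.
Qed.

(** Euler's field acts on a power of [1 + |x|^2] as multiplication by a bounded function times the
    exponent, so the error of the weight in the Pohozaev identity is of order [eta], uniformly in
    space. *)
Lemma awt_grad (eta : R) x : 0 <= eta -> `|dotv (grad (awt eta) x) x| <= 2 * eta.
move=> e0; rewrite dotv_grad.
have -> : \sum_i x ord0 i * partial i (awt eta) x = - (2 * eta * (dotv x x * rho x) * awt eta x).
 rewrite /dotv mulr_suml mulr_sumr mulr_suml -sumrN; apply: eq_bigr => i _.
 have [_ E] := is_derive_awt eta i x; rewrite [partial _ _ _]E; ring.
have /andP[a0 a1] := (awt_wgt e0).2 x.
have h1 : 0 <= dotv x x * rho x by rewrite mulr_ge0 ?dotv_ge0// ltW// rho_gt0.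
rewrite normrN ger0_norm; last by do 3?[apply: mulr_ge0 => //].
rewrite -[leRHS]mulr1 -mulrA ler_wpM2l ?mulr_ge0//.
by rewrite -[leRHS]mulr1 ler_pM// rho_dotv.
Qed.

Lemma awt_decay (eta : R) : 0 < eta -> forall e : R, 0 < e ->
 exists K : R, forall x, K < `|x| -> `|awt eta x| <= e.
move=> h0 e e0; pose L := Num.max 0 (- ln e / eta).
exists (expR L) => x xK; rewrite ger0_norm ?expR_ge0// -[leRHS]lnK// ler_expR.

have [i hi] : exists i, expR L < `|x ord0 i|.
 apply: contrapT => nE; move: xK; rewrite ltNge => /negP; apply.
 apply: norm_le_coord; first exact: expR_ge0.
 by move=> i; rewrite leNgt; apply/negP => ?; apply: nE; exists i.
have h : expR L <= 1 + dotv x x.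
 by have := sqr_le_dotv x i; rewrite -sqr_norm; nra.
have : L <= ln (1 + dotv x x) by rewrite -[leLHS]expRK ler_ln ?posrE ?expR_gt0//; apply: lt_le_trans (one_dotv x).
have : - ln e / eta <= L by rewrite le_max lexx orbT.
by move=> h1 h2; rewrite lerNl -ler_pdivrMl// mulrC (le_trans h1).
Qed.

Lemma expRN_lip (s t : R) : 0 <= s -> 0 <= t -> `|expR (- s) - expR (- t)| <= `|s - t|.
wlog st : s t / s <= t.
 move=> H s0 t0; case/orP: (le_total s t) => st; first exact: (H s t).
 by rewrite distrC [leRHS]distrC; exact: (H t s).
move=> s0 t0.
have e1 : expR (- t) <= expR (- s) by rewrite ler_expR lerN2.
rewrite ger0_norm ?subr_ge0// ler0_norm ?subr_le0// opprB.
have -> : expR (- t) = expR (- s) * expR (s - t) by rewrite -expRD; congr expR; ring.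
have h1 := expR_ge1Dx (s - t); have h2 : expR (- s) <= 1 by rewrite -expR0 ler_expR oppr_le0.
by have h3 := expR_ge0 (- s); nra.
Qed.

Lemma dotv_shift x y : 1 + dotv (x + y) (x + y) <= 2 * (1 + dotv x x) * (1 + dotv y y).
have -> : dotv (x + y) (x + y) = \sum_i (x ord0 i + y ord0 i) ^+ 2.
 by apply: eq_bigr => i _; rewrite !mxE expr2.
have h : \sum_i (x ord0 i + y ord0 i) ^+ 2 <= \sum_i (2 * (x ord0 i * x ord0 i) + 2 * (y ord0 i * y ord0 i)).
 by apply: ler_sum => i _; have := sqr_ge0 (x ord0 i - y ord0 i); nra.
rewrite big_split /= -!mulr_sumr -/(dotv x x) -/(dotv y y) in h.
have := dotv_ge0 x; have := dotv_ge0 y; nra.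
Qed.

(** [ln (1 + |x|^2)] changes under a translation by an amount that does not depend on the base point
    [y]. For small [eta] the weight is therefore nearly constant on bounded sets around any point,
    however remote, and its translates can only converge to constants. *)
Lemma awt_shift (eta : R) x y : 0 <= eta ->
 `|awt eta (x + y) - awt eta y| <= eta * ln (2 * (1 + dotv x x)).
move=> e0; have lnp (z : T) : 1 + dotv z z \is Num.pos by rewrite posrE; apply: lt_le_trans (one_dotv z).
apply: (le_trans (expRN_lip _ _)); rewrite ?mulr_ge0 ?ln_dotv//.
rewrite -mulrBr normrM (ger0_norm e0) ler_wpM2l//.
have px : 2 * (1 + dotv x x) \is Num.pos by rewrite posrE mulr_gt0// -posrE.
have le (z1 z2 : T) : 1 + dotv z1 z1 <= 2 * (1 + dotv x x) * (1 + dotv z2 z2) ->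
  ln (1 + dotv z1 z1) - ln (1 + dotv z2 z2) <= ln (2 * (1 + dotv x x)).
 move=> h; rewrite lerBlDr -lnM// ler_ln//.
 by rewrite posrE; apply: mulr_gt0; rewrite -posrE.
rewrite ler_norml lerNl opprB; apply/andP; split; apply: le; last exact: dotv_shift.
have := dotv_shift (- x) (x + y); rewrite addKr.
by have -> : dotv (- x) (- x) = dotv x x by apply: eq_bigr => i _; rewrite !mxE mulrNN.
Qed.

End hardy.

(** * Dilations in H^1 *)

Section dilation.
Local Opaque hn dg.
Implicit Types (i j : 'I_N) (t : R).

Lemma l2_dil_cvg v (s_ : nat -> R) : l2 v -> s_ n ~[n]~> (1 : R) ->
 (forall n, 2^-1 <= s_ n) -> nrm (dil (s_ n) v - v) ~[n]~> (0 : R).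
move=> lv cs s2; have s0 n : 0 < s_ n by apply: lt_le_trans (s2 n); rewrite invr_gt0.
apply/cvg0P => e e0; pose c : R := Num.sqrt (2 ^+ N) + 2.
have c0 : 0 < c by rewrite ltr_wpDl// sqrtr_ge0.
have [phi tp np] := test_dense lv (divr_gt0 e0 (mulr_gt0 (ltr0Sn R 1) c0)).
have lp := test_l2 tp; have cp := test_cont tp; have [M M0 sM] := test_supp tp.
have [B B0 HB] := supp_bounded cp sM.
have cphi : nrm (dil (s_ n) phi - phi) ~[n]~> (0 : R).
 apply: nrm_cvg0.
 have [|||||_] := @Int_dct _ _ _ mu (fun n x => (dil (s_ n) phi - phi) x ^+ 2) (cst 0)
   (fun x => (B + B) ^+ 2 * (\1_(cube (2 * M)) x * \1_(cube (2 * M)) x)).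
 - by move=> n; apply: intg_m (l2i (l2B (l2_dil (s0 n) lp) lp)).
 - exact: measurable_cst.
 - apply: aeW => x; apply: cvg_sqr0; apply/(@cvgBP _ (fun n => phi (s_ n *: x)) (phi x)).
  have : s_ n *: x ~[n]~> 1 *: x by apply: cvgZl.
  rewrite scale1r => H; apply: (cvg_comp (fun n => s_ n *: x) phi H); exact: cp.
 - by apply: intgZ; apply: l2_intgM; exact: l2_cube.
 - move=> n x; rewrite ger0_norm ?sqr_ge0// -expr2 -exprMn.
  rewrite -[leLHS]sqr_norm lerXn2r ?nnegrE ?mulr_ge0 ?ind_ge0 ?addr_ge0//.
  case: (lerP `|x| (2 * M)) => xM.
   rewrite ind1; last by apply/set_mem; exact: in_cube.
   by rewrite mulr1; apply: (le_trans (ler_normB _ _)); apply: lerD; exact: HB.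
  have z1 : phi x = 0 by apply/eqP/contraT => /sM; move: M0 xM; lra.
  have z2 : phi (s_ n *: x) = 0.
   apply/eqP/contraT => /sM; rewrite normrZ gtr0_norm// leNgt => /negP; case.
   apply: (@lt_le_trans _ _ (2^-1 * `|x|)); first by move: xM; lra.
   by rewrite ler_wpM2r.
  rewrite [(_ - _) x](_ : _ = phi (s_ n *: x) - phi x)// z1 z2 subrr normr0.
  by pos.
 by rewrite (_ : Int (cst 0) = 0)//; exact: Int0.
have [n0 Hn0] := cvg0E cphi (divr_gt0 e0 (ltr0Sn R 1)).
exists n0 => n /Hn0; rewrite !ger0_norm ?nrm_ge0// => h1.
have lvp := l2B lv lp; have ld := l2_dil (s0 n) lvp; have ldp := l2_dil (s0 n) lp.
have -> : dil (s_ n) v - v = dil (s_ n) (v - phi) + ((dil (s_ n) phi - phi) - (v - phi)).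
 apply/funext => x; rewrite /dil; fring.
have h2 : nrm (dil (s_ n) (v - phi)) <= Num.sqrt (2 ^+ N) * nrm (v - phi).
 rewrite nrm_dil// ler_wpM2r ?nrm_ge0// ler_sqrt; last by pos.
 rewrite -exprVn lerXn2r ?nnegrE ?invr_ge0 ?(ltW (s0 n))//.
 by rewrite -[leRHS]invrK lef_pV2 ?posrE ?invr_gt0.
apply: (le_trans (nrm_tri ld (l2B (l2B ldp lp) lvp))).
have h3 := nrm_triB (l2B ldp lp) lvp.
have h4 : c * nrm (v - phi) <= e / 2.
 by apply: (le_trans (ler_wpM2l (ltW c0) np)); rewrite le_eqVlt; apply/orP; left; apply/eqP; field; apply: lt0r_neq0.
have h5 := nrm_ge0 mu (v - phi).
by move: h1 h2 h3 h4; rewrite /c; lra.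
Qed.

Lemma dg_dil t v : 0 < t -> H1 v -> dg (dil t^-1 v) (dil t^-1 v) = t ^+ (N - 2) * dg v v.
move=> t0 /H1_sob sv; have ti : 0 < t^-1 by pos.
rewrite (dgE (sob_dil ti sv) (sob_dil ti sv)) (dgE sv sv) mulr_sumr; apply: eq_bigr => i _.
have lg := sob_grad i sv; have ld := l2_dil ti lg.
rewrite ipZ//; last exact: l2Z.
rewrite ipZr// ip_dil//.
have -> : t^-1 ^- N = t ^+ (N - 2) * t ^+ 2 by rewrite exprVn invrK -exprD subnK// ltnW.
by field; apply: lt0r_neq0.
Qed.

Lemma Int_dilV t (G : T -> R) : 0 < t -> intg G ->
 \I_x(G (t^-1 *: x)) = t ^+ N * Int G.
by move=> t0 iG; rewrite Int_dil ?invr_gt0// exprVn invrK. Qed.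

Lemma hn2E v : H1 v -> hn v ^+ 2 = dg v v + nrm v ^+ 2.
by move=> Hv; rewrite hn2// /hB nrm2//; exact: H1_l2. Qed.

Lemma nrm_dilV t v : 0 < t -> l2 v -> nrm (dil t^-1 v) ^+ 2 = t ^+ N * nrm v ^+ 2.
by move=> t0 lv; rewrite !nrmE -Int_dilV//; exact: l2i. Qed.

Lemma hn_dil_le t v : 0 < t <= 2 -> H1 v -> hn (dil t^-1 v) <= 2 ^+ N * hn v.
move=> /andP[t0 t2] Hv; have ti : 0 < t^-1 by pos.
have Hd := H1_dil ti Hv; have lv := H1_l2 Hv.
rewrite -ler_sqr ?nnegrE ?mulr_ge0 ?exprn_ge0 ?hn_ge0//.
rewrite exprMn !hn2E// dg_dil// nrm_dilV// mulrDr.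
have p1 : 1 <= 2 ^+ N :> R by rewrite exprn_ege1// ler1n.
have pp' : 2 ^+ N <= (2 ^+ N) ^+ 2 :> R by rewrite expr2 ler_peMl// exprn_ge0.
apply: lerD; apply: ler_wpM2r; rewrite ?dg_ge0 ?sqr_ge0//; apply: le_trans pp'.
 apply: (le_via (2 ^+ (N - 2))); first by rewrite lerXn2r ?nnegrE// ltW.
 by rewrite ler_eXn2l ?ltr1n// leq_subr.
by rewrite lerXn2r ?nnegrE// ltW.
Qed.

Lemma H1_dil_cvg w (s_ : nat -> R) : H1 w -> s_ n ~[n]~> (1 : R) ->
 (forall n, 2^-1 <= s_ n) -> hn (dil (s_ n) w - w) ~[n]~> (0 : R).
move=> Hw cs s2; have s0 n : 0 < s_ n by apply: lt_le_trans (s2 n); rewrite invr_gt0.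
have sw := H1_sob Hw; have lw := sob_l2 sw; have Hd n := H1B (H1_dil (s0 n) Hw) Hw.
suff cv : hn (dil (s_ n) w - w) ^+ 2 ~[n]~> (0 : R).
 apply/cvg0P => e e0; have [n0 Hn0] := cvg0E cv (exprn_gt0 2 e0).
 exists n0 => n /Hn0; rewrite ger0_norm ?sqr_ge0// => h1.
 by rewrite ger0_norm ?hn_ge0// -ler_sqr ?nnegrE ?hn_ge0// ltW.
have sD n := sobB (sob_dil (s0 n) sw) sw.
have E n : hn (dil (s_ n) w - w) ^+ 2 = \sum_i nrm (s_ n *: dil (s_ n) (Dw w i) - Dw w i) ^+ 2 +
  nrm (dil (s_ n) w - w) ^+ 2.
 rewrite hn2E// (dgE (sD n) (sD n)); congr (_ + _); apply: eq_bigr => i _.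
 by rewrite nrm2//; exact: (sob_grad i (sD n)).
have -> : (0 : R) = \sum_(i < N) 0 + 0 by rewrite big1// addr0.
under eq_fun do rewrite E.
apply: cvgD; last by apply: cvg_sqr0; exact: l2_dil_cvg.
apply: cvg_sum_seq => i; apply: cvg_sqr0; have lg := sob_grad i sw.
pose r n := `|s_ n - 1| * (nrm (dil (s_ n) (Dw w i) - Dw w i) + nrm (Dw w i)) + nrm (dil (s_ n) (Dw w i) - Dw w i).
apply: (@cvg0_le _ _ r); last first.
 have c1 := l2_dil_cvg lg cs s2.
 have -> : (0 : R) = `|1 - 1| * (0 + nrm (Dw w i)) + 0 by rewrite subrr normr0 mul0r addr0.
 apply: cvgD => //; apply: cvgM; last by apply: cvgD => //; exact: cvg_cst.
 by apply: cvg_norm; apply: cvgB => //; exact: cvg_cst.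
move=> n; have ld := l2_dil (s0 n) lg; rewrite ger0_norm ?nrm_ge0// /r.
have -> : s_ n *: dil (s_ n) (Dw w i) - Dw w i =
  (s_ n - 1) *: dil (s_ n) (Dw w i) + (dil (s_ n) (Dw w i) - Dw w i).
 apply/funext => x; rewrite /dil; fring.
apply: (le_trans (nrm_tri (l2Z _ ld) (l2B ld lg))); rewrite lerD2r nrmZ// ler_wpM2l//.
rewrite -{1}[dil (s_ n) (Dw w i)](subrK (Dw w i)).
exact: (nrm_tri (l2B ld lg) lg).
Qed.

Lemma H1_dil_cont w (e : R) : H1 w -> 0 < e -> exists2 d : R, 0 < d <= 2^-1 &
 forall s : R, `|s - 1| <= d -> hn (dil s w - w) <= e.
move=> Hw e0; apply: contrapT => nH.
have bad n : exists s : R, `|s - 1| <= n.+2%:R^-1 /\ e < hn (dil s w - w).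
 apply: contrapT => nb; apply: nH; exists n.+2%:R^-1.
  by rewrite invr_gt0 ltr0n /= lef_pV2 ?posrE ?ltr0n// ler_nat.
 move=> s sn; rewrite leNgt; apply/negP => lt; apply: nb; by exists s.
have [s_ Hs] := choice bad.
have cs : s_ n ~[n]~> (1 : R).
 apply/cvgBP; apply: (@cvg0_le _ _ (fun n => n.+1%:R^-1)); last exact: cvg_harmonic.
 move=> n; have [h1 _] := Hs n; apply: (le_trans h1).
 by rewrite lef_pV2 ?posrE ?ltr0n// ler_nat.
have s2 n : 2^-1 <= s_ n.
 have [h1 _] := Hs n; have h2 : n.+2%:R^-1 <= 2^-1 :> R by rewrite lef_pV2 ?posrE ?ltr0n// ler_nat.
 by move: (le_trans h1 h2); rewrite ler_norml => /andP[h3 _]; lra.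
have [n0 Hn0] := cvg0E (H1_dil_cvg Hw cs s2) e0.
have := Hn0 n0 (leqnn _); have [_] := Hs n0; rewrite ger0_norm ?hn_ge0//.
by move=> lt /(lt_le_trans lt); rewrite ltxx.
Qed.

End dilation.

(* (2 - (n + 2) t^n + n t^(n + 2)) / (1 - t)^2 is a polynomial with nonnegative coefficients
  and constant term 2. *)
Lemma dilation_profile (n : nat) (t : R) : 0 <= t ->
 2 * (1 - t) ^+ 2 <= 2 - n.+3%:R * t ^+ n.+1 + n.+1%:R * t ^+ n.+3.
move=> t0; elim: n => [|n IH].
 have -> : 2 - 3 * t ^+ 1 + 1 * t ^+ 3 = 2 * (1 - t) ^+ 2 + t * (1 - t) ^+ 2 by ring.
 by rewrite lerDl mulr_ge0// sqr_ge0.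
have -> : 2 - n.+4%:R * t ^+ n.+2 + n.+2%:R * t ^+ n.+4 =
  t * (2 - n.+3%:R * t ^+ n.+1 + n.+1%:R * t ^+ n.+3) + (1 - t) * (2 - t ^+ n.+2 * (1 + t)).
 have e4 : n.+4%:R = n%:R + 4 :> R by rewrite -addn4 natrD.
 have e3 : n.+3%:R = n%:R + 3 :> R by rewrite -addn3 natrD.
 have e2 : n.+2%:R = n%:R + 2 :> R by rewrite -addn2 natrD.
 have e1 : n.+1%:R = n%:R + 1 :> R by rewrite -addn1 natrD.
 rewrite e4 e3 e2 e1 (exprS t n.+3) (exprS t n.+2) (exprS t n.+1); ring.

suff h2 : 2 * (1 - t) ^+ 3 <= (1 - t) * (2 - t ^+ n.+2 * (1 + t)) by nra.
rewrite exprS mulrCA; case: (lerP t 1) => t1.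
 rewrite ler_wpM2l ?subr_ge0//.
 have : t ^+ n.+2 <= t by rewrite exprS ler_piMr// exprn_ile1.
 by move=> h; nra.
have h : 1 <= t ^+ n.+2 by rewrite exprn_ege1// ltW.
rewrite ler_wnM2l ?subr_le0 ?ltW//.
have := sqr_ge0 (1 - t); nra.
Qed.

Section nonlinear.
Variable f : R -> R.
Hypothesis nl : nonlin q f.
Local Notation F := (primitive0 f).

(* [lam] is the parameter of the monotonicity trick, [a] a weight whose decay at infinity
  restores compactness. *)
Definition Jf (lam : R) (V a u : T -> R) : R :=
 2^-1 * (lam * dg u u + \I_x(V x * u x ^+ 2))
 - \I_x(a x * primitive0 f (u x)).

Definition dJf (lam : R) (V a u psi : T -> R) : R :=
 lam * dg u psi + \I_x(V x * (u x * psi x))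
 - \I_x(a x * (f (u x) * psi x)).

Let cf := nl_cont nl.
Let q2 : 2 < q. exact: crit_gt2. Qed.

(** * Growth estimates for the nonlinearity *)

Section growth.
Let q0 : 0 < q. by move: q2; lra. Qed.
Let p0 : 0 < q - 1. by move: q2; lra. Qed.
Local Notation p := (q - 1).

Lemma powp_mul (t : R) : 0 <= t -> t `^ p * t = t `^ q.
by move=> t0; rewrite mulrC mulr_powRB1. Qed.

Lemma young_pow (a b : R) : 0 <= a -> 0 <= b -> a `^ p * b <= a `^ q + b `^ q.
move=> a0 b0; have [ab|ab] := leP b a.
 rewrite (le_via (a `^ p * a)) ?ler_wpM2l ?powR_ge0// powp_mul//.
 by rewrite lerDl powR_ge0.
rewrite (le_via (b `^ p * b))//; last by rewrite powp_mul// lerDr powR_ge0.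
by rewrite ler_wpM2r// powR_le// ltW.
Qed.

Lemma powRD_le (r a b : R) : 0 <= r -> 0 <= a -> 0 <= b ->
 (a + b) `^ r <= 2 `^ r * (a `^ r + b `^ r).
move=> r0 a0 b0; have [ab|ab] := leP b a.
 apply: (le_via ((2 * a) `^ r)).
 - by apply: powR_le => //; [exact: addr_ge0|move: ab; lra].
 - by rewrite powRM// ler_wpM2l// lerDl powR_ge0.
apply: (le_via ((2 * b) `^ r)).
- by apply: powR_le => //; [exact: addr_ge0|move: ab; lra].
- by rewrite powRM// ler_wpM2l// lerDr powR_ge0.
Qed.

Lemma f0E : f 0 = 0.
have h : f t @[t --> 0^'] --> (0 : R).
 have hid : t @[t --> (0 : R)^'] --> (0 : R) by apply: cvg_within_filter; exact: cvg_id.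
 have h' : (f t / t * t) @[t --> (0 : R)^'] --> (0 * 0 : R) by exact: cvgM (nl_at0 nl) hid.
 rewrite mul0r in h'; apply: cvg_trans h'; apply: near_eq_cvg; near=> t.
 by rewrite /= divfK//; near: t; exact: nbhs_dnbhs_neq.
have h2 : f t @[t --> 0^'] --> f 0 by apply: cvg_within_filter; exact: cf.
exact: (cvg_unique _ h2 h).
Unshelve. all: by end_near. Qed.

Lemma f_small (d : R) : 0 < d -> exists2 eta : R, 0 < eta & forall t, `|t| <= eta -> `|f t| <= d * `|t|.
move=> d0; have /cvgr0Pnorm_le/(_ _ d0)/nbhs_ballP[e /= e0 He] := (nl_at0 nl).
exists (e / 2); first by pos.
move=> t te; have [->|t0] := eqVneq t 0; first by rewrite f0E normr0 mulr0.
have := He t; rewrite /ball /= sub0r normrN => /(_ _ t0).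
rewrite normrM normfV ler_pdivrMr ?normr_gt0//; apply.
by rewrite (le_lt_trans te)// ltr_pdivrMr// ltr_pMr// ltr1n.
Qed.

Lemma f_large (d : R) : 0 < d -> exists2 M : R, 0 < M &
 forall t, M <= `|t| -> `|f t| <= d * `|t| `^ p.
move=> d0.
have /cvgr0Pnorm_le/(_ _ d0)[M1 [_ H1]] := (nl_pinfty nl).
have /cvgr0Pnorm_le/(_ _ d0)[M2 [_ H2]] := (nl_ninfty nl).
exists (`|M1| + `|M2| + 1); first by pos.
move=> t Mt.
have t0 : 0 < `|t| by rewrite (lt_le_trans _ Mt)// ltr_wpDl// addr_ge0.
have n1 := ler_norm M1; have n3 : - M2 <= `|M2|.
 by rewrite -normrN ler_norm.
have m1 := normr_ge0 M1; have m2 := normr_ge0 M2.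
have k : forall s : R, `| `|f s| / `|s| `^ p | <= d -> 0 < `|s| -> `|f s| <= d * `|s| `^ p.
 by move=> s + s0; rewrite ger0_norm ?divr_ge0// ler_pdivrMr ?powR_gt0.
apply: k => //; have [tp|tn] := leP 0 t.
 apply: H1; have E := ger0_norm tp; rewrite E in Mt; move: Mt n1 m2; lra.
apply: H2; have E := ltr0_norm tn; rewrite E in Mt; move: Mt n3 m1; lra.
Qed.

(** For small and for large arguments [f] is a small multiple of [|t| + |t| ^ (q - 1)]; in between
    it is bounded. The estimates that follow differ only in the quantity made to absorb the middle
    zone. *)
Lemma f_zones (d : R) : 0 < d -> exists eta B M : R, [/\ 0 < eta, 0 <= B, 0 < M &
 forall t, `|f t| <= d * (`|t| + `|t| `^ p) \/ [/\ eta <= `|t|, `|t| <= M & `|f t| <= B]].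
move=> d0; have [eta e0 He] := f_small d0; have [M M0 HM] := f_large d0.
have [B B0 HB] : exists2 B : R, 0 <= B & forall t, `|t| <= M -> `|f t| <= B.
 have : compact (f @` `[- M, M]).
  apply: continuous_compact; last exact: segment_compact.
  exact: continuous_subspaceT.
 move=> /compact_bounded[B [_ HB]]; exists (`|B| + 1) => [|t tM]; first by pos.
 apply: (HB (`|B| + 1)); first by rewrite (le_lt_trans (ler_norm B))// ltrDl.
 by exists t => //=; rewrite in_itv/= -ler_norml.
exists eta, B, M; split=> // t.
have [h|h] := leP `|t| eta.
 by left; rewrite (le_trans (He t h))// ler_wpM2l ?(ltW d0)// lerDl powR_ge0.
have [h2|h2] := leP `|t| M; last first.
 by left; rewrite (le_trans (HM t (ltW h2)))// ler_wpM2l ?(ltW d0)// lerDr.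
by right; split=> //; [exact: ltW|exact: HB].
Qed.

Lemma f_bd (d : R) : 0 < d -> exists2 C : R, 0 <= C & forall t,
 `|f t| <= d * `|t| `^ p + C * `|t|.
move=> d0; have [eta [B [M [e0 B0 M0 H]]]] := f_zones d0.
exists (d + B / eta); first by pos.
move=> t; have Be : 0 <= B / eta by pos.
have [h|[h1 h2 h3]] := H t.
 rewrite (le_trans h)// mulrDr mulrDl addrCA lerD2l// lerDl mulr_ge0//.
rewrite (le_trans h3)//.
rewrite -[leLHS](divfK (lt0r_neq0 e0)).
rewrite mulrDl addrA ler_wpDl ?addr_ge0 ?mulr_ge0 ?(ltW d0)//.
by rewrite ler_wpM2l.
Qed.

Lemma f_bd' (d : R) : 0 < d -> exists2 C : R, 0 <= C & forall t,
 `|f t| <= d * `|t| + C * `|t| `^ p.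
move=> d0; have [eta [B [M [e0 B0 M0 H]]]] := f_zones d0.
have ep : 0 < eta `^ p by pos.
exists (d + B / eta `^ p); first by pos.
move=> t; have Be : 0 <= B / eta `^ p by pos.
have [h|[h1 h2 h3]] := H t.
 rewrite (le_trans h)// mulrDr mulrDl addrA lerDl mulr_ge0// powR_ge0//.
rewrite (le_trans h3)//.
rewrite -[leLHS](divfK (lt0r_neq0 ep)).
rewrite mulrDl addrA ler_wpDl ?addr_ge0 ?mulr_ge0 ?(ltW d0)//.
by rewrite ler_wpM2l//; apply: powR_le => //; exact: ltW.
Qed.

(** The last term vanishes for [|t| <= eta]. It is thus controlled by the deviation of [u] from its
    averages once these are small, which is how vanishing is excluded. *)
Lemma f_bd0 (d : R) : 0 < d -> exists2 eta : R, 0 < eta & exists2 C : R, 0 <= C & forall t,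
 `|f t| <= d * (`|t| + `|t| `^ p) + C * pp (`|t| - eta).
move=> d0; have [eta [B [M [e0 B0 M0 H]]]] := f_zones d0.
have e20 : 0 < eta / 2 by pos.
exists (eta / 2) => //; exists (B / (eta / 2)); first by pos.
move=> t; have Be : 0 <= B / (eta / 2) by pos.
have ppp s : 0 <= pp s :> R.
 by have [h|h] := leP 0 s; [rewrite pp_pos|rewrite pp_neg// ltW].
have [h|[h1 h2 h3]] := H t.
 by rewrite (le_trans h)// lerDl mulr_ge0.
rewrite (le_trans h3)// ler_wpDl ?mulr_ge0 ?addr_ge0 ?(ltW d0)//.
rewrite -[leLHS](divfK (lt0r_neq0 e20)) ler_wpM2l//.
by rewrite pp_pos; move: h1 e0; lra.
Qed.

Lemma osc_arith (d1 P s t sp tp st stp : R) : 0 <= d1 -> 0 <= P -> 0 <= s -> 0 <= t ->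
 0 <= sp -> 0 <= tp -> st <= s + t -> stp <= P * (sp + tp) ->
 d1 * (st + stp) + d1 * (s + sp) <= d1 * (2 * P + 2) * (s + sp + tp) + d1 * (2 * P + 2) * t.
move=> d0 P0 s0 t0 sp0 tp0 h1 h2; rewrite -!mulrA -!mulrDr ler_wpM2l//.
have := mulr_ge0 P0 s0; have := mulr_ge0 P0 t0; have := mulr_ge0 P0 sp0; have := mulr_ge0 P0 tp0.
by move: s0 t0 sp0 tp0 h1 h2; lra.
Qed.

(** The critical powers, which no compactness controls, carry the small factor [d]; the large
    constant [C] is attached to [|t|], a quantity that local compactness sends to zero. Uniform
    continuity of [f] serves for small increments in the middle zone, while large increments are put
    into [C * |t|]. *)
Lemma f_osc (d : R) : 0 < d -> exists2 C : R, 0 <= C & forall s t,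
 `|f (s + t) - f s| <= d * (`|s| + `|s| `^ p + `|t| `^ p) + C * `|t|.
move=> d0; pose k := 2 * 2 `^ p + 2.
have k0 : 0 < k by rewrite ltr_wpDl// mulr_ge0// powR_ge0.
pose d1 := d / k; have d10 : 0 < d1 by rewrite divr_gt0.
have [eta [B [M [e0 B0 M0 H]]]] := f_zones d10.
have d1k : d1 * k = d by rewrite divfK// gt_eqF.
have pw : 0 <= 2 `^ p by pos.
have [sg sg0 Hsg] := heine (M + 1) cf (mulr_gt0 d10 e0).
(* With [|t| < eta / 2], either of [|s| >= eta] and [|s + t| >= eta] forces [|s| >= eta / 2], so the
   error [d1 * eta] of uniform continuity is dominated by [|s|]. *)
pose ta := Num.min sg (Num.min (eta / 2) 1).
have ta0 : 0 < ta by rewrite !lt_min sg0 ltr01 divr_gt0.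
exists (d + 2 * B / ta); first by pos.
move=> s t.
have Bt : 0 <= B / ta by pos.
have sp := powR_ge0 `|s| p; have tp := powR_ge0 `|t| p.
have s0 := normr_ge0 s; have t0 := normr_ge0 t.
have st : `|s + t| `^ p <= 2 `^ p * (`|s| `^ p + `|t| `^ p).
 apply: le_trans (powRD_le (ltW p0) s0 t0); apply: powR_le => //; first exact: ltW.
 exact: ler_normD.
have st1 := ler_normD s t.
have g : d1 * (`|s + t| + `|s + t| `^ p) + d1 * (`|s| + `|s| `^ p) <=
   d * (`|s| + `|s| `^ p + `|t| `^ p) + d * `|t|.
 by rewrite -d1k; exact: (osc_arith (ltW d10) pw s0 t0 sp tp st1 st).
have good : `|f (s + t)| <= d1 * (`|s + t| + `|s + t| `^ p) ->
  `|f s| <= d1 * (`|s| + `|s| `^ p) ->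
  `|f (s + t) - f s| <= d * (`|s| + `|s| `^ p + `|t| `^ p) + d * `|t|.
 by move=> h1 h2; rewrite (le_trans (ler_normB _ _))// (le_trans (lerD h1 h2)).
have fin : `|f (s + t) - f s| <= d * (`|s| + `|s| `^ p + `|t| `^ p) + d * `|t| ->
 `|f (s + t) - f s| <= d * (`|s| + `|s| `^ p + `|t| `^ p) + (d + 2 * B / ta) * `|t|.
 move=> h; rewrite (le_trans h)// lerD2l ler_wpM2r// lerDl.
 by pos.
have [tt|tt] := leP ta `|t|.
 have hB : B <= B / ta * `|t|.
  by rewrite -{1}[B](divfK (lt0r_neq0 ta0)) ler_wpM2l.
 have q1 : `|f (s + t)| <= d1 * (`|s + t| + `|s + t| `^ p) + B / ta * `|t|.
  have [h|[_ _ h]] := H (s + t); first by rewrite (le_trans h)// lerDl mulr_ge0.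
  by rewrite (le_trans h)// (le_trans hB)// lerDr mulr_ge0 ?(ltW d10)// addr_ge0.
 have q3 : `|f s| <= d1 * (`|s| + `|s| `^ p) + B / ta * `|t|.
  have [h|[_ _ h]] := H s; first by rewrite (le_trans h)// lerDl mulr_ge0.
  by rewrite (le_trans h)// (le_trans hB)// lerDr mulr_ge0 ?(ltW d10)// addr_ge0.
 have := ler_normB (f (s + t)) (f s).
 have E : (d + 2 * B / ta) * `|t| = d * `|t| + (B / ta * `|t| + B / ta * `|t|) by ring.
 rewrite E; move: q1 q3 g; move: (B / ta * `|t|) => bt.
 move: (d1 * (`|s + t| + _)) (d1 * (`|s| + _)) (d * (_ + _ + _)) (d * `|t|) => x1 x2 x3 x4.
 move: `|f (s + t)| `|f s| `|f (s + t) - f s| => *; lra.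
move: (tt); rewrite !lt_min => /andP[t1 /andP[t2 t3]].
have cl : `|s + t - s| <= sg by rewrite addrC addKr ltW.
have mid : eta <= `|s| \/ eta <= `|s + t| -> `|s| <= M + 1 -> `|s + t| <= M + 1 ->
  `|f (s + t) - f s| <= d * (`|s| + `|s| `^ p + `|t| `^ p) + d * `|t|.
 move=> hs s1 s2; rewrite (le_trans (Hsg _ _ s2 s1 cl))//.
 have se : eta <= 2 * `|s|.
  case: hs => [h|h]; first by move: h s0; lra.
  by move: h st1 t2; lra.
 rewrite -d1k -!(mulrA d1) -(mulrDr d1) ler_wpM2l ?(ltW d10)//; apply: (le_trans se).
 rewrite -mulrDr /k.
 have : 0 <= 2 * 2 `^ p * (`|s| + `|s| `^ p + `|t| `^ p + `|t|).
  by pos.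
 rewrite [X in _ -> _ <= X]mulrDl; move: sp tp s0 t0.
 move: (2 * 2 `^ p * _) => X1; move: (`|s| `^ p) (`|t| `^ p) `|s| `|t| => *; lra.
have st2 : `|s| <= `|s + t| + `|t| by rewrite -{1}[s](addrK t) ler_normB.
apply: fin; have [h1|[h1 h1' _]] := H (s + t); have [h2|[h2 h2' _]] := H s.
- exact: good.
- by apply: mid; [left|move: h2'; lra|move: h2' st1 t3; lra].
- by apply: mid; [right|move: h1' st2 t3; lra|move: h1'; lra].
- by apply: mid; [left|move: h2'; lra|move: h1'; lra].
Qed.

Lemma F_bd (d : R) : 0 < d -> exists2 C : R, 0 <= C & forall t,
 `|F t| <= d * `|t| `^ q + C * t ^+ 2.
move=> d0; have [C C0 HC] := f_bd d0; exists C => // t.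
have [c + E] := primitive0_mvt cf 0 t; rewrite primitive00 !subr0 in E *.
move=> ct; rewrite E normrM (le_trans (ler_wpM2r (normr_ge0 _) (HC c)))//.
rewrite mulrDl -powp_mul// mulrA lerD// ?ler_wpM2r ?ler_wpM2l ?(ltW d0) ?powR_le ?(ltW p0)//.
by rewrite -[t ^+ 2]sqr_norm expr2 mulrA ler_wpM2r// ler_wpM2l.
Qed.

Lemma F_bd' (d : R) : 0 < d -> exists2 C : R, 0 <= C & forall t,
 `|F t| <= d * t ^+ 2 + C * `|t| `^ q.
move=> d0; have [C C0 HC] := f_bd' d0; exists C => // t.
have [c + E] := primitive0_mvt cf 0 t; rewrite primitive00 !subr0 in E *.
move=> ct; rewrite E normrM (le_trans (ler_wpM2r (normr_ge0 _) (HC c)))//.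
rewrite mulrDl -powp_mul// mulrA lerD// ?ler_wpM2r ?ler_wpM2l ?powR_le ?(ltW p0)//.
by rewrite -[t ^+ 2]sqr_norm expr2 mulrA ler_wpM2r// ler_wpM2l// ltW.
Qed.

Lemma F_osc (d : R) : 0 < d -> exists2 C : R, 0 <= C & forall s t,
 `|F (s + t) - F s - f s * t| <= (d * (`|s| + `|s| `^ p + `|t| `^ p) + C * `|t|) * `|t|.
move=> d0; have [C C0 HC] := f_osc d0; exists C => // s t.
have [c + E] := primitive0_mvt cf s (s + t); rewrite E [s + t]addrC addrK => ct.
rewrite -mulrBl normrM ler_wpM2r//.
have := HC s (c - s); rewrite [s + _]addrC subrK => /le_trans -> //.
by rewrite lerD// ?ler_wpM2l ?(ltW d0)// lerD2l powR_le ?(ltW p0).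
Qed.

End growth.

(** * The energy functional and its derivative *)

Section functional.
Local Notation p := (q - 1).
Implicit Types (V a : T -> R).

Let q0 : 0 < q. by move: q2; lra. Qed.
Let p0 : 0 < p. by move: q2; lra. Qed.

Lemma mfn_H1 u : H1 u -> mfn u. by move/H1_l2/l2m. Qed.

Lemma intg_q u : H1 u -> intg (fun x => `|u x| `^ q).
move=> Hu; have [S S0 HS] := sobolev.
have s0 : 0 < hn u + 1 by rewrite ltr_wpDl// hn_ge0.
have [] // := HS u (hn u + 1) Hu s0.
rewrite (le_trans (dg_le_hn Hu))// lerXn2r ?nnegrE ?hn_ge0 ?(ltW s0)//; lra.
Qed.

Lemma q_bound : exists2 S : R, 0 < S & forall u s, H1 u -> 0 < s -> hn u <= s ->
 \I_x(`|u x| `^ q) <= S * s `^ q.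
have [S S0 HS] := sobolev; exists S => // u s Hu s0 us.
have [] // := HS u s Hu s0.
by rewrite (le_trans (dg_le_hn Hu))// lerXn2r ?nnegrE ?hn_ge0 ?(ltW s0).
Qed.

Lemma mfn_powr (r : R) u : mfn u -> mfn (fun x => `|u x| `^ r).
move=> mu_; apply: (measurableT_comp (measurable_powR r)).
by apply: measurableT_comp.
Qed.

Lemma mfn_norm u : mfn u -> mfn (fun x => `|u x|).
by move=> mu_; apply: measurableT_comp. Qed.

Lemma mfn_comp (g : R -> R) u : continuous g -> mfn u -> mfn (fun x => g (u x)).
by move=> cg mu_; apply: measurableT_comp => //; exact: continuous_measurable_fun. Qed.

Lemma intg_pp u psi : H1 u -> H1 psi -> intg (fun x => `|u x| `^ p * `|psi x|).
move=> Hu Hp; apply: (@intg_le _ _ _ mu _ (fun x => `|u x| `^ q + `|psi x| `^ q)).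
- by apply: measurable_funM; [exact: mfn_powr (mfn_H1 Hu)|exact: mfn_norm (mfn_H1 Hp)].
- by apply: intgD; exact: intg_q.
- by move=> x; rewrite ger0_norm ?mulr_ge0// young_pow.
Qed.

(** Young's inequality alone is not linear in [psi]; it is applied after scaling [psi] to norm at
    most one, which yields a bound of the critical term by [hn psi]. *)
Lemma pp_bound (M : R) : 0 < M -> exists2 C : R, 0 <= C & forall u psi, H1 u -> H1 psi ->
 hn u <= M -> \I_x(`|u x| `^ p * `|psi x|) <= C * hn psi.
move=> M0; have [S S0 HS] := q_bound.
have C0 : 0 <= S * M `^ q + S * 1 `^ q by rewrite addr_ge0 ?mulr_ge0 ?powR_ge0 ?ltW.
exists (S * M `^ q + S * 1 `^ q) => // u psi Hu Hp uM.
set C := S * M `^ q + _ in C0 *.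
have key s : hn psi < s -> \I_x(`|u x| `^ p * `|psi x|) <= C * s.
 move=> ps; have s0 : 0 < s by rewrite (le_lt_trans (hn_ge0 _) ps).
 have Hps := H1Z s^-1 Hp.
 have hps : hn (s^-1 *: psi) <= 1.
  by rewrite hnZ// gtr0_norm ?invr_gt0// mulrC ler_pdivrMr// mul1r ltW.
 have le x : `|u x| `^ p * `|psi x| <= s * (`|u x| `^ q + `|(s^-1 *: psi) x| `^ q).
  have -> : `|psi x| = s * `|(s^-1 *: psi) x|.
   have -> : (s^-1 *: psi) x = s^-1 * psi x by [].
   by rewrite normrM gtr0_norm ?invr_gt0// mulVKf// gt_eqF.
  by rewrite mulrCA ler_wpM2l ?(ltW s0)// young_pow.
 have i1 := intgD (intg_q Hu) (intg_q Hps).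
 rewrite (le_trans (Int_le (intg_pp Hu Hp) (intgZ s i1) le))//.
 rewrite IntZ// mulrC ler_wpM2r ?(ltW s0)// IntD; [|exact: intg_q..].
 by rewrite lerD// HS.
(* The estimate is known for all [s > hn psi]; letting [s] decrease to [hn psi] includes functions
   of norm zero. *)
rewrite leNgt; apply/negP => lt.
have C10 : 0 < C + 1 by pos.
set I := Int _ in key lt.
have := key (hn psi + (I - C * hn psi) / (C + 1)).
have d0 : 0 < (I - C * hn psi) / (C + 1) by rewrite divr_gt0// subr_gt0.
rewrite ltrDl d0 => /(_ isT); rewrite mulrDr leNgt => /negP; apply.
rewrite -ltrBrDl mulrA ltr_pdivrMr// mulrC ltr_pM2l ?subr_gt0//; lra.
Qed.

Lemma l1_bound u v : l2 u -> l2 v -> \I_x(`|u x| * `|v x|) <= nrm u * nrm v.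
exact: Int_norm_cs. Qed.

Lemma intg_l2n u v : l2 u -> l2 v -> intg (fun x => `|u x| * `|v x|).
by move=> lu lv; exact: l2_intgM (l2_norm lu) (l2_norm lv). Qed.

Lemma l1_hn u v : H1 u -> H1 v -> \I_x(`|u x| * `|v x|) <= hn u * hn v.
move=> Hu Hv; rewrite (le_trans (l1_bound (H1_l2 Hu) (H1_l2 Hv)))//.
by rewrite ler_pM ?nrm_ge0 ?nrm_le_hn.
Qed.

Lemma intg_f u psi : H1 u -> H1 psi -> intg (fun x => f (u x) * psi x).
move=> Hu Hp; have [C C0 HC] := f_bd ltr01.
apply: (@intg_le _ _ _ mu _ (fun x => `|u x| `^ p * `|psi x| + C * (`|u x| * `|psi x|))).
- by apply: measurable_funM; [exact: mfn_comp cf (mfn_H1 Hu)|exact: mfn_H1].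
- by apply: intgD; [exact: intg_pp|by apply: intgZ; apply: intg_l2n; exact: H1_l2].
- by move=> x; rewrite normrM mulrA -mulrDl ler_wpM2r// -[X in X + _]mul1r HC.
Qed.

Lemma intg_F u : H1 u -> intg (fun x => F (u x)).
move=> Hu; have [C C0 HC] := F_bd ltr01.
apply: (@intg_le _ _ _ mu _ (fun x => `|u x| `^ q + C * u x ^+ 2)).
- by apply: mfn_comp (mfn_H1 Hu) => //; exact: continuous_primitive0.
- by apply: intgD; [exact: intg_q|by apply: intgZ; apply: l2i; exact: H1_l2].
- by move=> x; rewrite -[X in X + _]mul1r HC.
Qed.

Lemma wgt_norm a : wgt a -> forall x, `|a x| <= 1.
by move=> [_ ha] x; have /andP[h1 h2] := ha x; rewrite ger0_norm. Qed.

Lemma pot_norm (V0 V1 : R) V : 0 <= V0 -> pot V0 V1 V -> forall x, `|V x| <= V1.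
by move=> V00 [_ hV] x; have /andP[h1 h2] := hV x; rewrite ger0_norm// (le_trans V00).
Qed.

(** The critical part costs a small multiple of [hn psi]; the remaining part contains the product
    [a * psi], which tends to zero in [L^2] along weakly null sequences when [a] decays. *)
Lemma f_int (M d : R) : 0 < M -> 0 < d -> exists2 C : R, 0 <= C & forall a u psi, wgt a ->
 H1 u -> H1 psi -> hn u <= M ->
 `|\I_x(a x * (f (u x) * psi x))| <=
  d * hn psi + C * \I_x(`|u x| * `|a x * psi x|).
move=> M0 d0; have [C1 C10 HC1] := pp_bound M0.
have d1 : 0 < d / (C1 + 1) by pos.
have [C C0 HC] := f_bd d1; exists C => // a u psi wa Hu Hp uM.
have ma := wa.1.
have mf : mfn (fun x => a x * (f (u x) * psi x)).
 by apply: measurable_funM => //; exact: intg_m (intg_f Hu Hp).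
have [lap _] := l2_bmul ma (wgt_norm wa) (H1_l2 Hp).
have i1 := intgZ (d / (C1 + 1)) (intg_pp Hu Hp).
have i2 := intgZ C (intg_l2n (H1_l2 Hu) lap).
apply: (le_trans (@Int_norm_le _ _ _ mu _ _ mf (intgD i1 i2) _)).
 move=> x; rewrite !normrM mulrCA.
 apply: (le_via ((d / (C1 + 1) * `|u x| `^ p + C * `|u x|) * (`|a x| * `|psi x|))).
  by rewrite ler_wpM2r ?mulr_ge0.
 rewrite mulrDl lerD//; last by rewrite -[leLHS]mulrA.
 by rewrite -[leLHS]mulrA ler_wpM2l ?(ltW d1)// ler_wpM2l// ler_piMl ?wgt_norm.
rewrite IntD// IntZ; last exact: intg_pp.
rewrite IntZ; last exact: intg_l2n (H1_l2 Hu) lap.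
rewrite lerD2r (le_trans (ler_wpM2l (ltW d1) (HC1 u psi Hu Hp uM)))//.
by rewrite mulrA [_ * C1]mulrC ler_wpM2r ?hn_ge0// absorb// ltW.
Qed.

Lemma f_osc_int (M d : R) : 0 < M -> 0 < d -> exists2 C : R, 0 <= C & forall u v psi,
 H1 u -> H1 v -> H1 psi -> hn u <= M -> hn v <= M ->
 \I_x(`|f (u x + v x) - f (u x)| * `|psi x|) <=
  d * hn psi + C * \I_x(`|v x| * `|psi x|).
move=> M0 d0; have [C1 C10 HC1] := pp_bound M0.
have k0 : 0 <= M + C1 + C1 by pos.
have d1 : 0 < d / (M + C1 + C1 + 1) by pos.
have [C C0 HC] := f_osc d1; exists C => // u v psi Hu Hv Hp uM vM.
set d' := d / _ in d1 HC.
have i0 := intg_l2n (H1_l2 Hu) (H1_l2 Hp).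
have i1 := intg_pp Hu Hp; have i2 := intg_pp Hv Hp.
have i3 := intg_l2n (H1_l2 Hv) (H1_l2 Hp).
have I1 := intgZ d' (intgD (intgD i0 i1) i2); have I2 := intgZ C i3.
have le x : `|f (u x + v x) - f (u x)| * `|psi x| <=
  d' * (`|u x| * `|psi x| + `|u x| `^ p * `|psi x| + `|v x| `^ p * `|psi x|) + C * (`|v x| * `|psi x|).
 rewrite -!mulrDl !mulrA -mulrDl ler_wpM2r//; exact: HC.
have If : intg (fun x => `|f (u x + v x) - f (u x)| * `|psi x|).
 apply: (@intg_le _ _ _ mu _ _ _ (intgD I1 I2)); last first.
  by move=> x; rewrite ger0_norm ?mulr_ge0.
 apply: measurable_funM; last exact: mfn_norm (mfn_H1 Hp).
 apply: mfn_norm; apply: measurable_funB; last exact: mfn_comp cf (mfn_H1 Hu).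
 exact: mfn_comp cf (mfn_H1 (H1D Hu Hv)).
rewrite (le_trans (Int_le If (intgD I1 I2) le))// IntD// IntZ; last exact: intgD (intgD i0 i1) i2.
rewrite IntZ// lerD2r IntD//; last exact: intgD.
rewrite IntD//.
have h : \I_x(`|u x| * `|psi x|) + \I_x(`|u x| `^ p * `|psi x|) +
  \I_x(`|v x| `^ p * `|psi x|) <= (M + C1 + C1) * hn psi.
 rewrite !mulrDl lerD ?HC1// lerD ?HC1// (le_trans (l1_hn Hu Hp))//.
 by rewrite ler_wpM2r ?hn_ge0.
rewrite (le_trans (ler_wpM2l (ltW d1) h))// mulrA [d' * _]mulrC ler_wpM2r ?hn_ge0//.
by rewrite absorb// ltW.
Qed.

Lemma F_osc_int (M d : R) : 0 < M -> 0 < d -> exists2 C : R, 0 <= C & forall u v,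
 H1 u -> H1 v -> hn u <= M -> hn v <= M ->
 \I_x(`|F (u x + v x) - F (u x) - f (u x) * v x|) <= d * hn v + C * hn v ^+ 2.
move=> M0 d0; have [C1 C10 HC1] := pp_bound M0.
have k0 : 0 <= M + C1 + C1 by pos.
have d1 : 0 < d / (M + C1 + C1 + 1) by pos.
have [C C0 HC] := F_osc d1; exists C => // u v Hu Hv uM vM.
set d' := d / _ in d1 HC.
have i0 := intg_l2n (H1_l2 Hu) (H1_l2 Hv).
have i1 := intg_pp Hu Hv; have i2 := intg_pp Hv Hv.
have i3 := intg_l2n (H1_l2 Hv) (H1_l2 Hv).
have I1 := intgZ d' (intgD (intgD i0 i1) i2); have I2 := intgZ C i3.
have le x : `|F (u x + v x) - F (u x) - f (u x) * v x| <=
  d' * (`|u x| * `|v x| + `|u x| `^ p * `|v x| + `|v x| `^ p * `|v x|) + C * (`|v x| * `|v x|).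
 rewrite -!mulrDl !mulrA -mulrDl; exact: HC.
have If : intg (fun x => `|F (u x + v x) - F (u x) - f (u x) * v x|).
 apply: intg_norm; apply: intgB; last exact: intg_f.
 by apply: intgB; [exact: intg_F (H1D Hu Hv)|exact: intg_F].
rewrite (le_trans (Int_le If (intgD I1 I2) le))// IntD// IntZ; last exact: intgD (intgD i0 i1) i2.
rewrite IntZ// IntD//; last exact: intgD.
rewrite IntD//.
have h : \I_x(`|u x| * `|v x|) + \I_x(`|u x| `^ p * `|v x|) +
  \I_x(`|v x| `^ p * `|v x|) <= (M + C1 + C1) * hn v.
 rewrite !mulrDl lerD ?HC1// lerD ?HC1// (le_trans (l1_hn Hu Hv))//.
 by rewrite ler_wpM2r ?hn_ge0.
rewrite lerD//; last by rewrite ler_wpM2l// expr2 l1_hn.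
rewrite (le_trans (ler_wpM2l (ltW d1) h))// mulrA [d' * _]mulrC ler_wpM2r ?hn_ge0//.
by rewrite absorb// ltW.
Qed.

Section fixed.
Variables (lam V1 : R) (V a : T -> R).
Hypothesis lam0 : 0 <= lam.
Hypothesis mV : mfn V.
Hypothesis VB : forall x, `|V x| <= V1.
Hypothesis wa : wgt a.
Local Notation J := (Jf lam V a).
Local Notation dJ := (dJf lam V a).

Let V10 : 0 <= V1. exact: le_trans (VB 0). Qed.
Let ma := wa.1.

Lemma intg_V u v : l2 u -> l2 v -> intg (fun x => V x * (u x * v x)).
by move=> lu lv; have [] := intg_bmul mV VB (l2_intgM lu lv). Qed.

Lemma V_bound u v : H1 u -> H1 v -> `|\I_x(V x * (u x * v x))| <= V1 * (hn u * hn v).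
move=> Hu Hv; have [_ h] := intg_bmul mV VB (l2_intgM (H1_l2 Hu) (H1_l2 Hv)).
rewrite (le_trans h)// ler_wpM2l// (le_trans _ (l1_hn Hu Hv))//.
by rewrite le_eqVlt; apply/orP; left; apply/eqP; apply: Int_eq => x; rewrite normrM.
Qed.

Lemma intg_af u psi : H1 u -> H1 psi -> intg (fun x => a x * (f (u x) * psi x)).
by move=> Hu Hp; have [] := intg_bmul ma (wgt_norm wa) (intg_f Hu Hp). Qed.

Lemma intg_aF u : H1 u -> intg (fun x => a x * F (u x)).
by move=> Hu; have [] := intg_bmul ma (wgt_norm wa) (intg_F Hu). Qed.

Lemma dJD u psi phi : H1 u -> H1 psi -> H1 phi -> dJ u (psi + phi) = dJ u psi + dJ u phi.
move=> Hu Hp Hf; rewrite /dJf dgDr//.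
have -> : \I_x(V x * (u x * (psi + phi) x)) =
  \I_x(V x * (u x * psi x)) + \I_x(V x * (u x * phi x)).
 rewrite -IntD; [|by apply: intg_V; exact: H1_l2..].
 by apply: Int_eq => x; rewrite -!mulrDr.
have -> : \I_x(a x * (f (u x) * (psi + phi) x)) =
  \I_x(a x * (f (u x) * psi x)) + \I_x(a x * (f (u x) * phi x)).
 rewrite -IntD; [|exact: intg_af..].
 by apply: Int_eq => x; rewrite -!mulrDr.
by ring.
Qed.

Lemma dJZ u c psi : H1 u -> H1 psi -> dJ u (c *: psi) = c * dJ u psi.
move=> Hu Hp; rewrite /dJf dgZr//.
have -> : \I_x(V x * (u x * (c *: psi) x)) = c * \I_x(V x * (u x * psi x)).
 rewrite -IntZ; last by apply: intg_V; exact: H1_l2.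
 by apply: Int_eq => x; rewrite -[(c *: psi) x]/(c * psi x); ring.
have -> : \I_x(a x * (f (u x) * (c *: psi) x)) = c * \I_x(a x * (f (u x) * psi x)).
 rewrite -IntZ; last exact: intg_af.
 by apply: Int_eq => x; rewrite -[(c *: psi) x]/(c * psi x); ring.
by ring.
Qed.

Lemma dg_hn u v : H1 u -> H1 v -> `|dg u v| <= hn u * hn v.
by move=> Hu Hv; rewrite (le_trans (dg_cs Hu Hv))// ler_pM ?bn_ge0 ?bndg_le_hn.
Qed.

Lemma dJ_bound (M : R) : 0 < M -> exists2 C : R, 0 <= C & forall u psi, H1 u -> H1 psi ->
 hn u <= M -> `|dJ u psi| <= C * hn psi.
move=> M0; have [C C0 HC] := f_int M0 ltr01.
exists (lam * M + V1 * M + (1 + C * M)).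
 by pos.
move=> u psi Hu Hp uM; rewrite /dJf (le_trans (ler_normB _ _))// mulrDl lerD//.
 rewrite (le_trans (ler_normD _ _))// mulrDl lerD//.
  rewrite normrM (ger0_norm lam0) -mulrA ler_wpM2l// (le_trans (dg_hn Hu Hp))//.
  by rewrite ler_wpM2r ?hn_ge0.
 rewrite (le_trans (V_bound Hu Hp))// -mulrA ler_wpM2l// ler_wpM2r ?hn_ge0//.
rewrite (le_trans (HC a u psi wa Hu Hp uM))// mulrDl lerD2l -mulrA ler_wpM2l//.
rewrite (le_via (\I_x(`|u x| * `|psi x|)))//.
 have [lap _] := l2_bmul ma (wgt_norm wa) (H1_l2 Hp).
 apply: Int_le; [exact: intg_l2n (H1_l2 Hu) lap|by apply: intg_l2n; exact: H1_l2|move=> x].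
 by rewrite ler_wpM2l// normrM ler_piMl ?wgt_norm.
by rewrite (le_trans (l1_hn Hu Hp))// ler_wpM2r ?hn_ge0.
Qed.

(** Beyond the linear terms, the change of the derivative is small up to an integral of
    [|v| * |psi|]. For fixed [psi] that integral vanishes along weakly null [v], so critical points
    pass to weak limits. *)
Lemma dJ_diff (M d : R) : 0 < M -> 0 < d -> exists2 C : R, 0 <= C & forall u v psi,
 H1 u -> H1 v -> H1 psi -> hn u <= M -> hn v <= M ->
 `|dJ (u + v) psi - dJ u psi - lam * dg v psi - \I_x(V x * (v x * psi x))| <=
   d * hn psi + C * \I_x(`|v x| * `|psi x|).
move=> M0 d0; have [C C0 HC] := f_osc_int M0 d0; exists C => // u v psi Hu Hv Hp uM vM.
rewrite (le_trans _ (HC u v psi Hu Hv Hp uM vM))//.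
have Huv := H1D Hu Hv.
have E : dJ (u + v) psi - dJ u psi - lam * dg v psi - \I_x(V x * (v x * psi x)) =
  - \I_x(a x * (f ((u + v) x) * psi x) - a x * (f (u x) * psi x)).
 rewrite IntB; [|exact: intg_af..].
 rewrite /dJf dgD//.
 have -> : \I_x(V x * ((u + v) x * psi x)) =
  \I_x(V x * (u x * psi x)) + \I_x(V x * (v x * psi x)).
  rewrite -IntD; [|by apply: intg_V; exact: H1_l2..].
  by apply: Int_eq => x; rewrite -mulrDr -mulrDl.
 by ring.
rewrite E normrN; apply: Int_norm_le.
- by apply: intg_m; apply: intgB; exact: intg_af.
- have := intg_norm (intgB (intg_f Huv Hp) (intg_f Hu Hp)).
 rewrite (_ : (fun x => `|f ((u + v) x) * psi x - f (u x) * psi x|) =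
  (fun x => `|f (u x + v x) - f (u x)| * `|psi x|))//.
 by apply/funext => x; rewrite -mulrBl normrM.
- move=> x; rewrite -mulrBr -mulrBl !normrM ler_piMl ?mulr_ge0// wgt_norm//.
Qed.

Lemma dJ_cont (M e : R) : 0 < M -> 0 < e -> exists2 d : R, 0 < d & forall u v psi,
 H1 u -> H1 v -> H1 psi -> hn u <= M -> hn v <= d ->
 `|dJ (u + v) psi - dJ u psi| <= e * hn psi.
move=> M0 e0; have e20 : 0 < e / 2 by pos.
have [C C0 HC] := dJ_diff M0 e20.
pose B := lam + V1 + C; have B0 : 0 <= B by rewrite !addr_ge0.
exists (Num.min M (e / 2 / (B + 1))).
 by rewrite lt_min M0 divr_gt0// ltr_wpDl.
move=> u v psi Hu Hv Hp uM; rewrite le_min => /andP[vM vd].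
have h := HC u v psi Hu Hv Hp uM vM.
have h1 := dg_hn Hv Hp; have h2 := V_bound Hv Hp; have h3 := l1_hn Hv Hp.
have h4 : lam * `|dg v psi| <= lam * (hn v * hn psi) by rewrite ler_wpM2l.
have h5 : C * \I_x(`|v x| * `|psi x|) <= C * (hn v * hn psi) by rewrite ler_wpM2l.
have h6 : B * (hn v * hn psi) <= e / 2 * hn psi.
 by rewrite mulrA ler_wpM2r ?hn_ge0// (le_trans (ler_wpM2l B0 vd))// absorb// ltW.
have t : `|dJ (u + v) psi - dJ u psi| <=
 `|dJ (u + v) psi - dJ u psi - lam * dg v psi - \I_x(V x * (v x * psi x))| +
 (lam * `|dg v psi| + `|\I_x(V x * (v x * psi x))|).
 rewrite -[lam in lam * `|_|](ger0_norm lam0) -normrM.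
 set A1 := dJ (u + v) psi - _; set A2 := lam * _; set A3 := Int _.
 have -> : `|A1| = `|(A1 - A2 - A3) + (A2 + A3)| by congr `|_|; ring.
 by rewrite (le_trans (ler_normD _ _))// lerD2l ler_normD.
rewrite (le_trans t)//.
have E : e * hn psi = e / 2 * hn psi + e / 2 * hn psi by rewrite -mulrDl -splitr.
rewrite E; move: h h2 h4 h5 h6; rewrite /B !mulrDl.
move: `|dJ (u + v) psi - _ - _ - _| (lam * `|_|) `|Int _| (lam * (_ * _)) (V1 * (_ * _))
 (C * (_ * _)) (C * Int _) (e / 2 * hn psi) => *; lra.
Qed.

(** Frechet differentiability, uniform on bounded sets: [d] depends on [M] and [e] only, so a step
    length can be fixed before the path to be deformed is known. *)
Lemma J_expand (M e : R) : 0 < M -> 0 < e -> exists2 d : R, 0 < d & forall u v,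
 H1 u -> H1 v -> hn u <= M -> hn v <= d ->
 `|J (u + v) - J u - dJ u v| <= e * hn v.
move=> M0 e0; have e20 : 0 < e / 2 by pos.
have [C C0 HC] := F_osc_int M0 e20.
pose B := lam + V1 + C; have B0 : 0 <= B by rewrite !addr_ge0.
exists (Num.min M (e / 2 / (B + 1))).
 by rewrite lt_min M0 divr_gt0// ltr_wpDl.
move=> u v Hu Hv uM; rewrite le_min => /andP[vM vd].
have Huv := H1D Hu Hv.
have h := HC u v Hu Hv uM vM.
have h1 := dg_le_hn Hv; have h2 := V_bound Hv Hv.
have E : J (u + v) - J u - dJ u v = 2^-1 * (lam * dg v v + \I_x(V x * (v x * v x)))
  - \I_x(a x * (F (u x + v x) - F (u x) - f (u x) * v x)).
 have -> : \I_x(a x * (F (u x + v x) - F (u x) - f (u x) * v x)) =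
  \I_x(a x * F ((u + v) x)) - \I_x(a x * F (u x)) -
  \I_x(a x * (f (u x) * v x)).
  rewrite -IntB; [|exact: intg_aF..]; rewrite -IntB; [|by apply: intgB; exact: intg_aF|exact: intg_af].
  by apply: Int_eq => x; rewrite -!mulrBr.
 have iV u1 u2 : H1 u1 -> H1 u2 -> intg (fun x => V x * (u1 x * u2 x)).
  by move=> H1u H2u; apply: intg_V; exact: H1_l2.
 have -> : \I_x(V x * (v x * v x)) = \I_x(V x * (u + v) x ^+ 2) -
   \I_x(V x * u x ^+ 2) - 2 * \I_x(V x * (u x * v x)).
  have i2 w : H1 w -> intg (fun x => V x * w x ^+ 2).
   by move=> Hw; have := iV w w Hw Hw; under eq_fun do rewrite -expr2.
  rewrite -IntB; [|exact: i2..]; rewrite -IntZ; last exact: iV.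
  rewrite -IntB; [|by apply: intgB; exact: i2|by apply: intgZ; exact: iV].
  by apply: Int_eq => x; rewrite -[(u + v) x]/(u x + v x); ring.
 rewrite /Jf /dJf (dgD Hu Hv Huv) (dgDr Hu Hv Hu) (dgDr Hu Hv Hv) [dg v u]dgC.
 move: (\I_x(V x * (u + v) x ^+ 2)) (\I_x(V x * u x ^+ 2))
  (\I_x(V x * (u x * v x))) (\I_x(a x * F ((u + v) x)))
  (\I_x(a x * F (u x))) (\I_x(a x * (f (u x) * v x)))
  (dg u u) (dg u v) (dg v v) => *; by field.
have [_ h3] := intg_bmul ma (wgt_norm wa)
 (intgB (intgB (intg_F Huv) (intg_F Hu)) (intg_f Hu Hv)).
rewrite mul1r in h3; have {}h3 := le_trans h3 h.
rewrite E.
have h4 : lam * dg v v <= lam * hn v ^+ 2 by rewrite ler_wpM2l.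
have h6 : B * hn v ^+ 2 <= e / 2 * hn v.
 by rewrite expr2 mulrA ler_wpM2r ?hn_ge0// (le_trans (ler_wpM2l B0 vd))// absorb// ltW.
have h7 : 0 <= lam * dg v v by rewrite mulr_ge0// dg_ge0.
rewrite (le_trans (ler_normB _ _))//.
have t : `|2^-1 * (lam * dg v v + \I_x(V x * (v x * v x)))| <=
  lam * dg v v + `|\I_x(V x * (v x * v x))|.
 rewrite normrM ger0_norm ?invr_ge0//.
 have := ler_normD (lam * dg v v) (\I_x(V x * (v x * v x))).
 by rewrite (ger0_norm h7); apply: le_trans; rewrite ler_piMl// invf_le1// ler1n.
have E2 : e * hn v = e / 2 * hn v + e / 2 * hn v by rewrite -mulrDl -splitr.
rewrite E2; rewrite -expr2 in h2; rewrite /B !mulrDl in h6.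
rewrite (le_trans (lerD t h3))// [leRHS]addrC addrCA lerD2l (le_trans _ h6)// lerD2r.
exact: lerD.
Qed.

Lemma J_cont (M e : R) : 0 < M -> 0 < e -> exists2 d : R, 0 < d & forall u v,
 H1 u -> H1 v -> hn u <= M -> hn v <= d -> `|J (u + v) - J u| <= e.
move=> M0 e0; have [d d0 Hd] := J_expand M0 ltr01; have [C C0 HC] := dJ_bound M0.
have C20 : 0 <= 1 + C by pos.
exists (Num.min d (e / (1 + C + 1))); first by rewrite lt_min d0 divr_gt0// ltr_wpDl.
move=> u v Hu Hv uM; rewrite le_min => /andP[vd vd2].
have h1 := Hd u v Hu Hv uM vd; have h2 := HC u v Hu Hv uM.
have -> : J (u + v) - J u = (J (u + v) - J u - dJ u v) + dJ u v by rewrite subrK.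
rewrite (le_trans (ler_normD _ _))// (le_trans (lerD h1 h2))// -mulrDl.
by rewrite (le_trans (ler_wpM2l C20 vd2))// absorb// ltW.
Qed.

Lemma criticalP u : critical_point J u <-> H1 u /\ forall psi, H1 psi -> dJ u psi = 0.
split=> [[Hu Hc]|[Hu Hc]]; split=> //.
 move=> psi Hp; apply/eqP; rewrite -normr_le0; apply/ler_addgt0Pr => e e0; rewrite add0r.
 pose e1 := e / 2 / (hn psi + 1).
 have hp1 : 0 < hn psi + 1 by rewrite ltr_wpDl// hn_ge0.
 have e10 : 0 < e1 by rewrite !divr_gt0.
 have [d1 d10 H1d] := Hc e1 e10.
 have Mu : 0 < hn u + 1 by rewrite ltr_wpDl// hn_ge0.
 have [d2 d20 H2d] := J_expand Mu e10.
 (* The test direction is shrunk into both neighbourhoods; by linearity the factor [t] cancels in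
    the end. *)
 pose t := Num.min d1 d2 / (hn psi + 1).
 have t0 : 0 < t by rewrite divr_gt0// lt_min d10.
 have Ht := H1Z t Hp.
 have ht : hn (t *: psi) <= Num.min d1 d2.
  by rewrite hnZ// gtr0_norm// mulrC /t absorb ?hn_ge0// le_min !ltW.
 move: ht; rewrite le_min => /andP[ht1 ht2].
 have h1 := H1d _ Ht; rewrite H1normE// in h1; have {}h1 := h1 ht1.
 have uM : hn u <= hn u + 1 by lra.
 have h2 := H2d u _ Hu Ht uM ht2.
 have h3 : `|dJ u (t *: psi)| <= e1 * hn (t *: psi) + e1 * hn (t *: psi).
  have -> : dJ u (t *: psi) = (J (u + t *: psi) - J u) - (J (u + t *: psi) - J u - dJ u (t *: psi)).
   by rewrite subKr.
  by rewrite (le_trans (ler_normB _ _))// lerD.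
 rewrite dJZ// hnZ// normrM (gtr0_norm t0) -mulrDl mulrCA ler_pM2l// in h3.
 rewrite (le_trans h3)// /e1 -mulrDl -splitr mulrC absorb ?hn_ge0// ltW//.
move=> e e0; have Mu : 0 < hn u + 1 by rewrite ltr_wpDl// hn_ge0.
have [d d0 Hd] := J_expand Mu e0; exists d => // v Hv; rewrite H1normE// => vd.
have uM : hn u <= hn u + 1 by lra.
by have := Hd u v Hu Hv uM vd; rewrite Hc// subr0.
Qed.

End fixed.
End functional.

Lemma absorb_le (K a x : R) : 0 <= K -> 0 <= a -> x <= K ->
 a / (K + 1) * x <= a.
move=> K0 a0 xK; rewrite (le_trans (ler_wpM2l _ xK)) ?divr_ge0 ?addr_ge0//.
by rewrite mulrC absorb.
Qed.

(** * Mountain pass geometry and a priori bounds *)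

Section geometry.
Variables (V0 V1 : R).
Hypothesis V00 : 0 < V0.
Implicit Types (V a : T -> R).

Lemma pot_ge V u : pot V0 V1 V -> l2 u -> V0 * nrm u ^+ 2 <= \I_x(V x * u x ^+ 2).
move=> pV lu; have VB := pot_norm (ltW V00) pV.
rewrite nrmE -IntZ; last exact: l2i lu.
apply: Int_le; first by apply: intgZ; exact: l2i lu.
 by have [] := intg_bmul pV.1 VB (l2i lu).
by move=> x; rewrite ler_wpM2r ?sqr_ge0//; have /andP[] := pV.2 x.
Qed.

Lemma pot_le V u : pot V0 V1 V -> l2 u -> \I_x(V x * u x ^+ 2) <= V1 * nrm u ^+ 2.
move=> pV lu; have VB := pot_norm (ltW V00) pV.
rewrite nrmE -IntZ; last exact: l2i lu.
apply: Int_le; last by move=> x; rewrite ler_wpM2r ?sqr_ge0//; have /andP[] := pV.2 x.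
 by have [] := intg_bmul pV.1 VB (l2i lu).
by apply: intgZ; exact: l2i lu.
Qed.

(** The mass part of [F] is kept at [V0 / 4], half of what the quadratic part offers, and the power
    part is bounded through Sobolev by the gradient alone. Hence the radius [s] refers to the
    gradient only. *)
Lemma aF_bound : exists2 C : R, 0 < C & forall a u (s : R), wgt a -> H1 u -> 0 < s ->
 dg u u <= s ^+ 2 ->
 `|\I_x(a x * F (u x))| <= V0 / 4 * nrm u ^+ 2 + C * s `^ q.
have V40 : 0 < V0 / 4 by pos.
have [C C0 HC] := F_bd' V40; have [S S0 HS] := sobolev.
exists (C * S + 1); first by pos.
move=> a u s wa Hu s0 us.
have [iq Hq] := HS u s Hu s0 us.
have lu := H1_l2 Hu.
have [_ h] := intg_bmul wa.1 (wgt_norm wa) (intg_F Hu).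
rewrite (le_trans h)// mul1r.
have i1 := intgZ (V0 / 4) (l2i lu); have i2 := intgZ C iq.
rewrite (le_trans (Int_le (intg_norm (intg_F Hu)) (intgD i1 i2) _))//.
rewrite IntD// IntZ ?IntZ//; last exact: l2i lu.
rewrite -nrmE lerD2l (le_trans (ler_wpM2l C0 Hq))// mulrA ler_wpM2r ?powR_ge0// lerDl//.
Qed.

Lemma mp_geometry : exists2 rho : R, 0 < rho & exists2 c0 : R, 0 < c0 &
 forall V a lam u, pot V0 V1 V -> wgt a -> 1 <= lam -> H1 u -> hn u <= rho ->
 c0 * hn u ^+ 2 <= Jf lam V a u.
have [C C0 HC] := aF_bound.
pose k := Num.min 2^-1 (V0 / 4).
have k0 : 0 < k by rewrite lt_min invr_gt0 ltr0n divr_gt0.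
(* At this radius [C * rho ^ (q - 2) = k / 2], so the superquadratic term takes at most half of the
   coercive one. *)
pose rho := (k / 2 / C) `^ ((q - 2)^-1).
have q20 : 0 < q - 2 by rewrite subr_gt0.
have rho0 : 0 < rho by rewrite powR_gt0 ?divr_gt0.
exists rho => //; exists (k / 2); first by pos.
move=> V a lam u pV wa lam1 Hu ur.
have lu := H1_l2 Hu.
have key s : 0 < s -> s <= rho -> hn u <= s -> k * hn u ^+ 2 <= Jf lam V a u + k / 2 * s ^+ 2.
 move=> s0 sr us.
 have ds : dg u u <= s ^+ 2.
  by rewrite (le_trans (dg_le_hn Hu))// lerXn2r ?nnegrE ?hn_ge0// ltW.
 have h1 := HC a u s wa Hu s0 ds; have h2 := pot_ge pV lu.
 have h3 : C * s `^ q <= k / 2 * s ^+ 2.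
  have -> : s `^ q = s `^ (q - 2) * s ^+ 2.
   by rewrite -powR_mulrn ?(ltW s0)// -powRD ?subrK// (gt_eqF s0) implybT.
  rewrite mulrA ler_wpM2r ?sqr_ge0// mulrC -ler_pdivlMr//.
  have -> : k / 2 / C = rho `^ (q - 2).
   by rewrite /rho -powRrM mulVf ?gt_eqF// powRr1// ltW// !divr_gt0.
  by apply: powR_le; [exact: ltW|exact: ltW|].
 have h4 : dg u u <= lam * dg u u by rewrite ler_peMl// dg_ge0.
 have h5 : k * dg u u <= 2^-1 * dg u u by rewrite ler_wpM2r ?dg_ge0// ge_min lexx.
 have h6 : k * nrm u ^+ 2 <= V0 / 4 * nrm u ^+ 2.
  by rewrite ler_wpM2r ?sqr_ge0// ge_min lexx orbT.
 have h7 := ler_norm (\I_x(a x * F (u x))).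
 rewrite hn2// /hB -nrm2// /Jf.
 move: h1 h2 h3 h4 h5 h6 h7.
 move: (Int _) (Int _) `|_| (dg u u) (lam * _) (nrm u ^+ 2) (C * _) (s ^+ 2) => *; lra.
(* [key] needs a positive [s]: the choice [s = hn u] works unless the norm is zero, where [s] tends
   to zero instead. *)
have [u0|u0] := leP (hn u) 0.
 have hu0 : hn u = 0 by apply/eqP; rewrite eq_le u0 hn_ge0.
 rewrite hu0 expr0n mulr0; apply/ler_addgt0Pr => e e0.
 pose s := Num.min rho (Num.min 1 (e / (k / 2))).
 have s0 : 0 < s by rewrite !lt_min rho0 ltr01 !divr_gt0.
 have sr : s <= rho by rewrite ge_min lexx.
 have := key s s0 sr; rewrite hu0 (ltW s0) expr0n mulr0 => /(_ isT) h.
 rewrite (le_trans h)// lerD2l mulrC -ler_pdivlMr ?divr_gt0//.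
 have s1 : s <= 1 by rewrite !ge_min lexx orbT.
 rewrite expr2 (le_via s) ?ler_piMr ?(ltW s0)//.
 by rewrite !ge_min lexx !orbT.
have := key (hn u) u0 ur (lexx _); move: (Jf _ _ _ _) (hn u ^+ 2) => *; lra.
Qed.

(** A bound of the gradient and an upper bound of the energy control the mass as well, because
    [aF_bound] leaves a fixed share of it on the left. The constant serves all [V], [a] and
    [lam >= 0] at once. *)
Lemma hn_from_dg (D E : R) : exists2 M : R, 0 < M & forall V a lam u, pot V0 V1 V -> wgt a ->
 0 <= lam -> H1 u -> dg u u <= D -> Jf lam V a u <= E -> hn u <= M.
have [C C0 HC] := aF_bound.
pose s := `|D| + 1; have s0 : 0 < s by rewrite ltr_wpDl.
have D0 : D <= s ^+ 2.
 rewrite (le_via s)//; first by rewrite (le_trans (ler_norm D))// lerDl.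
 by rewrite expr2 ler_peMr ?(ltW s0)// lerDr.
pose B := (`|E| + C * s `^ q) * 4 / V0.
have B0 : 0 <= B.
 by rewrite divr_ge0 ?(ltW V00)// mulr_ge0// addr_ge0// mulr_ge0 ?powR_ge0// ltW.
pose M := s ^+ 2 + B + 1.
have M0 : 0 < M by rewrite ltr_wpDl// addr_ge0 ?sqr_ge0.
exists M => // V a lam u pV wa lam0 Hu du JE.
have lu := H1_l2 Hu.
have h1 := HC a u s wa Hu s0 (le_trans du D0); have h2 := pot_ge pV lu.
have h3 : nrm u ^+ 2 <= B.
 rewrite ler_pdivlMr//.
 have h4 : 0 <= lam * dg u u by rewrite mulr_ge0// dg_ge0.
 have h5 := ler_norm E; have h7 := ler_norm (\I_x(a x * F (u x))).
 rewrite /Jf in JE; move: h1 h2 h4 h5 h7 JE.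
 move: (nrm u ^+ 2) (Int _) (Int _) `|Int _| (lam * _) `|E| (C * _) => *; lra.
rewrite -(@ler_pXn2r _ 2) ?nnegrE ?hn_ge0 ?(ltW M0)// hn2// /hB -nrm2//.
rewrite (le_via M)//.
 by rewrite /M ler_wpDr// lerD// (le_trans du).
rewrite expr2 ler_peMr ?(ltW M0)// /M lerDr addr_ge0 ?sqr_ge0//.
Qed.

Lemma J_bounded (M : R) : 0 < M -> exists2 C : R, 0 < C & forall V a lam u, pot V0 V1 V ->
 wgt a -> 0 <= lam <= 2 -> H1 u -> hn u <= M -> `|Jf lam V a u| <= C.
move=> M0; have [C C0 HC] := aF_bound.
pose B := M ^+ 2 + `|V1| * M ^+ 2 + (V0 / 4 * M ^+ 2 + C * M `^ q) + 1.
have B0 : 0 < B.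
 have m2 := sqr_ge0 M; have b1 : 0 <= `|V1| * M ^+ 2 by pos.
 have b2 : 0 <= V0 / 4 * M ^+ 2 by pos.
 have b3 : 0 <= C * M `^ q by rewrite mulr_ge0 ?powR_ge0// ltW.
 by rewrite ltr_wpDl// !addr_ge0.
exists B => // V a lam u pV wa /andP[lam0 lam2] Hu uM.
have lu := H1_l2 Hu.
have n2 : nrm u ^+ 2 <= M ^+ 2.
 rewrite lerXn2r ?nnegrE ?nrm_ge0 ?(ltW M0)//; exact: le_trans (nrm_le_hn Hu) uM.
have d2 : dg u u <= M ^+ 2.
 rewrite (le_trans (dg_le_hn Hu))// lerXn2r ?nnegrE ?hn_ge0 ?(ltW M0)//.
have h1 := HC a u M wa Hu M0 d2; have h2 := pot_ge pV lu; have h3 := pot_le pV lu.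
have h4 : V1 * nrm u ^+ 2 <= `|V1| * M ^+ 2.
 by rewrite (le_trans (ler_norm _))// normrM (ger0_norm (sqr_ge0 _)) ler_wpM2l.
have h5 : 0 <= V0 * nrm u ^+ 2 by rewrite mulr_ge0 ?sqr_ge0// ltW.
have h6 : V0 / 4 * nrm u ^+ 2 <= V0 / 4 * M ^+ 2 by rewrite ler_wpM2l// divr_ge0// ltW.
have h7 : lam * dg u u <= 2 * M ^+ 2 by rewrite ler_pM// dg_ge0.
have h8 : 0 <= lam * dg u u by rewrite mulr_ge0// dg_ge0.
have m2 := sqr_ge0 M.
rewrite /Jf (le_trans (ler_normB _ _))// ger0_norm; last first.
 by rewrite mulr_ge0 ?invr_ge0// addr_ge0// (le_trans h5).
rewrite /B; move: h1 h3 h4 h6 h7 m2 h5 h2; clear.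
move: (lam * _) (Int _) `|Int _| `|V1| (nrm u ^+ 2) (C * _) (M ^+ 2).
by move=> *; lra.
Qed.

(** * Compactness of bounded Palais-Smale sequences *)

Section palais_smale.
Variables (lam : R) (V a : T -> R).
Hypothesis lam1 : 1 <= lam.
Hypothesis pV : pot V0 V1 V.
Hypothesis wa : wgt a.
Hypothesis decay : decays a.
Local Notation J := (Jf lam V a).
Local Notation dJ := (dJf lam V a).

Let lam0 : 0 <= lam. exact: le_trans lam1. Qed.
Let mV := pV.1.
Let VB := pot_norm (ltW V00) pV.

(** The weak limit is critical by local compactness. Testing the difference of the equations for
    [w n] and [u] with [v n = w n - u] then gives strong convergence, since the nonlinear terms
    carry the decaying weight. The gradient bound [D] is inherited by lower semicontinuity. *)
Lemma ps_compact (u_ : nat -> T -> R) (M c D : R) (e_ : nat -> R) :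
 (forall n, H1 (u_ n)) -> (forall n, hn (u_ n) <= M) -> (forall n, dg (u_ n) (u_ n) <= D) ->
 e_ n ~[n]~> 0 ->
 (forall n psi, H1 psi -> `|dJ (u_ n) psi| <= e_ n * hn psi) ->
 J (u_ n) ~[n]~> c ->
 exists u, [/\ H1 u, forall psi, H1 psi -> dJ u psi = 0, J u = c & dg u u <= D].
move=> Hu0 HM0 HD0 e0 He0 HJ0.
have [k [u [kinc Hu wk]]] := H1_weak_compact Hu0 HM0.
pose w n := u_ (k n).
have Hw n : H1 (w n) by exact: Hu0.
have wM n : hn (w n) <= M by exact: HM0.
pose v n := w n - u.
have Hv n : H1 (v n) by exact: H1B.
have uv n : w n = u + v n by rewrite /v addrC subrK.
pose B := M + hn u + 1.
have B0 : 0 < B by rewrite ltr_wpDl// addr_ge0 ?hn_ge0// (le_trans (hn_ge0 _) (HM0 0%N)).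
have MB : M <= B by rewrite /B -addrA lerDl addr_ge0 ?hn_ge0.
have uB : hn u <= B by rewrite /B ler_wpDr// lerDr (le_trans (hn_ge0 _) (HM0 0%N)).
have vB n : hn (v n) <= B.
 by rewrite (le_trans (hn_triB (Hw n) Hu))// /B ler_wpDr// lerD2r.
have ew : e_ (k n) ~[n]~> 0 := cvg_sub kinc e0.
have cdg psi : H1 psi -> dg (v n) psi ~[n]~> 0.
 move=> Hp; rewrite (_ : (fun n => _) = (fun n => dg (w n) psi - dg u psi)).
  by apply/cvgBP; exact: wkcvg_dg.
 by apply/funext => n; rewrite dgBl.
have cV psi : H1 psi -> \I_x(V x * (v n x * psi x)) ~[n]~> 0.
 move=> Hp; have [lVp _] := l2_bmul mV VB (H1_l2 Hp).
 have E w' : H1 w' -> \I_x(V x * (w' x * psi x)) = ip w' (V * psi).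
  by move=> _; apply: Int_eq => x; rewrite mulrCA.
 rewrite (_ : (fun n => _) = (fun n => ip (w n) (V * psi) - ip u (V * psi))).
  by apply/cvgBP; exact: wkcvg_ip.
 by apply/funext => n; rewrite E// ipBl//; exact: H1_l2.
have crit psi : H1 psi -> dJ u psi = 0.
 move=> Hp; apply/eqP; rewrite -normr_le0; apply/ler_addgt0Pr => e ep; rewrite add0r.
 
 have d0 : 0 < e / 5 / (hn psi + 1) by pos.
 have e50 : 0 < e / 5 by pos.
 have [C C0 HC] := dJ_diff lam mV VB wa B0 d0.
 have c1 : (e_ (k n) * hn psi) ~[n]~> 0.
  by rewrite -[X in _ --> X](mul0r (hn psi)); apply: cvgM => //; exact: cvg_cst.
 have c2 : (lam * dg (v n) psi) ~[n]~> 0.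
  by rewrite -[X in _ --> X](mulr0 lam); apply: cvgM; [exact: cvg_cst|exact: cdg].
 have c3 := cV psi Hp.
 have c4 : (C * \I_x(`|w n x - u x| * `|psi x|)) ~[n]~> 0.
  rewrite -[X in _ --> X](mulr0 C); apply: cvgM; first exact: cvg_cst.
  by apply: (rellich_l2 Hw Hu wk wM); exact: H1_l2.
 have [n1 Hn1] := cvg0E c1 e50; have [n2 Hn2] := cvg0E c2 e50.
 have [n3 Hn3] := cvg0E c3 e50; have [n4 Hn4] := cvg0E c4 e50.
 pose n := (n1 + n2 + (n3 + n4))%N.
 have l1 : (n1 <= n)%N by rewrite /n -addnA leq_addr.
 have l2' : (n2 <= n)%N by rewrite /n -addnA addnCA leq_addr.
 have l3 : (n3 <= n)%N by rewrite /n addnCA leq_addr.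
 have l4 : (n4 <= n)%N by rewrite /n [(n3 + _)%N]addnC addnCA leq_addr.
 have h1 := le_trans (He0 (k n) psi Hp) (le_trans (ler_norm _) (Hn1 n l1)).
 have h2 := Hn2 n l2'; have h3 := Hn3 n l3.
 have h4 := le_trans (ler_norm _) (Hn4 n l4).
 have h5 := HC u (v n) psi Hu (Hv n) Hp uB (vB n).
 rewrite -uv in h5.
 have h6 : e / 5 / (hn psi + 1) * hn psi <= e / 5 by rewrite mulrC absorb ?hn_ge0// ltW.
 have h7 := le_trans h5 (lerD h6 h4).
 rewrite -[w n]/(u_ (k n)) in h7.
 have -> : dJ u psi = dJ (u_ (k n)) psi - (dJ (u_ (k n)) psi - dJ u psi - lam * dg (v n) psi
  - \I_x(V x * (v n x * psi x))) - lam * dg (v n) psi - \I_x(V x * (v n x * psi x)).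
  by move: (Int _) (dJ _ _) (dJ _ _) (lam * _) => *; ring.
 rewrite (le_trans (ler_normB _ _))// (_ : e = e / 5 + (e / 5 + e / 5) + e / 5 + e / 5); last by field.
 rewrite lerD// (le_trans (ler_normB _ _))// lerD// (le_trans (ler_normB _ _))// lerD//.
have cav : nrm (a * v n) ~[n]~> 0.
 exact: (rellich_decay Hw Hu wk wM wa.1 (wgt_norm wa) decay).
(* By [f_int]: the critical part is small with its factor, and the rest is bounded by the norm of
   [a * v n], which [rellich_decay] sends to zero. *)
have small (z : nat -> T -> R) : (forall n, H1 (z n)) -> (forall n, hn (z n) <= B) ->
  \I_x(a x * (f (z n x) * v n x)) ~[n]~> 0.
 move=> Hz zB; apply/cvg0P => e ep; have e20 : 0 < e / 2 by pos.
 have [C C0 HC] := f_int B0 (divr_gt0 e20 (ltr_wpDl (ltW B0) ltr01)).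
 have CB0 : 0 <= C * B by pos.
 have [n0 Hn0] := cvg0E cav (divr_gt0 e20 (ltr_wpDl CB0 ltr01)).
 exists n0 => n nn0; rewrite (le_trans (HC a (z n) (v n) wa (Hz n) (Hv n) (zB n)))//.
 have [lav _] := l2_bmul wa.1 (wgt_norm wa) (H1_l2 (Hv n)).
 rewrite [leRHS](splitr e) lerD//.
  by apply: absorb_le => //; exact: ltW.
 have h := Hn0 n nn0; rewrite ger0_norm ?nrm_ge0// in h.
 rewrite (le_via (C * (B * nrm (a * v n))))//.
  rewrite ler_wpM2l// (le_trans (l1_bound (H1_l2 (Hz n)) lav))// ler_wpM2r ?nrm_ge0//.
  exact: le_trans (nrm_le_hn (Hz n)) (zB n).
 by rewrite mulrA (le_trans (ler_wpM2l CB0 h))// absorb// ltW.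
pose m := Num.min 1 V0.
have m0 : 0 < m by rewrite lt_min ltr01.
(* Coercivity of the quadratic part with constant [m = min 1 V0], the two equations being
   subtracted. *)
have key n : m * hn (v n) ^+ 2 <= e_ (k n) * hn (v n) +
  `|\I_x(a x * (f (w n x) * v n x))| + `|\I_x(a x * (f (u x) * v n x))|.
 have h1 := le_trans (ler_norm _) (He0 (k n) (v n) (Hv n)).
 have h2 := crit (v n) (Hv n).
 have E : lam * dg (v n) (v n) + \I_x(V x * (v n x) ^+ 2) =
  dJ (w n) (v n) - dJ u (v n) + \I_x(a x * (f (w n x) * v n x)) -
  \I_x(a x * (f (u x) * v n x)).
  have -> : dg (v n) (v n) = dg (w n) (v n) - dg u (v n) by rewrite {1}/v dgBl.
  have -> : \I_x(V x * (v n x) ^+ 2) = \I_x(V x * (w n x * v n x)) -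
    \I_x(V x * (u x * v n x)).
   rewrite -IntB; [|by apply: (intg_V mV VB); exact: H1_l2..].
   by apply: Int_eq => x; rewrite -mulrBr -mulrBl expr2.
  rewrite /dJf.
  move: (dg _ _) (dg _ _) (\I_x(V x * (w n x * _))) (\I_x(V x * (u x * _))).
  move: (Int _) (Int _) => *; ring.
 have h3 : m * hn (v n) ^+ 2 <= lam * dg (v n) (v n) + \I_x(V x * (v n x) ^+ 2).
  rewrite hn2// /hB -nrm2; last exact: H1_l2.
  rewrite mulrDr lerD//.
   rewrite ler_wpM2r ?dg_ge0// (le_trans _ lam1)// ge_min lexx//.
  rewrite (le_trans _ (pot_ge pV (H1_l2 (Hv n))))// ler_wpM2r ?sqr_ge0// ge_min lexx orbT//.
 rewrite (le_trans h3)// E h2 subr0 lerD//; last by rewrite -normrN ler_norm.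
 by rewrite lerD// ler_norm.
have cv : hn (v n) ~[n]~> 0.
 apply/cvg0P => e ep.
 have me0 : 0 < m * e ^+ 2 / 3 by pos.
 have [n1 Hn1] := cvg0E ew (divr_gt0 me0 (ltr_wpDl (ltW B0) ltr01)).
 have [n2 Hn2] := (@cvg0P _ _).2 (small w Hw (fun n => le_trans (wM n) MB)) _ me0.
 have [n3 Hn3] := cvg0E (small (fun=> u) (fun=> Hu) (fun=> uB)) me0.
 exists (n1 + n2 + n3)%N => n nn.
 have l1 : (n1 <= n)%N by rewrite (leq_trans _ nn)// -addnA leq_addr.
 have l2' : (n2 <= n)%N by rewrite (leq_trans _ nn)// -addnA addnCA leq_addr.
 have l3 : (n3 <= n)%N by rewrite (leq_trans _ nn)// leq_addl.
 have h1 := le_trans (ler_norm _) (Hn1 n l1).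
 have h1' : e_ (k n) * hn (v n) <= m * e ^+ 2 / 3.
  rewrite (le_trans (ler_wpM2r (hn_ge0 _) h1))//.
  by apply: absorb_le => //; exact: ltW.
 rewrite ger0_norm ?hn_ge0// -(@ler_pXn2r _ 2) ?nnegrE ?hn_ge0 ?(ltW ep)//.
 rewrite -(ler_pM2l m0) (le_trans (key n))//.
 rewrite (_ : m * e ^+ 2 = m * e ^+ 2 / 3 + m * e ^+ 2 / 3 + m * e ^+ 2 / 3); last by field.
 by rewrite lerD ?Hn3// lerD ?Hn2.
exists u; split=> //.
 have c1 : J (w n) ~[n]~> c := cvg_sub kinc HJ0.
 have c2 : J (w n) ~[n]~> J u.
  apply/cvgBP; apply/cvg0P => e ep.
  have [d d0 Hd] := J_cont lam0 mV VB wa B0 ep.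
  have [n0 Hn0] := cvg0E cv d0.
  exists n0 => n nn0; rewrite uv; apply: Hd => //.
  by have := Hn0 n nn0; rewrite ger0_norm ?hn_ge0.
 exact: (cvg_unique _ c2 c1).
apply: (dg_lsc Hw Hu wk) => e ep; exists 0%N => n _.
by rewrite (le_trans (HD0 (k n)))// lerDl ltW.
Qed.

End palais_smale.
End geometry.

Lemma addrBK (Z : zmodType) (p x : Z) : p + (x - p) = x.
by rewrite addrC subrK. Qed.

(** * Mountain pass levels and the monotonicity trick *)

Section mountain_pass.
Variables (V0 V1 : R) (V a : T -> R) (tau : R).
Hypothesis V00 : 0 < V0.
Hypothesis pV : pot V0 V1 V.
Hypothesis wa : wgt a.
Hypothesis decay : decays a.
Hypothesis tau0 : 0 < tau.
Local Notation I lam := (Jf lam V a).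
Local Notation dI lam := (dJf lam V a).
Implicit Types (g : nat -> T -> R) (lam c : R).

Let mV := pV.1.
Let VB := pot_norm (ltW V00) pV.

Lemma I_lam lam lam' u : I lam' u = I lam u + (lam' - lam) / 2 * dg u u.
by rewrite /Jf; move: (Int _) (Int _) (dg u u) => *; field. Qed.

Lemma I_mono lam lam' u : H1 u -> lam <= lam' -> I lam u <= I lam' u.
move=> Hu ll; rewrite [leRHS](I_lam lam) lerDl mulr_ge0 ?dg_ge0// divr_ge0// subr_ge0//.
Qed.

Lemma I0 lam : I lam 0 = 0.
have d00 : dg (0 : T -> R) 0 = 0.
 by have := @dgZ 0 0 0 H1_0 H1_0; rewrite scale0r mul0r.
rewrite /Jf d00 mulr0 add0r !(@Int_eq _ _ _ mu _ (fun=> 0)) ?Int0 ?mulr0 ?subr0// => x.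
 by rewrite primitive00 mulr0.
by rewrite expr0n mulr0.
Qed.

Local Opaque Jf dJf hn dg.

(** The endpoint is negative for the largest parameter; as the functional increases with [lam], one
    class of paths serves the whole interval [[1, 1 + tau]]. *)
Definition gam (n : nat) g := [/\ forall i, H1 (g i), g 0%N = 0 & I (1 + tau) (g n) < 0].
Definition below lam (n : nat) g c := forall i t, (i < n)%N -> 0 <= t <= 1 ->
 I lam (seg (g i) (g i.+1) t) <= c.
(** Upper bounds along paths stand in for maxima, so no maximum has to be attained; [cc] is the
    mountain pass level. *)
Definition levels lam : set R := [set c | exists n g, gam n g /\ below lam n g c].
Definition cc lam : R := inf (levels lam).

(** After refinement with mesh [rho / 2], the path has a vertex with norm between [rho / 2] and
    [rho], where [mp_geometry] bounds the energy from below. *)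
Lemma levels_pos : exists2 b : R, 0 < b & forall lam c, 1 <= lam <= 1 + tau ->
 levels lam c -> b <= c.
have [rho rho0 [c0 c00 Hc]] := mp_geometry V1 V00.
exists (c0 * (rho / 2) ^+ 2); first by pos.
move=> lam c /andP[lam1 lamt] [n [g [[Hg g0 gn] bel]]].
have rho20 : 0 < rho / 2 by pos.
have [n' [g' [Hg' g'0 g'n' edge mesh]]] := fine_polygon n Hg rho20.
have ex : exists i, rho / 2 < hn (g' i).
 exists n'; rewrite g'n' ltNge; apply/negP => h.
 have h' : hn (g n) <= rho by move: h rho0; lra.
 have t1 : 1 <= 1 + tau by rewrite lerDl ltW.
 have := Hc V a (1 + tau) (g n) pV wa t1 (Hg n) h'.
 by rewrite leNgt => /negP; apply; rewrite (lt_le_trans gn)// mulr_ge0 ?sqr_ge0// ltW.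
(* The first vertex beyond radius [rho / 2]: its predecessor is inside, so it lies within radius
   [rho]. *)
have [i hi himin] := ex_minnP ex.
have in' : (i <= n')%N.
 apply: himin; rewrite g'n' ltNge; apply/negP => h.
 have h' : hn (g n) <= rho by move: h rho0; lra.
 have t1 : 1 <= 1 + tau by rewrite lerDl ltW.
 have := Hc V a (1 + tau) (g n) pV wa t1 (Hg n) h'.
 by rewrite leNgt => /negP; apply; rewrite (lt_le_trans gn)// mulr_ge0 ?sqr_ge0// ltW.
case: i hi himin in' => [|i] hi himin in'.
 by move: hi; rewrite g'0 g0 hn0 ltNge (ltW rho20).
have h1 : hn (g' i) <= rho / 2.
 by rewrite leNgt; apply/negP => h; have := himin _ h; rewrite ltnn.
have t1 : 0 <= (1 : R) <= 1 by rewrite ler01 lexx.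
have [m1 _] := mesh i 1 in' t1; rewrite seg1 in m1.
have h2 : hn (g' i.+1) <= rho.
 have -> : g' i.+1 = g' i + (g' i.+1 - g' i) by rewrite addrC subrK.
 rewrite (le_trans (hn_tri (Hg' i) (H1B (Hg' _) (Hg' _))))//.
 by rewrite (splitr rho) lerD.
have [k [s [kn s01 E]]] := edge i 1 in' t1; rewrite seg1 in E.
have := Hc V a lam (g' i.+1) pV wa lam1 (Hg' _) h2.
rewrite {2}E => /le_trans /(_ (bel k s kn s01)); apply: le_trans.
by rewrite ler_wpM2l ?(ltW c00)// lerXn2r ?nnegrE ?(ltW rho20) ?hn_ge0// ltW.
Qed.

Variables (n0 : nat) (g0 : nat -> T -> R) (m : R).
Hypothesis gam0 : gam n0 g0.
Hypothesis bel0 : below (1 + tau) n0 g0 m.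

Let t1 : 1 <= 1 + tau. by rewrite lerDl ltW. Qed.

Lemma levels_mono lam lam' c : lam <= lam' -> levels lam' c -> levels lam c.
move=> ll [n [g [gg bel]]]; exists n, g; split=> // i t iN t01.
have [Hg _ _] := gg.
by rewrite (le_trans (I_mono (H1_seg _ (Hg _) (Hg _)) ll))// bel.
Qed.

Lemma has_inf_levels lam : 1 <= lam <= 1 + tau -> has_inf (levels lam).
move=> lt; split.
 exists m; apply: (@levels_mono _ (1 + tau)); first by case/andP: lt.
 by exists n0, g0.
by have [b b0 Hb] := levels_pos; exists b => c; exact: Hb.
Qed.

Lemma cc_le lam c : 1 <= lam <= 1 + tau -> levels lam c -> cc lam <= c.
by move=> lt lc; apply: ge_inf => //; have [] := has_inf_levels lt. Qed.

Lemma cc_mono lam lam' : 1 <= lam -> lam <= lam' -> lam' <= 1 + tau -> cc lam <= cc lam'.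
move=> l1 ll lt.
have h' : 1 <= lam' <= 1 + tau by rewrite (le_trans l1).
have h : 1 <= lam <= 1 + tau by rewrite l1 (le_trans ll).
apply: lb_le_inf; first by have [] := has_inf_levels h'.
by move=> c lc; apply: cc_le => //; exact: levels_mono ll lc.
Qed.

Lemma cc_pos lam : 1 <= lam <= 1 + tau -> 0 < cc lam.
move=> lt; have [b b0 Hb] := levels_pos.
apply: (lt_le_trans b0); apply: lb_le_inf; first by have [] := has_inf_levels lt.
by move=> c; exact: Hb.
Qed.

Lemma cc_le_m lam : 1 <= lam <= 1 + tau -> cc lam <= m.
move=> lt; apply: cc_le => //; apply: (@levels_mono _ (1 + tau)); first by case/andP: lt.
by exists n0, g0.
Qed.

(* Jeanjean's monotonicity trick, with an elementary substitute for Lebesgue's theorem: the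
  last point where [cc lam - K * lam] is not below its initial value works. *)
Lemma slope : exists2 lam, 1 <= lam < 1 + tau & forall lam', lam < lam' -> lam' <= 1 + tau ->
 cc lam' - cc lam <= (m / tau + 1) * (lam' - lam).
pose K := m / tau + 1.
have c1 : 0 < cc 1 by apply: cc_pos; rewrite lexx.
have ct : cc (1 + tau) <= m by apply: cc_le_m; rewrite t1 lexx.
have m0 : 0 < m by rewrite (lt_le_trans c1)// cc_le_m// lexx.
have K0 : 0 < K by rewrite ltr_wpDl// divr_ge0// ltW.
pose A : set R := [set l | [/\ 1 <= l, l <= 1 + tau & cc 1 - K <= cc l - K * l]].
have A1 : A 1 by split=> //; rewrite mulr1.
have hA : has_sup A by split; [exists 1|exists (1 + tau) => l []].
pose s := sup A.
have s1 : 1 <= s by exact: ub_le_sup hA.2 _ A1.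
have st : s <= 1 + tau by apply: ge_sup => [|l []]; first by exists 1.
have As : A s.
 split=> //; apply/ler_addgt0Pr => e e0.
 have eK : 0 < e / K by pos.
 have [l Al sl] := sup_adherent eK hA.
 have ls : l <= s by exact: ub_le_sup hA.2 _ Al.
 case: Al => l1 lt h; rewrite (le_trans h)//.
 have := cc_mono l1 ls st.
 have : K * (s - l) <= e by rewrite mulrC -ler_pdivlMr//; move: sl; rewrite -/s; lra.
 move: (cc l) (cc s) => *; lra.
(* The supremum stays below [1 + tau]: the level rises by less than [m] over the interval, whereas
   [K * tau = m + tau]. *)
exists s.
 rewrite s1 lt_neqAle st andbT; apply/eqP => E.
 case: As => _ _; rewrite E => h.
 have : K * (1 + tau) - K = m + tau by rewrite /K; field; rewrite gt_eqF.
 move: h ct c1 tau0; move: (cc 1) (cc (1 + tau)) (K * _) => *; lra.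
move=> l' sl lt; rewrite leNgt; apply/negP => h.
have : l' <= s.
 apply: (ub_le_sup hA.2); split=> //; first by rewrite (le_trans s1)// ltW.
 case: As => _ _ As; move: h As; rewrite -/K; move: (cc 1) (cc s) (cc l') => *; lra.
by rewrite leNgt sl.
Qed.

Lemma normalize lam u (b : R) psi : 1 <= lam -> H1 u -> H1 psi -> b * hn psi < `|dI lam u psi| ->
 exists2 w, H1 w /\ hn w <= 1 & b <= dI lam u w.
move=> lam1 Hu Hp h.
have lam0 : 0 <= lam by exact: le_trans lam1.
have Mu : 0 < hn u + 1 by rewrite ltr_wpDl// hn_ge0.
have [C C0 HC] := dJ_bound lam0 mV VB wa Mu.
have uM : hn u <= hn u + 1 by lra.
have h2 := HC u psi Hu Hp uM.
have hp : 0 < hn psi.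
 rewrite lt_neqAle hn_ge0 andbT eq_sym; apply/eqP => E.
 by move: h h2; rewrite E !mulr0 => /lt_le_trans /[apply]; rewrite ltxx.
pose s := Num.sg (dI lam u psi) / hn psi.
exists (s *: psi).
 split; first exact: H1Z.
 rewrite hnZ// /s normrM normfV (gtr0_norm hp) mulfVK ?gt_eqF// normr_sg.
 by case: (_ == 0).
rewrite (dJZ lam mV VB wa)// /s mulrAC -normrEsg ler_pdivlMr// ltW//.
Qed.

(** Take an almost optimal path for [lam' = lam + t]. Its points with [lam]-energy above
    [cc lam - t] have bounded gradient, since the energy gap between [lam'] and [lam] is [t / 2]
    times the Dirichlet integral and at most a multiple of [t] by the slope bound. If none of the
    relevant points were almost critical, moving the high vertices along descent directions would
    produce a path below [cc lam]. *)
Lemma ps_sequence lam : 1 <= lam < 1 + tau ->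
 (forall lam', lam < lam' -> lam' <= 1 + tau ->
  cc lam' - cc lam <= (m / tau + 1) * (lam' - lam)) ->
 exists M : R, forall b : R, 0 < b -> exists u, [/\ H1 u, hn u <= M,
  dg u u <= 2 * (m / tau + 3), `|I lam u - cc lam| <= b &
  forall psi, H1 psi -> `|dI lam u psi| <= b * hn psi].
move=> /andP[lam1 lamt] slp; pose K := m / tau + 1; rewrite -/K in slp.
have lam0 : 0 <= lam by exact: le_trans lam1.
have lamI : 1 <= lam <= 1 + tau by rewrite lam1 ltW.
have c0 := cc_pos lamI.
have cm := cc_le_m lamI.
have m0 : 0 < m by exact: lt_le_trans cm.
have K0 : 0 < K by rewrite ltr_wpDl// divr_ge0// ltW.
(* This is [2 * (K + 2)]: the energy gap is at most [(K + 1) * t + t], divided by [t / 2]. *)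
pose D := 2 * (m / tau + 3).
have [M M0 HM] := hn_from_dg V1 V00 D (cc lam + (K + 1)).
exists M => b b0; apply: contrapT => H.
(* One unit ascent direction per point, chosen without any continuity: only finitely many vertices
   are moved, and edges interpolate linearly. *)
have /choice[Psi HPsi] : forall u, exists w, [/\ H1 w, hn w <= 1 &
  H1 u -> hn u <= M -> dg u u <= D -> `|I lam u - cc lam| <= b -> b <= dI lam u w].
 move=> u; have [[Hu uM uD uc]|nu] :=
  pselect [/\ H1 u, hn u <= M, dg u u <= D & `|I lam u - cc lam| <= b]; last first.
  exists 0; split; [exact: H1_0|by rewrite hn0 ler01|].
  by move=> h1 h2 h3 h4; exfalso; apply: nu.
 have [psi Hp hp] : exists2 psi, H1 psi & b * hn psi < `|dI lam u psi|.
  apply: contrapT => H2; apply: H; exists u; split=> // psi Hp.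
  by rewrite leNgt; apply/negP => h; apply: H2; exists psi.
 have [w [Hw w1] wb] := normalize lam1 Hu Hp hp.
 by exists w.
have M10 : 0 < M + 1 by pos.
have b40 : 0 < b / 4 by pos.
have [d1 d10 Hd1] := dJ_cont lam0 mV VB wa M0 b40.
have [d2 d20 Hd2] := J_expand lam0 mV VB wa M10 b40.
pose s := d2.
(* In turn: [lam + t] stays in the interval, [t] is at most [1], the endpoints of the path stay
   below the moving threshold, the energies stay within [b] of the level, and the gain [s * b / 2]
   exceeds the rise [(K + 2) * t]. *)
pose t := Num.min (Num.min (1 + tau - lam) 1) (Num.min (cc lam / 2)
 (Num.min (b / (K + 1)) (s * (b / 2) / (K + 2)))).
have lt0 : 0 < 1 + tau - lam by rewrite subr_gt0.
have K1 : 0 < K + 1 by pos.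
have K2 : 0 < K + 2 by pos.
have t0 : 0 < t by rewrite !lt_min lt0 ltr01 !divr_gt0 ?mulr_gt0 ?invr_gt0.
have tt : t <= 1 + tau - lam by rewrite /t !ge_min lexx.
have tl1 : t <= 1 by rewrite /t !ge_min lexx orbT.
have tc : t <= cc lam / 2 by rewrite /t !ge_min lexx !orbT.
have tb : (K + 1) * t <= b by rewrite mulrC -ler_pdivlMr// /t !ge_min lexx !orbT.
have ts : (K + 2) * t <= s * (b / 2) by rewrite mulrC -ler_pdivlMr// /t !ge_min lexx !orbT.
clearbody t.
pose lam' := lam + t.
have ll' : lam < lam' by rewrite ltrDl.
have lt' : lam' <= 1 + tau by rewrite /lam'; move: tt; lra.
have lamI' : 1 <= lam' <= 1 + tau by rewrite lt' andbT (le_trans lam1)// ltW.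
have sl := slp lam' ll' lt'; rewrite /lam' [lam + t]addrC addrK -/lam' in sl.
rewrite -[t + lam]addrC -/lam' in sl.
have [c [n [g [[Hg g00 gn] bel]]] cl] := inf_adherent t0 (has_inf_levels lamI').
have bel' i z : (i < n)%N -> 0 <= z <= 1 ->
  I lam' (seg (g i) (g i.+1) z) <= cc lam + (K + 1) * t.
 move=> iN z01; rewrite (le_trans (bel i z iN z01))// (le_trans (ltW cl))//.
 exact: mp_ar1 sl.
have good u : H1 u -> I lam' u <= cc lam + (K + 1) * t -> cc lam - t <= I lam u ->
  [/\ hn u <= M, dg u u <= D & `|I lam u - cc lam| <= b].
 move=> Hu h1 h2.
 have E : I lam' u = I lam u + t / 2 * dg u u.
  by rewrite (I_lam lam lam') /lam' [lam + t]addrC addrK.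
 have h3 : dg u u <= D.
  have h4 : t * dg u u <= t * D.
   have -> : t * D = 2 * ((K + 1) * t + t) by rewrite /D /K; ring.
   by rewrite E in h1; exact: mp_ar2 h1 h2.
  by rewrite ler_pM2l in h4.
 have h5 : I lam u <= cc lam + (K + 1) * t.
  by rewrite (le_trans _ h1)// I_mono// ltW.
 split=> //.
  apply: (HM V a lam u pV wa lam0 Hu h3); rewrite (le_trans h5)// lerD2l.
  by rewrite ler_piMr// ltW.
 rewrite ler_norml; apply/andP; split.
  have : t <= (K + 1) * t by rewrite ler_peMl ?(ltW t0)// lerDr ltW.
  by move=> h6; exact: mp_ar3 h2 h6 tb.
 exact: mp_ar4 h5 tb.
have t20 : 0 < t / 2 by pos.
have [d3 d30 Hd3] := J_cont lam0 mV VB wa M0 t20.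
pose ep := Num.min (Num.min d1 1) d3.
have ep0 : 0 < ep by rewrite !lt_min d10 ltr01.
have [n' [g' [Hg' g'0 g'n' edge mesh]]] := fine_polygon n Hg ep0.
(* Low vertices are left in place; only those that can reach the level move. *)
pose th i : R := if cc lam - t <= I lam (g' i) then 1 else 0.
pose gn' i : T -> R := g' i - (s * th i) *: Psi (g' i).
have HP u : H1 (Psi u) by have [] := HPsi u.
have P1 u : hn (Psi u) <= 1 by have [] := HPsi u.
have Hgn i : H1 (gn' i) by apply: H1B => //; exact: H1Z.
have th01 i : 0 <= th i <= 1 by rewrite /th; case: ifP; rewrite lexx ler01.
have unmod i : I lam (g' i) < cc lam - t -> gn' i = g' i.
 by move=> h; rewrite /gn' /th leNgt h /= mulr0 scale0r subr0.
have th1 i : cc lam - t <= I lam (g' i) -> th i = 1 by move=> h; rewrite /th h.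
have th0 i : I lam (g' i) < cc lam - t -> th i = 0 by move=> h; rewrite /th leNgt h.
have gnE i : gn' i = g' i - (s * th i) *: Psi (g' i) by [].
clearbody gn' th.
have tcc : t < cc lam by rewrite (le_lt_trans tc)// gtr_pMr// invf_lt1// ltr1n.
(* Both endpoints have energy at most [0], below [cc lam - t], so they are not moved. *)
have gam' : gam n' gn'.
 split; [exact: Hgn|by rewrite unmod g'0 g00// I0 subr_gt0|].
 rewrite unmod g'n'//.
 rewrite (le_lt_trans (I_mono (Hg n) (ltW lamt)))// (lt_trans gn)// subr_gt0//.
have vert i : (i <= n')%N -> (0 < n')%N -> exists k z, [/\ (k < n)%N, 0 <= z <= 1 & g' i = seg (g k) (g k.+1) z].
 case: i => [_ n0'|i iN _].
  have z0 : 0 <= (0 : R) <= 1 by rewrite lexx ler01.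
  by have [k [z [kn z01 E]]] := edge 0%N 0 n0' z0; exists k, z; rewrite -E seg0.
 have z1 : 0 <= (1 : R) <= 1 by rewrite ler01 lexx.
 by have [k [z [kn z01 E]]] := edge i 1 iN z1; exists k, z; rewrite -E seg1.
have modif i : (i <= n')%N -> (0 < n')%N -> cc lam - t <= I lam (g' i) ->
  hn (g' i) <= M /\ b <= dI lam (g' i) (Psi (g' i)).
 move=> iN n0' h; have [k [z [kn z01 E]]] := vert i iN n0'.
 have h1 : I lam' (g' i) <= cc lam + (K + 1) * t by rewrite E; exact: bel'.
 have [h2 h3 h4] := good _ (Hg' i) h1 h.
 by split=> //; have [_ _] := HPsi (g' i); apply.
have low : below lam n' gn' (cc lam - t / 2).
 move=> i z iN z01; have /andP[z0 z1] := z01.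
 have n0' : (0 < n')%N by exact: leq_ltn_trans iN.
 pose x := seg (g' i) (g' i.+1) z.
 have Hx : H1 x by exact: H1_seg.
 have [k [zz [kn zz01 Ex]]] := edge i z iN z01.
 have hx : I lam' x <= cc lam + (K + 1) * t by rewrite /x Ex; exact: bel'.
 have [mp mq] := mesh i z iN z01; rewrite -/x in mp mq.
 move: (mp) (mq); rewrite !le_min => /andP[/andP[mp1 mp2] mp3] /andP[/andP[mq1 mq2] mq3].
 pose cp : R := (1 - z) * th i; pose cq : R := z * th i.+1.
 have z10 : 0 <= 1 - z by rewrite subr_ge0; exact: z1.
 have /andP[ti0 ti1] := th01 i; have /andP[tj0 tj1] := th01 i.+1.
 have cp0 : 0 <= cp := mulr_ge0 z10 ti0.
 have cq0 : 0 <= cq := mulr_ge0 z0 tj0.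
 pose om := cp *: Psi (g' i) + cq *: Psi (g' i.+1).
 have Hom : H1 om by apply: H1D; exact: H1Z.
 have hom : hn om <= cp + cq.
  apply: (le_trans (hn_tri (H1Z _ (HP _)) (H1Z _ (HP _)))).
  by rewrite !(hnZ _ (HP _)) (ger0_norm cp0) (ger0_norm cq0) lerD// ler_piMr.
 have E : seg (gn' i) (gn' i.+1) z = x + (- s) *: om.
  rewrite !gnE; apply/funext => y.
  have A1 (p1 q1 tp tq Pp Pq : R) : p1 - s * tp * Pp + z * (q1 - s * tq * Pq - (p1 - s * tp * Pp)) =
   p1 + z * (q1 - p1) + (- s) * ((1 - z) * tp * Pp + z * tq * Pq) by ring.
  exact: A1.
 have c1 : cp + cq <= 1.
  have h1 : cp <= 1 - z by rewrite /cp ler_piMr// subr_ge0.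
  have h2 : cq <= z by rewrite /cq ler_piMr.
  by rewrite -[leRHS](subrK z) lerD.
 have s0 : 0 < s by [].
 have clos p : H1 p -> hn p <= M -> hn (x - p) <= d1 -> forall w, H1 w -> hn w <= 1 -> b <= dI lam p w ->
   3 / 4 * b <= dI lam x w.
  move=> Hp pM pd w Hw w1 bw.
  have := Hd1 p (x - p) w Hp (H1B Hx Hp) Hw pM pd; rewrite addrBK => h.
  have : `|dI lam x w - dI lam p w| <= b / 4.
   by rewrite (le_trans h)// ler_piMr// ltW.
  rewrite ler_norml => /andP[h1 _]; exact: mp_ar5 h1 bw.
 have in1 : (i <= n')%N by exact: ltnW.
 have dp : cp * (3 / 4 * b) <= cp * dI lam x (Psi (g' i)).
  have [h|h] := leP (cc lam - t) (I lam (g' i)); last by rewrite /cp (th0 _ h) mulr0 !mul0r.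
  have [pM pb] := modif i in1 n0' h; apply: (ler_wpM2l cp0).
  exact: (clos (g' i)).
 have dq : cq * (3 / 4 * b) <= cq * dI lam x (Psi (g' i.+1)).
  have [h|h] := leP (cc lam - t) (I lam (g' i.+1)); last by rewrite /cq (th0 _ h) mulr0 !mul0r.
  have [pM pb] := modif i.+1 iN n0' h; apply: (ler_wpM2l cq0).
  exact: (clos (g' i.+1)).
 have dom : (cp + cq) * (3 / 4 * b) <= dI lam x om.
  rewrite (dJD lam mV VB wa)//; [|exact: H1Z..].
  by rewrite !(dJZ lam mV VB wa)// mulrDl lerD.
 have xM : 0 < cp + cq -> hn x <= M + 1.
  move=> hc; have [h|h] := leP (cc lam - t) (I lam (g' i)).
   have [pM _] := modif i in1 n0' h.
   have -> : x = g' i + (x - g' i) by rewrite addrC subrK.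
   by rewrite (le_trans (hn_tri (Hg' i) (H1B Hx (Hg' i))))// lerD.
  have [h2|h2] := leP (cc lam - t) (I lam (g' i.+1)).
   have [pM _] := modif i.+1 iN n0' h2.
   have -> : x = g' i.+1 + (x - g' i.+1) by rewrite addrC subrK.
   by rewrite (le_trans (hn_tri (Hg' i.+1) (H1B Hx (Hg' i.+1))))// lerD.
  by move: hc; rewrite /cp /cq (th0 _ h) (th0 _ h2) !mulr0 addr0 ltxx.
 (* On an edge the displacement is the convex combination of those of its ends, and so is the
    guaranteed decrease, proportional to [cp + cq]. *)
 have main : I lam (x + (- s) *: om) <= I lam x - s * (cp + cq) * (b / 2).
  have [hc|hc] := leP (cp + cq) 0.
   have hc0 : cp + cq = 0 by apply/eqP; rewrite eq_le hc addr_ge0.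
   have cpz : cp = 0 by apply/eqP; rewrite eq_le cp0 andbT -hc0 lerDl.
   have cqz : cq = 0 by apply/eqP; rewrite eq_le cq0 andbT -hc0 lerDr.
   by rewrite /om cpz cqz !scale0r addr0 scaler0 addr0 addr0 mulr0 mul0r subr0.
  have hs : hn ((- s) *: om) <= d2.
   rewrite hnZ// normrN gtr0_norm// -[leRHS]mulr1 ler_wpM2l ?(ltW s0)//.
   exact: le_trans hom c1.
  have := Hd2 x ((- s) *: om) Hx (H1Z _ Hom) (xM hc) hs.
  rewrite ler_norml => /andP[_]; rewrite (dJZ lam mV VB wa)// hnZ// normrN (gtr0_norm s0).
  have e1 : s * hn om <= s * (cp + cq) by rewrite ler_wpM2l// ltW.
  have e2 : b / 4 * (s * hn om) <= b / 4 * (s * (cp + cq)) by rewrite ler_wpM2l// ltW.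
  have e3 : s * ((cp + cq) * (3 / 4 * b)) <= s * dI lam x om by rewrite ler_wpM2l// ltW.
  exact: mp_ar6 e2 e3.
 rewrite E (le_trans main)//.
 have [h|h] := leP (cc lam - t / 2) (I lam x); last first.
  rewrite (le_trans _ (ltW h))// gerBl mulr_ge0 ?mulr_ge0 ?addr_ge0 ?divr_ge0 ?(ltW s0) ?(ltW b0)//.
 have ht : cc lam - t <= I lam x by rewrite (le_trans _ h)// lerD2l lerN2 ler_pdivrMr// ler_peMr ?(ltW t0)// ler1n.
 have [xM' _ _] := good x Hx hx ht.
 have near p : H1 p -> hn (x - p) <= d3 -> cc lam - t <= I lam p.
  move=> Hp hp; have hp' : hn (p - x) <= d3.
   by rewrite -opprB -scaleN1r hnZ ?normrN1 ?mul1r//; exact: H1B.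
  have := Hd3 x (p - x) Hx (H1B Hp Hx) xM' hp'; rewrite addrBK ler_norml => /andP[h1 _].
  exact: mp_ar7 h1 h.
 (* Near the top of the path the mesh forces both ends of the edge above the threshold, so the full
    decrease is available. *)
 have cE : cp + cq = 1.
  by rewrite /cp /cq (th1 _ (near _ (Hg' i) mp3)) (th1 _ (near _ (Hg' i.+1) mq3)) !mulr1 subrK.
 rewrite cE mulr1.
 have h5 : I lam x <= cc lam + (K + 1) * t by rewrite (le_trans _ hx)// I_mono// ltW.
 exact: mp_ar8 h5 ts t0.
have : cc lam <= cc lam - t / 2 by apply: cc_le => //; exists n', gn'.
by rewrite leNgt gtrBl t20.
Qed.

Theorem mp_critical : exists lam u, [/\ 1 <= lam <= 1 + tau, H1 u,
 forall psi, H1 psi -> dI lam u psi = 0, 0 < I lam u <= m & dg u u <= 2 * (m / tau + 3)].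
have [lam lamI slp] := slope; have [M HM] := ps_sequence lamI slp.
have /choice[u_ Hu] : forall n : nat, exists u, [/\ H1 u, hn u <= M,
  dg u u <= 2 * (m / tau + 3), `|I lam u - cc lam| <= n.+1%:R^-1 &
  forall psi, H1 psi -> `|dI lam u psi| <= n.+1%:R^-1 * hn psi].
 by move=> n; apply: HM; rewrite invr_gt0.
have lam1 : 1 <= lam by case/andP: lamI.
have lamI' : 1 <= lam <= 1 + tau by case/andP: lamI => -> /ltW.
have cI : I lam (u_ n) ~[n]~> cc lam.
 apply/cvgBP; apply: (@cvg0_le _ _ (fun n => n.+1%:R^-1)); last exact: cvg_harmonic.
 by move=> n; have [] := Hu n.
have [u [H1u cu Iu du]] := @ps_compact _ _ V00 lam V a lam1 pV wa decay u_ M (cc lam) _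
 (fun n => n.+1%:R^-1) (fun n => let: And5 h _ _ _ _ := Hu n in h)
 (fun n => let: And5 _ h _ _ _ := Hu n in h) (fun n => let: And5 _ _ h _ _ := Hu n in h)
 cvg_harmonic (fun n => let: And5 _ _ _ _ h := Hu n in h) cI.
exists lam, u; split=> //.
by rewrite Iu cc_pos// cc_le_m.
Qed.

End mountain_pass.

Lemma powR_continuous_at (al y : R) : 0 < y ->
 {for y, continuous (fun z => z `^ al)}.
by move=> y0; exact: is_derive_cont_at (is_derive1_powR al y0).
Qed.

(** * Bounded smooth truncations of powers *)

Section truncated_power.
Context (k : R).
Hypothesis k0 : 0 < k.
Implicit Types t al : R.

(** [br] is a bounded smooth truncation of [1 + t ^ 2], which it approaches as [k -> 0]; [bz] is its
    logarithmic derivative [t * br' / br], with values in [[0, 2]] whatever [k] is. Thus [tp al] is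
    an admissible substitute for [t * (1 + t ^ 2) ^ al], and its derivative is comparable with
    [br ^ al]. *)
Definition bw t : R := (1 + k * t ^+ 2)^-1.
Definition br t : R := 1 + t ^+ 2 * bw t.
Definition bz t : R := 2 * t ^+ 2 * bw t ^+ 2 / br t.

Let d0 t : 0 < 1 + k * t ^+ 2.
by rewrite ltr_wpDr// mulr_ge0 ?sqr_ge0// ltW. Qed.

Lemma bw_bd t : 0 < bw t <= 1.
by rewrite invr_gt0 d0 invf_le1 ?d0// lerDl mulr_ge0 ?sqr_ge0// ltW. Qed.

Lemma br_ge1 t : 1 <= br t.
by rewrite lerDl mulr_ge0 ?sqr_ge0//; have /andP[/ltW] := bw_bd t. Qed.

Lemma br_gt0 t : 0 < br t. exact: lt_le_trans (br_ge1 t). Qed.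

Lemma br_le t : br t <= 1 + k^-1.
rewrite lerD2l /bw ler_pdivrMr ?d0// mulrDr mulr1 mulrA mulVf ?gt_eqF// mul1r.
by pos.
Qed.

Lemma br_le2 t : br t <= 1 + t ^+ 2.
by rewrite lerD2l ler_piMr ?sqr_ge0//; have /andP[] := bw_bd t. Qed.

Lemma bz_bd t : 0 <= bz t <= 2.
have /andP[w0 w1] := bw_bd t.
apply/andP; split.
 by rewrite divr_ge0 ?(ltW (br_gt0 t))// mulr_ge0 ?sqr_ge0// mulr_ge0 ?sqr_ge0.
rewrite ler_pdivrMr ?br_gt0// -mulrA ler_wpM2l// /br.
rewrite (le_via (t ^+ 2 * bw t))//; last by rewrite lerDr.
by rewrite ler_wpM2l ?sqr_ge0// expr2 ler_piMr// ltW.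
Qed.

Lemma is_derive_sqr t : is_derive t 1 (fun s : R => s ^+ 2) (2 * t).
apply: (@is_derive_quad _ _ _ 1) => h.
by rewrite mul1r (_ : _ - _ = h ^+ 2) ?ger0_norm ?sqr_ge0//; ring.
Qed.

Lemma is_derive_bw t : is_derive t 1 bw (- (2 * k * t) * bw t ^+ 2).
have h1 : is_derive t 1 (fun s : R => 1 + k * s ^+ 2) (2 * k * t).
 apply: (@is_derive_quad _ _ _ k) => h.
 rewrite (_ : _ - _ = k * h ^+ 2); last by ring.
 by rewrite normrM (gtr0_norm k0) ger0_norm ?sqr_ge0.
have := @is_deriveV _ (fun s : R => 1 + k * s ^+ 2) t (2 * k * t) 1 (lt0r_neq0 (d0 t)) h1.
move=> h; apply: (is_derive_eq h).
by rewrite /GRing.scale /= /bw exprVn mulrC mulNr mulrN.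
Qed.

Lemma is_derive_br t : is_derive t 1 br (2 * t * bw t ^+ 2).
have h := is_deriveD (is_derive_cst (1 : R) t 1) (is_deriveM (is_derive_sqr t) (is_derive_bw t)).
apply: (is_derive_eq h); rewrite /GRing.scale /= /bw.
by field; exact: lt0r_neq0.
Qed.

Lemma is_derive_brp al t : is_derive t 1 (fun s => br s `^ al)
 (al * br t `^ (al - 1) * (2 * t * bw t ^+ 2)).
exact: is_derive1_comp (is_derive1_powR al (br_gt0 t)) (is_derive_br t). Qed.

Definition tp al t : R := t * br t `^ al.
Definition dtp al t : R := br t `^ al * (1 + al * bz t).

Lemma is_derive_tp al t : is_derive t 1 (tp al) (dtp al t).
have h := is_deriveM (is_derive_id t 1) (is_derive_brp al t).
apply: (is_derive_eq h); rewrite /GRing.scale /= /dtp /bz.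
have -> : br t `^ al = br t `^ (al - 1) * br t.
 rewrite -{3}(powRr1 (ltW (br_gt0 t))) -powRD ?subrK//.
 by rewrite (gt_eqF (br_gt0 t)) implybT.
by field; exact: lt0r_neq0 (br_gt0 t).
Qed.

Lemma continuous_dtp al : continuous (dtp al).
have cw := is_derive_cont is_derive_bw; have cr := is_derive_cont is_derive_br.
have cs := is_derive_cont is_derive_sqr.
move=> t; rewrite /continuous_at /dtp; apply: cvgM.
 exact: (is_derive_cont (is_derive_brp al)).
apply: cvgD; first exact: cvg_cst.
apply: cvgM; first exact: cvg_cst.
rewrite /bz; apply: cvgM; last by apply: cvgV; [exact: lt0r_neq0 (br_gt0 t)|exact: cr].
apply: cvgM; first by apply: cvgM; [exact: cvg_cst|exact: cs].
have E : (fun s => bw s ^+ 2) = (fun s => bw s * bw s) by apply/funext => s; rewrite expr2.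
by rewrite E expr2; apply: cvgM; exact: cw.
Qed.

Lemma dtp_bd al t : 0 <= al -> br t `^ al <= dtp al t <= (1 + 2 * al) * br t `^ al.
move=> a0; have /andP[z0 z2] := bz_bd t; have p0 := powR_ge0 (br t) al.
apply/andP; split; first by rewrite ler_peMr// lerDl mulr_ge0.
by rewrite /dtp mulrC ler_wpM2r// lerD2l mulrC ler_wpM2r.
Qed.

Lemma dtp_bounded al : 0 <= al -> forall t, `|dtp al t| <= (1 + 2 * al) * (1 + k^-1) `^ al.
move=> a0 t; have /andP[h1 h2] := dtp_bd t a0.
rewrite ger0_norm ?(le_trans (powR_ge0 _ _) h1)// (le_trans h2)// ler_wpM2l ?addr_ge0 ?mulr_ge0//.
by apply: powR_le => //; [exact: ltW (br_gt0 t)|exact: br_le].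
Qed.

End truncated_power.

Lemma bk_ar (d y z : R) : d <= y + z -> y <= (d + 1) / 2 -> d <= 1 + 2 * z.
lra. Qed.

(** * Square integrability of the nonlinear term *)

Section brezis_kato.
Variables (V0 V1 lam : R) (V a u : T -> R).
Hypothesis V00 : 0 < V0.
Hypothesis pV : pot V0 V1 V.
Hypothesis wa : wgt a.
Hypothesis lam1 : 1 <= lam.
Hypothesis Hu : H1 u.
Hypothesis crit : forall psi, H1 psi -> dJf lam V a u psi = 0.

Let s : R := q / 2 - 1.
Let s0 : 0 <= s. by rewrite /s; move: q2; lra. Qed.
Let s20 : 0 <= s / 2. by pos. Qed.

Lemma powq1 (x : R) : 0 <= x -> x `^ (q - 1) = x `^ (q - 2) * x.
have q1 : 0 < q - 1 by move: q2; lra.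
move=> x0; rewrite mulrC -(mulr_powRB1 x0 q1); congr (_ * _ `^ _).
by rewrite -addrA -opprD.
Qed.

Lemma powq2 (x : R) : 0 <= x -> x `^ (q - 2) * x ^+ 2 = x `^ q.
move=> x0; rewrite -powR_mulrn// -powRD ?subrK//.
by rewrite (gt_eqF (lt_trans _ q2)).
Qed.

Lemma young2 (al be : R) : 0 <= al -> 0 <= be -> al `^ (q - 2) * be ^+ 2 <= al `^ q + be `^ q.
move=> a0 b0; have qE := powq2.
have q20 : 0 <= q - 2 by rewrite subr_ge0 ltW.
have [ab|ab] := leP be al.
 rewrite (le_via (al `^ (q - 2) * al ^+ 2))//; last by rewrite qE// lerDl powR_ge0.
 by rewrite ler_wpM2l ?powR_ge0// lerXn2r.
rewrite (le_via (be `^ (q - 2) * be ^+ 2))//; last by rewrite qE// lerDr powR_ge0.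
by rewrite ler_wpM2r ?sqr_ge0// powR_le// ltW.
Qed.

(** The equation is tested with [G = u * br ^ s], for which [u * G = g ^ 2] and the gradient of [g]
    is bounded by the product of those of [u] and [G]. The exponent [s = q / 2 - 1] is the largest
    for which [u ^ 2 * (1 + u ^ 2) ^ s] is of order [|u| ^ q] and so already integrable. The bound
    does not depend on the truncation [k]. *)
Lemma bk_step : exists2 B : R, 0 <= B & forall k : R, 0 < k ->
 intg (fun x => `|tp k (s / 2) (u x)| `^ q) /\
 \I_x(`|tp k (s / 2) (u x)| `^ q) <= B.
have [S S0 HS] := sobolev.
have lu := H1_l2 Hu.
pose Bq := \I_x(`|u x| `^ q).
have Bq0 : 0 <= Bq by apply: Int_ge0 => x; exact: powR_ge0.
pose B2 := 2 `^ s * (nrm u ^+ 2 + Bq).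
have B20 : 0 <= B2 by rewrite mulr_ge0// addr_ge0 ?sqr_ge0.
pose c := (1 + s) ^+ 2.
have c0 : 0 < c by rewrite exprn_gt0// ltr_wpDr.
have w0 : 0 <= c * (Bq + S) by pos.
(* Since [f] is subcritical at infinity, the critical term can be given a factor so small that it is
   absorbed at once, without splitting the potential by size. *)
have de0 : 0 < 2^-1 / (c * (Bq + S) + 1) by pos.
have [C C0 HC] := f_bd de0.
set de := 2^-1 / _ in de0 HC.
pose D := 1 + 2 * (c * (C * B2)).
have D0 : 0 <= D by rewrite addr_ge0// mulr_ge0// mulr_ge0 ?(ltW c0)// mulr_ge0.
pose sD := Num.sqrt D + 1.
have sD0 : 0 < sD by rewrite ltr_wpDl// sqrtr_ge0.
exists (S * sD `^ q); first by rewrite mulr_ge0 ?powR_ge0// ltW.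
move=> k k0.
have tp0 al : tp k al 0 = 0 by rewrite /tp mul0r.
have sG := sob_comp (tp0 s) (is_derive_tp k0 s) (@continuous_dtp _ k0 s) (dtp_bounded k0 s0) (H1_sob Hu).
have sg := sob_comp (tp0 (s / 2)) (is_derive_tp k0 (s / 2)) (@continuous_dtp _ k0 (s / 2))
 (dtp_bounded k0 s20) (H1_sob Hu).
pose G x := tp k s (u x); pose g x := tp k (s / 2) (u x).
have HG : H1 G := sob_H1 sG.
have Hg : H1 g := sob_H1 sg.
have lG := H1_l2 HG; have lg := H1_l2 Hg.
have uG x : u x * G x = g x ^+ 2.
 rewrite /G /g /tp exprMn mulrA -expr2; congr (_ * _).
 rewrite -powR_mulrn// -powRrM; congr (_ `^ _); by field.
have uGn x : `|u x| * `|G x| = g x ^+ 2 by rewrite -normrM uG ger0_norm ?sqr_ge0.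
have dgG : dg g g <= c * dg u G.
 rewrite (dgE sg sg) (dgE (H1_sob Hu) sG) mulr_sumr; apply: ler_sum => i _.
 have lgi := sob_grad i sg; have lGi := sob_grad i sG; have lui := H1_Dw i Hu.
 have i1 := l2_intgM lgi lgi; have i2 := l2_intgM lui lGi.
 rewrite -IntZ//; apply: Int_le => //; first exact: intgZ.
 move=> x; have /andP[h1 h2] := dtp_bd k0 (u x) s0; have /andP[h3 h4] := dtp_bd k0 (u x) s20.
 have E1 : dtp k (s / 2) (u x) * Dw u i x * (dtp k (s / 2) (u x) * Dw u i x) =
  dtp k (s / 2) (u x) ^+ 2 * Dw u i x ^+ 2 by ring.
 have E2 : c * (Dw u i x * (dtp k s (u x) * Dw u i x)) = c * dtp k s (u x) * Dw u i x ^+ 2 by ring.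
 rewrite E1 E2 ler_wpM2r ?sqr_ge0//.
 have h5 : dtp k (s / 2) (u x) ^+ 2 <= ((1 + 2 * (s / 2)) * br k (u x) `^ (s / 2)) ^+ 2.
  rewrite lerXn2r ?nnegrE// ?(le_trans (powR_ge0 _ _) h3)//.
  by rewrite mulr_ge0 ?powR_ge0// addr_ge0// mulr_ge0.
 rewrite (le_trans h5)// exprMn (_ : 1 + 2 * (s / 2) = 1 + s); last by field.
 rewrite ler_wpM2l ?(ltW c0)// (le_trans _ h1)// -powR_mulrn// -powRrM.
 by rewrite (_ : s / 2 * 2 = s)//; field.
have g2i : intg (fun x => g x ^+ 2) := l2i lg.
have ug2 : intg (fun x => `|u x| `^ (q - 2) * g x ^+ 2).
 apply: (@intg_le _ _ _ mu _ (fun x => `|u x| `^ q + `|g x| `^ q)).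
 - by apply: measurable_funM; [exact: mfn_powr (mfn_H1 Hu)|exact: intg_m g2i].
 - by apply: intgD; exact: intg_q.
 - move=> x; rewrite (_ : _ * _ = `|u x| `^ (q - 2) * `|g x| ^+ 2).
   by rewrite ger0_norm ?mulr_ge0// young2.
  by rewrite sqr_norm.
have upG x : `|u x| `^ (q - 1) * `|G x| = `|u x| `^ (q - 2) * g x ^+ 2.
 by rewrite -uGn mulrA powq1.
have weak : dg u G <= de * \I_x(`|u x| `^ (q - 2) * g x ^+ 2) + C * \I_x(g x ^+ 2).
 have := crit HG; rewrite /dJf.
 have h1 : 0 <= \I_x(V x * (u x * G x)).
  apply: Int_ge0 => x; rewrite uG mulr_ge0 ?sqr_ge0//.
  by have /andP[h _] := pV.2 x; rewrite (le_trans (ltW V00)).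
 have h2 : \I_x(a x * (f (u x) * G x)) <=
   de * \I_x(`|u x| `^ (q - 2) * g x ^+ 2) + C * \I_x(g x ^+ 2).
  rewrite -IntZ// -IntZ// -IntD; [|exact: intgZ..].
  apply: Int_le; [exact: (intg_af wa)|by apply: intgD; exact: intgZ|move=> x].
  rewrite (le_trans (ler_norm _))// (normrM (a x)) (normrM (f (u x))) (le_via (`|f (u x)| * `|G x|))//.
   by rewrite ler_piMl ?mulr_ge0// (wgt_norm wa).
  rewrite (le_trans (ler_wpM2r (normr_ge0 _) (HC (u x))))// mulrDl -!mulrA upG uGn//.
 have h3 : dg u G <= lam * dg u G.
  rewrite ler_peMl// -(ler_pM2l c0) mulr0 (le_trans _ dgG)// dg_ge0//.
 move=> /eqP; rewrite subr_eq add0r => /eqP h4.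
 by rewrite (le_trans h3)// (le_trans _ h2)// -h4 lerDl.
have g2B : \I_x(g x ^+ 2) <= B2.
 rewrite /B2 nrmE /Bq -IntD; [|exact: l2i lu|exact: intg_q].
 rewrite -IntZ; last by apply: intgD; [exact: l2i lu|exact: intg_q].
 apply: Int_le => //; first by apply: intgZ; apply: intgD; [exact: l2i lu|exact: intg_q].
 move=> x; rewrite -uG /G /tp mulrA -expr2.
 have h : br k (u x) `^ s <= 2 `^ s * (1 + `|u x| `^ (q - 2)).
  rewrite (le_via ((1 + `|u x| ^+ 2) `^ s))//.
   by apply: powR_le => //; [exact: ltW (br_gt0 k0 _)|rewrite sqr_norm br_le2].
  rewrite (le_trans (powRD_le s0 ler01 (sqr_ge0 _)))// powR1 -powR_mulrn// -powRrM.
  by rewrite (_ : 2 * s = q - 2)// /s; field.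
 rewrite (le_trans (ler_wpM2l (sqr_ge0 _) h))// mulrCA ler_wpM2l// mulrDr mulr1 lerD2l.
 by rewrite mulrC -[u x ^+ 2]sqr_norm powq2.
(* Dividing [g] by the square root of [X] makes its gradient at most one, so that Sobolev and Young
   give an estimate linear in [X]; the [+ 1] avoids a zero divisor. *)
pose X := dg g g + 1.
have X0 : 0 < X by rewrite ltr_wpDl// dg_ge0.
pose x0 := Num.sqrt X.
have x00 : 0 < x0 by rewrite sqrtr_gt0.
have x02 : x0 ^+ 2 = X by rewrite sqr_sqrtr// ltW.
have ugB : \I_x(`|u x| `^ (q - 2) * g x ^+ 2) <= X * (Bq + S).
 have Hgx := H1Z x0^-1 Hg.
 have dgx : dg (x0^-1 *: g) (x0^-1 *: g) <= 1 ^+ 2.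
  rewrite dgZ// dgZr// mulrA -invfM -expr2 x02 expr1n ler_pdivrMl// mulr1 lerDl//.
 have [iq hq] := HS _ _ Hgx ltr01 dgx; rewrite powR1 mulr1 in hq.
 have i1 := intgD (intg_q Hu) iq.
 rewrite (le_via (\I_x(X * (`|u x| `^ q + `|(x0^-1 *: g) x| `^ q))))//.
  apply: Int_le => //; first exact: intgZ.
  move=> x; have -> : g x ^+ 2 = X * `|(x0^-1 *: g) x| ^+ 2.
   have -> : `|(x0^-1 *: g) x| ^+ 2 = X^-1 * g x ^+ 2.
    have -> : (x0^-1 *: g) x = x0^-1 * g x by [].
    by rewrite sqr_norm -x02 -exprVn; exact: exprMn.
   by rewrite mulVKf// gt_eqF.
  by rewrite mulrCA ler_wpM2l ?(ltW X0)// young2.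
 rewrite IntZ// ler_wpM2l ?(ltW X0)// IntD//; last exact: intg_q.
 by rewrite lerD2l.
have dgD : dg g g <= D.
 have h1 : dg g g <= c * (de * (X * (Bq + S)) + C * B2).
  rewrite (le_trans dgG)// ler_wpM2l ?(ltW c0)// (le_trans weak)// lerD// ler_wpM2l//.
  exact: ltW.
 have h2 : c * (de * (X * (Bq + S))) <= X / 2.
  have -> : c * (de * (X * (Bq + S))) = X * (de * (c * (Bq + S))) by ring.
  rewrite ler_wpM2l ?(ltW X0)// /de; apply: absorb_le => //.
 by rewrite mulrDr in h1; exact: bk_ar h1 h2.
have [|iq hq] := HS g sD Hg sD0; last by split.
rewrite (le_trans dgD)// -[leLHS](sqr_sqrtr D0) lerXn2r ?nnegrE ?sqrtr_ge0 ?(ltW sD0)//.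
by rewrite lerDl.
Qed.

(** As [k -> 0], [bk_step] bounds the integral of a function of order [|u| ^ (q ^ 2 / 2)]. One step
    is enough, because [2 * (q - 1) <= q ^ 2 / 2] amounts to [(q - 2) ^ 2 >= 0]; where [|u| <= 1]
    the square of [u] dominates. *)
Lemma brezis_kato : l2 (fun x => `|u x| `^ (q - 1)).
have [B B0 HB] := bk_step.
pose k (n : nat) : R := n.+1%:R^-1.
have k0 n : 0 < k n by rewrite invr_gt0.
have lu := H1_l2 Hu.
pose z x := `|u x * (1 + u x ^+ 2) `^ (s / 2)| `^ q.
have mz : mfn z.
 apply: mfn_powr; apply: measurable_funM; first exact: l2m lu.
 apply: (measurableT_comp (measurable_powR (s / 2))).
 by apply: measurable_funD => //; apply: measurable_funX; exact: l2m lu.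
have [iz _] : intg z /\ Int z <= B.
 apply: (@Int_fatou _ _ _ mu (fun n x => `|tp (k n) (s / 2) (u x)| `^ q)) => //.
 - by move=> n; have [] := HB _ (k0 n).
 - by move=> x; exact: powR_ge0.
 - apply: aeW => x; set t := u x.
  have cw : bw (k n) t ~[n]~> (1 : R).
   rewrite /bw -[X in _ --> X]invr1; apply: cvgV; first exact: oner_neq0.
   rewrite -[X in _ --> X]addr0; apply: cvgD; first exact: cvg_cst.
   rewrite -[X in _ --> X](mul0r (t ^+ 2)); apply: cvgM; last exact: cvg_cst.
   exact: cvg_harmonic.
  have cr : br (k n) t ~[n]~> 1 + t ^+ 2.
   apply: cvgD; first exact: cvg_cst.
   by rewrite -[X in _ --> X]mulr1; apply: cvgM => //; exact: cvg_cst.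
  have pos : 0 < 1 + t ^+ 2 by rewrite ltr_wpDr// sqr_ge0.
  have cp : br (k n) t `^ (s / 2) ~[n]~> (1 + t ^+ 2) `^ (s / 2).
   apply: (@cvg_comp _ _ _ (fun n => br (k n) t) (fun z => z `^ (s / 2)) _ _ _ cr).
   exact: powR_continuous_at.
  have ct : `|tp (k n) (s / 2) t| ~[n]~> `|t * (1 + t ^+ 2) `^ (s / 2)|.
   by apply: cvg_norm; apply: cvgM => //; exact: cvg_cst.
  have [t0|t0] := eqVneq t 0.
   rewrite /z -/t t0 mul0r normr0 powR0; last by rewrite gt_eqF// (lt_trans _ q2).
   rewrite (_ : (fun n => _) = fun=> 0); first exact: cvg_cst.
   by apply/funext => n; rewrite /tp mul0r normr0 powR0// gt_eqF// (lt_trans _ q2).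
  have pos2 : 0 < `|t * (1 + t ^+ 2) `^ (s / 2)|.
   by rewrite normr_gt0 mulf_neq0// gt_eqF// powR_gt0.
  apply: (@cvg_comp _ _ _ (fun n => `|tp (k n) (s / 2) t|) (fun z => z `^ q) _ _ _ ct).
  exact: powR_continuous_at.
 - by move=> n; have [] := HB _ (k0 n).
split; first exact: mfn_powr (l2m lu).
apply: (@intg_le _ _ _ mu _ (fun x => u x ^+ 2 + z x)).
- by apply: measurable_funX; exact: mfn_powr (l2m lu).
- by apply: intgD => //; exact: l2i lu.
move=> x; rewrite ger0_norm// -powR_mulrn// -powRrM.
have z0 : 0 <= z x by exact: powR_ge0.
have e2 : 2 <= (q - 1) * 2 by move: q2; lra.
have [ux|ux] := leP `|u x| 1.
 rewrite ler_wpDr// -[u x ^+ 2]sqr_norm.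
 have [->|u0] := eqVneq (u x) 0.
  by rewrite normr0 powR0 ?expr0n// gt_eqF// (lt_le_trans _ e2).
 by rewrite -[leRHS]powR_mulrn//; apply: ger_powR => //; rewrite normr_gt0 u0.
rewrite ler_wpDl ?sqr_ge0// /z normrM powRM// (ger0_norm (powR_ge0 _ _)).
have h : `|u x| `^ (s * q) <= ((1 + u x ^+ 2) `^ (s / 2)) `^ q.
 rewrite -powRrM (_ : s * q = 2 * (s / 2 * q)); last by field.
 rewrite powRrM powR_mulrn// sqr_norm; apply: powR_le.
 - by rewrite mulr_ge0// ltW// (lt_trans _ q2).
 - exact: sqr_ge0.
 - by rewrite lerDr.
rewrite (le_trans _ (ler_wpM2l (powR_ge0 _ _) h))// -powRD; last first.
 have -> : `|u x| != 0 by rewrite gt_eqF// (lt_trans ltr01 ux).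
 by rewrite implybT.
apply: ler_powR; first exact: ltW.
rewrite /s.
suff : 0 <= q ^+ 2 / 2 - (q - 1) * 2 by move: q => y; rewrite expr2; lra.
have : 0 <= (q - 2) ^+ 2 by exact: sqr_ge0.
move: q => y; rewrite !expr2; lra.
Qed.

End brezis_kato.

(** * Differentiating the primitive along a solution *)

Section chain.
Implicit Types (h : T -> R) (i j : 'I_N).
Let p0 : 0 < q - 1. by move: q2; lra. Qed.

Lemma f_l2 u : l2 u -> l2 (fun x => `|u x| `^ (q - 1)) -> l2 (fun x => f (u x)).
move=> lu lp; have [C C0 H] := f_bd ltr01.
apply: (@l2_le _ _ _ _ _ (fun x => 1 * `|u x| `^ (q - 1) + C * `|u x|)).
- apply: mfn_comp; [exact: cf|exact: l2m lu].
- by apply: l2D; apply: l2Z => //; exact: l2_norm.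
- by move=> x; apply: (le_trans (H _)); rewrite ler_norm.
Qed.

Lemma l2_osc_pow u y : l2 u -> l2 (fun x => `|u x| `^ (q - 1)) ->
 l2 (fun x => `|(shf y u - u) x| `^ (q - 1)) /\
 nrm (fun x => `|(shf y u - u) x| `^ (q - 1)) <= 2 `^ (q - 1) * (nrm (fun x => `|u x| `^ (q - 1)) * 2).
move=> lu lp; pose w := fun x => `|u x| `^ (q - 1).
have lw : l2 (shf y w) by exact: l2_shf.
have ls : l2 (2 `^ (q - 1) *: (shf y w + w)) by apply: l2Z; exact: l2D.
have le x : `| `|(shf y u - u) x| `^ (q - 1)| <= `|(2 `^ (q - 1) *: (shf y w + w)) x|.
 rewrite ger0_norm//; apply: (le_trans _ (ler_norm _)).
 have h := powRD_le (ltW p0) (normr_ge0 (u (x + y))) (normr_ge0 (u x)).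
 apply: le_trans h; apply: powR_le; [exact: ltW|exact: normr_ge0|exact: ler_normB].
have lm : l2 (fun x => `|(shf y u - u) x| `^ (q - 1)).
 apply: (l2_le _ ls le); apply: mfn_powr; apply: measurable_funB; [exact: mfn_shf (l2m lu)|exact: l2m lu].
split => //; apply: (le_trans (nrm_le lm ls le)).
rewrite nrmZ; last exact: l2D.
rewrite ger0_norm// ler_wpM2l// (le_trans (nrm_tri lw lp))//.
by rewrite nrm_shf// mulr_natr mulr2n.
Qed.

(* [F(u)] is differentiated through its Taylor remainder, controlled in [L^1] because
  [|u|^(q-1)] is square integrable. *)
Lemma chain_F i Phi u (g : 'I_N -> T -> R) : c1b i Phi -> sob u g -> H1 u ->
 l2 (fun x => `|u x| `^ (q - 1)) ->
 ip (Phi * (fun x => f (u x))) (g i) = - \I_x(partial i Phi x * F (u x)).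
move=> cP su Hu lp; have lu := sob_l2 su; have lg := sob_grad i su.
have lf := f_l2 lu lp; have [lPf _] := c1b_l2 cP lf; have iF := intg_F Hu.
have [mP mdP dP [K HK]] := cP.
have K0 : 0 <= K by apply: le_trans (HK 0).1; exact: normr_ge0.
pose t_ n : R := n.+1%:R^-1.
have nt : null t_ := null_harmonic.
pose X n := \I_x(dq i (- t_ n) Phi x * F (u x)).
have C1 : X n ~[n]~> \I_x(partial i Phi x * F (u x)).
 apply: (@Int_wcvg _ _ _ K) => //.
 - by move=> n; exact: mfn_dq.
 - move=> n x; apply: dq_bounded => //; last by rewrite oppr_eq0; exact: nt.2.
  by move=> y; exact: (HK y).2.
 - by move=> x; apply: (@dq_ptw _ _ _ (fun n => - t_ n)) => //; exact: nullN.
have C2 : ip (dq i (t_ n) u) (Phi * (fun x => f (u x))) ~[n]~> ip (g i) (Phi * (fun x => f (u x))).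
 apply: ip_cvg => //; first by move=> n; exact: l2_dq.
 by apply: dq_cvg => //; exact: sob_dq.
suff C3 : X n + ip (dq i (t_ n) u) (Phi * (fun x => f (u x))) ~[n]~> (0 : R).
 have /eqP : \I_x(partial i Phi x * F (u x)) + ip (g i) (Phi * (fun x => f (u x))) = 0.
  exact: (cvg_unique _ (cvgD C1 C2) C3).
 by rewrite addrC addr_eq0 ipC => /eqP.
apply/cvg0P => e e0.
pose A := nrm u + nrm (fun x => `|u x| `^ (q - 1)) + 2 `^ (q - 1) * (nrm (fun x => `|u x| `^ (q - 1)) * 2).
have A0 : 0 <= A by rewrite !addr_ge0 ?nrm_ge0// mulr_ge0// mulr_ge0 ?nrm_ge0.
pose B := K * (A * nrm (g i)).
have B0 : 0 <= B by rewrite !mulr_ge0 ?nrm_ge0.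
have d0 : 0 < e / 2 / (B + 1) by pos.
have [C C0 HC] := F_osc d0.
pose D := K * (C * nrm (g i) * nrm (g i)).
have D0 : 0 <= D by rewrite !mulr_ge0 ?nrm_ge0.
have e1 : 0 < e / 2 / (D + 1) by pos.
have [n0 Hn0] := cvg0E nt.1 e1.
exists n0 => n /Hn0 tn; have t0 : 0 < t_ n by rewrite invr_gt0.
rewrite /X; move: (t_ n) t0 tn => t t0 tn.
rewrite (gtr0_norm t0) in tn.
pose dl := shf (t *: ee i) u - u.
have ldl : l2 dl by apply: l2B => //; exact: l2_shf.
have ndl : nrm dl <= nrm (g i) * t.
 by rewrite -[X in _ * X](gtr0_norm t0); apply: dq_le => //; exact: sob_weak.
have iFs : intg (fun x => F (shf (t *: ee i) u x)) by exact: (intg_shift (t *: ee i) iF).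
have HK1 x := (HK x).1.
have iP1 := (intg_bmul mP HK1 iF).1; have iP2 := (intg_bmul mP HK1 iFs).1.
have iP3 := l2_intgM lPf ldl.
(* A translation of the integral containing [F (u)] turns the sum of both quotients exactly into the
   Taylor remainder of [F] tested with [Phi], divided by [- t]. *)
have E : \I_x(dq i (- t) Phi x * F (u x)) + ip (dq i t u) (Phi * (fun x => f (u x))) =
 - t^-1 * \I_x(Phi x * (F (u x + dl x) - F (u x) - f (u x) * dl x)).
 have -> : (fun x => Phi x * (F (u x + dl x) - F (u x) - f (u x) * dl x)) =
   (fun x => Phi x * F (shf (t *: ee i) u x) - Phi x * F (u x) - (Phi * (fun x => f (u x))) x * dl x).
  apply/funext => x; rewrite {1}/dl.
  have -> : u x + (shf (t *: ee i) u - u) x = shf (t *: ee i) u x by rewrite addrC; exact: subrK.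
  rewrite /shf; fring.
 rewrite IntB//; last exact: intgB.
 rewrite IntB//.
 have -> : \I_x(Phi x * F (shf (t *: ee i) u x)) = \I_x(Phi (x - t *: ee i) * F (u x)).
  rewrite -(Int_shift (- (t *: ee i)) iP2); apply: Int_eq => x.
  by rewrite /shf subrK.
 have iP4 : intg (fun x => Phi (x - t *: ee i) * F (u x)).
  exact: (intg_bmul (mfn_shf (- (t *: ee i)) mP) (fun x => HK1 _) iF).1.
 have -> : \I_x(dq i (- t) Phi x * F (u x)) =
  - t^-1 * (\I_x(Phi (x - t *: ee i) * F (u x)) - \I_x(Phi x * F (u x))).
  rewrite -IntB// -IntZ; last exact: intgB.
  apply: Int_eq => x; rewrite dqE scaleNr invrN.
  rewrite /shf; fring.
 have -> : ip (dq i t u) (Phi * (fun x => f (u x))) =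
   t^-1 * \I_x((Phi * (fun x => f (u x))) x * dl x).
  by rewrite ipZ// ipC.
 ring.
rewrite E normrM normrN normfV (gtr0_norm t0).
have [lop nop] := l2_osc_pow (t *: ee i) lu lp.
pose W := (e / 2 / (B + 1)) *: ((fun x => `|u x|) + (fun x => `|u x| `^ (q - 1)) + (fun x => `|dl x| `^ (q - 1)))
 + C *: (fun x => `|dl x|).
have lW0 : l2 ((fun x => `|u x|) + (fun x => `|u x| `^ (q - 1)) + (fun x => `|dl x| `^ (q - 1))).
 by apply: l2D => //; apply: l2D => //; exact: l2_norm.
have lW : l2 W by apply: l2D; apply: l2Z => //; exact: l2_norm.
have W0 x : 0 <= W x.
 have P1' := normr_ge0 (u x); have P2' := powR_ge0 `|u x| (q - 1).
 have P3' := powR_ge0 `|dl x| (q - 1); have P4' := normr_ge0 (dl x).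
 by apply: addr_ge0; apply: mulr_ge0 => //; [exact: ltW|rewrite !addr_ge0].
have nW : nrm W <= e / 2 / (B + 1) * A + C * (nrm (g i) * t).
 apply: (le_trans (nrm_tri (l2Z _ lW0) (l2Z C (l2_norm ldl)))).
 rewrite !nrmZ//; last exact: l2_norm.
 rewrite (gtr0_norm d0) (ger0_norm C0) nrm_norm; apply: lerD; last by rewrite ler_wpM2l.
 rewrite ler_wpM2l ?(ltW d0)//; apply: (le_trans (nrm_tri _ _)) => //.
  by apply: l2D => //; exact: l2_norm.
 apply: lerD => //; apply: (le_trans (nrm_tri _ _)) => //; first exact: l2_norm.
 by rewrite nrm_norm.
have le1 : `|\I_x(Phi x * (F (u x + dl x) - F (u x) - f (u x) * dl x))| <= K * (nrm W * nrm dl).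
 apply: (le_via (\I_x(K * (`|W x| * `|dl x|)))).
  have iWd : intg (fun x => `|W x| * `|dl x|) by exact: l2_intgM (l2_norm lW) (l2_norm ldl).
  apply: Int_norm_le.
  - have := intgB (intgB iP2 iP1) iP3 => /intg_m; congr (measurable_fun _ _).
   apply/funext => x; rewrite {2}/dl.
   have -> : u x + (shf (t *: ee i) u - u) x = shf (t *: ee i) u x by rewrite addrC; exact: subrK.
   rewrite /shf; fring.
  - exact: intgZ.
  - move=> x; rewrite normrM; apply: ler_pM => //.
   by rewrite (ger0_norm (W0 x)); exact: HC.
 rewrite IntZ; last exact: l2_intgM (l2_norm lW) (l2_norm ldl).
 by rewrite ler_wpM2l//; exact: Int_norm_cs.
have le2 : K * (nrm W * nrm dl) <= K * ((e / 2 / (B + 1) * A + C * (nrm (g i) * t)) * (nrm (g i) * t)).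
 by rewrite ler_wpM2l// ler_pM ?nrm_ge0.
rewrite mulrC ler_pdivrMr// (le_trans (le_trans le1 le2))//.
have h1 := absorb_le B0 (ltW (divr_gt0 e0 (ltr0Sn R 1))) (lexx B).
have h2 : D * t <= e / 2.
 apply: (le_via (D * (e / 2 / (D + 1)))); first by rewrite ler_wpM2l.
 by rewrite mulrC; apply: absorb_le => //; rewrite ltW// divr_gt0.
rewrite (_ : K * _ = (e / 2 / (B + 1) * B + D * t) * t); last by rewrite /B /D; ring.
by rewrite ler_pM2r// [leRHS](splitr e) lerD.
Qed.

End chain.

(** * The Pohozaev identity *)

Section pohozaev.
Implicit Types (h V a W : T -> R) (i j : 'I_N) (g : 'I_N -> T -> R).

Lemma ip_dqs i u g w : sob u g -> l2 w ->
 ip w (dq i n.+1%:R^-1 u + dq i (- n.+1%:R^-1) u) ~[n]~> 2 * ip w (g i).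
move=> su lw; have lu := sob_l2 su; have lg := sob_grad i su.
have lD n : l2 (dq i n.+1%:R^-1 u + dq i (- n.+1%:R^-1) u) by apply: l2D; exact: l2_dq.
have := ip_cvg lD (l2D lg lg) lw (dqs_cvg i su null_harmonic).
by under eq_fun do rewrite ipC; rewrite ipC ipDr// mulr_natl mulr2n.
Qed.

(* Tests the equation with [xi (u(. + t e_i) - u(. - t e_i)) / t]. *)
Lemma local_pohozaev (V0 V1 lam : R) V a (z : T -> R) u g i : pot V0 V1 V -> wgt a -> sob u g -> H1 u ->
 l2 (fun x => `|u x| `^ (q - 1)) -> (forall psi, H1 psi -> dJf lam V a u psi = 0) ->
 (forall j, c1b j z) -> c1b i (V * z) -> c1b i (a * z) ->
 lam * \sum_j (- ip (partial i z * g j) (g j) + 2 * ip (partial j z * g j) (g i))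
 - ip (partial i (V * z) * u) u + 2 * \I_x(partial i (a * z) x * F (u x)) = 0.
move=> pV wa su Hu lp crit cz cV ca.
have lu := sob_l2 su; have lf := f_l2 lu lp.
have [lVu _] := c1b_l2 cV lu; have [laf _] := c1b_l2 ca lf.
pose D n v := dq i n.+1%:R^-1 v + dq i (- n.+1%:R^-1) v.
have lD n v : l2 v -> l2 (D n v) by move=> lv; apply: l2D; exact: l2_dq.
have sD n : sob (D n u) (fun j => D n (g j)).
 by apply: sobD; apply: sobZ; apply: sobB => //; exact: sob_shf.
have sv n := sob_mul (c1b_l2 (cz i) (lD n _ lu)).1 cz (sD n).
have E n : lam * \sum_j (ip (z * g j) (D n (g j)) + ip (partial j z * g j) (D n u))
  + ip (V * z * u) (D n u) - ip (a * z * (fun x => f (u x))) (D n u) = 0.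
 rewrite -[RHS](crit _ (sob_H1 (sv n))) /dJf (dgE su (sv n)); congr (_ * _ + _ - _).
 - apply: eq_bigr => j _; have lg := sob_grad j su.
  have [l1 l4] := c1b_l2 (cz j) lg; have [l3 _] := c1b_l2 (cz j) (lD n _ lg).
  have [_ l5] := c1b_l2 (cz j) (lD n _ lu).
  have E (b c d : R) : b * c * d = c * (b * d) by ring.
  rewrite [RHS]ipDr//; congr (_ + _); apply: Int_eq => x; exact: E.
 - apply: Int_eq => x; fring.
 - apply: Int_eq => x; fring.
have C : lam * \sum_j (ip (z * g j) (D n (g j)) + ip (partial j z * g j) (D n u))
  + ip (V * z * u) (D n u) - ip (a * z * (fun x => f (u x))) (D n u) ~[n]~>
 lam * \sum_j (- ip (partial i z * g j) (g j) + 2 * ip (partial j z * g j) (g i))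
 + 2 * ip (V * z * u) (g i) - 2 * ip (a * z * (fun x => f (u x))) (g i).
 apply: cvgB; last exact: ip_dqs.
 apply: cvgD; last exact: ip_dqs.
 apply: cvgMr; apply: cvg_sum_seq => j; have lg := sob_grad j su.
 apply: cvgD; first exact: ibp_sym (cz i) lg null_harmonic.
 by apply: ip_dqs => //; have [] := c1b_l2 (cz j) lg.
move: C; under eq_fun do rewrite E.
move=> C.
rewrite -[RHS](cvg_unique (@Rhausdorff R) C (cvg_cst (0 : R))).
by rewrite (ibp cV su) (chain_F ca su Hu lp) mulrN opprK.
Qed.

(** The local identities for the fields [xi d i] are summed over [i], and the cutoff is removed. The
    bounded function [W] is a majorant of [x . grad V], which need not be bounded below: only the
    difference, of known sign, appears as an unbounded weight, and its integrability is part of the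
    conclusion. *)
Theorem pohozaev (V0 V1 lam Ka KW : R) V a W u : 0 < V0 -> pot V0 V1 V -> wgt a -> 1 <= lam ->
 Ck 1 V -> Ck 1 a -> (forall x, `|dotv (grad a x) x| <= Ka) ->
 mfn W -> (forall x, `|W x| <= KW) -> (forall x, 0 <= W x - dotv (grad V x) x) ->
 H1 u -> (forall psi, H1 psi -> dJf lam V a u psi = 0) ->
 intg (fun x => (W x - dotv (grad V x) x) * u x ^+ 2) /\
 2 * N%:R * Jf lam V a u = 2 * lam * dg u u + \I_x((W x - dotv (grad V x) x) * u x ^+ 2)
  - \I_x(W x * u x ^+ 2) + 2 * \I_x(dotv (grad a x) x * F (u x)).
move=> V00 pV wa lam1 CV Ca HKa mW HKW th0 Hu crit.
have lp := brezis_kato V00 pV wa lam1 Hu crit.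
have su := H1_sob Hu; have lu := sob_l2 su; have iu := l2i lu.
have iF := intg_F Hu; set g := Dw u in su.
have lg j := sob_grad j su.
pose d n : R := n.+1%:R^-1.
have d0 n : 0 < d n by rewrite invr_gt0.
have dc : d n ~[n]~> (0 : R) by exact: cvg_harmonic.
have one (h : T -> R) : h = cst 1 * h by rewrite mul1r.
have Cone : Ck 1 (cst 1 : T -> R) by exact: Ck_cst.
have cz n i j : c1b j (xi (d n) i).
 apply: (@c1b_supp _ ((d n)^-1 + 1)); first exact: Ck1_xi.
 by rewrite (one (xi _ _)); exact: (supp_xi (d0 n)).
have chz n h i : Ck 1 h -> c1b i (h * xi (d n) i).
 move=> Ch; apply: (@c1b_supp _ ((d n)^-1 + 1)); last exact: (supp_xi (d0 n)).
 by apply: CkM => //; exact: Ck1_xi.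
have mdx n i j : mfn (partial j (xi (d n) i)) by have [] := cz n i j.
have wcv h i j : intg h ->
  \I_x(partial j (xi (d n) i) x * h x) ~[n]~> (j == i)%:R * Int h.
 move=> ih; rewrite -IntZ//; apply: (@Int_wcvg _ (cst (j == i)%:R) _ 5) => //.
 - by move=> n x; apply: partial_xi_bound; exact: ltW.
 - by move=> x; exact: partial_xi_cvg.
pose th x := W x - dotv (grad V x) x.
have mgV := mfn_xgrad CV; have mga := mfn_xgrad Ca.
have mchi n : mfn (chi (d n) : T -> R) by apply: mfn_cont; exact: Ck_cont (Ck1_chi _).
have chi1 n x : `|chi (d n) x| <= 1 by rewrite ger0_norm ?chi_ge0// chi_le1// ltW.
pose S1 n := \sum_i \sum_j (- ip (partial i (xi (d n) i) * g j) (g j) + 2 * ip (partial j (xi (d n) i) * g j) (g i)).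
pose S2 n := \sum_(i < N) \I_x(partial i (xi (d n) i) x * (V x * u x ^+ 2)).
pose S3 n := \sum_(i < N) \I_x(partial i (xi (d n) i) x * (a x * F (u x))).
pose S4 n := \I_x(chi (d n) x * (W x * u x ^+ 2)).
pose S5 n := \I_x(chi (d n) x * (dotv (grad a x) x * F (u x))).
have iVu : intg (fun x => V x * u x ^+ 2).
 exact: (intg_bmul pV.1 (pot_norm (ltW V00) pV) iu).1.
have iaF := intg_aF wa Hu.
have iWu := (intg_bmul mW HKW iu).1.
have igF := (intg_bmul mga HKa iF).1.
have ixg n h i : Ck 1 h -> forall k, intg k -> intg (fun x => xi (d n) i x * partial i h x * k x).
 move=> Ch k ik; have Cp := Ck1_partial (i := i) Ch.
 have cp : continuous (xi (d n) i * partial i h).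
  by apply: contM => //; exact: Ck_cont (Ck1_xi _ _).
 have sp : supp_in (xi (d n) i * partial i h) ((d n)^-1 + 1) by rewrite mulrC; exact: supp_xi.
 have [B _ HB] := supp_bounded cp sp.
 exact: (intg_bmul (mfn_cont cp) HB ik).1.
have sxg n h k : Ck 1 h -> intg k -> \sum_i \I_x(xi (d n) i x * partial i h x * k x) =
  \I_x(chi (d n) x * (dotv (grad h x) x * k x)) /\
  intg (fun x => chi (d n) x * (dotv (grad h x) x * k x)).
 move=> Ch ik.
 have -> : (fun x => chi (d n) x * (dotv (grad h x) x * k x)) =
   (fun x => \sum_i xi (d n) i x * partial i h x * k x).
  apply/funext => x; rewrite dotv_grad mulr_suml mulr_sumr; apply: eq_bigr => i _.
  rewrite /xi; fring.
 by rewrite -Int_sum; [split=> //; apply: intg_sum => i _; exact: ixg|move=> i _; exact: ixg].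
have id n : \I_x(chi (d n) x * (th x * u x ^+ 2)) =
  S2 n + S4 n - lam * S1 n - 2 * S3 n - 2 * S5 n.
 have [EV iV] := sxg n _ _ CV iu; have [Ea ia] := sxg n _ _ Ca iF.
 have -> : \I_x(chi (d n) x * (th x * u x ^+ 2)) = S4 n -
   \I_x(chi (d n) x * (dotv (grad V x) x * u x ^+ 2)).
  rewrite /S4 -IntB//; last exact: (intg_bmul (mchi n) (chi1 n) iWu).1.
  apply: Int_eq => x; rewrite /th; ring.
 have sum0 : lam * S1 n - (S2 n + \I_x(chi (d n) x * (dotv (grad V x) x * u x ^+ 2)))
   + 2 * (S3 n + S5 n) = 0.
  rewrite /S1 /S2 /S3 /S5 -EV -Ea -!big_split /= !mulr_sumr -sumrN -!big_split /=.
  apply: big1 => i _.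
  rewrite -[RHS](local_pohozaev pV wa su Hu lp crit (cz n i) (chz n _ i CV) (chz n _ i Ca)).
  have bx h k : Ck 1 h -> intg (fun x => h x * k x) -> intg k ->
    \I_x(partial i (xi (d n) i) x * (h x * k x)) + \I_x(xi (d n) i x * partial i h x * k x) =
    \I_x(partial i (h * xi (d n) i) x * k x).
   move=> Ch ihk ik; rewrite -IntD; last exact: ixg.
    apply: Int_eq => x; rewrite (partialMx i _ Ch (Ck1_xi _ _)).
    rewrite /xi; fring.
   by apply: (intg_bmul (mdx n i i) _ ihk).1 => x; apply: partial_xi_bound; exact: ltW.
  rewrite (bx _ _ CV)// (bx _ _ Ca)//; congr (_ - _ + _).
  apply: Int_eq => x; fring.
 have ar (x1 x2 x3 x4 x5 y : R) : lam * x1 - (x2 + y) + 2 * (x3 + x5) = 0 ->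
  x4 - y = x2 + x4 - lam * x1 - 2 * x3 - 2 * x5 by lra.
 exact: ar.
(* The limit of the right side of [id]: the divergence of [x] gives the factors [N], its gradient
   the term [2 * dg u u]. *)
pose L := N%:R * \I_x(V x * u x ^+ 2) + \I_x(W x * u x ^+ 2)
 - lam * (- (N%:R * dg u u) + 2 * dg u u) - 2 * (N%:R * \I_x(a x * F (u x)))
 - 2 * \I_x(dotv (grad a x) x * F (u x)).
have SN (c : R) : \sum_(i < N) c = N%:R * c by rewrite sumr_const card_ord mulr_natl.
have limL : \I_x(chi (d n) x * (th x * u x ^+ 2)) ~[n]~> L.
 under eq_fun do rewrite id.
 have dA : dg u u = \sum_j ip (g j) (g j) by rewrite (dgE su su).
 have chiI h : intg h -> \I_x(chi (d n) x * h x) ~[n]~> Int h.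
  move=> ih; have -> : Int h = \I_x(cst 1 x * h x) by apply: Int_eq => x; rewrite mul1r.
  by apply: (@Int_wcvg _ (cst 1) _ 1) => // x; exact: chi_cvg.
 apply: cvgB; last by apply: cvgMr; exact: chiI.
 apply: cvgB; last first.
  apply: cvgMr; rewrite -SN; apply: cvg_sum_seq => i.
  by have := wcv _ i i iaF; rewrite eqxx mul1r.
 apply: cvgB; last first.
  apply: cvgMr; have -> : - (N%:R * dg u u) + 2 * dg u u =
    \sum_(i < N) \sum_(j < N) (- ip (g j) (g j) + 2 * ((j == i)%:R * ip (g j) (g i))).
   rewrite -SN dA -sumrN mulr_sumr -big_split /=; apply: eq_bigr => i _.
   rewrite big_split /= sumrN; congr (_ + _).
   rewrite (bigD1 i)//= eqxx mul1r big1 ?addr0// => j ji; by rewrite (negPf ji) mul0r mulr0.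
  apply: cvg_sum_seq => i; apply: cvg_sum_seq => j.
  apply: cvgD; last apply: cvgMr.
   apply: cvgN; have := wcv _ i i (l2_intgM (lg j) (lg j)); rewrite eqxx mul1r.
   by under eq_fun do under eq_Rintegral do rewrite mulrA.
  have := wcv _ i j (l2_intgM (lg j) (lg i)).
  by under eq_fun do under eq_Rintegral do rewrite mulrA.
 apply: cvgD; last exact: chiI.
 rewrite -SN; apply: cvg_sum_seq => i.
 by have := wcv _ i i iVu; rewrite eqxx mul1r.
have ichi n : intg (fun x => chi (d n) x * (th x * u x ^+ 2)).
 have [_ iV] := sxg n _ _ CV iu.
 have := intgB (intg_bmul (mchi n) (chi1 n) iWu).1 iV; congr (intg _).
 by apply/funext => x; rewrite /th; ring.
have mth : mfn (fun x => th x * u x ^+ 2).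
 apply: measurable_funM; first exact: measurable_funB.
 exact: intg_m iu.
have ptw x : chi (d n) x * (th x * u x ^+ 2) ~[n]~> th x * u x ^+ 2.
 by rewrite -[X in _ --> X]mul1r; apply: cvgMl; exact: chi_cvg.
have thu0 x : 0 <= th x * u x ^+ 2 by rewrite mulr_ge0 ?sqr_ge0//; exact: th0.
(* The cut-off integrals converge, hence are bounded, and Fatou yields integrability; it then serves
   as dominating function for the limit. *)
have ith : intg (fun x => th x * u x ^+ 2).
 have [K [_ HK]] : bounded_fun (fun n => \I_x(chi (d n) x * (th x * u x ^+ 2))).
  by apply: cvg_seq_bounded; apply/cvg_ex; exists L.
 apply: (@Int_fatou _ _ _ mu (fun n x => chi (d n) x * (th x * u x ^+ 2)) _ (K + 1) _ _ _ _ _ _).1 => //.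
 - by move=> n x; apply: mulr_ge0; [exact: chi_ge0|exact: thu0].
 - by apply: aeW.
 - move=> n; apply: (le_trans (ler_norm _)); apply: (HK (K + 1)); rewrite ?ltrDl//.
split => //.
have EL : \I_x(th x * u x ^+ 2) = L.
 apply: (cvg_unique _ _ limL) => //.
 have [|||||_] := @Int_dct _ _ _ mu (fun n x => chi (d n) x * (th x * u x ^+ 2))
  (fun x => th x * u x ^+ 2) (fun x => th x * u x ^+ 2) => //.
 - by move=> n; exact: intg_m (ichi n).
 - exact: aeW.
 - move=> n x; rewrite normrM (ger0_norm (thu0 x)) -[leRHS]mul1r ler_wpM2r//.
by rewrite EL /L /Jf; field.
Qed.

End pohozaev.

Lemma cvg_transfer (x_ y_ : nat -> R) (l : R) :
 x_ n - y_ n ~[n]~> (0 : R) -> y_ n ~[n]~> l -> x_ n ~[n]~> l.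
move=> h1 h2; rewrite -[l]add0r (_ : x_ = (fun n => (x_ n - y_ n) + y_ n)); first exact: cvgD.
by apply/funext => n; rewrite subrK.
Qed.

Lemma cvg_zero (x_ : nat -> R) (l : R) :
 (forall n, x_ n = 0) -> x_ n ~[n]~> l -> l = 0.
move=> h1 h2; apply: (cvg_unique (@Rhausdorff R) h2).
by rewrite (_ : x_ = cst 0); [exact: cvg_cst|apply/funext].
Qed.

(** * Passing to weak limits and excluding vanishing *)

Section limits.
Local Opaque hn dg.
Implicit Types (h V a W : T -> R) (i j : 'I_N).

Lemma dg_shf y u v : H1 u -> H1 v -> dg (shf y u) (shf y v) = dg u v.
move=> /H1_sob su /H1_sob sv; rewrite (dgE (sob_shf y su) (sob_shf y sv)) (dgE su sv).
by apply: eq_bigr => i _; exact: ip_shf2 (sob_grad i su) (sob_grad i sv).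
Qed.

Lemma hn_shf y u : H1 u -> hn (shf y u) = hn u.
move=> Hu; have Hs := H1_shf y Hu; apply/eqP.
rewrite -(eqrXn2 (n := 2)) ?hn_ge0// !hn2// /hB dg_shf//; apply/eqP; congr (_ + _).
by rewrite -!nrm2 ?nrm_shf//; exact: H1_l2.
Qed.

Lemma F_l1_bound (M : R) : 0 < M -> exists2 C : R, 0 <= C & forall u, H1 u -> hn u <= M ->
 \I_x(`|F (u x)|) <= C.
move=> M0; have [C C0 H] := F_osc_int M0 ltr01.
exists (1 * M + C * M ^+ 2); first by pos.
move=> u Hu HM; have := H 0 u H1_0 Hu.
rewrite hn0 => /(_ (ltW M0) HM) h1.
have -> : \I_x(`|F (u x)|) = \I_x(`|F ((0 : T -> R) x + u x) - F ((0 : T -> R) x) - f ((0 : T -> R) x) * u x|).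
 by apply: Int_eq => x; rewrite [(0 : T -> R) x]/0 f0E primitive00 add0r mul0r !subr0.
apply: (le_trans h1); apply: lerD; first by rewrite ler_wpM2l.
by rewrite ler_wpM2l// lerXn2r ?nnegrE ?hn_ge0// ltW.
Qed.

Lemma weighted_cvg (u_ : nat -> T -> R) u (M B : R) om : (forall n, H1 (u_ n)) -> H1 u ->
 wkcvg u_ u -> (forall n, hn (u_ n) <= M) -> mfn om -> (forall x, `|om x| <= B) ->
 decays om ->
 \I_x(om x * u_ n x ^+ 2) ~[n]~> \I_x(om x * u x ^+ 2).
move=> Hu_ Hu wk HM mo HB dec; apply/cvgBP.
have lu := H1_l2 Hu; have M0 : 0 <= M by apply: le_trans (HM 0%N); exact: hn_ge0.
pose r n := nrm (om * (u_ n - u)) * (M + nrm u).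
apply: (@cvg0_le _ _ r); last first.
 by rewrite -[X in _ --> X](mul0r (M + nrm u)); apply: cvgMl; exact: rellich_decay dec.
move=> n; have lun := H1_l2 (Hu_ n).
have lo v : l2 v -> intg (fun x => om x * v x ^+ 2) by move=> lv; exact: (intg_bmul mo HB (l2i lv)).1.
rewrite -IntB//; [|exact: lo|exact: lo].
have [lod _] := l2_bmul mo HB (l2B lun lu).
have -> : \I_x(om x * u_ n x ^+ 2 - om x * u x ^+ 2) = ip (om * (u_ n - u)) (u_ n + u).
 apply: Int_eq => x.
 fring.
apply: (le_trans (ip_cs lod (l2D lun lu))); rewrite /r ler_wpM2l ?nrm_ge0//.
apply: (le_trans (nrm_tri lun lu)); rewrite lerD2r; exact: le_trans (nrm_le_hn (Hu_ n)) (HM n).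
Qed.

(** Coefficients are allowed to vary and are only required to be bounded and pointwise convergent,
    so that the translated equations of a sequence escaping to infinity are covered. *)
Lemma crit_limit (u_ : nat -> T -> R) u (lam_ : nat -> R) (V_ a_ : nat -> T -> R) V a (M V1 : R) :
 (forall n, H1 (u_ n)) -> H1 u -> wkcvg u_ u -> (forall n, hn (u_ n) <= M) ->
 lam_ n ~[n]~> (1 : R) -> (forall n, mfn (V_ n)) -> (forall n x, `|V_ n x| <= V1) ->
 mfn V -> (forall x, V_ n x ~[n]~> V x) -> (forall n, wgt (a_ n)) -> wgt a ->
 (forall x, a_ n x ~[n]~> a x) ->
 (forall n psi, H1 psi -> dJf (lam_ n) (V_ n) (a_ n) (u_ n) psi = 0) ->
 forall psi, H1 psi -> dJf 1 V a u psi = 0.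
move=> Hu_ Hu wk HM cl mV_ HV mV cV wa_ wa ca crit psi Hp.
have lu := H1_l2 Hu; have lpsi := H1_l2 Hp.
pose d n := \I_x(`|u_ n x - u x| * `|psi x|).
have d0 : d n ~[n]~> (0 : R) by exact: rellich_l2 HM lpsi.
have V10 : 0 <= V1 by apply: le_trans (HV 0%N 0); exact: normr_ge0.
have c1 : lam_ n * dg (u_ n) psi ~[n]~> 1 * dg u psi by apply: cvgM => //; exact: wkcvg_dg.
have c2 : \I_x(V_ n x * (u_ n x * psi x)) ~[n]~> \I_x(V x * (u x * psi x)).
 have h1 := Int_wcvg mV_ mV HV cV (l2_intgM lu lpsi).
 have h2 : \I_x(V_ n x * (u_ n x * psi x)) - \I_x(V_ n x * (u x * psi x)) ~[n]~> (0 : R).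
  apply: (@cvg0_le _ _ (fun n => V1 * d n)); last by rewrite -[X in _ --> X](mulr0 V1); exact: cvgMr.
  move=> n; have lun := H1_l2 (Hu_ n).
  rewrite -IntB; [|exact: intg_V (mV_ n) (HV n) _ _ lun lpsi|exact: intg_V (mV_ n) (HV n) _ _ lu lpsi].
  rewrite -IntZ; last exact: intg_l2n (l2B lun lu) lpsi.
  apply: Int_norm_le.
  - exact: intg_m (intgB (intg_V (mV_ n) (HV n) lun lpsi) (intg_V (mV_ n) (HV n) lu lpsi)).
  - apply: intgZ; exact: intg_l2n (l2B lun lu) lpsi.
  - move=> x; rewrite -mulrBr -mulrBl normrM normrM; apply: ler_pM => //; by pos.
 exact: cvg_transfer h2 h1.
have c3 : \I_x(a_ n x * (f (u_ n x) * psi x)) ~[n]~> \I_x(a x * (f (u x) * psi x)).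
 have h1 := Int_wcvg (fun n => (wa_ n).1) wa.1 (fun n => wgt_norm (wa_ n)) ca (intg_f Hu Hp).
 have h2 : \I_x(a_ n x * (f (u_ n x) * psi x)) - \I_x(a_ n x * (f (u x) * psi x)) ~[n]~> (0 : R).
  apply/cvg0P => e e0.
  pose M' := M + hn u + 1.
  have M0 : 0 <= M by apply: le_trans (HM 0%N); exact: hn_ge0.
  have M'0 : 0 < M' by rewrite ltr_wpDl// addr_ge0 ?hn_ge0.
  have dd : 0 < e / 2 / (hn psi + 1) by rewrite !divr_gt0// ltr_wpDl ?hn_ge0.
  have [C C0 HC] := f_osc_int M'0 dd.
  have e1 : 0 < e / 2 / (C + 1) by pos.
  have [n0 Hn0] := cvg0E d0 e1.
  exists n0 => n /Hn0 dn; have Hun := Hu_ n.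
  have HMv : hn (u_ n - u) <= M'.
   apply: (le_trans (hn_triB Hun Hu)); rewrite /M'; have := HM n; lra.
  have HMu : hn u <= M' by rewrite /M'; lra.
  have h := HC u (u_ n - u) psi Hu (H1B Hun Hu) Hp HMu HMv.
  have i1 := intg_f Hun Hp; have i2 := intg_f Hu Hp.
  have wn := wgt_norm (wa_ n).
  rewrite -IntB; [|exact: (intg_bmul (wa_ n).1 wn i1).1|exact: (intg_bmul (wa_ n).1 wn i2).1].
  apply: (le_via (\I_x(`|f (u x + (u_ n - u) x) - f (u x)| * `|psi x|))).
   have E x : u x + (u_ n - u) x = u_ n x by rewrite addrC; exact: subrK.
   have i3 : intg (fun x => `|f (u x + (u_ n - u) x) - f (u x)| * `|psi x|).
    have := intg_norm (intgB i1 i2); congr (intg _); apply/funext => x.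
    by rewrite E -mulrBl normrM.
   apply: Int_norm_le => //.
    exact: intg_m (intgB (intg_bmul (wa_ n).1 wn i1).1 (intg_bmul (wa_ n).1 wn i2).1).
   move=> x; rewrite E -mulrBr -mulrBl normrM normrM -[leRHS]mul1r ler_wpM2r ?mulr_ge0//.
  apply: (le_trans h); rewrite [leRHS](splitr e); apply: lerD.
   by apply: absorb_le; rewrite ?hn_ge0// ltW// divr_gt0.
  have dn' : \I_x(`|(u_ n - u) x| * `|psi x|) <= e / 2 / (C + 1) by apply: le_trans dn; exact: ler_norm.
  apply: (le_via (C * (e / 2 / (C + 1)))); first by rewrite ler_wpM2l.
  by rewrite mulrC; apply: absorb_le => //; rewrite ltW// divr_gt0.
 exact: cvg_transfer h2 h1.
rewrite /dJf; apply: (cvg_zero _ (cvgB (cvgD c1 c2) c3)) => n; exact: (crit n _ Hp).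
Qed.

Lemma dJ_shf y lam V a u psi (V1 : R) : mfn V -> (forall x, `|V x| <= V1) -> wgt a ->
 H1 u -> H1 psi ->
 dJf lam (shf y V) (shf y a) (shf y u) psi = dJf lam V a u (shf (- y) psi).
move=> mV HV wa Hu Hp; have Hs := H1_shf (- y) Hp.
have E : psi = shf y (shf (- y) psi) by rewrite -{1}(shfK (- y) psi) opprK.
rewrite {1}/dJf {1 2 3}E dg_shf//; congr (_ + _ - _).
 by rewrite -[RHS](Int_shift y (intg_V mV HV (H1_l2 Hu) (H1_l2 Hs))).
by rewrite -[RHS](Int_shift y (intg_bmul wa.1 (wgt_norm wa) (intg_f Hu Hs)).1).
Qed.

Lemma avg_shf r y u : avg r (shf y u) 0 = avg r u y.
by rewrite /avg !shfA ?add0r ?addr0. Qed.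

(* Vanishing would make the superlinear term too small to balance the quadratic part. *)
Lemma nonvanishing (V0 V1 M : R) : 0 < V0 -> 0 < M -> exists2 r : R, 0 < r & exists2 ka : R, 0 < ka &
 forall lam V a u, 1 <= lam -> pot V0 V1 V -> wgt a -> H1 u -> hn u <= M -> 0 < hn u ->
 dJf lam V a u u = 0 -> exists x, ka < `|avg r u x|.
move=> V00 M0; have [S Spos HS] := q_bound.
pose c1 := Num.min 1 V0.
have c10 : 0 < c1 by rewrite lt_min ltr01.
pose B := 1 + S * M `^ (q - 2).
have B0 : 0 <= B by rewrite addr_ge0// mulr_ge0 ?powR_ge0// ltW.
have d0 : 0 < c1 / 4 / (B + 1) by pos.
set dl := c1 / 4 / (B + 1) in d0.
have [ka ka0 [C C0 HC]] := f_bd0 d0.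
have N0 : 0 < N%:R :> R by rewrite ltr0n; apply: leq_trans N3.
(* The deviation term costs at most [c1 / 4], as does the term with [dl]: together half of the
   coercivity constant, a contradiction. *)
pose r := c1 / 4 / ((C * N%:R) + 1).
have CN : 0 <= C * N%:R by pos.
have r0 : 0 < r by rewrite !divr_gt0// ltr_wpDl.
exists r => //; exists ka => // lam V a u lam1 pV wa Hu HM hu crit.
apply: contrapT => nE.
have k1 : dl * B <= c1 / 4 by apply: absorb_le => //; rewrite ltW// divr_gt0.
clearbody dl.
have av x : `|avg r u x| <= ka by rewrite leNgt; apply/negP => ?; apply: nE; exists x.
have lu := H1_l2 Hu; have [lav nav] := avg_diff r0 Hu.
have bn0 : bn dg u <= hn u := bndg_le_hn Hu.
have low : c1 * hn u ^+ 2 <= lam * dg u u + \I_x(V x * (u x * u x)).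
 rewrite hn2// /hB -nrm2// mulrDr; apply: lerD.
  rewrite ler_wpM2r ?dg_ge0//; apply: le_trans lam1; by rewrite ge_min lexx.
 apply: (le_via (V0 * nrm u ^+ 2)); first by rewrite ler_wpM2r ?sqr_ge0// ge_min lexx orbT.
 apply: (le_trans (pot_ge V00 pV lu)); rewrite le_eqVlt; apply/orP; left; apply/eqP.
 by apply: Int_eq => x; rewrite expr2.
have iq := intg_q Hu.
have iav : intg (fun x => `|(u - avg r u) x| * `|u x|) by exact: intg_l2n lav lu.
pose G x := dl * (u x ^+ 2 + `|u x| `^ q) + C * (`|(u - avg r u) x| * `|u x|).
have iG : intg G by apply: intgD; apply: intgZ => //; apply: intgD => //; exact: l2i.
have up : \I_x(a x * (f (u x) * u x)) <= Int G.
 apply: (le_trans (ler_norm _)); apply: Int_norm_le => //.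
  exact: intg_m (intg_bmul wa.1 (wgt_norm wa) (intg_f Hu Hu)).1.
 move=> x; rewrite normrM -[leRHS]mul1r; apply: ler_pM => //; first exact: wgt_norm.
 rewrite normrM; apply: (le_trans (ler_wpM2r (normr_ge0 _) (HC _))); rewrite /G mulrDl; apply: lerD.
  rewrite -mulrA ler_wpM2l ?(ltW d0)// mulrDl -expr2 sqr_norm lerD2l.
  rewrite powp_mul//; lra.
 rewrite -mulrA ler_wpM2l// ler_wpM2r//.
 have h : `|u x| - ka <= `|(u - avg r u) x|.
  rewrite lerBlDr -[X in `|X| <= _](subrK (avg r u x)); apply: (le_trans (ler_normD _ _)).
  by rewrite lerD2l.
 by case: (lerP 0 (`|u x| - ka)) => s0; [rewrite pp_pos|rewrite pp_neg// ltW].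
have upG : Int G <= c1 / 2 * hn u ^+ 2.
 rewrite IntD; [|by apply: intgZ; apply: intgD => //; exact: l2i|exact: intgZ].
 rewrite !IntZ//; last by apply: intgD => //; exact: l2i.
 rewrite IntD//; last exact: l2i.
 have h1 : \I_x(u x ^+ 2) <= hn u ^+ 2.
  by rewrite -nrmE lerXn2r ?nnegrE ?nrm_ge0 ?hn_ge0//; exact: nrm_le_hn.
 have h2 : \I_x(`|u x| `^ q) <= S * M `^ (q - 2) * hn u ^+ 2.
  apply: (le_trans (HS u (hn u) Hu hu (lexx _))); rewrite -mulrA ler_wpM2l ?(ltW Spos)//.
  have -> : hn u `^ q = hn u `^ (q - 2) * hn u ^+ 2.
   rewrite -powR_mulrn ?hn_ge0// -powRD; last by rewrite (gt_eqF hu) implybT.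
   by congr (_ `^ _); ring.
  rewrite ler_wpM2r ?sqr_ge0//; apply: powR_le; rewrite//; move: q2; lra.
 have h3 : \I_x(`|(u - avg r u) x| * `|u x|) <= N%:R * r * hn u ^+ 2.
  apply: (le_trans (Int_norm_cs lav lu)).
  rewrite expr2 mulrA; apply: ler_pM; rewrite ?nrm_ge0//; last exact: nrm_le_hn.
  apply: (le_trans nav); rewrite ler_wpM2l// mulr_ge0// ltW//.
 have k2 : r * (C * N%:R) <= c1 / 4 by apply: absorb_le => //; rewrite ltW// divr_gt0.
 have H2 := sqr_ge0 (hn u).
 have j1 : dl * (\I_x(u x ^+ 2) + \I_x(`|u x| `^ q)) <= c1 / 4 * hn u ^+ 2.
  apply: (le_via (dl * (B * hn u ^+ 2))).
   rewrite ler_wpM2l ?(ltW d0)// /B mulrDl mul1r; exact: lerD.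
  by rewrite mulrA ler_wpM2r.
 have j2 : C * \I_x(`|(u - avg r u) x| * `|u x|) <= c1 / 4 * hn u ^+ 2.
  apply: (le_via (C * (N%:R * r * hn u ^+ 2))); first by rewrite ler_wpM2l.
  have -> (z : R) : C * (N%:R * r * z) = r * (C * N%:R) * z by ring.
  exact: ler_wpM2r.
 by apply: (le_trans (lerD j1 j2)); rewrite -mulrDl le_eqVlt; apply/orP; left; apply/eqP; congr (_ * _); field.
have : c1 * hn u ^+ 2 <= c1 / 2 * hn u ^+ 2.
 apply: (le_trans low); apply: le_trans upG; apply: le_trans up.
 by rewrite -subr_le0 -crit.
rewrite ler_pM2r ?exprn_gt0//; lra.
Qed.

End limits.

(** * Data of the perturbed problem and profiles of dilations *)

Definition Veps (Voo eps : R) (h : T -> R) : T -> R :=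
 fun x => Voo - eps * h x.

(** The hypotheses on [h] for a fixed [eps]. [d_half] keeps the potential above [Voo / 2]; [d_small]
    lets Hardy's constant [4 * N] absorb the weight [eps * Ch * rho]. *)
Record datum (Voo eps Ch : R) (h : T -> R) : Prop := Datum {
 d_V : 0 < Voo;
 d_e : 0 <= eps;
 d_C1 : Ck 1 h;
 d_h0 : forall x, 0 <= h x;
 d_dec : decays h;
 d_C : 0 <= Ch;
 d_grad : forall x, - dotv (grad h x) x <= Ch * rho x;
 d_half : forall x, eps * h x <= Voo / 2;
 d_small : eps * Ch * (4 * N%:R) <= 1 }.

Definition crit (lam : R) (V a u : T -> R) :=
 H1 u /\ forall psi, H1 psi -> dJf lam V a u psi = 0.

(** [A], [VB] and [D] stand for gradient, mass and [F] integrals. The hypothesis is the Pohozaev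
    identity with factor [al]; under it the energy of the dilate by [t] lies below [A / N] by a
    quadratic deficit in [1 - t], from [dilation_profile], and by the share of [D] lost to [al]. *)
Lemma profile_ar (A VB D al t : R) : (2 < N)%N -> 0 <= t -> 0 <= A ->
 2^-1 * (A + VB) - al * D = A / N%:R ->
 2^-1 * (t ^+ (N - 2) * A + t ^+ N * VB) - t ^+ N * D <=
  A / N%:R * (1 - (1 - t) ^+ 2) - (1 - al) * D * t ^+ N.
case: N => [|[|[|k]]]// _ t0 A0; rewrite subSS subSS subn0 => E.
have h := dilation_profile k t0.
have N0 : k.+3%:R != 0 :> R by rewrite pnatr_eq0.
have VBE : VB = 2 * (A / k.+3%:R) - A + 2 * (al * D) by rewrite -E; field.
have e1 : k.+1%:R = k.+3%:R - 2 :> R by rewrite -[k.+3]addn2 natrD addrK.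
rewrite VBE -subr_ge0.
have -> : A / k.+3%:R * (1 - (1 - t) ^+ 2) - (1 - al) * D * t ^+ k.+3 -
  (2^-1 * (t ^+ k.+1 * A + t ^+ k.+3 * (2 * (A / k.+3%:R) - A + 2 * (al * D))) - t ^+ k.+3 * D) =
  A / k.+3%:R / 2 * (2 - k.+3%:R * t ^+ k.+1 + k.+1%:R * t ^+ k.+3 - 2 * (1 - t) ^+ 2).
 by rewrite e1; move: k.+3%:R N0 => n3 N0; field.
by rewrite mulr_ge0 ?subr_ge0// !divr_ge0.
Qed.

(** Dilating by [2] is enough for negative energy in every dimension at least three, so all
    comparison paths end there. *)
Lemma profile2_ar (A VB D al : R) : (2 < N)%N -> 0 < A ->
 0 <= (1 - al) * D -> 2^-1 * (A + VB) - al * D = A / N%:R ->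
 2^-1 * (2 ^+ (N - 2) * A + 2 ^+ N * VB) - 2 ^+ N * D < 0.
case: N => [|[|[|k]]]// _ A0 D0; rewrite subSS subSS subn0 => E.
have N0 : k.+3%:R != 0 :> R by rewrite pnatr_eq0.
have VBE : VB = 2 * (A / k.+3%:R) - A + 2 * (al * D) by rewrite -E; field.
have e1 : k%:R = k.+3%:R - 3 :> R by rewrite -[k.+3]addn3 natrD addrK.
rewrite VBE (exprS 2 k.+2) (exprS 2 k.+1); have p0 : 0 < 2 ^+ k.+1 :> R by pos.
move: (2 ^+ k.+1) p0 => P p0.
have -> : 2^-1 * (P * A + 2 * (2 * P) * (2 * (A / k.+3%:R) - A + 2 * (al * D))) - 2 * (2 * P) * D =
  - (P * A / k.+3%:R / 2 * (3 * k%:R + 1)) - 4 * P * ((1 - al) * D).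
 by rewrite e1; move: k.+3%:R N0 => n3 N0; field.
have h1 : 0 < P * A / k.+3%:R / 2 * (3 * k%:R + 1) by pos.
have h2 : 0 <= 4 * P * ((1 - al) * D) by pos.
by rewrite -opprD oppr_lt0; exact: ltr_pwDl.
Qed.

Lemma half_ar (m a : R) : m < a -> m + (a - m) / 2 < a.
lra. Qed.

(* Upper bounds for the mountain pass level, along polygons in [H^1]. *)
Definition adm (V : T -> R) (c : R) :=
 exists (n : nat) (g : nat -> T -> R), [/\ forall i, H1 (g i), g 0%N = 0,
  Jf 1 V (cst 1) (g n) < 0 & below V (cst 1) 1 n g c].

(** * Paths of dilations *)

Section paths.
Local Opaque hn dg dJf.

Lemma wgt1 : wgt (cst 1 : T -> R).
by split=> [|x]; [exact: measurable_cst|rewrite /= ler01 lexx]. Qed.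

(** The polygon goes from [0] straight to a strongly contracted copy of [w] and then through dilates
    up to factor [2]. Contracted copies are small in [H^1] because [N >= 3], and continuity of
    dilations keeps the energy on the edges within [e] of that at the vertices. *)
Lemma path_adm (V0 V1 : R) (V : T -> R) w (m e : R) : 0 < V0 -> pot V0 V1 V -> H1 w -> 0 <= m ->
 (forall t : R, 0 < t <= 2 -> Jf 1 V (cst 1) (dil t^-1 w) <= m) ->
 Jf 1 V (cst 1) (dil 2^-1 w) < 0 -> 0 < e -> adm V (m + e).
move=> V00 pV Hw m0 HJ J2 e0; have VB := pot_norm (ltW V00) pV.
pose M := 2 ^+ N * hn w + 1.
have p2 : 0 < 2 ^+ N :> R by pos.
have M0 : 0 < M by rewrite ltr_wpDl// mulr_ge0 ?hn_ge0// ltW.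
have [d d0 Hd] := J_cont ler01 pV.1 VB wgt1 M0 e0.
pose c := hn w ^+ 2 + 1.
have c0 : 0 < c by rewrite ltr_wpDl ?sqr_ge0.
(* Both powers [t0 ^ (N - 2)] and [t0 ^ N] are at most [t0], which makes the contracted copy of norm
   at most [d]. *)
pose t0 := Num.min 1 (d ^+ 2 / c).
have t00 : 0 < t0 by rewrite lt_min ltr01 divr_gt0// exprn_gt0.
have t01 : t0 <= 1 by rewrite ge_min lexx.
have hg0 : hn (dil t0^-1 w) <= d.
 have ti : 0 < t0^-1 by pos.
 rewrite -ler_sqr ?nnegrE ?hn_ge0 ?(ltW d0)// (hn2E (H1_dil ti Hw)) dg_dil// nrm_dilV//; last exact: H1_l2.
 have hN k : (0 < k)%N -> t0 ^+ k <= t0 by case: k => // k _; rewrite exprS ler_piMr ?(ltW t00)// exprn_ile1// ltW.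
 apply: (le_via (t0 * hn w ^+ 2)).
  rewrite hn2E// mulrDr; apply: lerD; apply: ler_wpM2r; rewrite ?dg_ge0 ?sqr_ge0//; apply: hN.
   by rewrite subn_gt0.
  by apply: leq_trans N3.
 apply: (le_via (t0 * c)); first by rewrite ler_wpM2l ?(ltW t00)// lerDl.
 by rewrite -ler_pdivlMr// ge_min lexx orbT.
clearbody t0.
have [dl /andP[dl0 _] Hdl] := H1_dil_cont Hw (divr_gt0 d0 p2).
have [n hn1] : exists n : nat, 2 / (dl * t0) <= n.+1%:R.
 by exists (Num.truncn (2 / (dl * t0))); apply/ltW/truncnS_gt.
pose t (i : nat) : R := t0 + i%:R * ((2 - t0) / n.+1%:R).
have n0 : 0 < n.+1%:R :> R by pos.
have st0 : 0 < (2 - t0) / n.+1%:R by rewrite divr_gt0//; lra.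
have tpos i : 0 < t i by rewrite ltr_pwDl// mulr_ge0// ltW.
have tle i : (i <= n.+1)%N -> t i <= 2.
 move=> ile; have : i%:R * ((2 - t0) / n.+1%:R) <= n.+1%:R * ((2 - t0) / n.+1%:R).
  by rewrite ler_wpM2r ?(ltW st0)// ler_nat.
 have -> : n.+1%:R * ((2 - t0) / n.+1%:R) = 2 - t0 by rewrite mulrC divfK ?lt0r_neq0.
 by rewrite /t; move: (i%:R * _) => z; lra.
have tn : t n.+1 = 2 by rewrite /t mulrC divfK ?lt0r_neq0//; ring.
have tS i : t i.+1 = t i + (2 - t0) / n.+1%:R by rewrite /t -[i.+1]addn1 natrD; ring.
(* Vertex [0] is the origin, so the dilates are shifted by one and the path has [n.+2] edges. *)
pose g i := if i is k.+1 then dil (t k)^-1 w else 0.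
have Hg i : H1 (g i) by case: i => [|i]; [exact: H1_0|apply: H1_dil => //; rewrite invr_gt0].
exists n.+2, g; split; [exact: Hg|exact: erefl|by rewrite /g tn; exact: J2|].
move=> i s; case: i => [_|i ile] /andP[s0 s1].
 have E : seg (g 0%N) (g 1%N) s = 0 + s *: g 1%N by rewrite /seg /= subr0.
 rewrite E; have hs : hn (s *: g 1%N) <= d.
  rewrite hnZ// ger0_norm// (le_trans _ hg0)// /g /t mul0r addr0.
  by rewrite ler_piMl ?hn_ge0.
 have := Hd 0 (s *: g 1%N) H1_0 (H1Z s (Hg 1%N)); rewrite hn0 I0 subr0.
 by move=> /(_ (ltW M0) hs)/(le_trans (ler_norm _)) => h; apply: (le_trans h); rewrite lerDr.
have ile' : (i <= n.+1)%N by rewrite ltnW.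
have r0 : 0 < (t i)^-1 by pos.
have diff : g i.+2 - g i.+1 = dil (t i)^-1 (dil (t i / t i.+1) w - w).
 apply/funext => x; rewrite /g /dil -[LHS]/(w ((t i.+1)^-1 *: x) - w ((t i)^-1 *: x)).
 rewrite -[RHS]/(w ((t i / t i.+1) *: ((t i)^-1 *: x)) - w ((t i)^-1 *: x)).
 by rewrite scalerA mulrAC mulfV ?lt0r_neq0// mul1r.
have rs : 0 < t i / t i.+1 by pos.
have hd : hn (s *: (g i.+2 - g i.+1)) <= d.
 rewrite hnZ; last exact: H1B.
 apply: (le_via (hn (g i.+2 - g i.+1))); first by rewrite ger0_norm// ler_piMl ?hn_ge0.
 have Hdd : H1 (dil (t i / t i.+1) w - w) by apply: H1B => //; exact: H1_dil.
 rewrite diff; apply: (le_trans (hn_dil_le _ Hdd)); first by rewrite tpos tle.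
 rewrite -ler_pdivlMl// [X in _ <= X]mulrC; apply: Hdl.
 have -> : t i / t i.+1 - 1 = - ((2 - t0) / n.+1%:R / t i.+1).
  have ar (a b z : R) : b != 0 -> b = a + z -> a / b - 1 = - (z / b).
   move=> b0 E; have -> : a = b - z by rewrite E addrK.
   by rewrite mulrBl mulfV// addrAC subrr add0r.
  by apply: ar (tS i); exact: lt0r_neq0.
 rewrite normrN ger0_norm; last by pos.
 have tt : t0 <= t i.+1 by rewrite /t lerDl mulr_ge0// ltW.
 rewrite ler_pdivrMr// ler_pdivrMr//.
 apply: (le_via 2); first lra.
 move: hn1; rewrite ler_pdivrMr ?mulr_gt0// => h1; apply: (le_trans h1).
 by rewrite mulrC ler_wpM2r ?(ltW n0)// ler_wpM2l// ltW.
have hM : hn (g i.+1) <= M.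
 apply: (le_trans (hn_dil_le _ Hw)); first by rewrite tpos tle.
 by rewrite lerDl.
have := Hd (g i.+1) (s *: (g i.+2 - g i.+1)) (Hg _) (H1Z s (H1B (Hg _) (Hg _))) hM hd.
move=> /(le_trans (ler_norm _)); rewrite lerBlDl => h; apply: (le_trans h); rewrite lerD2r.
by apply: HJ; rewrite tpos tle.
Qed.

(** With zero gradient, the Sobolev inequality holds with every positive [s], which forces the
    integral of [|w| ^ q] and hence [w] to vanish. *)
Lemma dg_gt0 w : H1 w -> 0 < hn w -> 0 < dg w w.
move=> Hw hw; rewrite lt_def dg_ge0// andbT; apply/eqP => A0.
have [S S0 HS] := sobolev.
have [iq _] := HS w 1 Hw ltr01 (ltac:(rewrite A0 expr1n; exact: ler01)).
have z : \I_x(`|w x| `^ q) = 0.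
 apply/le_anti; rewrite Int_ge0 ?andbT; last by move=> x; exact: powR_ge0.
 apply/ler_addgt0Pr => e e0; rewrite add0r.
 pose s := (e / S) `^ q^-1.
 have s0 : 0 < s by rewrite powR_gt0// divr_gt0.
 have [_ h] := HS w s Hw s0 (ltac:(rewrite A0; exact: sqr_ge0)).
 apply: (le_trans h); rewrite /s -powRrM mulVf ?powRr1; last 2 first.
 - by pos.
 - by apply: lt0r_neq0; move: q2; lra.
 by rewrite mulrC divfK// lt0r_neq0.
have ae := Int_eq0_ae (fun x => powR_ge0 _ _) iq z.
have lw := H1_l2 Hw.
have nw : nrm w = 0.
 rewrite -(nrm0 mu); apply: nrm_ae; [exact: l2m lw|exact: measurable_cst|].
 apply: filterS ae => x /eqP; rewrite powR_eq0 normr_eq0 => /andP[/eqP -> _] //.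
have := hn2E Hw; rewrite A0 nw expr0n addr0 => /eqP.
by rewrite expf_eq0 /= => /eqP h0; rewrite h0 ltxx in hw.
Qed.

Lemma nrm0_hn w : H1 w -> nrm w = 0 -> hn w = 0.
move=> Hw nw; have lw := H1_l2 Hw; have w0 := nrm_eq0 lw nw.
have sw0 : sob w (fun=> cst 0).
 split=> // i; split; first exact: l2_0.
 move=> phi tp; have lp := test_l2 (test_partial i tp).
 have -> : \I_x(w x * partial i phi x) = ip (cst 0) (partial i phi).
  by apply: ip_ae2 => //; [exact: l2_0|exact: aeW].
 rewrite -[X in - X]/(ip (cst 0) phi); have z u : ip (cst 0) u = 0.
  by rewrite -[RHS](@Int0 _ _ _ mu); apply: Int_eq => x; rewrite mul0r.
 by rewrite !z oppr0.
apply/eqP; rewrite -sqrf_eq0 (hn_sob sw0).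
rewrite nw expr0n addr0; apply/eqP; apply: big1 => i _.
by rewrite (_ : nrm (cst 0) = 0) ?expr0n//; exact: nrm0.
Qed.
End paths.

Section perturbed_potential.
Variables (Voo eps Ch : R) (h : T -> R).
Hypothesis dat : datum Voo eps Ch h.
Local Notation V := (Veps Voo eps h).

Let V0p : 0 < Voo / 2. by rewrite divr_gt0// (d_V dat). Qed.

(** * Energy limits and the alternative for sequences of solutions *)

Section dichotomy.
Local Opaque hn dg Jf dJf.
Implicit Types (i j : 'I_N).

Lemma Veps_pot : pot (Voo / 2) Voo V.
have [V0 e0 C1 h0 _ _ _ hf _] := dat; split.
 apply: measurable_funB; first exact: measurable_cst.
 apply: measurable_funM; first exact: measurable_cst.
 by apply: mfn_cont; exact: Ck_cont C1.
move=> x; rewrite /Veps; have := hf x; have := mulr_ge0 e0 (h0 x); lra.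
Qed.

Lemma VepsE : V = cst Voo + (- eps) *: h.
by apply/funext => x; rewrite /Veps -mulNr. Qed.

Lemma Ck1_Veps : Ck 1 V.
by rewrite VepsE; apply: CkD; [exact: Ck_cst|apply: CkZ; exact: (d_C1 dat)]. Qed.

Lemma grad_Veps x : dotv (grad V x) x = - eps * dotv (grad h x) x.
rewrite !dotv_grad mulr_sumr; apply: eq_bigr => i _.
suff -> : partial i V x = - eps * partial i h x by ring.
have Ch1 := d_C1 dat; have Cc (c : R) : Ck 1 (cst c : T -> R) by exact: Ck_cst.
rewrite VepsE partialD; last 2 first.
- by move=> y; exact: Ck1_derivable.
- by move=> y; apply: Ck1_derivable; exact: CkZ.
rewrite partial_cst [(0 + _) x]add0r.
have -> : - eps *: h = cst (- eps) * h by apply/funext.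
by rewrite partialMx// partial_cst -[RHS]addr0; congr (_ + _); exact: mulr0.
Qed.

(** [x . grad V = - eps * x . grad h] is at most [wW], a bounded decaying weight; the difference
    [wth] is nonnegative but otherwise uncontrolled. *)
Definition wW x : R := eps * Ch * rho x.
Definition wth x : R := wW x - dotv (grad V x) x.

Lemma wth_ge0 x : 0 <= wth x.
rewrite /wth /wW grad_Veps mulNr opprK -mulrA -mulrDr mulr_ge0 ?(d_e dat)//.
by have := d_grad dat x; lra.
Qed.

Lemma mfn_rho : mfn rho.
by apply: mfn_cont; exact: Ck_cont Ck1_rho. Qed.

Lemma mfn_W : mfn wW.
by apply: measurable_funM; [exact: measurable_cst|exact: mfn_rho]. Qed.

Lemma W_bound x : `|wW x| <= eps * Ch.
have C0 : 0 <= eps * Ch by rewrite mulr_ge0 ?(d_e dat) ?(d_C dat).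
by rewrite normrM (ger0_norm C0) -[leRHS]mulr1 ler_wpM2l// ger0_norm ?rho_le1// ltW// rho_gt0.
Qed.

Lemma rho_decay : decays rho.
move=> e e0; exists e^-1 => x xK; have ei : 0 < e^-1 by pos.
have [i hi] : exists i, e^-1 < `|x ord0 i|.
 apply: contrapT => nE; move: xK; rewrite ltNge => /negP; apply.
 apply: norm_le_coord; first exact: ltW.
 by move=> i; rewrite leNgt; apply/negP => ?; apply: nE; exists i.
have h1 : e^-1 <= 1 + dotv x x.
 have := sqr_le_dotv x i; rewrite -sqr_norm.
 by have := sqr_ge0 (`|x ord0 i| - 1); nra.
rewrite ger0_norm ?(ltW (rho_gt0 x))// -[leRHS]invrK lef_pV2// posrE//.
by apply: lt_le_trans h1.
Qed.

Lemma W_decay : decays wW.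
have C0 : 0 <= eps * Ch by rewrite mulr_ge0 ?(d_e dat) ?(d_C dat).
move=> e e0; have e1 : 0 < e / (eps * Ch + 1) by pos.
have [K HK] := rho_decay e1; exists K => x /HK hx.
rewrite normrM (ger0_norm C0); apply: (le_trans (ler_wpM2l C0 hx)).
by rewrite mulrC; apply: absorb_le => //; exact: ltW.
Qed.

Lemma poh_eq (lam eta : R) u : 1 <= lam -> 0 <= eta -> crit lam V (awt eta) u ->
 intg (fun x => wth x * u x ^+ 2) /\
 2 * N%:R * Jf lam V (awt eta) u = 2 * lam * dg u u + \I_x(wth x * u x ^+ 2)
  - \I_x(wW x * u x ^+ 2) + 2 * \I_x(dotv (grad (awt eta) x) x * F (u x)).
move=> l1 e0 [Hu c].
exact: (pohozaev V0p Veps_pot (awt_wgt e0) l1 Ck1_Veps (@Ck1_awt eta)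
  (fun x => awt_grad x e0) mfn_W W_bound wth_ge0 Hu c).
Qed.

Lemma tail_bound (eta : R) u : 0 <= eta -> H1 u ->
 `|2 * \I_x(dotv (grad (awt eta) x) x * F (u x))| <= 4 * eta * \I_x(`|F (u x)|).
move=> e0 Hu; have iF := intg_F Hu.
have mg := mfn_xgrad (@Ck1_awt eta).
have [_ b] := intg_bmul mg (fun x => awt_grad x e0) iF.
rewrite normrM ger0_norm//; move: b; lra.
Qed.

Lemma W_hardy u : H1 u -> \I_x(wW x * u x ^+ 2) <= dg u u.
move=> Hu; have [ir hr] := hardy Hu.
have C0 : 0 <= eps * Ch by rewrite mulr_ge0 ?(d_e dat) ?(d_C dat).
have -> : (fun x => wW x * u x ^+ 2) = (fun x => eps * Ch * (rho x * u x ^+ 2)).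
 by apply/funext => x; rewrite /wW mulrA.
rewrite IntZ//; apply: (le_trans (ler_wpM2l C0 hr)); rewrite mulrA.
by rewrite -[leRHS]mul1r ler_wpM2r ?dg_ge0// (d_small dat).
Qed.

(** In the Pohozaev identity the [wth] term has a good sign, and by Hardy the [wW] term takes away
    one of the two Dirichlet integrals; the other one is bounded by the energy, up to the error of
    order [eta] of the weight. *)
Lemma coercive (lam eta : R) u : 1 <= lam -> 0 <= eta -> crit lam V (awt eta) u ->
 dg u u <= 2 * N%:R * Jf lam V (awt eta) u + 4 * eta * \I_x(`|F (u x)|).
move=> l1 e0 c; have [it ->] := poh_eq l1 e0 c; have [Hu _] := c.
have := tail_bound e0 Hu; rewrite ler_norml => /andP[h1 _].
have h2 := W_hardy Hu; have h3 := dg_ge0 Hu.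
have h4 : 0 <= \I_x(wth x * u x ^+ 2).
 by apply: Int_ge0 => x; rewrite mulr_ge0 ?sqr_ge0// wth_ge0.
have h5 : dg u u <= lam * dg u u by rewrite -[leLHS]mul1r ler_wpM2r.
move: h1 h2 h3 h4 h5; lra.
Qed.

Section sequence.
Variables (u_ : nat -> T -> R) (lam_ eta_ : nat -> R) (e M : R).
Hypothesis cr : forall n, crit (lam_ n) V (awt (eta_ n)) (u_ n).
Hypothesis l1 : forall n, 1 <= lam_ n.
Hypothesis e0 : forall n, 0 <= eta_ n.
Hypothesis ce : eta_ n ~[n]~> (0 : R).
Hypothesis cJ : Jf (lam_ n) V (awt (eta_ n)) (u_ n) ~[n]~> e.
Hypothesis HM : forall n, hn (u_ n) <= M.

(** The [wW] integrals converge by compactness. The weight [wth] may be unbounded and need not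
    decay, so it enters through bounded decaying minorants [om], whose integrals converge too. *)
Lemma eventually_A u om (B : R) : H1 u -> wkcvg u_ u -> mfn om ->
 (forall x, 0 <= om x <= wth x) -> (forall x, `|om x| <= B) ->
 decays om ->
 forall d : R, 0 < d -> exists n0, forall n, (n0 <= n)%N -> dg (u_ n) (u_ n) <=
  2^-1 * (2 * N%:R * e - \I_x(om x * u x ^+ 2) + \I_x(wW x * u x ^+ 2)) + d.
move=> Hu wk mo o1 oB od d d0; have Hu_ n := (cr n).1.
have M0 : 0 < M + 1 by rewrite ltr_wpDl//; apply: le_trans (HM 0%N); exact: hn_ge0.
have [CF CF0 HF] := F_l1_bound M0.
have c1 := weighted_cvg Hu_ Hu wk HM mo oB od.
have c2 := weighted_cvg Hu_ Hu wk HM mfn_W W_bound W_decay.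
have c3 : 2 * N%:R * Jf (lam_ n) V (awt (eta_ n)) (u_ n) - \I_x(om x * u_ n x ^+ 2)
  + \I_x(wW x * u_ n x ^+ 2) + 4 * CF * eta_ n ~[n]~>
  2 * N%:R * e - \I_x(om x * u x ^+ 2) + \I_x(wW x * u x ^+ 2) + 4 * CF * 0.
 by apply: cvgD; [apply: cvgD => //; apply: cvgB => //; exact: cvgMr|exact: cvgMr].
rewrite mulr0 addr0 in c3.
have d20 : 0 < 2 * d by pos.
have [n0 Hn0] := cvg0E ((@cvgBP _ _ _).2 c3) d20.
exists n0 => n /Hn0/(le_trans (ler_norm _)) h1.
have [it E] := poh_eq (l1 n) (e0 n) (cr n).
have := tail_bound (e0 n) (Hu_ n); rewrite ler_norml => /andP[h2 _].
have h3 : \I_x(om x * u_ n x ^+ 2) <= \I_x(wth x * u_ n x ^+ 2).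
 apply: Int_le => //; first exact: (intg_bmul mo oB (l2i (H1_l2 (Hu_ n)))).1.
 by move=> x; rewrite ler_wpM2r ?sqr_ge0//; have /andP[] := o1 x.
have h4 : eta_ n * \I_x(`|F (u_ n x)|) <= eta_ n * CF.
 rewrite ler_wpM2l//; apply: HF => //; apply: (le_trans (HM n)); lra.
have h5 : dg (u_ n) (u_ n) <= lam_ n * dg (u_ n) (u_ n) by rewrite -[leLHS]mul1r ler_wpM2r ?dg_ge0.
move: h1 h2 h3 h4 h5; rewrite E.
have ar (A L t w X o n1 ef ec k d' : R) : 2 * L * A + t - w + X - o + w + 4 * ec * n1 - k <= 2 * d' ->
  - (4 * n1 * ef) <= X -> o <= t -> n1 * ef <= n1 * ec -> A <= L * A -> A <= 2^-1 * k + d' by lra.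
exact: ar.
Qed.

(** For solutions the Pohozaev identity expresses the energy through the gradient, the [wth]
    integral and the [wW] integral: the first two are lower semicontinuous and the last one
    converges. This replaces semicontinuity of the functional, in which [F] has no sign. *)
Lemma energy_limit u : crit 1 V (cst 1) u -> wkcvg u_ u -> Jf 1 V (cst 1) u <= e.
move=> c wk; have [Hu _] := c; rewrite -awt0 in c *.
have [it E] := poh_eq (lexx 1) (lexx 0) c.
have tl : \I_x(dotv (grad (awt 0) x) x * F (u x)) = 0.
 apply/eqP; rewrite -normr_le0; have := tail_bound (lexx 0) Hu; rewrite mulr0 mul0r normrM ger0_norm//; lra.
have mth : mfn wth by apply: measurable_funB; [exact: mfn_W|apply: mfn_xgrad; exact: Ck1_Veps].
(* Truncations of [wth] in height and in space: compact for each [n], and increasing to [wth]. *)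
pose om n x : R := \1_(cube n%:R) x * Num.min (wth x) n%:R.
have mi n := mfn_cube n%:R.
have mo n : mfn (om n).
 by apply: measurable_funM => //; apply: measurable_minr => //; exact: measurable_cst.
have min0 n x : 0 <= Num.min (wth x) n%:R by rewrite le_min wth_ge0 ler0n.
have o1 n x : 0 <= om n x <= wth x.
 rewrite mulr_ge0 ?ind_ge0//=; apply: (le_via (1 * Num.min (wth x) n%:R)).
  by rewrite ler_wpM2r// ind_le1.
 by rewrite mul1r ge_min lexx.
have oB n x : `|om n x| <= n%:R.
 rewrite normrM ind_norm (ger0_norm (min0 n x)) -[leRHS]mul1r ler_pM ?ind_ge0 ?ind_le1//.
 by rewrite ge_min lexx orbT.
have od n : decays (om n).
 move=> e'0; exists (n%:R + 1) => x xK; rewrite /om ind0 ?mul0r ?normr0 ?ltW//.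
 move=> xc; move: xK; apply/negP; rewrite -leNgt; apply: norm_le_coord; first by pos.
 move=> i; move: xc => /(_ i); rewrite /= in_itv /= => /andP[]; rewrite ler_norml => ? ?.
 by apply/andP; split; lra.
have Hu_ n := (cr n).1.
have bd n : dg u u <= 2^-1 * (2 * N%:R * e - \I_x(om n x * u x ^+ 2) + \I_x(wW x * u x ^+ 2)).
 apply: (dg_lsc Hu_ Hu wk) => d d0; exact: (eventually_A Hu wk (mo n) (o1 n) (oB n) (od n)).
have [|||||_ c1] := @Int_dct _ _ _ mu (fun n x => om n x * u x ^+ 2) (fun x => wth x * u x ^+ 2)
 (fun x => wth x * u x ^+ 2) => //.
- by move=> n; apply: measurable_funM => //; exact: intg_m (l2i (H1_l2 Hu)).
- exact: intg_m it.
- apply: aeW => x; apply: cvgMl.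
 have [k hk] : exists k : nat, wth x + `|x| <= k%:R.
  by exists (Num.truncn (wth x + `|x|)).+1; apply/ltW/truncnS_gt.
 have w0 := wth_ge0 x; have x0 := normr_ge0 x.
 apply/cvgBP; apply/cvg0P => d d0; exists k => n kn.
 have kn' : k%:R <= n%:R :> R by rewrite ler_nat.
 rewrite /om ind1; last by apply/set_mem; apply: in_cube; lra.
 by rewrite mul1r min_l; [rewrite subrr normr0 ltW|lra].
- move=> n x; have /andP[om0 omx] := o1 n x; rewrite ger0_norm; last by apply: mulr_ge0 => //; exact: sqr_ge0.
 by apply: ler_wpM2r => //; exact: sqr_ge0.
have b2 : \I_x(wth x * u x ^+ 2) <= 2 * N%:R * e + \I_x(wW x * u x ^+ 2) - 2 * dg u u.
 rewrite -(cvg_lim _ c1)//; apply: limr_le; first exact: cvgP c1.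
 by apply: nearW => n; have := bd n; lra.
have N0 : 0 < 2 * N%:R :> R by rewrite mulr_gt0// ltr0n; apply: leq_trans N3.
by rewrite -(ler_pM2l N0) E tl; move: b2; lra.
Qed.

End sequence.

Lemma avg_cube (K r : R) u y : 0 < r -> l2 u -> `|y| <= K ->
 `|avg r u y| <= r ^- N * nrm \1_(Q r) * nrm (\1_(cube (K + r)) * u).
move=> r0 lu yK; have mi := mfn_cube (K + r).
have [li _] := l2_bmul mi (K := 1) (fun x => ltac:(by rewrite ind_norm ind_le1)) lu.
suff -> : avg r u y = avg r (\1_(cube (K + r)) * u) y by exact: avg_bound.
congr (_ * _); apply: Int_eq => z.
case: (pselect (Q r z)) => [zQ|zQ]; last by rewrite ind0// !mul0r.
rewrite ind1// !mul1r /shf [RHS]/(\1_(cube (K + r)) (z + y) * u (z + y)) ind1.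
 exact: (esym (mul1r _)).
apply/set_mem; apply: in_cube; rewrite addrC; apply: (le_trans (ler_normD _ _)); apply: lerD => //.
apply: norm_le_coord; first exact: ltW.
by move=> i; move: zQ => /(_ i); rewrite /= in_itv /= => /andP[z0 zr]; rewrite ger0_norm// ltW.
Qed.

Lemma comp_incr (k l : nat -> nat) : {homo k : m n / (m < n)%N} -> {homo l : m n / (m < n)%N} ->
 {homo (k \o l) : m n / (m < n)%N}.
by move=> hk hl m n /hl/hk. Qed.

(** If the weak limit is null, [nonvanishing] gives centres around which the averages of the
    solutions stay away from zero, and local compactness drives these centres to infinity. Around
    them the potential tends to [Voo] and, by [awt_shift], the weight tends to a single number along
    a subsequence. *)
Theorem dichotomy (u_ : nat -> T -> R) (lam_ eta_ : nat -> R) (e DD : R) :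
 (forall n, crit (lam_ n) V (awt (eta_ n)) (u_ n)) -> (forall n, 1 <= lam_ n) ->
 lam_ n ~[n]~> (1 : R) -> (forall n, 0 <= eta_ n) -> eta_ n ~[n]~> (0 : R) ->
 Jf (lam_ n) V (awt (eta_ n)) (u_ n) ~[n]~> e ->
 (forall n, dg (u_ n) (u_ n) <= DD) -> (forall n, 0 < hn (u_ n)) ->
 (exists u, [/\ crit 1 V (cst 1) u, 0 < hn u & Jf 1 V (cst 1) u <= e]) \/
 (exists w (al : R), [/\ 0 <= al <= 1, crit 1 (cst Voo) (cst al) w, 0 < hn w & dg w w <= N%:R * e]).
move=> cr0 l10 cl0 e00 ce0 cJ0 HD0 hp0; have pV := Veps_pot.
have [M M0 HM0] : exists2 M : R, 0 < M & forall n, hn (u_ n) <= M.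
 have [E [_ HE]] : bounded_fun (fun n => Jf (lam_ n) V (awt (eta_ n)) (u_ n)).
  by apply: cvg_seq_bounded; apply/cvg_ex; exists e.
 have [M M0 HM] := hn_from_dg Voo V0p DD (E + 1); exists M => // n.
 have [Hu _] := cr0 n.
 apply: (HM _ _ (lam_ n) _ pV (awt_wgt (e00 n))) => //; first exact: le_trans (l10 n).
 by apply: (le_trans (ler_norm _)); apply: (HE (E + 1)); rewrite ?ltrDl.
have [k [u [ki Hu wk]]] := H1_weak_compact (fun n => (cr0 n).1) HM0.
pose v_ n := u_ (k n); pose lam n := lam_ (k n); pose eta n := eta_ (k n).
have cr n : crit (lam n) V (awt (eta n)) (v_ n) by exact: cr0.
have l1 n : 1 <= lam n by exact: l10.
have e0 n : 0 <= eta n by exact: e00.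
have cl : lam n ~[n]~> (1 : R) := cvg_sub ki cl0.
have ce : eta n ~[n]~> (0 : R) := cvg_sub ki ce0.
have cJ : Jf (lam n) V (awt (eta n)) (v_ n) ~[n]~> e := cvg_sub ki cJ0.
have HM n : hn (v_ n) <= M by exact: HM0.
have hp n : 0 < hn (v_ n) by exact: hp0.
have Hv n := (cr n).1.
have HV x : `|V x| <= Voo := pot_norm (ltW V0p) pV x.
have awt_cvg (t_ : nat -> R) (y_ : nat -> T) (al : R) : (forall n, 0 <= t_ n) -> t_ n ~[n]~> (0 : R) ->
  awt (t_ n) (y_ n) ~[n]~> al -> forall x, awt (t_ n) (x + y_ n) ~[n]~> al.
 move=> t0 ct ca x; apply: cvg_transfer ca.
 apply: (@cvg0_le _ _ (fun n => t_ n * ln (2 * (1 + dotv x x)))); first by move=> n; exact: awt_shift.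
 by rewrite -[X in _ --> X](mul0r (ln (2 * (1 + dotv x x)))); exact: cvgMl.
case: (ltrP 0 (hn u)) => hu.
 left; exists u; have cu : crit 1 V (cst 1) u.
  split=> //; apply: (@crit_limit v_ u lam (fun=> V) (fun n => awt (eta n)) V (cst 1) M Voo) => //.
  - by move=> n; exact: pV.1.
  - exact: pV.1.
  - by move=> x; exact: cvg_cst.
  - by move=> n; exact: awt_wgt.
  - by split=> [|x]; [exact: measurable_cst|rewrite /= ler01 lexx].
  - have a0 : awt (eta n) (0 : T) ~[n]~> (1 : R).
    have -> : (fun n => awt (eta n) (0 : T)) = cst 1; last exact: cvg_cst.
    apply/funext => n; rewrite /awt.
    have -> : dotv (0 : T) 0 = 0 by apply: big1 => i _; rewrite mxE mul0r.
    by rewrite addr0 ln1 mulr0 oppr0 expR0.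
   by move=> x; have := awt_cvg eta (fun=> 0) 1 e0 ce a0 x; rewrite addr0.
  - by move=> n psi Hp; exact: (cr n).2.
 by split=> //; exact: (energy_limit cr l1 e0 ce cJ HM cu wk).
right; have nu0 : nrm u = 0.
 by apply/le_anti; rewrite nrm_ge0 andbT (le_trans (nrm_le_hn Hu)).
have [r r0 [ka ka0 HN]] := nonvanishing Voo V0p M0.
have ex n : exists x, ka < `|avg r (v_ n) x|.
 by apply: (HN _ _ _ _ (l1 n) pV (awt_wgt (e0 n)) (Hv n)) => //; exact: (cr n).2.
have [y_ Hy] := choice ex.
(* Averages at centres in a fixed ball are controlled by the [L^2] norm on a cube, which tends to
   zero. *)
have far (K : R) : exists n0, forall n, (n0 <= n)%N -> K < `|y_ n|.
 have cc := rellich_cube (K + r) Hv Hu wk HM.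
 pose c := r ^- N * nrm \1_(Q r : set T).
 have c0 : 0 <= c by rewrite mulr_ge0 ?nrm_ge0// invr_ge0 exprn_ge0// ltW.
 have k0 : 0 < ka / (c + 1) by pos.
 have [n0 Hn0] := cvg0E cc k0.
 exists n0 => n /Hn0; rewrite ger0_norm ?nrm_ge0// => hn'.
 rewrite ltNge; apply/negP => yK.
 have lvn := H1_l2 (Hv n); have lu := H1_l2 Hu.
 have mi := mfn_cube (K + r).
 have i1 x : `|\1_(cube (K + r)) x| <= 1 :> R by rewrite ind_norm ind_le1.
 have [la _] := l2_bmul mi i1 (l2B lvn lu); have [lb nb] := l2_bmul mi i1 lu.
 have := Hy n; apply/negP; rewrite -leNgt; apply: (le_trans (avg_cube r0 lvn yK)).
 have -> : \1_(cube (K + r)) * v_ n = \1_(cube (K + r)) * (v_ n - u) + \1_(cube (K + r)) * u.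
  by rewrite mulrBr subrK.
 apply: (le_via (c * (ka / (c + 1)))).
  rewrite ler_wpM2l//; apply: (le_trans (nrm_tri la lb)).
  by rewrite nu0 mulr0 in nb; rewrite -[leRHS]addr0; apply: lerD.
 by rewrite mulrC; apply: absorb_le => //; exact: ltW.
pose w_ n := shf (y_ n) (v_ n).
have Hw n : H1 (w_ n) by exact: H1_shf.
have HMw n : hn (w_ n) <= M by rewrite hn_shf.
have [k2 [w [k2i Hw' wk2]]] := H1_weak_compact Hw HMw.
have aw1 n : `|awt (eta (k2 n)) (y_ (k2 n))| <= 1 by exact: (wgt_norm (awt_wgt (e0 _))).
have [k3 [k3i [al ca]]] := BW aw1.
pose kk := k2 \o k3; have kki : {homo kk : m n / (m < n)%N} by exact: comp_incr.
have wkk : wkcvg (w_ \o kk) w by exact: (wkcvg_sub k3i wk2).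
have kkn n : (n <= kk n)%N by exact: inc_ge.
have al01 : 0 <= al <= 1.
 rewrite -(cvg_lim _ ca)//; apply/andP; split; [apply: limr_ge|apply: limr_le]; try exact: cvgP ca;
  by apply: nearW => n; have /andP[] := (awt_wgt (e0 (kk n))).2 (y_ (kk n)).
have Vc x : shf (y_ (kk n)) V x ~[n]~> Voo.
 have hc : h (x + y_ (kk n)) ~[n]~> (0 : R).
  apply/cvg0P => d d0; have [K HK] := d_dec dat d0.
  have [n0 Hn0] := far (K + `|x|).
  exists n0 => n n0n; apply: HK; have h1 := Hn0 _ (leq_trans n0n (kkn n)).
  have h2 : `|y_ (kk n)| <= `|x + y_ (kk n)| + `|x|.
   by rewrite -{1}[y_ (kk n)](addKr x) addrC; apply: (le_trans (ler_normB _ _)); rewrite lexx.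
  by move: h1 h2; lra.
 have H : Voo - eps * h (x + y_ (kk n)) ~[n]~> Voo - eps * 0.
  by apply: cvgB; [exact: cvg_cst|exact: cvgMr].
 by rewrite mulr0 subr0 in H.
exists w, al; split=> //.
- split=> //; apply: (@crit_limit (w_ \o kk) w (lam \o kk) (fun n => shf (y_ (kk n)) V)
  (fun n => shf (y_ (kk n)) (awt (eta (kk n)))) (cst Voo) (cst al) M Voo) => //.
 + by move=> n; exact: Hw.
 + by move=> n; exact: HMw.
 + exact: cvg_sub kki cl.
 + by move=> n; apply: mfn_shf; exact: pV.1.
 + by move=> n x; exact: HV.
 + move=> n; have [m1 m2] := awt_wgt (e0 (kk n)); split; [exact: mfn_shf|by move=> x; exact: m2].
 + by apply: (awt_cvg (eta \o kk) (y_ \o kk)) => //; [move=> n; exact: e0|exact: cvg_sub kki ce].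
 + move=> n psi Hp; rewrite (dJ_shf _ _ pV.1 HV (awt_wgt (e0 _)) (Hv _) Hp).
  by apply: (cr (kk n)).2; exact: H1_shf.
- rewrite ltNge; apply/negP => hw.
 have nw0 : nrm w = 0.
  by apply/le_anti; rewrite nrm_ge0 andbT (le_trans (nrm_le_hn Hw')).
 have := avg_bound 0 r0 (H1_l2 Hw'); rewrite nw0 mulr0; apply/negP; rewrite -ltNge.
 apply: (lt_le_trans ka0).
 have ca1 : avg r ((w_ \o kk) n) 0 ~[n]~> avg r w 0 by apply: wkcvg_avg => //; move=> n; exact: Hw.
 have ca2 : `|avg r ((w_ \o kk) n) 0| ~[n]~> `|avg r w 0| by exact: cvg_norm ca1.
 rewrite -(cvg_lim _ ca2)//; apply: limr_ge; first exact: cvgP ca2.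
 by apply: nearW => n; rewrite /= avg_shf ltW.
(* Gradients are translation invariant, so the bound comes from the untranslated sequence with
   [om = 0]; its weak limit is null and the [wW] term disappears, which leaves [N * e]. *)
- apply: (dg_lsc (fun n => Hw (kk n)) Hw' wkk) => d d0.
 have z0 : \I_x((cst 0 : T -> R) x * u x ^+ 2) = 0.
  by rewrite -[RHS](@Int0 _ _ _ mu); apply: Int_eq => x; rewrite mul0r.
 have [||||n0 Hn0] := eventually_A cr l1 e0 ce cJ HM (om := cst 0) (B := 0) Hu wk _ _ _ _ d0.
 + exact: measurable_cst.
 + by move=> x; rewrite lexx wth_ge0.
 + by move=> x; rewrite normr0.
 + by move=> e' e'0; exists 0 => x _; rewrite normr0 ltW.
 exists n0 => n n0n; rewrite /= dg_shf//.
 apply: (le_trans (Hn0 _ (leq_trans n0n (kkn n)))); rewrite z0 subr0 lerD2r.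
 have h1 := W_hardy Hu; have h2 := dg_le_hn Hu.
 have h3 : hn u = 0 by apply/le_anti; rewrite hu hn_ge0.
 by rewrite h3 expr0n /= in h2; move: h1 h2; lra.
Qed.

End dichotomy.

(** * Comparison with the problem at infinity *)

Section comparison.
Local Opaque hn dg dJf.
Let mh : mfn (fun x => eps * h x).
apply: measurable_funM; first exact: measurable_cst.
by apply: mfn_cont; exact: Ck_cont (d_C1 dat).
Qed.

Let hB x : `|eps * h x| <= Voo / 2.
by rewrite ger0_norm ?(d_half dat)// mulr_ge0 ?(d_e dat) ?(d_h0 dat). Qed.

Lemma dil_energy w (t : R) : H1 w -> 0 < t ->
 Jf 1 V (cst 1) (dil t^-1 w) = 2^-1 * (t ^+ (N - 2) * dg w w + t ^+ N * (Voo * nrm w ^+ 2))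
  - t ^+ N * \I_x(F (w x)) - 2^-1 * \I_x(eps * h x * (dil t^-1 w) x ^+ 2).
move=> Hw t0; have ti : 0 < t^-1 by pos.
have ld := l2_dil ti (H1_l2 Hw); have id := l2i ld.
rewrite /Jf dg_dil// mul1r.
have -> : \I_x(V x * dil t^-1 w x ^+ 2) = Voo * (t ^+ N * nrm w ^+ 2) - \I_x(eps * h x * (dil t^-1 w) x ^+ 2).
 rewrite -nrm_dilV ?nrmE//; last exact: H1_l2.
 rewrite -IntZ// -IntB; [|exact: intgZ|exact: (intg_bmul mh hB id).1].
 by apply: Int_eq => x; rewrite -mulrBl.
have -> : \I_x(cst 1 x * F (dil t^-1 w x)) = t ^+ N * \I_x(F (w x)).
 by rewrite -Int_dilV ?(intg_F Hw)//; apply: Int_eq => x; rewrite mul1r.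
ring.
Qed.

Lemma grad_cst (c : R) x : dotv (grad (cst c) x) x = 0.
by rewrite dotv_grad big1// => i _; rewrite partial_cst mulr0. Qed.

(** With constant coefficients the Pohozaev identity reduces the energy to a multiple of the
    gradient; this is the hypothesis of [profile_ar]. *)
Lemma limit_profile w (al : R) : 0 <= al <= 1 -> crit 1 (cst Voo) (cst al) w ->
 2^-1 * (dg w w + Voo * nrm w ^+ 2) - al * \I_x(F (w x)) = dg w w / N%:R.
move=> al01 [Hw c]; have V0 := d_V dat.
have pV : pot Voo Voo (cst Voo : T -> R) by split=> [|x]; [exact: measurable_cst|rewrite /= lexx].
have wa : wgt (cst al : T -> R) by split; [exact: measurable_cst|].
have Cc (b : R) : Ck 1 (cst b : T -> R) by exact: Ck_cst.
have b0 (b : R) (k : R) x : 0 <= k -> `|dotv (grad (cst b) x) x| <= k by rewrite grad_cst normr0.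
have [||_] := pohozaev (KW := 0) (W := cst 0) V0 pV wa (lexx 1) (Cc _) (Cc _) (fun x => b0 al 0 x (lexx 0))
  (measurable_cst _) _ _ Hw c.
- by move=> x; rewrite normr0.
- by move=> x; rewrite grad_cst subr0.
have Z (k : T -> R) : \I_x(0 * k x) = 0.
 by rewrite -[RHS](@Int0 _ _ _ mu); apply: Int_eq => x; rewrite mul0r.
under [X in _ = _ + X - _ + _]eq_Rintegral do rewrite grad_cst subr0.
under [X in _ = _ + 2 * X]eq_Rintegral do rewrite grad_cst.
rewrite !Z /Jf !IntZ; [|exact: (intg_F Hw)|exact: l2i (H1_l2 Hw)].
rewrite -nrmE; have N0 : N%:R != 0 :> R by rewrite pnatr_eq0 -lt0n; apply: leq_trans N3.
move: (dg w w) (nrm w ^+ 2) (Int _) N0 => A B E N0 H.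
have E2 : 2 * N%:R * (2^-1 * (1 * A + Voo * B) - al * E) = 2 * A by rewrite H; ring.
by apply: (mulfI N0); rewrite mulrCA mulfV// mulr1; move: E2; lra.
Qed.

(** The perturbation may vanish on most of the mass of [w], so [w] is translated: a cube on which
    [w] has nonzero average is brought into a small ball where [eps * h] is bounded below. *)
Lemma spread w : H1 w -> 0 < nrm w -> (exists x0, 0 < eps * h x0) ->
 exists y, 0 < \I_x(eps * h x * shf y w x ^+ 2).
move=> Hw nw [x0 hx0]; have lw := H1_l2 Hw.
pose c := eps * h x0 / 2; have c0 : 0 < c by rewrite divr_gt0.
have ch : continuous (fun x => eps * h x) by apply: contZ; exact: Ck_cont (d_C1 dat).
have [dl dl0 Hdl] : exists2 dl : R, 0 < dl & forall x, `|x - x0| <= dl -> c <= eps * h x.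
 have /(@cvgrPdist_lt _ _ _ (nbhs x0) (nbhs_filter x0))/(_ c c0)/nbhs_ballP[dl /= dl0 H] := ch x0.
 exists (dl / 2); first by pos.
 move=> x xx; have /H : ball x0 dl x.
  by rewrite -ball_normE /ball_ /= distrC; apply: (le_lt_trans xx); lra.
 by rewrite /= ltr_norml => /andP[_]; rewrite /c; lra.
have b0 : 0 <= N%:R * bn dg w by rewrite mulr_ge0// sqrtr_ge0.
(* The first bound fits the cube into the ball; with the second, vanishing of all averages would
   give [nrm w <= nrm w / 2] by [avg_diff]. *)
pose r := Num.min dl (nrm w / 2 / (N%:R * bn dg w + 1)).
have r0 : 0 < r by rewrite lt_min dl0 !divr_gt0// ltr_wpDl.
have [z hz] : exists z, avg r w z != 0.
 apply: contrapT => nE; have [_ hav] := avg_diff r0 Hw.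
 have E : w - avg r w = w.
  apply/funext => x; have -> : (w - avg r w) x = w x - avg r w x by [].
  rewrite (_ : avg r w x = 0) ?subr0//; apply/eqP/negPn/negP => ?; by apply: nE; exists x.
 rewrite E in hav.
 have h1 : N%:R * r * bn dg w <= nrm w / 2.
  rewrite mulrAC -mulrC; apply: (le_via (nrm w / 2 / (N%:R * bn dg w + 1) * (N%:R * bn dg w))).
   by rewrite ler_wpM2r// ge_min lexx orbT.
  by apply: absorb_le => //; rewrite ltW// divr_gt0.
 by move: (le_trans hav h1) nw; lra.
exists (z - x0); rewrite lt_def; apply/andP; split; last first.
 by apply: Int_ge0 => x; rewrite mulr_ge0 ?sqr_ge0// mulr_ge0 ?(d_e dat) ?(d_h0 dat).
apply/eqP => I0'; move/eqP: hz; apply.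
have lq := @l2_Q r; have lz := @l2_shf z _ lw.
have mQ : mfn (\1_(Q r) : T -> R) by exact: mfn_box.
have i1 x : `|\1_(Q r) x| <= 1 :> R by rewrite ind_norm ind_le1.
have [lm _] := l2_bmul mQ i1 lz.
suff n0 : nrm (\1_(Q r) * shf z w) = 0.
 rewrite /avg; have -> : ip \1_(Q r) (shf z w) = ip \1_(Q r) (\1_(Q r) * shf z w).
  apply: Int_eq => x; rewrite -[(_ * shf z w) x]/(\1_(Q r) x * shf z w x).
  by rewrite mulrA -expr2 ind_sqr.
 have := ip_cs lq lm; rewrite n0 mulr0 normr_le0 => /eqP ->; by rewrite mulr0.
apply/eqP; rewrite -sqrf_eq0 nrmE; apply/eqP.
have lzx := @l2_shf (z - x0) _ lw.
have im := l2i lm; have is' := intg_shift (- x0) im.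
rewrite -(Int_shift (- x0) im); apply/le_anti; rewrite Int_ge0 ?andbT; last by move=> x; exact: sqr_ge0.
rewrite -(ler_pM2l c0) mulr0 -I0' -IntZ//; apply: Int_le.
- exact: intgZ.
- exact: (intg_bmul mh hB (l2i lzx)).1.
move=> x; rewrite -[(\1_(Q r) * shf z w) (x - x0)]/(\1_(Q r) (x - x0) * w (x - x0 + z)).
have -> : shf (z - x0) w x = w (x - x0 + z) by rewrite /shf; congr w; rewrite -addrA [- x0 + z]addrC.
case: (pselect (Q r (x - x0))) => [xQ|xQ]; last first.
 by rewrite ind0// mul0r expr0n mulr0 mulr_ge0 ?sqr_ge0// mulr_ge0 ?(d_e dat) ?(d_h0 dat).
rewrite ind1// mul1r ler_wpM2r ?sqr_ge0//; apply: Hdl; apply: (le_via r); last by rewrite ge_min lexx.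
apply: norm_le_coord; first exact: ltW.
by move=> i; move: xQ => /(_ i); rewrite /= in_itv /= => /andP[z0 zr]; rewrite ger0_norm// ltW.
Qed.

Local Opaque Jf.

Lemma eps_h_ge0 x : 0 <= eps * h x.
by rewrite mulr_ge0 ?(d_e dat) ?(d_h0 dat). Qed.

Section profile.
Variables (A B E al : R) (w : T -> R).
Hypotheses (A0 : 0 < A) (aE : 0 <= (1 - al) * E) (Hw : H1 w).
Hypothesis prof : 2^-1 * (A + Voo * B) - al * E = A / N%:R.
Hypotheses (EA : dg w w = A) (EB : nrm w ^+ 2 = B) (EE : \I_x(F (w x)) = E).

Let Hi t := \I_x(eps * h x * (dil t^-1 w) x ^+ 2).

Let Hi0 t : 0 <= Hi t.
by apply: Int_ge0 => x; rewrite mulr_ge0 ?sqr_ge0// eps_h_ge0. Qed.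

Let An : 0 < A / N%:R.
by rewrite divr_gt0// ltr0n; apply: leq_trans N3. Qed.

(** A gap that is uniform in [t] survives the approximation by polygons. The maximum with [0] is
    needed because the path starts at [0], with energy [0]. *)
Lemma comp_finish (e1 : R) : 0 < e1 ->
 (forall t : R, 0 < t <= 2 -> Jf 1 V (cst 1) (dil t^-1 w) <= A / N%:R - e1) ->
 exists2 c : R, c < A / N%:R & adm V c.
move=> e10 HJ; have [m Em] : exists m : R, m = Num.max 0 (A / N%:R - e1) by eexists.
have mA : m < A / N%:R by rewrite Em gt_max An /= ltrBlDr ltrDl.
exists (m + (A / N%:R - m) / 2); first exact: half_ar.
apply: (path_adm (divr_gt0 (d_V dat) (ltr0Sn R 1)) (Veps_pot) Hw).
- by rewrite Em le_max lexx.
- by move=> t /HJ hJ; rewrite Em le_max hJ orbT.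
- rewrite (dil_energy Hw (ltr0Sn R 1)) EA EB EE.
 apply: (@le_lt_trans _ _ (2^-1 * (2 ^+ (N - 2) * A + 2 ^+ N * (Voo * B)) - 2 ^+ N * E)).
  by rewrite gerBl; apply: mulr_ge0; [rewrite invr_ge0 ler0n|exact: Hi0].
 exact: (profile2_ar N3 A0 aE prof).
- by rewrite divr_gt0// subr_gt0.
Qed.

Lemma comp_up (t : R) : 0 < t ->
 Jf 1 V (cst 1) (dil t^-1 w) <= A / N%:R * (1 - (1 - t) ^+ 2) - (1 - al) * E * t ^+ N - 2^-1 * Hi t.
move=> t0; rewrite (dil_energy Hw t0) EA EB EE lerD2r.
exact: (profile_ar N3 (ltW t0) (ltW A0) prof).
Qed.

Lemma comp_small (t d : R) : d ^+ 2 <= (1 - t) ^+ 2 ->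
 A / N%:R * (1 - (1 - t) ^+ 2) <= A / N%:R - A / N%:R * d ^+ 2.
by move=> hd; rewrite mulrBr mulr1 lerD2l lerN2 ler_wpM2l// ltW. Qed.

Lemma comp_le (t : R) : A / N%:R * (1 - (1 - t) ^+ 2) <= A / N%:R.
by rewrite ler_piMr ?(ltW An)// gerBl sqr_ge0. Qed.

(** For [t <= 1 / 2] the quadratic deficit of the profile is bounded below, and for larger [t] the
    loss [(1 - al) * E * t ^ N] is. *)
Lemma comp_alpha : 0 < (1 - al) * E -> exists2 c : R, c < A / N%:R & adm V c.
move=> ee; have [e1 Ee] : exists e1 : R, e1 = Num.min ((1 - al) * E * 2^-1 ^+ N) (A / N%:R * 2^-1 ^+ 2) by eexists.
apply: (@comp_finish e1).
 by rewrite Ee lt_min; apply/andP; split; apply: mulr_gt0 => //; rewrite exprn_gt0// invr_gt0.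
move=> t /andP[t0 t2]; apply: (le_trans (comp_up t0)).
have h1 := Hi0 t; case: (lerP t 2^-1) => tt.
 have ht : 2^-1 ^+ 2 <= (1 - t) ^+ 2 by rewrite lerXn2r ?nnegrE; lra.
 have h2 := comp_small ht; have h3 : e1 <= A / N%:R * 2^-1 ^+ 2 by rewrite Ee ge_min lexx orbT.
 have h4 : 0 <= (1 - al) * E * t ^+ N by pos.
 by move: (Hi t) (A / N%:R * 2^-1 ^+ 2) (_ * t ^+ N) h1 h2 h3 h4 => *; lra.
have h2 := comp_le t.
have h3 : e1 <= (1 - al) * E * t ^+ N.
 apply: (le_via ((1 - al) * E * 2^-1 ^+ N)); first by rewrite Ee ge_min lexx.
 by rewrite ler_wpM2l// lerXn2r ?nnegrE ?invr_ge0 ?(ltW t0)// ltW.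
by move: (Hi t) (_ * t ^+ N) h1 h2 h3 => *; lra.
Qed.

Lemma weight_close (t e2 : R) : 0 < t -> e2 <= 1 -> hn (dil t^-1 w - w) <= e2 ->
 \I_x(eps * h x * w x ^+ 2) - Hi t <= e2 * (Voo / 2 * (2 * nrm w + 1)).
move=> t0 e21 hd; have ti : 0 < t^-1 by pos.
have lw := H1_l2 Hw; have ld := l2_dil ti lw; have V0 := d_V dat.
have nd : nrm (dil t^-1 w - w) <= e2 by apply: le_trans hd; apply: nrm_le_hn; apply: H1B => //; exact: H1_dil.
rewrite /Hi -IntB; [|exact: (intg_bmul mh hB (l2i lw)).1|exact: (intg_bmul mh hB (l2i ld)).1].
have [lm nm] := l2_bmul mh hB (l2B lw ld).
have -> : \I_x(eps * h x * w x ^+ 2 - eps * h x * (dil t^-1 w) x ^+ 2) =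
  ip ((fun x => eps * h x) * (w - dil t^-1 w)) (w + dil t^-1 w).
 apply: Int_eq => x; fring.
apply: (le_trans (ler_norm _)); apply: (le_trans (ip_cs lm (l2D lw ld))).
have n2 : nrm (w + dil t^-1 w) <= 2 * nrm w + 1.
 have -> : w + dil t^-1 w = (dil t^-1 w - w) + (w + w) by rewrite addrA subrK addrC.
 apply: (le_trans (nrm_tri (l2B ld lw) (l2D lw lw))).
 have := nrm_tri lw lw; have := le_trans nd e21.
 by move: (nrm _) (nrm _) (nrm _) => *; lra.
have -> : e2 * (Voo / 2 * (2 * nrm w + 1)) = Voo / 2 * e2 * (2 * nrm w + 1) by ring.
apply: ler_pM; rewrite ?nrm_ge0//; apply: (le_trans nm); rewrite ler_wpM2l ?divr_ge0 ?(ltW V0)//.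
by rewrite nrmB.
Qed.

(** Near [t = 1] the perturbation still sees a positive share of the dilated profile, by continuity
    of dilations; away from [1] the quadratic deficit provides the gap. *)
Lemma comp_h : 0 < \I_x(eps * h x * w x ^+ 2) -> exists2 c : R, c < A / N%:R & adm V c.
have [H EH] : exists H : R, H = \I_x(eps * h x * w x ^+ 2) by eexists.
rewrite -EH => Hy; have V0 := d_V dat.
have [C EC] : exists C : R, C = Voo / 2 * (2 * nrm w + 1) by eexists.
have C0 : 0 <= C by rewrite EC mulr_ge0 ?divr_ge0 ?addr_ge0 ?mulr_ge0 ?nrm_ge0// ltW.
have [e2 Ee] : exists e2 : R, e2 = Num.min 1 (H / 2 / (C + 1)) by eexists.
have e20 : 0 < e2 by rewrite Ee lt_min ltr01 !divr_gt0// ltr_wpDl.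
have [dl /andP[dl0 dl2] Hdl] := H1_dil_cont Hw e20.
have [e1 Ee1] : exists e1 : R, e1 = Num.min (H / 4) (A / N%:R * (dl / 2) ^+ 2) by eexists.
apply: (@comp_finish e1).
 by rewrite Ee1 lt_min divr_gt0//= mulr_gt0// exprn_gt0// divr_gt0.
move=> t /andP[t0 t2]; apply: (le_trans (comp_up t0)).
have h4 : 0 <= (1 - al) * E * t ^+ N by pos.
case: (lerP `|t^-1 - 1| dl) => td.
 have e21 : e2 <= 1 by rewrite Ee ge_min lexx.
 have h1 := weight_close t0 e21 (Hdl _ td); rewrite -EH -EC in h1.
 have h5 : e2 * C <= H / 2.
  apply: (le_via (H / 2 / (C + 1) * C)); first by rewrite Ee ler_wpM2r// ge_min lexx orbT.
  by apply: absorb_le => //; rewrite ltW// divr_gt0.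
 have h2 := comp_le t.
 have h3 : e1 <= H / 4 by rewrite Ee1 ge_min lexx.
 by move: (Hi t) (e2 * C) (_ * t ^+ N) h1 h2 h3 h4 h5 => *; lra.
have hd : (dl / 2) ^+ 2 <= (1 - t) ^+ 2.
 rewrite -[leRHS]sqr_norm lerXn2r ?nnegrE//; first by pos.
 case: (lerP t 2^-1) => tt; first by rewrite ger0_norm; lra.
 have h5 : dl * t < `|1 - t|.
  have -> : 1 - t = (t^-1 - 1) * t by rewrite mulrBl mul1r mulVf// lt0r_neq0.
  by rewrite normrM (gtr0_norm t0) ltr_pM2r.
 by apply: ltW; apply: le_lt_trans h5; rewrite ler_wpM2l// ltW.
have h2 := comp_small hd.
have h3 : e1 <= A / N%:R * (dl / 2) ^+ 2 by rewrite Ee1 ge_min lexx orbT.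
by have h1 := Hi0 t; move: (Hi t) (A / N%:R * (dl / 2) ^+ 2) (_ * t ^+ N) h1 h2 h3 h4 => *; lra.
Qed.

End profile.

Lemma comparison w (al : R) : 0 <= al <= 1 -> crit 1 (cst Voo) (cst al) w -> 0 < hn w ->
 (al < 1 \/ exists x0, 0 < eps * h x0) -> exists2 c : R, c < dg w w / N%:R & adm V c.
move=> al01 cw hw cases; have [Hw _] := cw; have lw := H1_l2 Hw.
have A0 := dg_gt0 Hw hw; have V0 := d_V dat.
have prof := limit_profile al01 cw; have /andP[al0 al1] := al01.
have Nr : 3 <= N%:R :> R by rewrite ler_nat.
have Np : 0 < N%:R :> R by apply: lt_le_trans Nr.
have [E EE] : exists E : R, \I_x(F (w x)) = E by eexists.
rewrite EE in prof.
(* By [limit_profile], [al * E] is at least [(1 / 2 - 1 / 3) * dg w w], hence positive, and [al] is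
   not negative. *)
have E0 : 0 < E.
 have aE' : 0 < al * E.
  have -> : al * E = 2^-1 * (dg w w + Voo * nrm w ^+ 2) - dg w w / N%:R by rewrite -prof; ring.
  have h1 : dg w w / N%:R <= dg w w / 3 by rewrite ler_wpM2l ?(ltW A0)// lef_pV2// posrE.
  have h2 : 0 <= Voo * nrm w ^+ 2 by rewrite mulr_ge0 ?sqr_ge0// ltW.
  by move: (_ / N%:R) (Voo * _) h1 h2 A0 => *; lra.
 rewrite ltNge; apply/negP => E'; move: aE'; apply/negP; rewrite -leNgt.
 by rewrite mulr_ge0_le0.
have aE : 0 <= (1 - al) * E by rewrite mulr_ge0 ?subr_ge0// ltW.
case: cases => [al_lt|hx].
 apply: (comp_alpha A0 aE Hw prof erefl erefl EE).
 by rewrite mulr_gt0// subr_gt0.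
have nw : 0 < nrm w.
 rewrite lt_def nrm_ge0 andbT; apply/eqP => nw; move: hw; by rewrite (nrm0_hn Hw nw) ltxx.
have [y Hy] := spread Hw nw hx.
apply: (comp_h A0 aE (H1_shf y Hw) prof _ _ _ Hy).
- exact: dg_shf.
- by rewrite nrm_shf.
- by rewrite -EE -[RHS](Int_shift y (intg_F Hw)).
Qed.

End comparison.

(** * Mountain pass solutions and the least energy level *)

Section final.
Local Opaque hn dg dJf.
Local Notation I := (Jf 1 V (cst 1)).

Let pV := Veps_pot.

(** The indicator of the unit cube times [s0] satisfies the inequality, and bumps decreasing onto
    that cube pass to the limit by dominated convergence. *)
Lemma positive_potential (s0 : R) : 2^-1 * Voo * s0 ^+ 2 < F s0 ->
 exists v, H1 v /\ 2^-1 * Voo * nrm v ^+ 2 < \I_x(F (v x)).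
move=> Fs; pose b k : T -> R := bump (k.+1%:R^-1 ^+ 2) (fun=> 0) (fun=> 1 + k.+1%:R^-1).
have e0 k : 0 < k.+1%:R^-1 ^+ 2 :> R by pos.
have tb k : test_function (b k) by exact: test_bump.
have Hb k : H1 (s0 *: b k) by apply: H1Z; exact: H1_test.
pose G t : R := F (s0 * t) - 2^-1 * Voo * s0 ^+ 2 * t ^+ 2.
have [C C0 HC] := F_bd ltr01.
have V0 := d_V dat.
pose K := `|s0| `^ q + C * s0 ^+ 2 + 2^-1 * Voo * s0 ^+ 2.
have K1 : 0 <= C * s0 ^+ 2 by rewrite mulr_ge0 ?sqr_ge0.
have K2 : 0 <= 2^-1 * Voo * s0 ^+ 2 by rewrite mulr_ge0 ?sqr_ge0// mulr_ge0// ltW.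
have GK t : 0 <= t <= 1 -> `|G t| <= K.
 move=> /andP[t0 t1]; have t2 : t ^+ 2 <= 1 by rewrite expr_le1.
 apply: (le_trans (ler_normB _ _)); apply: lerD; last first.
  by rewrite ger0_norm; [rewrite -[leRHS]mulr1 ler_wpM2l|rewrite mulr_ge0 ?sqr_ge0].
 apply: (le_trans (HC _)); rewrite mul1r; apply: lerD.
  by apply: powR_le; rewrite//; [move: q2; lra|rewrite normrM (ger0_norm t0) ler_piMr].
 by rewrite exprMn mulrA -[leRHS]mulr1 ler_wpM2l.
have G0 : G 0 = 0 by rewrite /G mulr0 primitive00 expr0n mulr0 subr0.
have cF : continuous F by exact: continuous_primitive0 cf.
have cG : continuous G.
 move=> t; apply: cvgB; last by apply: cvgMr; apply: exprn_continuous.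
 apply: (@continuous_comp _ _ _ (fun t => s0 * t) F); last exact: cF.
 by apply: cvgMr; exact: cvg_id.
have bs k x : b k x != 0 -> `|x| <= 2.
 move=> bx; apply: norm_le_coord => // i; have /andP[x0 x1] := bump_box bx i.
 rewrite ger0_norm ?(ltW x0)//; apply: (le_trans (ltW x1)).
 have kk : k.+1%:R^-1 <= 1 :> R by rewrite invf_le1 ?ltr0n// ler1n.
 by rewrite -[2]/(1 + 1) lerD2l.
have b01 k x : 0 <= b k x <= 1 by rewrite bump_ge0 bump_le1.
have mb k : mfn (b k) by apply: mfn_cont; exact: test_cont.
have [|||||_ cv] := @Int_dct _ _ _ mu (fun k x => G (b k x)) (fun x => G (\1_(Q 1) x))
  (fun x => K * (\1_(cube 2) x * \1_(cube 2) x)).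
- by move=> k; exact: mfn_comp.
- by apply: mfn_comp => //; exact: mfn_box.
- apply: aeW => x; apply: (cvg_comp (fun k => b k x) G); last exact: cG.
 exact: (@bump_cvg (fun=> 0) (fun=> 1) x).
- by apply: intgZ; apply: l2_intgM; exact: l2_cube.
- move=> k x; case: (eqVneq (b k x) 0) => [->|bx].
  by rewrite G0 normr0 !mulr_ge0 ?ind_ge0// !addr_ge0.
 rewrite ind1; last by apply/set_mem; apply: in_cube; exact: bs bx.
 by rewrite !mulr1; exact: GK.
have Gp : 0 < \I_x(G (\1_(Q 1) x)).
 have -> : \I_x(G (\1_(Q 1) x)) = \I_x(G 1 * (\1_(Q 1) x) ^+ 2).
  apply: Int_eq => x; case: (pselect (Q 1 x)) => xQ.
   by rewrite ind1// expr1n mulr1.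
  by rewrite ind0// expr0n mulr0 G0.
 rewrite IntZ; last exact: l2i (l2_Q _).
 rewrite -nrmE nrm_Q2// expr1n mulr1 /G mulr1 expr1n mulr1; lra.
have [k0 Hk] := cvg0E ((@cvgBP _ _ _).2 cv) (divr_gt0 Gp (ltr0Sn R 1)).
have {Hk} := Hk _ (leqnn k0); rewrite ler_norml => /andP[hk _].
have Gk : 0 < \I_x(G (b k0 x)) by move: (Int _) (Int _) hk Gp => *; lra.
exists (s0 *: b k0); split => //.
have iF := intg_F (Hb k0); have lb := test_l2 (tb k0).
have E : \I_x(G (b k0 x)) = \I_x(F ((s0 *: b k0) x)) - 2^-1 * Voo * nrm (s0 *: b k0) ^+ 2.
 rewrite nrmZ// exprMn sqr_norm nrmE mulrA -IntZ; last exact: l2i.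
 by rewrite -IntB//; apply: intgZ; exact: l2i.
by rewrite -subr_gt0 -E.
Qed.

(** Under dilation the volume terms scale like [t ^ N] and the gradient like [t ^ (N - 2)], so a
    positive balance of the volume terms wins for large [t]; the perturbation only lowers the
    energy. *)
Lemma negative_energy (s0 : R) : 2^-1 * Voo * s0 ^+ 2 < F s0 -> exists2 v, H1 v & I v < 0.
move=> /positive_potential[v [Hv]]; rewrite -subr_gt0.
have [G EG] : exists G : R, G = \I_x(F (v x)) - 2^-1 * Voo * nrm v ^+ 2 by eexists.
rewrite -EG => G0; have A0 := dg_ge0 Hv.
have [t Et] : exists t : R, t = dg v v / G + 1 by eexists.
have AG : 0 <= dg v v / G by pos.
have t1 : 1 <= t by rewrite Et lerDr.
have t0 : 0 < t by apply: lt_le_trans t1.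
have tG : dg v v < t * G by rewrite Et mulrDl divfK ?lt0r_neq0// mul1r ltrDl.
exists (dil t^-1 v); first by apply: H1_dil; rewrite ?invr_gt0.
rewrite (dil_energy Hv t0).
have h1 : 0 <= \I_x(eps * h x * dil t^-1 v x ^+ 2).
 by apply: Int_ge0 => x; rewrite mulr_ge0 ?sqr_ge0// (eps_h_ge0).
have -> : t ^+ N = t ^+ (N - 2) * t ^+ 2 by rewrite -exprD subnK// ltnW.
have P0 : 0 < t ^+ (N - 2) by pos.
have ttG : dg v v < t ^+ 2 * G.
 by rewrite expr2 -mulrA; apply: (lt_le_trans tG); rewrite ler_peMl// mulr_ge0 ?ltW.
move: (t ^+ (N - 2)) (t ^+ 2) (Int _) (nrm v ^+ 2) (Int _) EG P0 ttG h1 A0 => P t2 Y B X EG P0 ttG h1 A0.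
have -> : 2^-1 * (P * dg v v + P * t2 * (Voo * B)) - P * t2 * X - 2^-1 * Y =
  P * (2^-1 * dg v v - t2 * G) - 2^-1 * Y by rewrite EG; ring.
have h2 : P * (2^-1 * dg v v - t2 * G) < 0 by rewrite pmulr_rlt0//; lra.
by move: (P * _) h2 h1 => *; lra.
Qed.

Lemma adm_ge0 c : adm V c -> 0 <= c.
move=> [n [g [Hg g0 gn bl]]]; case: n gn bl => [|n] gn bl.
 by move: gn; rewrite g0 I0 ltxx.
have := bl 0%N 0 (ltn0Sn n) (ltac:(by rewrite lexx ler01)).
by rewrite seg0 g0 I0.
Qed.

Lemma adm_nonempty v : H1 v -> I v < 0 -> exists c, adm V c.
move=> Hv Iv; have M0 : 0 < hn v + 1 by rewrite ltr_wpDl ?hn_ge0.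
have [C C0 HC] := J_bounded Voo V0p M0.
exists C, 1%N, (fun i => if i is _.+1 then v else 0); split=> //.
 by case=> [|i]//; exact: H1_0.
move=> [|i]// t _ /andP[t0 t1]; apply: (le_trans (ler_norm _)).
apply: (HC V (cst 1) 1 _ pV wgt1); first by rewrite ler01 ler1n.
 by apply: H1_seg => //; exact: H1_0.
have -> : seg 0 v t = t *: v by rewrite /seg add0r subr0.
rewrite hnZ// ger0_norm//; apply: (le_via (hn v)); last by rewrite lerDl.
by rewrite ler_piMl ?hn_ge0.
Qed.

(** One integrable majorant for the whole polygon, so that replacing the weight [1] by [awt] costs
    little uniformly along the path. *)
Lemma F_dominated (g : nat -> T -> R) (n : nat) : (forall i, H1 (g i)) ->
 exists2 H : T -> R, intg H & forall i (t : R) x, (i <= n)%N -> 0 <= t <= 1 ->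
  `|F (seg (g i) (g i.+1) t x)| <= H x.
move=> Hg; have [C C0 HC] := F_bd ltr01.
pose K i x := 2 `^ q * `|g i x| `^ q + C * 2 * g i x ^+ 2.
have iK i : intg (K i).
 by apply: intgD; apply: intgZ; [exact: (intg_q)|exact: l2i (H1_l2 (Hg i))].
have K0 i x : 0 <= K i x.
 by rewrite addr_ge0// mulr_ge0 ?sqr_ge0// mulr_ge0.
pose S x := \sum_(i < n.+2) K i x.
exists (fun x => S x + S x); first by apply: intgD; apply: intg_sum => i _; exact: iK.
move=> i t x ile /andP[t0 t1].
have KS j : (j < n.+2)%N -> K j x <= S x.
 by move=> jn; rewrite /S (bigD1 (Ordinal jn))//= lerDl sumr_ge0.
apply: (le_via (K i x + K i.+1 x)); last first.
 by apply: lerD; apply: KS; rewrite ?ltnS// ltnW.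
set a := g i x; set b := g i.+1 x.
have -> : seg (g i) (g i.+1) t x = a + t * (b - a) by [].
have sab : `|a + t * (b - a)| <= `|a| + `|b|.
 have -> : a + t * (b - a) = (1 - t) * a + t * b by ring.
 apply: (le_trans (ler_normD _ _)); rewrite !normrM; apply: lerD; rewrite ler_piMl//.
  by rewrite ger0_norm; lra.
 by rewrite ger0_norm.
apply: (le_trans (HC _)); rewrite mul1r /K -/a -/b addrACA; apply: lerD.
 rewrite -mulrDr; apply: le_trans (powRD_le _ (normr_ge0 a) (normr_ge0 b)); last by move: q2; lra.
 by apply: powR_le => //; move: q2; lra.
rewrite -mulrDr -[C * 2 * _]mulrA ler_wpM2l//.
have h1 : (a + t * (b - a)) ^+ 2 <= (`|a| + `|b|) ^+ 2.
 by rewrite -[leLHS]sqr_norm lerXn2r ?nnegrE ?addr_ge0.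
apply: (le_trans h1); rewrite -[a ^+ 2]sqr_norm -[b ^+ 2]sqr_norm.
have := sqr_ge0 (`|a| - `|b|); move: `|a| `|b| => *; nra.
Qed.

Lemma awt_defect (H : T -> R) : intg H ->
 \I_x((1 - awt k.+1%:R^-1 x) * H x) ~[k]~> (0 : R).
move=> iH; have -> : (0 : R) = \I_x(cst 0 x * H x).
 by rewrite -[LHS](@Int0 _ _ _ mu); apply: Int_eq => x; rewrite mul0r.
have w k : wgt (awt k.+1%:R^-1 : T -> R) by apply: awt_wgt; rewrite invr_ge0.
apply: (@Int_wcvg _ (cst 0) _ 1) => //.
- by move=> k; apply: measurable_funB; [exact: measurable_cst|exact: (w k).1].
- by move=> k x; have /andP[a0 a1] := (w k).2 x; rewrite ger0_norm; lra.
- move=> x; apply: (@cvg0_le _ _ (fun k => k.+1%:R^-1 * ln (1 + dotv x x))); last first.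
  by rewrite -[X in _ --> X](mul0r (ln (1 + dotv x x))); apply: cvgMl; exact: cvg_harmonic.
 move=> k; have k0 : 0 <= k.+1%:R^-1 :> R by rewrite invr_ge0.
 have m0 := mulr_ge0 k0 (ln_dotv x).
 have := expRN_lip (lexx 0) m0; rewrite oppr0 expR0 sub0r normrN => h1.
 by apply: (le_trans h1); rewrite ger0_norm.
Qed.

Lemma J_weight (lam : R) (a v : T -> R) : wgt a -> H1 v ->
 Jf lam V a v = I v + (lam - 1) / 2 * dg v v + \I_x((1 - a x) * F (v x)).
move=> wa Hv; have iF := intg_F Hv.
have iaF := intg_aF wa Hv; have i1F := intg_aF wgt1 Hv.
have -> : \I_x((1 - a x) * F (v x)) = \I_x(cst 1 x * F (v x)) - \I_x(a x * F (v x)).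
 by rewrite -IntB//; apply: Int_eq => x; rewrite mulrBl.
by rewrite /Jf; field.
Qed.

Lemma zero_hn u (lam : R) (a : T -> R) : H1 u -> wgt a -> Jf lam V a u != 0 -> 0 < hn u.
move=> Hu wa; rewrite lt_def hn_ge0 andbT; apply: contraNneq => hu.
have nu : nrm u = 0 by apply/le_anti; rewrite nrm_ge0 andbT -hu nrm_le_hn.
have du : dg u u = 0 by apply/le_anti; rewrite dg_ge0// andbT (le_trans (dg_le_hn Hu))// hu expr0n.
have u0 := nrm_eq0 (H1_l2 Hu) nu; have mu' := l2m (H1_l2 Hu).
have E1 : \I_x(V x * u x ^+ 2) = \I_x(0).
 apply: Int_ae; [exact: intg_m (intg_bmul pV.1 (pot_norm (ltW V0p) pV) (l2i (H1_l2 Hu))).1|exact: measurable_cst|].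
 by apply: filterS u0 => x ->; rewrite expr0n mulr0.
have E2 : \I_x(a x * F (u x)) = \I_x(0).
 apply: Int_ae; [exact: intg_m (intg_aF wa Hu)|exact: measurable_cst|].
 by apply: filterS u0 => x ->; rewrite primitive00 mulr0.
by rewrite /Jf du E1 E2 !Int0 !mulr0 addr0 mulr0 subr0.
Qed.

Lemma I_le_limit w : H1 w ->
 I w <= 2^-1 * (dg w w + Voo * nrm w ^+ 2) - 1 * \I_x(F (w x)).
move=> Hw; have := pot_le V0p pV (H1_l2 Hw).
have -> : I w = 2^-1 * (dg w w + \I_x(V x * w x ^+ 2)) - 1 * \I_x(F (w x)).
 rewrite /Jf mul1r; congr (_ - _); rewrite mul1r.
 by apply: Int_eq => x; rewrite mul1r.
by move: (Int _) (Int _) (nrm w ^+ 2) => *; lra.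
Qed.

Local Opaque Jf.

(** A path admissible for [lam = 1] and weight [1] stays admissible, with a slightly higher level,
    for a short interval of [lam] and for all weights close to [1]. *)
Lemma perturb (c d : R) : adm V c -> 0 < d -> exists2 tau : R, 0 < tau <= d &
 exists k0 : nat, forall k, (k0 <= k)%N -> exists (n : nat) (g : nat -> T -> R),
  gam V (awt k.+1%:R^-1) tau n g /\ below V (awt k.+1%:R^-1) (1 + tau) n g (c + d).
move=> [n [g [Hg g0 gn bl]]] d0.
have [M M0 HM] : exists2 M : R, 0 <= M & forall i (t : R), (i <= n)%N -> 0 <= t <= 1 ->
  dg (seg (g i) (g i.+1) t) (seg (g i) (g i.+1) t) <= M.
 pose S := \sum_(i < n.+2) hn (g i).
 have KS j : (j < n.+2)%N -> hn (g j) <= S.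
  by move=> jn; rewrite /S (bigD1 (Ordinal jn))//= lerDl sumr_ge0// => i _; exact: hn_ge0.
 exists ((S + (S + S)) ^+ 2); first exact: sqr_ge0.
 move=> i t ile /andP[t0 t1]; have Hs := H1_seg t (Hg i) (Hg i.+1).
 apply: (le_trans (dg_le_hn Hs)); rewrite lerXn2r ?nnegrE ?hn_ge0 ?addr_ge0 ?sumr_ge0//; try by move=> j _; exact: hn_ge0.
 have HB := H1B (Hg i.+1) (Hg i).
 apply: (le_trans (hn_tri (Hg i) (H1Z t HB))); apply: lerD; first by apply: KS; rewrite ltnS ltnW.
 rewrite hnZ// ger0_norm//; apply: (le_via (hn (g i.+1 - g i))); first by rewrite ler_piMl ?hn_ge0.
 apply: (le_trans (hn_triB (Hg i.+1) (Hg i))); apply: lerD; apply: KS; rewrite ?ltnS//; exact: ltnW.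
have [H iH HF] := F_dominated n Hg.
(* The second entry keeps the energy of the endpoint negative after perturbation. *)
have [dd Ed] : exists dd : R, dd = Num.min d (- I (g n)) by eexists.
have dd0 : 0 < dd by rewrite Ed lt_min d0 oppr_gt0.
pose tau := Num.min d (dd / 2 / (M + 1)).
have tau0 : 0 < tau by rewrite lt_min d0 !divr_gt0// ltr_wpDl.
exists tau; first by rewrite tau0 ge_min lexx.
have tM : tau * M <= dd / 2.
 apply: (le_via (dd / 2 / (M + 1) * M)); first by rewrite ler_wpM2r// ge_min lexx orbT.
 by apply: absorb_le => //; rewrite ltW// divr_gt0.
clearbody tau.
have [k0 Hk0] := cvg0E (awt_defect iH) (divr_gt0 dd0 (ltr0Sn R 2)).
exists k0 => k /Hk0 hk; exists n, g.
have wk : wgt (awt k.+1%:R^-1 : T -> R) by apply: awt_wgt; rewrite invr_ge0.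
have mk : mfn (fun x => 1 - awt k.+1%:R^-1 x : R) by apply: measurable_funB; [exact: measurable_cst|exact: wk.1].
have bk x : `|1 - awt k.+1%:R^-1 x| <= 1 :> R.
 by have /andP[a0 a1] := wk.2 x; rewrite ger0_norm; lra.
have key i (t : R) : (i <= n)%N -> 0 <= t <= 1 -> Jf (1 + tau) V (awt k.+1%:R^-1) (seg (g i) (g i.+1) t) <
  I (seg (g i) (g i.+1) t) + dd.
 move=> ile t01; have Hs := H1_seg t (Hg i) (Hg i.+1).
 have h1 := HM i t ile t01; have h2 := dg_ge0 Hs.
 have h3 : `|\I_x((1 - awt k.+1%:R^-1 x) * F (seg (g i) (g i.+1) t x))| <= dd / 3.
  apply: le_trans (le_trans (ler_norm _) hk).
  have iF := intg_F Hs.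
  apply: Int_norm_le; [exact: intg_m (intg_bmul mk bk iF).1|exact: (intg_bmul mk bk iH).1|].
  move=> x; rewrite normrM ger0_norm; last by have /andP[a0 a1] := wk.2 x; lra.
  by rewrite ler_wpM2l; [|have /andP[a0 a1] := wk.2 x; lra|exact: HF].
 have h4 : tau * dg (seg (g i) (g i.+1) t) (seg (g i) (g i.+1) t) <= tau * M by rewrite ler_wpM2l// ltW.
 rewrite (J_weight _ wk Hs) [1 + tau]addrC addrK.
 have ar (A B I0 m : R) : tau * A <= tau * m -> tau * m <= dd / 2 -> `|B| <= dd / 3 -> I0 + tau / 2 * A + B < I0 + dd.
  by rewrite ler_norml => *; have := dd0; lra.
 exact: ar h4 tM h3.
split; last first.
 move=> i t ile t01; apply: (le_trans (ltW (key i t (ltnW ile) t01))).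
 by apply: lerD; [exact: bl|rewrite Ed ge_min lexx].
split=> //; have := key n 0 (leqnn n) (ltac:(by rewrite lexx ler01)); rewrite seg0 => h1.
apply: (lt_le_trans h1); rewrite -lerBrDl sub0r Ed ge_min lexx orbT//.
Qed.

Let S := adm V.

Lemma adm_has_inf v : H1 v -> I v < 0 -> has_inf S.
move=> Hv Iv; split; first exact: adm_nonempty Hv Iv.
by exists 0 => c; exact: adm_ge0.
Qed.

(** When [comparison] does not apply, [al = 1] and [eps * h] vanishes identically; the problem at
    infinity is then the original one, and [w] itself is the required solution, with energy at most
    [dg w w / N]. *)
Lemma resolve v (e : R) : H1 v -> I v < 0 -> e <= inf S ->
 (exists u, [/\ crit 1 V (cst 1) u, 0 < hn u & I u <= e]) \/
 (exists w (al : R), [/\ 0 <= al <= 1, crit 1 (cst Voo) (cst al) w, 0 < hn w & dg w w <= N%:R * e]) ->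
 exists u, [/\ crit 1 V (cst 1) u, 0 < hn u & I u <= e].
move=> Hv Iv eS [//|[w [al [al01 cw hw dw]]]].
have Np : 0 < N%:R :> R by rewrite ltr0n; apply: leq_trans N3.
have dwe : dg w w / N%:R <= e by rewrite ler_pdivrMr// mulrC.
have no : ~ (al < 1 \/ exists x0, 0 < eps * h x0).
 move=> /(comparison al01 cw hw)[c cw' ac].
 have : inf S <= c by apply: ge_inf => //; exact: (adm_has_inf Hv Iv).2.
 by rewrite leNgt => /negP; apply; apply: (lt_le_trans cw'); exact: le_trans dwe eS.
have /andP[al0 al1] := al01.
have alE : al = 1.
 by apply/le_anti; rewrite al1 leNgt; apply/negP => lt; apply: no; left.
have VE : V = cst Voo.
 apply/funext => x; rewrite /Veps (_ : eps * h x = 0) ?subr0//.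
 apply/le_anti; rewrite (eps_h_ge0) andbT leNgt; apply/negP => lt.
 by apply: no; right; exists x.
have prof := limit_profile al01 cw.
exists w; rewrite alE in cw prof; split=> //; first by rewrite VE.
by apply: le_trans dwe; rewrite -prof; apply: I_le_limit; have [] := cw.
Qed.

(** The bound obtained from the mountain pass blows up as [tau] shrinks, so [eta] is chosen last,
    small enough for the Pohozaev error to be at most [1]; the final gradient bound is then
    independent of [j]. *)
Lemma approximate v (j : nat) : H1 v -> I v < 0 -> exists (lam eta : R) u,
 [/\ 1 <= lam <= 1 + j.+1%:R^-1, 0 <= eta <= j.+1%:R^-1, crit lam V (awt eta) u &
  0 < Jf lam V (awt eta) u <= inf S + 2 * j.+1%:R^-1 /\ dg u u <= 2 * N%:R * (inf S + 2) + 1].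
move=> Hv Iv; have hS := adm_has_inf Hv Iv.
have [d Ed] : exists d : R, d = j.+1%:R^-1 by eexists.
have d0 : 0 < d by rewrite Ed invr_gt0.
have d1 : d <= 1 by rewrite Ed invf_le1 ?ltr0n// ler1n.
rewrite -Ed.
have [c Sc cS] := inf_adherent d0 hS.
have [tau /andP[tau0 taud] [k0 Hk0]] := perturb Sc d0.
pose D := 2 * ((c + d) / tau + 3).
have [M M0 HM] := hn_from_dg Voo V0p D (c + d).
have [CF CF0 HF] := F_l1_bound M0.
have [k1 Hk1] : exists k1 : nat, 4 * CF <= k1%:R.
 by exists (Num.truncn (4 * CF)).+1; apply/ltW/truncnS_gt.
(* [k0] makes the path admissible, [k1] bounds the error of the weight in [coercive], and [j] forces
   [eta] to tend to zero. *)
pose k := maxn k0 (maxn k1 j).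
have [n [g [gg bb]]] := Hk0 k (leq_maxl _ _).
pose eta : R := k.+1%:R^-1.
have eta0 : 0 < eta by rewrite invr_gt0.
have etad : eta <= d by rewrite Ed lef_pV2 ?posrE ?ltr0n// ler_nat ltnS !leq_max leqnn !orbT.
have wk := awt_wgt (ltW eta0).
have [lam [u [/andP[l1 l2'] Hu cu /andP[J0 Jm] Du]]] :=
 mp_critical V0p pV wk (awt_decay eta0) tau0 gg bb.
have cr : crit lam V (awt eta) u by [].
have hM : hn u <= M by apply: (HM V (awt eta) lam u pV wk (le_trans ler01 l1) Hu Du Jm).
have small : 4 * eta * \I_x(`|F (u x)|) <= 1.
 apply: (le_via (eta * (4 * CF))).
  have ar (x y z : R) : x * y * z = y * (x * z) by ring.
  rewrite ar; apply: ler_wpM2l; first exact: ltW.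
  by apply: ler_wpM2l; [rewrite ler0n|exact: HF].
 rewrite /eta mulrC ler_pdivrMr// mul1r; apply: (le_trans Hk1).
 by rewrite ler_nat leqW// !leq_max leqnn orbT.
exists lam, eta, u; split=> //.
- by rewrite l1 (le_trans l2')// lerD2l.
- by rewrite ltW.
have Jb : Jf lam V (awt eta) u <= inf S + 2 * d.
 apply: (le_trans Jm); have -> : 2 * d = d + d by ring.
 by rewrite addrA lerD2r ltW.
rewrite J0 Jb; split=> //.
apply: (le_trans (coercive l1 (ltW eta0) cr)); apply: lerD => //.
apply: ler_wpM2l; first by rewrite mulr_ge0// ler0n.
by apply: (le_trans Jb); rewrite lerD2l -[leRHS]mulr1; apply: ler_wpM2l; rewrite ?ler0n.
Qed.

Lemma ground_below v : H1 v -> I v < 0 ->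
 exists u, [/\ crit 1 V (cst 1) u, 0 < hn u & I u <= inf S].
move=> Hv Iv; have hS := adm_has_inf Hv Iv.
have [lam_ Hl] := choice (fun j => @approximate v j Hv Iv).
have [eta_ He] := choice Hl; have [u_ {Hl He} Hu] := choice He.
have i0 : 0 <= inf S by apply: lb_le_inf; [exact: hS.1|move=> c; exact: adm_ge0].
have inv1 n : n.+1%:R^-1 <= 1 :> R by rewrite invf_le1 ?ltr0n// ler1n.
have Jb n : `|Jf (lam_ n) V (awt (eta_ n)) (u_ n)| <= inf S + 2.
 have [_ _ _ [/andP[J0 J1] _]] := Hu n.
 rewrite (gtr0_norm J0); apply: (le_trans J1); rewrite lerD2l -[leRHS]mulr1.
 by apply: ler_wpM2l; [rewrite ler0n|exact: inv1].
have [k [ki [e ce]]] := BW Jb.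
have eS : e <= inf S.
 apply/ler_addgt0Pr => d d0.
 have c2 : inf S + 2 * (k n).+1%:R^-1 ~[n]~> inf S + 2 * 0.
  by apply: cvgD; [exact: cvg_cst|apply: cvgMr; exact: (cvg_sub ki (@cvg_harmonic R))].
 rewrite mulr0 addr0 in c2.
 apply: (le_via (inf S)); last by rewrite lerDl ltW.
 rewrite -(cvg_lim _ ce)// -(cvg_lim _ c2)//; apply: ler_lim; [exact: cvgP ce|exact: cvgP c2|].
 by apply: nearW => n; have [_ _ _ [/andP[_ J1] _]] := Hu (k n).
have [u [cu hu Iu]] : exists u, [/\ crit 1 V (cst 1) u, 0 < hn u & I u <= e].
 apply: (resolve Hv Iv eS).
 apply: (dichotomy (u_ := u_ \o k) (lam_ := lam_ \o k) (eta_ := eta_ \o k)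
   (DD := 2 * N%:R * (inf S + 2) + 1)) => //=.
 - by move=> n; have [] := Hu (k n).
 - by move=> n; have [/andP[]] := Hu (k n).
 - apply: (cvg_sub ki (u := lam_)).
  apply: (@cvg_transfer _ (fun=> 1)); last exact: cvg_cst.
  apply: (@cvg0_le _ _ (fun n => n.+1%:R^-1)); last exact: cvg_harmonic.
  by move=> n; have [/andP[l1 l3] _ _ _] := Hu n; rewrite ger0_norm ?subr_ge0// lerBlDl.
 - by move=> n; have [_ /andP[]] := Hu (k n).
 - apply: (cvg_sub ki (u := eta_)).
  apply: (@cvg0_le _ _ (fun n => n.+1%:R^-1)); last exact: cvg_harmonic.
  by move=> n; have [_ /andP[l1 l3] _ _] := Hu n; rewrite ger0_norm.
 - by move=> n; have [_ _ _ []] := Hu (k n).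
 - move=> n; have [_ /andP[e0 _] [Hun _] [/andP[J0 _] _]] := Hu (k n).
  exact: (zero_hn Hun (awt_wgt e0) (lt0r_neq0 J0)).
by exists u; split=> //; exact: le_trans Iu eS.
Qed.

(** With [eta = 0], [coercive] shows that critical points have nonnegative energy, so the infimum
    exists; it is at most the mountain pass level, which is what [resolve] requires of the limit
    energy of a minimizing sequence. *)
Theorem least_energy (s0 : R) : 2^-1 * Voo * s0 ^+ 2 < F s0 ->
 exists u, [/\ crit 1 V (cst 1) u, 0 < hn u &
  forall v, crit 1 V (cst 1) v -> 0 < hn v -> I u <= I v].
move=> /negative_energy[z Hz Iz].
pose K := [set I u | u in [set u | crit 1 V (cst 1) u /\ 0 < hn u]].
have [u1 [cu1 hu1 Iu1]] := ground_below Hz Iz.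
have Np : 0 < 2 * N%:R :> R by rewrite mulr_gt0// ltr0n; apply: leq_trans N3.
have co u : crit 1 V (cst 1) u -> dg u u <= 2 * N%:R * I u.
 move=> cu; have := cu; rewrite -awt0 => /(coercive (lexx 1) (lexx 0)).
 by rewrite mulr0 mul0r addr0 awt0.
have lbK : has_lbound K.
 exists 0 => _ [u [cu _] <-]; rewrite -(pmulr_rge0 _ Np).
 by apply: le_trans (co u cu); apply: dg_ge0; have [] := cu.
have hK : has_inf K by split=> //; exists (I u1), u1.
have mS : inf K <= inf S by apply: le_trans Iu1; apply: ge_inf => //; exists u1.
have seq n : exists u, [/\ crit 1 V (cst 1) u, 0 < hn u & I u < inf K + n.+1%:R^-1].
 have n0 : 0 < n.+1%:R^-1 :> R by rewrite invr_gt0.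
 by have [_ [u [cu hu] <-] lt] := inf_adherent n0 hK; exists u.
have [u_ Hu] := choice seq.
have ge u : crit 1 V (cst 1) u -> 0 < hn u -> inf K <= I u.
 by move=> cu hu; apply: ge_inf => //; exists u.
have cI : I (u_ n) ~[n]~> inf K.
 apply/cvgBP; apply: (@cvg0_le _ _ (fun n => n.+1%:R^-1)); last exact: cvg_harmonic.
 move=> n; have [cu hu lt] := Hu n; rewrite ger0_norm ?subr_ge0 ?ge//.
 by rewrite lerBlDl ltW.
have [u [cu hu Iu]] : exists u, [/\ crit 1 V (cst 1) u, 0 < hn u & I u <= inf K].
 apply: (resolve Hz Iz mS).
 apply: (dichotomy (u_ := u_) (lam_ := fun=> 1) (eta_ := fun=> 0)
   (DD := 2 * N%:R * (inf K + 1))) => //.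
 - by move=> n; rewrite awt0; have [] := Hu n.
 - exact: cvg_cst.
 - exact: cvg_cst.
 - by rewrite awt0.
 - move=> n; have [cu hu lt] := Hu n; apply: (le_trans (co _ cu)); rewrite ler_wpM2l ?(ltW Np)//.
  by apply: (le_trans (ltW lt)); rewrite lerD2l invf_le1 ?ltr0n// ler1n.
 - by move=> n; have [] := Hu n.
exists u; split; [exact: cu|exact: hu|move=> v cv hv; exact: le_trans Iu (ge v cv hv)].
Qed.

End final.

End perturbed_potential.
End nonlinear.
End dimension_at_least_three.
Local Opaque hn dg dJf.

(** * From the statement to the working hypotheses *)

Section translation.
Implicit Types (h : T -> R).

Lemma enorm2 x : enorm x ^+ 2 = dotv x x.
by rewrite /enorm sqr_sqrtr// dotv_ge0. Qed.

Lemma norm_le_enorm x : `|x| <= enorm x.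
apply: norm_le_coord; first exact: sqrtr_ge0.
move=> i; rewrite -ler_sqr ?nnegrE ?sqrtr_ge0// enorm2 sqr_norm.
exact: sqr_le_dotv.
Qed.

Lemma enorm_gt (A : R) x : `|A| < `|x| -> A <= enorm x.
by move=> h; apply: le_trans (ler_norm A) (le_trans (ltW h) (norm_le_enorm x)). Qed.

Lemma energyE (Voo eps V0 V1 : R) h (f : R -> R) u : 0 < V0 -> pot V0 V1 (Veps Voo eps h) -> H1 u ->
 energy Voo eps h f u = Jf f 1 (Veps Voo eps h) (cst 1) u.
move=> V00 pV Hu; have iu := l2i (H1_l2 Hu).
have iD : intg (fun x => \sum_i Dw u i x ^+ 2) by apply: intg_sum => i _; exact: l2i (H1_Dw i Hu).
have iV := (intg_bmul pV.1 (pot_norm (ltW V00) pV) iu).1.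
rewrite /energy /Jf mul1r; congr (_ * _ - _); last by apply: Int_eq => x; rewrite mul1r.
have -> : dg u u = \I_x(\sum_i Dw u i x ^+ 2).
 rewrite dg_def Int_sum; last by move=> i _; exact: l2i (H1_Dw i Hu).
 by apply: eq_bigr => i _; apply: Int_eq => x; rewrite expr2.
rewrite -IntD//; apply: Int_eq => x; by rewrite enorm2; congr (_ + _).
Qed.

Lemma critical_point_eq (J J' : (T -> R) -> R) u : (forall v, H1 v -> J v = J' v) ->
 critical_point J u -> critical_point J' u.
move=> E [Hu H]; split=> // e e0; have [d d0 Hd] := H e e0; exists d => // v Hv vd.
by have := Hd v Hv vd; rewrite !E//; exact: (H1D Hu Hv).
Qed.

Lemma ae_zero_hn u : H1 u -> ae_zero u <-> hn u = 0.
move=> Hu; have lu := H1_l2 Hu; split => [u0|hu].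
 apply: nrm0_hn => //; rewrite -(nrm0 mu); apply: nrm_ae => //; [exact: l2m lu|exact: measurable_cst].
apply: (nrm_eq0 lu); apply/le_anti; rewrite nrm_ge0 andbT -hu; exact: nrm_le_hn.
Qed.

Lemma cont_sum (g : 'I_N -> T -> R) : (forall i, continuous (g i)) ->
 continuous (fun x => \sum_i g i x).
move=> cg; elim: (index_enum _) => [|i s IH].
 rewrite (_ : (fun x => _) = cst 0); first by move=> x; exact: cst_continuous.
 by apply/funext => x; rewrite big_nil.
rewrite (_ : (fun x => _) = g i + (fun x => \sum_(i <- s) g i x)).
 by move=> x; apply: continuousD; [exact: cg|exact: IH].
by apply/funext => x; rewrite big_cons.
Qed.

(** Outside the unit ball the finite supremum gives decay of order [|x|^-2], inside it continuity
    gives a bound. *)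
Lemma radial_bound h : Ck 1 h ->
 (ereal_sup (range (fun x => (- (enorm x ^+ 2 * dotv (grad h x) x))%:E)) < +oo)%E ->
 exists2 Ch : R, 0 <= Ch & forall x, - dotv (grad h x) x <= Ch * rho x.
move=> C1 hs; have [C HC] : exists C : R, forall x, - (dotv x x * dotv (grad h x) x) <= C.
 move: hs; set S := ereal_sup _ => hs.
 have ub x : ((- (dotv x x * dotv (grad h x) x))%:E <= S)%E.
  by rewrite -enorm2; apply: ereal_sup_ubound; exists x.
 case: S hs ub => [C _ ub| |_ ub] //; first by exists C => x; rewrite -lee_fin.
 by have := ub 0; rewrite leNgt ltNyr.
have cd : continuous (fun x => dotv (grad h x) x).
 rewrite (_ : (fun x => _) = (fun x => \sum_i x ord0 i * partial i h x)).
  by apply: cont_sum => i; apply: contM; [exact: coord_continuous|exact: Ck1_partial].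
 by apply/funext => x; rewrite dotv_grad.
have [B B0 HB] := continuous_bounded 1 cd.
(* The factor [2] comes from [1 + |x|^2 <= 2 |x|^2] outside the unit ball and [1 + |x|^2 <= 2]
   inside. *)
exists (2 * (`|C| + B)); first by rewrite mulr_ge0// addr_ge0.
move=> x; have d0 := dotv_ge0 x; rewrite -[X in _ <= X]/(_ / _) ler_pdivlMr; last by rewrite ltr_wpDr.
have cC := ler_norm C; have hC := HC x.
case: (lerP 1 (dotv x x)) => d1.
 have : - dotv (grad h x) x <= `|C|.
  case: (lerP 0 (- dotv (grad h x) x)) => s; last by apply: (le_trans (ltW s)).
  apply: le_trans (le_trans hC cC); rewrite -mulrN.
  by rewrite ler_peMl.
 by move: hC cC B0 d1; move: (dotv (grad h x) x) (dotv x x) `|C| => g d c *; nra.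
have x1 : `|x| <= 1.
 by apply: (le_trans (norm_le_enorm x)); rewrite /enorm -[leRHS]sqrtr1 ler_sqrt ?ler01// ltW.
have := HB x x1; rewrite ler_norml => /andP[hB _].
have c0 := normr_ge0 C.
by move: hB B0 d1 d0 c0; move: (dotv (grad h x) x) (dotv x x) `|C| => g d c *; nra.
Qed.

End translation.
End euclidean_space.

Theorem corollary1p7 (R : realType) (N : nat) (Voo : R)
  (h : 'rV[R]_N -> R) (f : R -> R)
  (N_ge3 : (3 <= N)%N) (Voo_gt0 : 0 < Voo)
  (h_C1 : Ck 1 h)
  (h_ge0 : forall x, 0 <= h x)
  (h_lim : forall e : R, 0 < e ->
     exists A : R, forall x, A <= enorm x -> `|h x| <= e)
  (h_sup : (ereal_sup
     (range (fun x => (- (enorm x ^+ 2 * dotv (grad h x) x))%:E)) < +oo)%E)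
  (f_cont : continuous f)
  (f_growth : exists2 C0 : R, 0 < C0 &
     forall t, `|f t| <= C0 * (1 + `|t| `^ (crit_exp N - 1)))
  (f_at0 : f t / t @[t --> 0^'] --> (0 : R))
  (f_at_pinfty :
     `|f t| / `|t| `^ ((N%:R + 2) / (N%:R - 2)) @[t --> +oo] --> (0 : R))
  (f_at_ninfty :
     `|f t| / `|t| `^ ((N%:R + 2) / (N%:R - 2)) @[t --> -oo] --> (0 : R))
  (F_s0 : exists2 s0 : R, 0 < s0 & primitive0 f s0 > 2^-1 * Voo * s0 ^+ 2) :
  exists2 eps0 : R, 0 < eps0 &
    forall eps : R, 0 < eps <= eps0 ->
      exists u : 'rV[R]_N -> R,
        least_energy_solution (energy Voo eps h f) u.
Proof.
have nl : nonlin (crit_exp N) f.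
 have E : (N%:R + 2) / (N%:R - 2) = crit_exp N - 1 :> R.
  have N3R : 3 <= N%:R :> R by rewrite ler_nat.
  have N2 : N%:R - 2 != 0 :> R by apply: lt0r_neq0; move: N3R; lra.
  by rewrite /crit_exp; field.
 by split=> //; rewrite -E.
have [Ch Ch0 HCh] := radial_bound h_C1 h_sup.
have [B B0 HB] : exists2 B : R, 0 <= B & forall x, h x <= B.
 have [A HA] := h_lim 1 ltr01.
 have [B B0 HB] := continuous_bounded `|A| (Ck_cont h_C1).
 exists (1 + B); first by rewrite addr_ge0.
 move=> x; apply: (le_trans (ler_norm _)); case: (lerP `|x| `|A|) => xA.
  by apply: (le_trans (HB x xA)); rewrite lerDr.
 by apply: (le_trans (HA x (enorm_gt xA))); rewrite lerDl.
have [s0 _ Fs] := F_s0.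
have CN0 : 0 <= Ch * (4 * N%:R) by rewrite !mulr_ge0.
(* The first bound gives [eps * h <= Voo / 2], the second lets Hardy's inequality absorb the radial
   derivative of the perturbation. *)
exists (Num.min (Voo / 2 / (B + 1)) (1 / (Ch * (4 * N%:R) + 1))).
 by rewrite lt_min !divr_gt0// ltr_wpDl.
move=> eps /andP[e0]; rewrite le_min => /andP[eB eC].
have dat : datum Voo eps Ch h.
 split=> //; first exact: ltW.
 - by move=> e /h_lim[A HA]; exists `|A| => x /enorm_gt; exact: HA.
 - move=> x; apply: (le_via (eps * B)); first by rewrite ler_wpM2l// ltW.
  apply: (le_via (Voo / 2 / (B + 1) * B)); first by rewrite ler_wpM2r.
  by apply: absorb_le => //; rewrite ltW// divr_gt0.
 - rewrite -mulrA; apply: (le_via (1 / (Ch * (4 * N%:R) + 1) * (Ch * (4 * N%:R)))).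
   by rewrite ler_wpM2r.
  by apply: absorb_le.
have V0p : 0 < Voo / 2 by rewrite divr_gt0.
have pV := Veps_pot dat; have VB := pot_norm (ltW V0p) pV.
have EE u : H1 u -> energy Voo eps h f u = Jf f 1 (Veps Voo eps h) (cst 1) u.
 by move=> Hu; exact: energyE pV Hu.
have critE u : critical_point (energy Voo eps h f) u <-> crit f 1 (Veps Voo eps h) (cst 1) u.
 rewrite /crit -(criticalP N_ge3 nl (ler01 : 0 <= 1) pV.1 VB (@wgt1 R N)).
 by split; apply: critical_point_eq => v Hv; rewrite EE.
have zE u : H1 u -> ~ ae_zero u <-> 0 < hn u.
 by move=> Hu; rewrite (ae_zero_hn Hu) lt_def hn_ge0 andbT; split => /eqP.
have [u [cu hu Hu]] := least_energy N_ge3 nl dat Fs; have [H1u _] := cu.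
exists u; split; [exact/critE|exact/zE|].
apply/eqP; rewrite eq_le; apply/andP; split.
 apply: le_ereal_inf_tmp => _ [v [/critE cv nv] <-]; have [H1v _] := cv.
 by rewrite lee_fin (EE _ H1u) (EE _ H1v); apply: (Hu v cv); exact/(zE _ _ _ H1v).
by apply: ereal_inf_lbound; exists u => //; split; [exact/critE|exact/zE].
Qed.
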